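(* Assume the Riemann Hypothesis. Let $1/2<\sigma_0<1$, $2\gamma_1\le t_0\le50$, $x\ge x_0\ge4\exp(2e^2)$, and let $\mathcal{N}_1=\mathcal{N}_1(\sigma_0,t_0,x_0)$ and $\alpha=\alpha(\sigma_0,t_0,x_0)$. Let $s=\sigma+it$ with $\sigma>1/2$ and $\sigma>\alpha$. Then \[ \left|\sum_{n\le x}\frac{\mu(n)}{n^s}-\frac{1}{\zeta(s)}\right|\le\mathcal{N}_1\left(1+\frac{|s|}{\sigma-\alpha}\right)\frac{\log x}{x^{\sigma-\alpha}}+\frac{\mathcal{N}_1|s|}{(\sigma-\alpha)^2x^{\sigma-\alpha}}. \]
   Context: $\mu$ is the Möbius function, $\zeta$ the Riemann zeta-function; RH asserts all nontrivial zeros of $\zeta$ have real part $1/2$. $\gamma_1\approx14.1347$ is the positive ordinate of the first nontrivial zero. $\delta(t_0)=(1+1/t_0)^2$; $\lambda(t_0)=(t_0/2)\log\log(3t_0/2)$; with $\delta=\delta(t_0)$: $a_1(t_0)=\delta\left(\frac{117}{4}+3\delta+(3+\delta)\left(\frac{t_0}{e^{e^2}}+\frac{3+e}{e}\right)\right)$, $a_2(t_0)=\frac{\delta}{75}\left(\frac{t_0}{2\gamma_1}+1+\frac1e\right)$, $a_4(t_0)=\frac{4\delta}{5e}\left(3+\frac{\delta}{4}\right)$. For $a,b,c>0$ let $\mathcal{M}(a,b,c;t)=a+\frac{b}{(\log t)^c\log\log t}$, $\mathcal{M}_1(t)=\mathcal{M}(0.759282,20.1911,0.285;t)$, $\mathcal{M}_2(t)=\mathcal{M}(0.653,60.12,0.2705;t)$.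 Define $\widehat\phi_1(u)=0.96$ for $\log\log2\pi\le u<\log\log10^{2465}$ and $\widehat\phi_1(u)=1.719282-\mathcal{M}_1(10^{2465})+\frac{20.1911}{ue^{0.285u}}$ for $u\ge\log\log10^{2465}$; $\widehat\phi_2(u)=2.491$ for $\log\log2\pi\le u<\log\log10^{208}$ and $\widehat\phi_2(u)=3.144-\mathcal{M}_2(10^{208})+\frac{60.12}{ue^{0.2705u}}$ for $u\ge\log\log10^{208}$. Define $\omega(t_0;u)=\frac{a_1(t_0)\widehat\phi_2(u)}{\lambda(t_0)u}+\frac{a_2(t_0)u}{\lambda(t_0)e^u}+\frac{15.83}{e^u}+\frac{12\lambda(t_0)}{ue^{e^u}}\left(\frac{3\widehat\phi_1(u)}{2u}+\frac{3}{100e^{u+e^u}}\right)+\frac{a_4(t_0)\widehat\phi_2(u)}{u^2e^u}$, $\omega_1(\sigma,t_0;u)=2\left(\frac{\widehat\phi_1(u)}{u}+\frac{1}{50e^{u+e^u}}\right)\log\left(1+\frac{2\lambda(t_0)}{(\sigma-\frac12)u}\right)+\omega(t_0;u)$, $\omega_{0,1}(\sigma_0,t_0,x_0)=\omega_1\left(\sigma_0,t_0;\log\log\left(\frac{3e\sqrt{x_0}}{2}\right)\right)$, $\alpha(\sigma_0,t_0,x_0)=\sigma_0+\frac12\omega_{0,1}(\sigma_0,t_0,x_0)$, and $\mathcal{N}_1(\sigma_0,t_0,x_0)=\frac1\pi\left(\frac{3e}{2}\right)^{\omega_{0,1}}\left(\frac12+\frac{1}{\log x_0}+\frac{1.1-\sigma_0}{x_0^{\sigma_0-\frac12}\log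 x_0}\right)+\frac{1}{x_0^{\frac12\omega_{0,1}}}\left(\frac{8e^{e^2}}{\pi\sigma_0(\sigma_0-\frac12)\log x_0}+\frac{23.6}{x_0^{\sigma_0-\frac12}}\right)$ with $\omega_{0,1}=\omega_{0,1}(\sigma_0,t_0,x_0)$. *)

(* Defs.v *)
From Stdlib Require Import Reals ZArith.
From Coquelicot Require Import Coquelicot.
From mathcomp Require ssreflect ssrbool eqtype ssrnat seq prime.
Open Scope R_scope.

Definition mobius (n : nat) : R :=
  if Nat.eqb n 0 then 0
  else if seq.all (fun p => Nat.eqb (prime.logn p n) 1) (prime.primes n)
       then (-1) ^ (seq.size (prime.primes n))
       else 0.

Definition npow (n : nat) (z : C) : C :=
  (exp (fst z * ln (INR n)) * cos (snd z * ln (INR n)),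
   exp (fst z * ln (INR n)) * sin (snd z * ln (INR n))).

Definition CSeries (f : nat -> C) : C :=
  (Series (fun k => fst (f k)), Series (fun k => snd (f k))).

(* zeta(s) = 1/(s-1) + sum_{n>=1} ( n^{-s} - int_n^{n+1} x^{-s} dx ),
   with int_n^{n+1} x^{-s} dx = (n^{1-s} - (n+1)^{1-s})/(s-1);
   the series converges for Re s > 0 and this is the analytic continuation. *)
Definition zeta (s : C) : C :=
  Cplus (Cinv (Cminus s 1))
    (CSeries (fun k =>
       Cminus (npow (S k) (Copp s))
         (Cdiv (Cminus (npow (S k) (Cminus 1 s)) (npow (S (S k)) (Cminus 1 s)))
               (Cminus s 1)))).

(* 1/zeta(s), with the usual convention 1/zeta(1) = 0 at the pole *)
Definition inv_zeta (s : C) : C :=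
  if Req_EM_T (fst s) 1 then
    (if Req_EM_T (snd s) 0 then RtoC 0 else Cinv (zeta s))
  else Cinv (zeta s).

Definition RH : Prop :=
  forall s : C, 0 < fst s < 1 -> zeta s = RtoC 0 -> fst s = 1/2.

Definition is_gamma1 (g : R) : Prop :=
  0 < g /\ zeta (1/2, g) = RtoC 0 /\
  (forall s : C, 0 < fst s < 1 -> 0 < snd s < g -> zeta s <> RtoC 0).

Fixpoint mob_partial (N : nat) (x : R) (s : C) : C :=
  match N with
  | O => RtoC 0
  | S m => Cplus (mob_partial m x s)
             (if Rle_dec (INR (S m)) x
              then Cmult (RtoC (mobius (S m))) (npow (S m) (Copp s))
              else RtoC 0)
  end.

Definition mob_sum (x : R) (s : C) : C := mob_partial (Z.to_nat (up x)) x s.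

Definition ee : R := exp 1.

Definition delta (t0 : R) : R := (1 + 1 / t0) ^ 2.
Definition lambda (t0 : R) : R := (t0 / 2) * ln (ln (3 * t0 / 2)).

Definition a1 (t0 : R) : R :=
  let d := delta t0 in
  d * (117 / 4 + 3 * d + (3 + d) * (t0 / exp (exp 2) + (3 + ee) / ee)).
Definition a2 (g t0 : R) : R :=
  delta t0 / 75 * (t0 / (2 * g) + 1 + 1 / ee).
Definition a4 (t0 : R) : R :=
  let d := delta t0 in 4 * d / (5 * ee) * (3 + d / 4).

Definition Mfun (a b c t : R) : R := a + b / (Rpower (ln t) c * ln (ln t)).
Definition M1 (t : R) : R := Mfun 0.759282 20.1911 0.285 t.
Definition M2 (t : R) : R := Mfun 0.653 60.12 0.2705 t.

(* defined for u >= log log (2 pi); values below that are irrelevant *)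
Definition phi1 (u : R) : R :=
  if Rlt_dec u (ln (ln (10 ^ 2465))) then 0.96
  else 1.719282 - M1 (10 ^ 2465) + 20.1911 / (u * exp (0.285 * u)).
Definition phi2 (u : R) : R :=
  if Rlt_dec u (ln (ln (10 ^ 208))) then 2.491
  else 3.144 - M2 (10 ^ 208) + 60.12 / (u * exp (0.2705 * u)).

Definition omega (g t0 u : R) : R :=
  let l := lambda t0 in
  a1 t0 * phi2 u / (l * u) + a2 g t0 * u / (l * exp u) + 15.83 / exp u
  + 12 * l / (u * exp (exp u)) * (3 * phi1 u / (2 * u) + 3 / (100 * exp (u + exp u)))
  + a4 t0 * phi2 u / (u ^ 2 * exp u).

Definition omega1 (g sigma t0 u : R) : R :=
  2 * (phi1 u / u + 1 / (50 * exp (u + exp u)))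
    * ln (1 + 2 * lambda t0 / ((sigma - 1 / 2) * u))
  + omega g t0 u.

Definition omega01 (g sigma0 t0 x0 : R) : R :=
  omega1 g sigma0 t0 (ln (ln (3 * ee * sqrt x0 / 2))).

Definition alpha (g sigma0 t0 x0 : R) : R := sigma0 + omega01 g sigma0 t0 x0 / 2.

Definition N1 (g sigma0 t0 x0 : R) : R :=
  let w := omega01 g sigma0 t0 x0 in
  / PI * Rpower (3 * ee / 2) w
    * (1 / 2 + 1 / ln x0 + (1.1 - sigma0) / (Rpower x0 (sigma0 - 1 / 2) * ln x0))
  + 1 / Rpower x0 (w / 2)
    * (8 * exp (exp 2) / (PI * sigma0 * (sigma0 - 1 / 2) * ln x0)
       + 23.6 / Rpower x0 (sigma0 - 1 / 2)).

(* Main.v *)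
(* The exponent alpha exceeds 1/2 by at least 4.33/u, u = log log (3 e sqrt x0 / 2), because minimising
   D + (3/4) log (1 + 2 lambda / D) + 12.6 / lambda over D, lambda > 0 gives 4.33; here lambda > 0 because a
   trapezoid rule for zeta shows gamma_1 > 0.96.  If alpha >= 1, the trivial bound |M(n)| <= n on the summatory
   function M of mu is already n^alpha.  Otherwise u > 8.66, and RH is used in the strong form
   |M(n)| <= n^(1/2 + 4.1/v), v = log log sqrt n.  The latter is obtained without zeros or functional equation.
   On the lines b = 1/2 + 0.01/v < c = 1/2 + 2.61/v, a bound log |zeta(b+it)| <= S gives, by Borel-Caratheodory
   and the three lines theorem on [b, 3/2], the bound S/3 for |log zeta(c+it)|, and the three lines theorem on
   [1/50, c] returns this to the line b as tau + S/3; iterating, S <= (3/2) tau.  Hence 1/zeta(c+it) is at most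
   a constant times T^(slope) for |t| <= T, and Perron's formula with a Cesaro kernel bounds M.
   Finally |M(n)| <= n^alpha for n >= [x] turns, by partial summation, into
   |sum - 1/zeta(s)| <= (1 + |s|/(sigma - alpha)) x^(alpha - sigma), where the series is identified with 1/zeta
   by the three lines theorem; and N_1 log x >= 1. *)

Require Import Defs.
From Stdlib Require Import Reals Lra Lia Psatz ZArith Wf_nat IndefiniteDescription.
From Coquelicot Require Import Coquelicot.
From mathcomp Require ssreflect ssrfun ssrbool eqtype ssrnat seq path div prime zify.
Open Scope R_scope.

(** * Complex estimates and second-order jets *)

(** [zreg], that is (1 - 1/s) zeta(s), replaces zeta: it has no pole, stays within 2/3 of 1 on Re s
    = 4 and under RH does not vanish for Re s > 1/2, so one logarithm serves the whole strip. What
    shapes the estimates is growth in t: the three lines theorem is proved for functions bounded on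
    the strip. Hence the Gaussian factors exp(k (s - s0)^2) and the bounds exp(S + t^2/T^2), whose
    excess over exp(S) is at most a constant factor for |t| <= T. Exponents for n = exp(2 exp v),
    with T = sqrt n: the line Re s = c gives 1/2 + 2.61/v; the growth T^(2.71/v) of 1/zeta adds
    1.355/v; a factor T^(0.1/v), which makes the line integral converge, adds 0.05/v. The total
    4.015/v leaves 0.085/v for all constants. The gap between 4.1 and 4.33 pays for passing from u
    to v, since n may be smaller than the square of (3/2) e sqrt x0. *)

Ltac ceq := apply injective_projections; simpl; try ring.

Lemma Cmod_sqr (z : C) : Cmod z ^ 2 = fst z ^ 2 + snd z ^ 2.
Proof. unfold Cmod. rewrite pow2_sqrt; [reflexivity|nra]. Qed.

Lemma Cmod_fst (z : C) : Rabs (fst z) <= Cmod z.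
Proof. pose proof (Rmax_Cmod z). pose proof (Rmax_l (Rabs (fst z)) (Rabs (snd z))). lra. Qed.

Lemma Cmod_snd (z : C) : Rabs (snd z) <= Cmod z.
Proof. pose proof (Rmax_Cmod z). pose proof (Rmax_r (Rabs (fst z)) (Rabs (snd z))). lra. Qed.

Lemma Cmod_le_sum (z : C) : Cmod z <= Rabs (fst z) + Rabs (snd z).
Proof.
  pose proof (Rabs_pos (fst z)); pose proof (Rabs_pos (snd z)).
  apply Rsqr_incr_0; [|apply Cmod_ge_0|lra].
  rewrite !Rsqr_pow2, Cmod_sqr, <- (pow2_abs (fst z)), <- (pow2_abs (snd z)). nra.
Qed.

Lemma Cmod_real (x : R) : 0 <= x -> Cmod (RtoC x) = x.
Proof. intros; rewrite Cmod_R; apply Rabs_pos_eq; auto. Qed.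

Lemma Cmod_sub_sym (x y : C) : Cmod (x - y) = Cmod (y - x).
Proof. rewrite <- Cmod_opp. f_equal. ceq. Qed.

Lemma Cmod_sub_triangle (x y : C) : Cmod x - Cmod y <= Cmod (x - y).
Proof.
  replace (Cmod x) with (Cmod (x - y + y)) by (f_equal; ceq).
  pose proof (Cmod_triangle (x - y) y). lra.
Qed.

Lemma Cmod_minus_le (x y : C) : Cmod (x - y) <= Cmod x + Cmod y.
Proof. unfold Cminus. rewrite <- (Cmod_opp y). apply Cmod_triangle. Qed.

(** Cauchy-Schwarz in the plane: the left side is the real part of [Cconj z * w]. *)
Lemma Cmod_dot (z w : C) : fst z * fst w + snd z * snd w <= Cmod z * Cmod w.
Proof.
  replace (fst z * fst w + snd z * snd w) with (fst (Cconj z * w)%C) by (simpl; ring).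
  rewrite <- (Cmod_conj z), <- Cmod_mult.
  eapply Rle_trans; [apply Rle_abs|apply Cmod_fst].
Qed.

Lemma Cneq_0_Cmod (z : C) : 0 < Cmod z -> z <> RtoC 0.
Proof. intros H ->. rewrite Cmod_0 in H. lra. Qed.

(** * The complex exponential and its Taylor remainders *)

Definition cexp (z : C) : C := (exp (fst z) * cos (snd z), exp (fst z) * sin (snd z)).

Arguments cexp z%_C_scope.

Lemma cexp_plus (z w : C) : cexp (z + w) = (cexp z * cexp w)%C.
Proof.
  unfold cexp. apply injective_projections; simpl; rewrite exp_plus, ?cos_plus, ?sin_plus; ring.
Qed.

Lemma cexp_0 : cexp 0 = 1.
Proof. unfold cexp; apply injective_projections; simpl; rewrite exp_0, ?cos_0, ?sin_0; ring. Qed.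

Lemma Cmod_cexp (z : C) : Cmod (cexp z) = exp (fst z).
Proof.
  pose proof (exp_pos (fst z)).
  apply Rsqr_inj; [apply Cmod_ge_0|lra|].
  rewrite !Rsqr_pow2, Cmod_sqr. unfold cexp; simpl.
  pose proof (sin2_cos2 (snd z)). unfold Rsqr in *. nra.
Qed.

Lemma cexp_neq_0 (z : C) : cexp z <> 0.
Proof. apply Cneq_0_Cmod. rewrite Cmod_cexp. apply exp_pos. Qed.

Lemma cexp_RtoC (x : R) : cexp (RtoC x) = RtoC (exp x).
Proof. unfold cexp; apply injective_projections; simpl; rewrite ?cos_0, ?sin_0; ring. Qed.

Lemma cexp_opp (z : C) : (cexp z * cexp (- z) = 1)%C.
Proof. rewrite <- cexp_plus, <- cexp_0. f_equal. ceq. Qed.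

(* Test F against the direction of F b - F a and apply the real mean value theorem. *)
Lemma cmvt (F F' : R -> C) (a b K : R) :
  a <= b ->
  (forall x, a <= x <= b -> is_derive (fun r => fst (F r)) x (fst (F' x))) ->
  (forall x, a <= x <= b -> is_derive (fun r => snd (F r)) x (snd (F' x))) ->
  (forall x, a <= x <= b -> Cmod (F' x) <= K) ->
  Cmod (F b - F a) <= K * (b - a).
Proof.
  intros Hab H1 H2 HK.
  set (u := (F b - F a)%C).
  destruct (Req_dec (Cmod u) 0) as [E|E].
  { rewrite E. specialize (HK a ltac:(lra)). pose proof (Cmod_ge_0 (F' a)). nra. }
  assert (Hu : 0 < Cmod u) by (pose proof (Cmod_ge_0 u); lra).
  destruct (MVT_gen (fun r => fst u * fst (F r) + snd u * snd (F r)) a b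
     (fun r => fst u * fst (F' r) + snd u * snd (F' r))) as [c [Hc Hm]].
  - rewrite Rmin_left, Rmax_right by lra. intros x Hx.
    apply (is_derive_plus (fun r => fst u * fst (F r)) (fun r => snd u * snd (F r))).
    + apply is_derive_scal. apply H1; lra.
    + apply is_derive_scal. apply H2; lra.
  - rewrite Rmin_left, Rmax_right by lra. intros x Hx.
    apply continuity_pt_filterlim. apply (ex_derive_continuous (fun r => fst u * fst (F r) + snd u * snd (F r))).
    eexists. apply (is_derive_plus (fun r => fst u * fst (F r)) (fun r => snd u * snd (F r))).
    + apply is_derive_scal. apply H1; lra.
    + apply is_derive_scal. apply H2; lra.
  - rewrite Rmin_left, Rmax_right in Hc by lra.
    assert (E1 : Cmod u ^ 2 = fst u * fst (F b) + snd u * snd (F b) - (fst u * fst (F a) + snd u * snd (F a))).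
    { rewrite Cmod_sqr. unfold u; simpl. ring. }
    pose proof (Cmod_dot u (F' c)) as Hf.
    specialize (HK c Hc).
    assert (Cmod u * Cmod u <= Cmod u * (K * (b - a))).
    { replace (Cmod u * Cmod u) with (Cmod u ^ 2) by ring. rewrite E1, Hm.
      assert (fst u * fst (F' c) + snd u * snd (F' c) <= Cmod u * K).
      { eapply Rle_trans; [|apply Rmult_le_compat_l; [lra|exact HK]].
        lra. }
      nra. }
    apply Rmult_le_reg_l with (Cmod u); auto.
Qed.

Lemma is_derive_cexp_line (z w : C) (x : R) :
  is_derive (fun r => fst (cexp (z + RtoC r * w))) x (fst (w * cexp (z + RtoC x * w))%C) /\
  is_derive (fun r => snd (cexp (z + RtoC r * w))) x (snd (w * cexp (z + RtoC x * w))%C).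
Proof. split; simpl; auto_derive; auto; unfold Rminus; ring. Qed.

Definition cE1 (z : C) : C := (cexp z - 1)%C.
Definition cE2 (z : C) : C := (cexp z - 1 - z)%C.
Definition cE3 (z : C) : C := (cexp z - 1 - z - z * z / 2)%C.

Arguments cE1 z%_C_scope.
Arguments cE2 z%_C_scope.
Arguments cE3 z%_C_scope.

Lemma exp_le_compat (x y : R) : x <= y -> exp x <= exp y.
Proof. intros [H| ->]; [left; apply exp_increasing; auto|lra]. Qed.

Lemma Cmod_scal (r : R) (z : C) : 0 <= r -> Cmod (RtoC r * z) = r * Cmod z.
Proof. intros; rewrite Cmod_mult, Cmod_real; auto. Qed.

(** Mean value inequality along the segment from 0 to [z]. The bounds for [cE2] and [cE3] repeat it:
    along the segment, the derivative of each remainder is [z] times the preceding one. *)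
Lemma cE1_bound (z : C) : Cmod (cE1 z) <= Cmod z * exp (Cmod z).
Proof.
  unfold cE1.
  replace (cexp z - 1)%C with (cexp (RtoC 0 + RtoC 1 * z) - cexp (RtoC 0 + RtoC 0 * z))%C.
  2:{ replace (RtoC 0 + RtoC 1 * z)%C with z by ceq.
      replace (RtoC 0 + RtoC 0 * z)%C with (RtoC 0) by ceq. rewrite cexp_0. reflexivity. }
  eapply Rle_trans; [apply (cmvt (fun r => cexp (RtoC 0 + RtoC r * z)) (fun r => (z * cexp (RtoC 0 + RtoC r * z))%C) 0 1 (Cmod z * exp (Cmod z)))|lra].
  - lra.
  - intros; apply is_derive_cexp_line.
  - intros; apply is_derive_cexp_line.
  - intros x Hx. rewrite Cmod_mult. apply Rmult_le_compat_l; [apply Cmod_ge_0|].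
    rewrite Cmod_cexp. apply exp_le_compat.
    eapply Rle_trans; [apply Rle_abs|]. eapply Rle_trans; [apply Cmod_fst|].
    replace (RtoC 0 + RtoC x * z)%C with (RtoC x * z)%C by ceq. rewrite Cmod_scal by lra.
    pose proof (Cmod_ge_0 z). nra.
Qed.

Lemma cE2_bound (z : C) : Cmod (cE2 z) <= Cmod z ^ 2 * exp (Cmod z).
Proof.
  set (F := fun r => (cexp (RtoC r * z) - 1 - RtoC r * z)%C).
  replace (cE2 z) with (F 1 - F 0)%C.
  2:{ unfold F, cE2. replace (RtoC 1 * z)%C with z by ceq.
      replace (RtoC 0 * z)%C with (RtoC 0) by ceq. rewrite cexp_0. ceq. }
  eapply Rle_trans; [apply (cmvt F (fun r => (z * cE1 (RtoC r * z))%C) 0 1 (Cmod z ^ 2 * exp (Cmod z)))|lra].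
  - lra.
  - intros; unfold F, cE1; simpl; auto_derive; auto; unfold Rminus; ring.
  - intros; unfold F, cE1; simpl; auto_derive; auto; unfold Rminus; ring.
  - intros x Hx. rewrite Cmod_mult.
    pose proof (cE1_bound (RtoC x * z)) as H. rewrite Cmod_scal in H by lra.
    pose proof (Cmod_ge_0 z).
    assert (exp (x * Cmod z) <= exp (Cmod z)) by (apply exp_le_compat; nra).
    pose proof (exp_pos (x * Cmod z)).
    assert (x * Cmod z * exp (x * Cmod z) <= Cmod z * exp (Cmod z)).
    { apply Rmult_le_compat; nra. }
    nra.
Qed.

Lemma cE3_bound (z : C) : Cmod (cE3 z) <= Cmod z ^ 3 * exp (Cmod z).
Proof.
  set (F := fun r => (cexp (RtoC r * z) - 1 - RtoC r * z - RtoC (r * r / 2) * (z * z))%C).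
  replace (cE3 z) with (F 1 - F 0)%C.
  2:{ unfold F, cE3. replace (RtoC 1 * z)%C with z by ceq.
      replace (RtoC 0 * z)%C with (RtoC 0) by ceq. rewrite cexp_0. ceq; field. }
  eapply Rle_trans; [apply (cmvt F (fun r => (z * cE2 (RtoC r * z))%C) 0 1 (Cmod z ^ 3 * exp (Cmod z)))|lra].
  - lra.
  - intros; unfold F, cE2; simpl; auto_derive; auto; unfold Rminus; field.
  - intros; unfold F, cE2; simpl; auto_derive; auto; unfold Rminus; field.
  - intros x Hx. rewrite Cmod_mult.
    pose proof (cE2_bound (RtoC x * z)) as H. rewrite Cmod_scal in H by lra.
    pose proof (Cmod_ge_0 z).
    assert (exp (x * Cmod z) <= exp (Cmod z)) by (apply exp_le_compat; nra).
    pose proof (exp_pos (x * Cmod z)).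
    assert ((x * Cmod z) ^ 2 * exp (x * Cmod z) <= Cmod z ^ 2 * exp (Cmod z)).
    { apply Rmult_le_compat; try nra. apply pow_incr; nra. }
    replace (Cmod z ^ 3 * exp (Cmod z)) with (Cmod z * (Cmod z ^ 2 * exp (Cmod z))) by ring.
    apply Rmult_le_compat_l; lra.
Qed.

(* Second-order jets stand in for holomorphy: a cubic error term is all that the maximum principle below needs. *)
Definition jet (f : C -> C) (z a b : C) : Prop :=
  exists d K, 0 < d /\ 0 <= K /\ forall h, Cmod h < d ->
    Cmod (f (z + h)%C - (f z + a * h + b * (h * h)))%C <= K * Cmod h ^ 3.

Definition J (f : C -> C) (z : C) : Prop := exists a b, jet f z a b.

Lemma jet_ext (f g : C -> C) (z a b : C) : (forall w, f w = g w) -> jet f z a b -> jet g z a b.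
Proof. intros E (d & K & Hd & HK & H). exists d, K; repeat split; auto. intros; rewrite <- !E; auto. Qed.

Lemma jet_ext_loc (f g : C -> C) (z a b : C) (e : R) : 0 < e ->
  (forall h, Cmod h < e -> f (z + h)%C = g (z + h)%C) -> jet f z a b -> jet g z a b.
Proof.
  intros He E (d & K & Hd & HK & H). exists (Rmin d e), K; repeat split; auto.
  { apply Rmin_glb_lt; auto. }
  intros h Hh. pose proof (Rmin_l d e); pose proof (Rmin_r d e).
  rewrite <- E by lra.
  replace (g z) with (f z). 2:{ pose proof (E 0). replace (z + 0)%C with z in H2 by ceq. apply H2. rewrite Cmod_0; lra. }
  apply H; lra.
Qed.

Lemma jet_const (c z : C) : jet (fun _ => c) z 0 0.
Proof. exists 1, 0; repeat split; try lra. intros h _.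
  replace (c - _)%C with (RtoC 0) by ceq. rewrite Cmod_0; lra. Qed.

Lemma jet_id (z : C) : jet (fun w => w) z 1 0.
Proof. exists 1, 0; repeat split; try lra. intros h _.
  replace (z + h - _)%C with (RtoC 0) by ceq. rewrite Cmod_0; lra. Qed.

Lemma jet_plus (f g : C -> C) (z a b a' b' : C) :
  jet f z a b -> jet g z a' b' -> jet (fun w => f w + g w)%C z (a + a')%C (b + b')%C.
Proof.
  intros (d & K & Hd & HK & H) (d' & K' & Hd' & HK' & H').
  exists (Rmin d d'), (K + K'); repeat split; [apply Rmin_glb_lt; auto|lra|].
  intros h Hh. pose proof (Rmin_l d d'); pose proof (Rmin_r d d').
  specialize (H h ltac:(lra)). specialize (H' h ltac:(lra)).
  replace (f (z + h) + g (z + h) - (f z + g z + (a + a') * h + (b + b') * (h * h)))%C with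
   ((f (z + h) - (f z + a * h + b * (h * h))) + (g (z + h) - (g z + a' * h + b' * (h * h))))%C by ceq.
  eapply Rle_trans; [apply Cmod_triangle|]. nra.
Qed.

Lemma jet_lip (f : C -> C) (z a b : C) : jet f z a b ->
  exists d K, 0 < d /\ 0 <= K /\ forall h, Cmod h < d -> Cmod (f (z + h)%C - f z)%C <= K * Cmod h.
Proof.
  intros (d & K & Hd & HK & H). exists (Rmin d 1), (Cmod a + Cmod b + K).
  pose proof (Cmod_ge_0 a); pose proof (Cmod_ge_0 b).
  repeat split; [apply Rmin_glb_lt; lra|lra|].
  intros h Hh. pose proof (Rmin_l d 1); pose proof (Rmin_r d 1).
  specialize (H h ltac:(lra)).
  replace (f (z + h) - f z)%C with ((f (z + h) - (f z + a * h + b * (h * h))) + (a * h + b * (h * h)))%C by ceq.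
  eapply Rle_trans; [apply Cmod_triangle|].
  pose proof (Cmod_triangle (a * h) (b * (h * h))) as H5. rewrite !Cmod_mult in H5.
  pose proof (Cmod_ge_0 h) as Hh0.
  assert (Cmod h * Cmod h <= Cmod h) by nra.
  assert (Cmod h ^ 3 <= Cmod h) by (simpl; nra). nra.
Qed.

Lemma jet_mult (f g : C -> C) (z a b a' b' : C) :
  jet f z a b -> jet g z a' b' ->
  jet (fun w => f w * g w)%C z (a * g z + f z * a')%C (b * g z + a * a' + f z * b')%C.
Proof.
  intros Hf Hg. destruct (jet_lip _ _ _ _ Hf) as (df & Lf & Hdf & HLf & HF).
  destruct (jet_lip _ _ _ _ Hg) as (dg & Lg & Hdg & HLg & HG).
  destruct Hf as (d & K & Hd & HK & H). destruct Hg as (d' & K' & Hd' & HK' & H').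
  set (e := Rmin (Rmin d d') (Rmin (Rmin df dg) 1)).
  set (A := Cmod a); set (B := Cmod b); set (A' := Cmod a'); set (B' := Cmod b').
  exists e, ((K * (Cmod (g z) + Lg)) + K' * (Cmod (f z) + A + B) + (A * B' + B * A') + B * B').
  assert (He : e <= d /\ e <= d' /\ e <= df /\ e <= dg /\ e <= 1).
  { unfold e. repeat split; unfold Rmin; repeat destruct Rle_dec; lra. }
  assert (HA : 0 <= A) by apply Cmod_ge_0. assert (HB : 0 <= B) by apply Cmod_ge_0.
  assert (HA' : 0 <= A') by apply Cmod_ge_0. assert (HB' : 0 <= B') by apply Cmod_ge_0.
  pose proof (Cmod_ge_0 (f z)) as Hfz. pose proof (Cmod_ge_0 (g z)) as Hgz.
  repeat split.
  { unfold e, Rmin; repeat destruct Rle_dec; lra. }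
  { assert (0 <= K * (Cmod (g z) + Lg)) by nra. assert (0 <= K' * (Cmod (f z) + A + B)) by nra.
    assert (0 <= A * B') by nra. assert (0 <= B * A') by nra. assert (0 <= B * B') by nra. lra. }
  intros h Hh. pose proof (Cmod_ge_0 h) as Hh0.
  specialize (H h ltac:(lra)). specialize (H' h ltac:(lra)).
  specialize (HF h ltac:(lra)). specialize (HG h ltac:(lra)).
  set (rf := (f (z + h) - (f z + a * h + b * (h * h)))%C) in *.
  set (rg := (g (z + h) - (g z + a' * h + b' * (h * h)))%C) in *.
  (* The remainder of the product: each factor's remainder times the other factor, plus the terms of
     order 3 and 4 in [h] from the product of the two quadratic polynomials. *)
  replace (f (z + h) * g (z + h) - (f z * g z + (a * g z + f z * a') * h + (b * g z + a * a' + f z * b') * (h * h)))%C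
   with (rf * g (z + h)%C + (f z + a * h + b * (h * h)) * rg + ((a * b' + b * a') * (h * (h * h)) + b * b' * (h * h * (h * h))))%C
   by (unfold rf, rg; ceq).
  set (m := Cmod h) in *.
  assert (Hm : m <= 1) by lra.
  assert (Hg2 : Cmod (g (z + h)%C) <= Cmod (g z) + Lg).
  { pose proof (Cmod_sub_triangle (g (z + h)%C) (g z)). nra. }
  assert (Hf2 : Cmod (f z + a * h + b * (h * h))%C <= Cmod (f z) + A + B).
  { eapply Rle_trans; [apply Cmod_triangle|]. rewrite !Cmod_mult. fold m B.
    pose proof (Cmod_triangle (f z) (a * h)) as Ht. rewrite Cmod_mult in Ht. fold A m in Ht.
    assert (m * m <= 1) by nra. nra. }
  assert (Hm3 : 0 <= m ^ 3) by (apply pow_le; auto).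
  assert (Hm4 : m ^ 4 <= m ^ 3) by (simpl in *; nra).
  eapply Rle_trans; [apply Cmod_triangle|].
  eapply Rle_trans; [apply Rplus_le_compat_r; apply Cmod_triangle|].
  assert (T1 : Cmod (rf * g (z + h)%C) <= K * (Cmod (g z) + Lg) * m ^ 3).
  { rewrite Cmod_mult. pose proof (Cmod_ge_0 rf). pose proof (Cmod_ge_0 (g (z + h)%C)).
    apply Rle_trans with (K * m ^ 3 * (Cmod (g z) + Lg)); [|nra].
    apply Rmult_le_compat; auto. }
  assert (T2 : Cmod ((f z + a * h + b * (h * h)) * rg) <= K' * (Cmod (f z) + A + B) * m ^ 3).
  { rewrite Cmod_mult. pose proof (Cmod_ge_0 rg). pose proof (Cmod_ge_0 (f z + a * h + b * (h * h))%C).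
    apply Rle_trans with ((Cmod (f z) + A + B) * (K' * m ^ 3)); [|nra].
    apply Rmult_le_compat; auto. }
  assert (T3 : Cmod ((a * b' + b * a') * (h * (h * h)) + b * b' * (h * h * (h * h))) <= (A * B' + B * A') * m ^ 3 + B * B' * m ^ 3).
  { eapply Rle_trans; [apply Cmod_triangle|]. rewrite !Cmod_mult. fold m B B'.
    pose proof (Cmod_triangle (a * b') (b * a')) as Ht. rewrite !Cmod_mult in Ht. fold A A' B B' in Ht.
    assert (0 <= B * B') by nra.
    apply Rplus_le_compat.
    - replace (m * (m * m)) with (m ^ 3) by ring. apply Rmult_le_compat_r; auto.
    - replace (m * m * (m * m)) with (m ^ 4) by ring. apply Rmult_le_compat_l; auto. }
  lra.
Qed.

Lemma jet_comp (f g : C -> C) (z a b a' b' : C) :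
  jet f z a b -> jet g (f z) a' b' ->
  jet (fun w => g (f w)) z (a' * a)%C (a' * b + b' * (a * a))%C.
Proof.
  intros Hf Hg. destruct (jet_lip _ _ _ _ Hf) as (df & Lf & Hdf & HLf & HF).
  destruct Hf as (d & K & Hd & HK & H). destruct Hg as (d' & K' & Hd' & HK' & H').
  set (e := Rmin (Rmin d df) (Rmin (d' / (Lf + 1)) 1)).
  set (A := Cmod a); set (B := Cmod b); set (A' := Cmod a'); set (B' := Cmod b').
  assert (Hq : 0 < d' / (Lf + 1)) by (apply Rdiv_lt_0_compat; lra).
  assert (He : 0 < e /\ e <= d /\ e <= df /\ e <= d' / (Lf + 1) /\ e <= 1).
  { unfold e. repeat split; unfold Rmin; repeat destruct Rle_dec; lra. }
  assert (HA : 0 <= A) by apply Cmod_ge_0. assert (HB : 0 <= B) by apply Cmod_ge_0.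
  assert (HA' : 0 <= A') by apply Cmod_ge_0. assert (HB' : 0 <= B') by apply Cmod_ge_0.
  exists e, (K' * Lf ^ 3 + A' * K + B' * ((B + K) * (Lf + A))).
  assert (0 <= Lf ^ 3) by (apply pow_le; auto).
  repeat split; [lra| |].
  { assert (0 <= K' * Lf ^ 3) by nra. assert (0 <= A' * K) by nra. assert (0 <= (B + K) * (Lf + A)) by nra. nra. }
  intros h Hh. pose proof (Cmod_ge_0 h) as Hh0.
  specialize (H h ltac:(lra)). specialize (HF h ltac:(lra)).
  set (k := (f (z + h) - f z)%C) in *.
  assert (Hk : Cmod k < d').
  { apply Rle_lt_trans with (Lf * Cmod h); auto.
    assert (Cmod h * (Lf + 1) < d').
    { apply Rmult_lt_reg_r with (/ (Lf + 1)); [apply Rinv_0_lt_compat; lra|].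
      rewrite Rmult_assoc, Rinv_r by lra. fold (d' / (Lf + 1)). lra. }
    nra. }
  specialize (H' k Hk). replace (f z + k)%C with (f (z + h)%C) in H' by (unfold k; ceq).
  set (rg := (g (f (z + h)%C) - (g (f z) + a' * k + b' * (k * k)))%C) in *.
  set (rf := (f (z + h) - (f z + a * h + b * (h * h)))%C) in *.
  (* The last summand is [b' (k^2 - (a h)^2)], factored through [k - a h = b h^2 + rf]. *)
  replace (g (f (z + h)%C) - (g (f z) + a' * a * h + (a' * b + b' * (a * a)) * (h * h)))%C with
    (rg + a' * rf + b' * ((b * (h * h) + rf) * (k + a * h)))%C by (unfold rg, rf, k; ceq).
  set (m := Cmod h) in *. assert (Hm : m <= 1) by lra.
  assert (Hm3 : 0 <= m ^ 3) by (apply pow_le; auto).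
  eapply Rle_trans; [apply Cmod_triangle|].
  eapply Rle_trans; [apply Rplus_le_compat_r; apply Cmod_triangle|].
  rewrite !Cmod_mult. fold A' B'.
  assert (T1 : Cmod rg <= K' * Lf ^ 3 * m ^ 3).
  { eapply Rle_trans; [exact H'|]. rewrite Rmult_assoc. apply Rmult_le_compat_l; auto.
    rewrite <- Rpow_mult_distr. apply pow_incr. split; [apply Cmod_ge_0|auto]. }
  assert (T2 : A' * Cmod rf <= A' * K * m ^ 3) by nra.
  assert (T3 : Cmod (b * (h * h) + rf) <= (B + K) * m ^ 2).
  { eapply Rle_trans; [apply Cmod_triangle|]. rewrite !Cmod_mult. fold m B.
    assert (m ^ 3 <= m ^ 2) by (simpl; nra). nra. }
  assert (T4 : Cmod (k + a * h) <= (Lf + A) * m).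
  { eapply Rle_trans; [apply Cmod_triangle|]. rewrite !Cmod_mult. fold m A. nra. }
  assert (T5 : Cmod (b * (h * h) + rf) * Cmod (k + a * h) <= (B + K) * (Lf + A) * m ^ 3).
  { replace ((B + K) * (Lf + A) * m ^ 3) with (((B + K) * m ^ 2) * ((Lf + A) * m)) by ring.
    apply Rmult_le_compat; auto; apply Cmod_ge_0. }
  assert (B' * (Cmod (b * (h * h) + rf) * Cmod (k + a * h)) <= B' * ((B + K) * (Lf + A) * m ^ 3)) by (apply Rmult_le_compat_l; auto).
  lra.
Qed.

Lemma jet_cexp (z : C) : jet cexp z (cexp z) (cexp z / 2)%C.
Proof.
  exists 1, (exp (fst z) * exp 1). pose proof (exp_pos (fst z)); pose proof (exp_pos 1).
  repeat split; try nra.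
  intros h Hh. rewrite cexp_plus.
  replace (cexp z * cexp h - (cexp z + cexp z * h + cexp z / 2 * (h * h)))%C with (cexp z * cE3 h)%C.
  2:{ unfold cE3. generalize (cexp z) (cexp h). intros u v. ceq; field. }
  rewrite Cmod_mult, Cmod_cexp. pose proof (cE3_bound h).
  assert (exp (Cmod h) <= exp 1) by (apply exp_le_compat; lra).
  pose proof (Cmod_ge_0 h). assert (0 <= Cmod h ^ 3) by (apply pow_le; auto).
  assert (Cmod h ^ 3 * exp (Cmod h) <= Cmod h ^ 3 * exp 1) by (apply Rmult_le_compat_l; auto).
  rewrite Rmult_assoc. apply Rmult_le_compat_l; [lra|]. lra.
Qed.

(** The geometric series has the exact remainder [- h^3 / (z^3 (z + h))], and [|z + h| >= |z|/2]. *)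
Lemma jet_inv (z : C) : z <> RtoC 0 -> jet Cinv z (- (/ z * / z))%C (/ z * / z * / z)%C.
Proof.
  intros Hz. pose proof (proj1 (Cmod_gt_0 z) Hz) as Hp.
  exists (Cmod z / 2), (2 / Cmod z ^ 4).
  assert (0 < Cmod z ^ 4) by (apply pow_lt; auto).
  repeat split; [lra| |].
  { left; apply Rdiv_lt_0_compat; lra. }
  intros h Hh.
  assert (Hzh : Cmod z / 2 <= Cmod (z + h)).
  { pose proof (Cmod_sub_triangle z (- h)). rewrite Cmod_opp in H0.
    replace (z - - h)%C with (z + h)%C in H0 by ceq. lra. }
  assert (Hn : (z + h)%C <> RtoC 0) by (apply Cneq_0_Cmod; lra).
  replace (/ (z + h) - (/ z + - (/ z * / z) * h + / z * / z * / z * (h * h)))%C with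
    (- (h * h * h) / (z * z * z * (z + h)))%C.
  2:{ field. auto. }
  rewrite Cmod_div by (repeat apply Cmult_neq_0; auto).
  rewrite Cmod_opp, !Cmod_mult.
  pose proof (Cmod_ge_0 h).
  unfold Rdiv. replace (2 * / Cmod z ^ 4 * Cmod h ^ 3) with (Cmod h * Cmod h * Cmod h * (2 * / Cmod z ^ 4)) by ring.
  apply Rmult_le_compat_l; [repeat apply Rmult_le_pos; auto|].
  replace (2 * / Cmod z ^ 4) with (/ (Cmod z * Cmod z * Cmod z * (Cmod z / 2))) by (field; lra).
  assert (0 < Cmod z * Cmod z * Cmod z) by (repeat apply Rmult_lt_0_compat; auto).
  apply Rinv_le_contravar; [apply Rmult_lt_0_compat; lra|]. apply Rmult_le_compat_l; lra.
Qed.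

Lemma J_const (c z : C) : J (fun _ => c) z.
Proof. do 2 eexists; apply jet_const. Qed.
Lemma J_id (z : C) : J (fun w => w) z.
Proof. do 2 eexists; apply jet_id. Qed.
Lemma J_plus (f g : C -> C) (z : C) : J f z -> J g z -> J (fun w => f w + g w)%C z.
Proof. intros (a & b & H) (a' & b' & H'). do 2 eexists; eapply jet_plus; eauto. Qed.
Lemma J_mult (f g : C -> C) (z : C) : J f z -> J g z -> J (fun w => f w * g w)%C z.
Proof. intros (a & b & H) (a' & b' & H'). do 2 eexists; eapply jet_mult; eauto. Qed.
Lemma J_comp (f g : C -> C) (z : C) : J f z -> J g (f z) -> J (fun w => g (f w)) z.
Proof. intros (a & b & H) (a' & b' & H'). do 2 eexists; eapply jet_comp; eauto. Qed.
Lemma J_ext (f g : C -> C) (z : C) : (forall w, f w = g w) -> J f z -> J g z.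
Proof. intros E (a & b & H). do 2 eexists; eapply jet_ext; eauto. Qed.
Lemma J_opp (f : C -> C) (z : C) : J f z -> J (fun w => - f w)%C z.
Proof. intros H. apply (J_ext (fun w => RtoC (-1) * f w)%C). { intros; ceq. } apply J_mult; auto. apply J_const. Qed.
Lemma J_minus (f g : C -> C) (z : C) : J f z -> J g z -> J (fun w => f w - g w)%C z.
Proof. intros; apply J_plus; auto. apply J_opp; auto. Qed.
Lemma J_inv (f : C -> C) (z : C) : J f z -> f z <> RtoC 0 -> J (fun w => / f w)%C z.
Proof. intros Hf Hz. apply (J_comp f Cinv); auto. do 2 eexists; apply jet_inv; auto. Qed.
Lemma J_div (f g : C -> C) (z : C) : J f z -> J g z -> g z <> RtoC 0 -> J (fun w => f w / g w)%C z.
Proof. intros; apply J_mult; auto. apply J_inv; auto. Qed.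
Lemma J_cexp (f : C -> C) (z : C) : J f z -> J (fun w => cexp (f w)) z.
Proof. intros Hf. apply (J_comp f cexp); auto. do 2 eexists; apply jet_cexp. Qed.

Definition ccont (f : C -> C) (z : C) : Prop :=
  forall eps, 0 < eps -> exists d, 0 < d /\ forall h, Cmod h < d -> Cmod (f (z + h)%C - f z)%C < eps.

Lemma J_ccont (f : C -> C) (z : C) : J f z -> ccont f z.
Proof.
  intros (a & b & H) eps He. destruct (jet_lip _ _ _ _ H) as (d & K & Hd & HK & Hl).
  exists (Rmin d (eps / (K + 1))).
  assert (0 < eps / (K + 1)) by (apply Rdiv_lt_0_compat; lra).
  split; [apply Rmin_glb_lt; auto|].
  intros h Hh. pose proof (Rmin_l d (eps / (K + 1))); pose proof (Rmin_r d (eps / (K + 1))).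
  specialize (Hl h ltac:(lra)). pose proof (Cmod_ge_0 h).
  assert (Cmod h * (K + 1) < eps).
  { apply Rmult_lt_reg_r with (/ (K + 1)); [apply Rinv_0_lt_compat; lra|].
    rewrite Rmult_assoc, Rinv_r by lra. fold (eps / (K + 1)). lra. }
  nra.
Qed.

Lemma ccont_fst (f : C -> C) (x y : R) : ccont f (x, y) -> continuity_2d_pt (fun u v => fst (f (u, v))) x y.
Proof.
  intros H eps. destruct (H eps (cond_pos eps)) as (d & Hd & Hl).
  assert (Hd2 : 0 < d / 2) by lra. exists (mkposreal _ Hd2). simpl. intros u v Hu Hv.
  specialize (Hl (u - x, v - y)).
  replace (Cplus (x, y) (u - x, v - y)) with ((u, v) : C) in Hl by ceq.
  eapply Rle_lt_trans; [|apply Hl].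
  - apply (Cmod_fst (f (u, v) - f (x, y))%C).
  - eapply Rle_lt_trans; [apply Cmod_le_sum|]. simpl. lra.
Qed.

Lemma ccont_snd (f : C -> C) (x y : R) : ccont f (x, y) -> continuity_2d_pt (fun u v => snd (f (u, v))) x y.
Proof.
  intros H eps. destruct (H eps (cond_pos eps)) as (d & Hd & Hl).
  assert (Hd2 : 0 < d / 2) by lra. exists (mkposreal _ Hd2). simpl. intros u v Hu Hv.
  specialize (Hl (u - x, v - y)).
  replace (Cplus (x, y) (u - x, v - y)) with ((u, v) : C) in Hl by ceq.
  eapply Rle_lt_trans; [|apply Hl].
  - apply (Cmod_snd (f (u, v) - f (x, y))%C).
  - eapply Rle_lt_trans; [apply Cmod_le_sum|]. simpl. lra.
Qed.

(** * Maximum principle and three lines theorem *)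

(** Projection onto [a, b]; it extends the partial maximum in [max_rect] to the whole line, so that
    the endpoints need no separate treatment. *)
Definition clamp (a b x : R) : R := Rmax a (Rmin b x).
Lemma clamp_in a b x : a <= b -> a <= clamp a b x <= b.
Proof. intros; unfold clamp, Rmax, Rmin; repeat destruct Rle_dec; lra. Qed.
Lemma clamp_id a b x : a <= x <= b -> clamp a b x = x.
Proof. intros; unfold clamp, Rmax, Rmin; repeat destruct Rle_dec; lra. Qed.
Lemma clamp_lip a b x y : Rabs (clamp a b x - clamp a b y) <= Rabs (x - y).
Proof. unfold clamp, Rmax, Rmin; repeat destruct Rle_dec; unfold Rabs; repeat destruct Rcase_abs; lra. Qed.

(** An iterated maximum. The maximiser [ym x] in the second variable is merely chosen; what is
    continuous in [x] is the maximal value, by uniform continuity of [p]. *)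
Lemma max_rect (p : R -> R -> R) (a b c d : R) : a <= b -> c <= d ->
  (forall x y, a <= x <= b -> c <= y <= d -> continuity_2d_pt p x y) ->
  exists x0 y0, a <= x0 <= b /\ c <= y0 <= d /\
    forall x y, a <= x <= b -> c <= y <= d -> p x y <= p x0 y0.
Proof.
  intros Hab Hcd Hc.
  assert (H1 : forall x, exists y, a <= x <= b -> c <= y <= d /\ forall v, c <= v <= d -> p x v <= p x y).
  { intros x. destruct (Rle_dec a x) as [Ha|Ha]; [destruct (Rle_dec x b) as [Hb|Hb]|].
    - destruct (continuity_ab_maj (fun v => p x v) c d Hcd) as (y & Hy & Hy').
      { intros v Hv. apply continuity_pt_filterlim.
        apply continuity_pt_filterlim. intros e He. destruct (Hc x v ltac:(lra) Hv (mkposreal e He)) as (de & Hde).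
        exists de. split; [apply cond_pos|]. intros w [_ Hw]. simpl in *. unfold Rdist in *. apply Hde; auto.
        rewrite Rminus_diag. rewrite Rabs_R0. apply cond_pos. }
      exists y. intros _. auto.
    - exists 0; lra.
    - exists 0; lra. }
  destruct (functional_choice _ H1) as (ym & Hym). clear H1.
  set (g := fun x => p (clamp a b x) (ym (clamp a b x))).
  assert (Hg : forall x, continuity_pt g x).
  { intros x e He. destruct (uniform_continuity_2d p a b c d Hc (mkposreal e He)) as (de & Hde).
    exists de. split; [apply cond_pos|]. intros w [_ Hw]. simpl in *. unfold Rdist in *.
    pose proof (clamp_in a b x Hab) as Hx'. pose proof (clamp_in a b w Hab) as Hw'.
    pose proof (clamp_lip a b w x). pose proof (clamp_lip a b x w). rewrite (Rabs_minus_sym x w) in H0.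
    destruct (Hym _ Hx') as [Hyx Hmx]. destruct (Hym _ Hw') as [Hyw Hmw].
    unfold g. specialize (Hmx _ Hyw). specialize (Hmw _ Hyx).
    pose proof (Hde (clamp a b x) (ym (clamp a b w)) (clamp a b w) (ym (clamp a b w)) Hx' Hyw Hw' Hyw ltac:(lra)) as U1.
    pose proof (Hde (clamp a b x) (ym (clamp a b x)) (clamp a b w) (ym (clamp a b x)) Hx' Hyx Hw' Hyx ltac:(lra)) as U2.
    rewrite Rminus_diag, Rabs_R0 in U1, U2. specialize (U1 (cond_pos de)). specialize (U2 (cond_pos de)).
    apply Rabs_def2 in U1. apply Rabs_def2 in U2. apply Rabs_def1; lra. }
  destruct (continuity_ab_maj g a b Hab) as (x0 & Hx0 & Hx0').
  { intros; apply Hg. }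
  exists x0, (ym x0). destruct (Hym x0 Hx0') as [Hy Hm]. repeat split; try lra.
  intros x y Hx Hyy. specialize (Hx0 x Hx). unfold g in Hx0. rewrite !clamp_id in Hx0 by auto.
  destruct (Hym x Hx) as [_ Hm']. specialize (Hm' y Hyy). lra.
Qed.

(** All mixed terms cancel over the directions [h], [-h], [ih], [-ih], because both the directions
    and their squares sum to 0. The remaining coefficient of [h^2] is nonnegative: discrete
    subharmonicity of |q|^2. *)
Lemma four_point (g0 a b : C) (h : R) :
  let q w := (g0 + a * w + b * (w * w))%C in
  Cmod (q (RtoC h)) ^ 2 + Cmod (q (RtoC (-h))) ^ 2 + Cmod (q (0, h)) ^ 2 + Cmod (q (0, - h)) ^ 2
  = 4 * Cmod g0 ^ 2 + 4 * h ^ 2 * Cmod a ^ 2 + 4 * h ^ 4 * Cmod b ^ 2.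
Proof. intros q. rewrite !Cmod_sqr. unfold q. simpl. ring. Qed.

(* Four-point second-difference test: |f|^2 + eta x^2 is strictly subharmonic. *)
Lemma no_interior_max (f : C -> C) (z : C) (eta d : R) : 0 < eta -> 0 < d -> J f z ->
  ~ (forall h, Cmod h < d -> Cmod (f (z + h)%C) ^ 2 + eta * fst (z + h)%C ^ 2 <= Cmod (f z) ^ 2 + eta * fst z ^ 2).
Proof.
  intros He Hd (a & b & e & K & Hepos & HK & Hj) Hmax.
  set (Q := Cmod (f z) + Cmod a + Cmod b).
  pose proof (Cmod_ge_0 (f z)) as P0; pose proof (Cmod_ge_0 a) as Pa; pose proof (Cmod_ge_0 b) as Pb.
  assert (Hq : forall w, Cmod w < e -> Cmod w <= 1 ->
     Cmod (f z + a * w + b * (w * w))%C ^ 2 - 2 * Q * K * Cmod w ^ 3 <= Cmod (f (z + w)%C) ^ 2).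
  { intros w Hw Hw1. specialize (Hj w Hw). pose proof (Cmod_ge_0 w) as Pw.
    set (q := (f z + a * w + b * (w * w))%C) in *.
    assert (Cmod q <= Q).
    { unfold q, Q. eapply Rle_trans; [apply Cmod_triangle|]. pose proof (Cmod_triangle (f z) (a * w)) as Ht.
      rewrite !Cmod_mult in *. assert (Cmod w * Cmod w <= 1) by nra. nra. }
    pose proof (Cmod_sub_triangle q (f (z + w)%C)) as Ht. rewrite Cmod_sub_sym in Ht.
    pose proof (Cmod_ge_0 q). pose proof (Cmod_ge_0 (f (z + w)%C)).
    assert (0 <= Cmod w ^ 3) by (apply pow_le; auto).
    set (rho := K * Cmod w ^ 3) in *. assert (0 <= rho) by (unfold rho; nra).
    replace (2 * Q * K * Cmod w ^ 3) with (2 * Q * rho) by (unfold rho; ring).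
    destruct (Rle_dec (Cmod q) rho); [|nra].
    assert (Cmod q ^ 2 <= Q * rho) by (simpl; rewrite Rmult_1_r; apply Rmult_le_compat; lra). nra. }
  (* The four cubic errors total at most [8 Q K h^3]. This [h] keeps them below [eta h^2], while the
     term [eta x^2] gains [2 eta h^2] over the four points. *)
  set (h := Rmin (Rmin (d / 2) (e / 2)) (Rmin 1 (eta / (8 * Q * K + 1)))).
  assert (HQ : 0 <= Q) by (unfold Q; lra).
  assert (HQK : 0 <= Q * K) by nra.
  assert (Hr : 0 < eta / (8 * Q * K + 1)) by (apply Rdiv_lt_0_compat; lra).
  assert (Hh : 0 < h /\ h <= d / 2 /\ h <= e / 2 /\ h <= 1 /\ h <= eta / (8 * Q * K + 1)).
  { unfold h, Rmin; repeat destruct Rle_dec; lra. }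
  destruct Hh as (Hh0 & Hh1 & Hh2 & Hh3 & Hh4).
  assert (Hh5 : h * (8 * Q * K) < eta).
  { assert (h * (8 * Q * K + 1) <= eta).
    { apply Rmult_le_reg_r with (/ (8 * Q * K + 1)); [apply Rinv_0_lt_compat; lra|].
      rewrite Rmult_assoc, Rinv_r by lra. fold (eta / (8 * Q * K + 1)). lra. }
    nra. }
  assert (M1 : Cmod (RtoC h) = h) by (apply Cmod_real; lra).
  assert (M2 : Cmod (RtoC (-h)) = h) by (rewrite Cmod_R, Rabs_Ropp; apply Rabs_pos_eq; lra).
  assert (M3 : Cmod (0, h) = h).
  { unfold Cmod; simpl. replace (0 * (0 * 1) + h * (h * 1)) with (h * h) by ring. apply sqrt_square; lra. }
  assert (M4 : Cmod (0, - h) = h).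
  { unfold Cmod; simpl. replace (0 * (0 * 1) + - h * (- h * 1)) with (h * h) by ring. apply sqrt_square; lra. }
  pose proof (four_point (f z) a b h) as F4. simpl in F4.
  pose proof (Hq (RtoC h) ltac:(lra) ltac:(lra)) as Q1. pose proof (Hq (RtoC (-h)) ltac:(lra) ltac:(lra)) as Q2.
  pose proof (Hq (0, h) ltac:(lra) ltac:(lra)) as Q3. pose proof (Hq (0, -h) ltac:(lra) ltac:(lra)) as Q4.
  pose proof (Hmax (RtoC h) ltac:(lra)) as X1. pose proof (Hmax (RtoC (-h)) ltac:(lra)) as X2.
  pose proof (Hmax (0, h) ltac:(lra)) as X3. pose proof (Hmax (0, -h) ltac:(lra)) as X4.
  rewrite M1 in Q1. rewrite M2 in Q2. rewrite M3 in Q3. rewrite M4 in Q4.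
  simpl in *.
  pose proof (pow2_ge_0 (Cmod a)); pose proof (pow2_ge_0 (Cmod b)). simpl in *.
  assert (0 <= h * h * (Cmod a * Cmod a)) by (apply Rmult_le_pos; nra).
  assert (0 <= h * h * (h * h) * (Cmod b * Cmod b)) by (apply Rmult_le_pos; nra).
  assert (h * h * (h * (8 * Q * K)) < h * h * eta) by (apply Rmult_lt_compat_l; nra).
  nra.
Qed.

(** For each [eta > 0] the maximum of |f|^2 + eta x^2 over the rectangle is attained on the
    boundary, by [no_interior_max]. Letting [eta] tend to 0 is done by contradiction, with an
    explicit [eta]. *)
Lemma rect_max (f : C -> C) (x1 x2 T A : R) : x1 < x2 -> 0 < T ->
  (forall z, x1 <= fst z <= x2 -> - T <= snd z <= T -> J f z) ->
  (forall z, x1 <= fst z <= x2 -> - T <= snd z <= T -> (fst z = x1 \/ fst z = x2 \/ snd z = T \/ snd z = - T) -> Cmod (f z) <= A) ->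
  forall z, x1 <= fst z <= x2 -> - T <= snd z <= T -> Cmod (f z) <= A.
Proof.
  intros Hx HT HJ HB z Hz1 Hz2.
  assert (HA : 0 <= A). { eapply Rle_trans; [apply Cmod_ge_0|apply (HB (x1, T))]; simpl; auto; lra. }
  set (X := Rmax (x1 ^ 2) (x2 ^ 2)).
  assert (HX : forall x, x1 <= x <= x2 -> x ^ 2 <= X).
  { intros x Hxx. unfold X. pose proof (Rmax_l (x1 ^ 2) (x2 ^ 2)); pose proof (Rmax_r (x1 ^ 2) (x2 ^ 2)).
    destruct (Rle_dec 0 x); nra. }
  assert (Hmain : forall eta, 0 < eta -> Cmod (f z) ^ 2 <= A ^ 2 + eta * X).
  { intros eta He.
    destruct (max_rect (fun x y => Cmod (f (x, y)) ^ 2 + eta * x ^ 2) x1 x2 (- T) T) as (x0 & y0 & Hx0 & Hy0 & Hm); try lra.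
    { intros x y Hxx Hyy. apply continuity_2d_pt_plus.
      - apply (continuity_2d_pt_ext (fun u v => fst (f (u, v)) * fst (f (u, v)) + snd (f (u, v)) * snd (f (u, v)))).
        { intros u v. rewrite Cmod_sqr. ring. }
        pose proof (J_ccont _ _ (HJ (x, y) Hxx Hyy)) as Hcc.
        apply continuity_2d_pt_plus; apply continuity_2d_pt_mult; apply ccont_fst || apply ccont_snd; auto.
      - apply continuity_2d_pt_mult; [apply continuity_2d_pt_const|].
        apply (continuity_2d_pt_ext (fun u v => u * u)). { intros; ring. }
        apply continuity_2d_pt_mult; apply continuity_2d_pt_id1. }
    assert (Hb : Cmod (f (x0, y0)) <= A).
    { destruct (Rle_lt_or_eq_dec _ _ (proj1 Hx0)) as [L1|E]; [|apply HB; simpl; auto].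
      destruct (Rle_lt_or_eq_dec _ _ (proj2 Hx0)) as [L2|E]; [|apply HB; simpl; auto].
      destruct (Rle_lt_or_eq_dec _ _ (proj1 Hy0)) as [L3|E]; [|apply HB; simpl; auto].
      destruct (Rle_lt_or_eq_dec _ _ (proj2 Hy0)) as [L4|E]; [|apply HB; simpl; auto].
      exfalso. set (d := Rmin (Rmin (x0 - x1) (x2 - x0)) (Rmin (y0 + T) (T - y0))).
      assert (Hd : 0 < d /\ d <= x0 - x1 /\ d <= x2 - x0 /\ d <= y0 + T /\ d <= T - y0).
      { unfold d, Rmin; repeat destruct Rle_dec; lra. }
      apply (no_interior_max f (x0, y0) eta d He ltac:(lra) (HJ (x0, y0) Hx0 Hy0)).
      intros [h k] Hh. pose proof (Cmod_fst (h, k)). pose proof (Cmod_snd (h, k)). simpl in *.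
      assert (Rabs h < d) by lra. assert (Rabs k < d) by lra.
      apply Rabs_def2 in H1. apply Rabs_def2 in H2.
      specialize (Hm (x0 + h) (y0 + k) ltac:(lra) ltac:(lra)). exact Hm. }
    destruct z as [x y]; simpl in *. specialize (Hm x y Hz1 Hz2). simpl in Hm.
    pose proof (HX x0 Hx0). pose proof (Cmod_ge_0 (f (x0, y0))).
    assert (0 <= eta * (x * (x * 1))) by (apply Rmult_le_pos; nra).
    assert (eta * (x0 * (x0 * 1)) <= eta * X) by (apply Rmult_le_compat_l; simpl in *; lra).
    assert (Cmod (f (x0, y0)) * (Cmod (f (x0, y0)) * 1) <= A * (A * 1)) by nra. lra. }
  apply Rnot_lt_le; intros Hlt.
  assert (HX0 : 0 <= X). { eapply Rle_trans; [apply (pow2_ge_0 x1)|apply HX; lra]. }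
  pose proof (Hmain ((Cmod (f z) ^ 2 - A ^ 2) / (2 * (X + 1)))) as HH.
  assert (0 < Cmod (f z) ^ 2 - A ^ 2) by nra.
  specialize (HH ltac:(apply Rdiv_lt_0_compat; lra)).
  set (D := Cmod (f z) ^ 2 - A ^ 2) in *.
  assert (D / (2 * (X + 1)) * X <= D / 2).
  { replace (D / 2) with (D / (2 * (X + 1)) * (X + 1)) by (field; lra).
    apply Rmult_le_compat_l; [left; apply Rdiv_lt_0_compat; lra|lra]. }
  unfold D in *; lra.
Qed.

(** Phragmen-Lindelof: the factor exp(eta z^2) makes [f] small on the horizontal sides of a tall
    rectangle, to which [rect_max] applies. At the fixed point [z] the factor disappears as [eta]
    tends to 0. *)
Lemma strip_max (f : C -> C) (x1 x2 M A : R) : x1 < x2 -> 0 < A ->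
  (forall z, x1 <= fst z <= x2 -> J f z) ->
  (forall z, x1 <= fst z <= x2 -> Cmod (f z) <= M) ->
  (forall y, Cmod (f (x1, y)) <= A) -> (forall y, Cmod (f (x2, y)) <= A) ->
  forall z, x1 <= fst z <= x2 -> Cmod (f z) <= A.
Proof.
  intros Hx HAp HJ HM HA1 HA2 z Hz.
  assert (HM0 : 0 <= M) by (eapply Rle_trans; [apply Cmod_ge_0|apply (HM z Hz)]).
  set (X := Rmax (x1 ^ 2) (x2 ^ 2)).
  assert (HX : forall x, x1 <= x <= x2 -> x ^ 2 <= X).
  { intros x Hxx. unfold X. pose proof (Rmax_l (x1 ^ 2) (x2 ^ 2)); pose proof (Rmax_r (x1 ^ 2) (x2 ^ 2)).
    destruct (Rle_dec 0 x); nra. }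
  assert (HX0 : 0 <= X). { eapply Rle_trans; [apply (pow2_ge_0 x1)|apply HX; lra]. }
  assert (Hmain : forall eta, 0 < eta -> Cmod (f z) * exp (eta * (fst z ^ 2 - snd z ^ 2)) <= A * exp (eta * X)).
  { intros eta He.
    set (g := fun w => (f w * cexp (RtoC eta * (w * w)))%C).
    assert (Hg : forall w, Cmod (g w) = Cmod (f w) * exp (eta * (fst w ^ 2 - snd w ^ 2))).
    { intros w. unfold g. rewrite Cmod_mult, Cmod_cexp. f_equal. f_equal. simpl. ring. }
    rewrite <- Hg.
    (* This height makes [M exp (- eta T^2) <= A], through [exp y >= 1 + y] and [T <= T^2]. *)
    set (T := Rabs (snd z) + 1 + M / (eta * A)).
    assert (Hq : 0 <= M / (eta * A)) by (apply Rmult_le_pos; [auto|left; apply Rinv_0_lt_compat; nra]).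
    pose proof (Rabs_pos (snd z)).
    assert (HT : 1 <= T) by (unfold T; lra).
    assert (HTM : M * exp (- eta * T ^ 2) <= A).
    { assert (M <= eta * A * T).
      { unfold T. replace M with (eta * A * (M / (eta * A))) at 1 by (field; lra).
        apply Rmult_le_compat_l; nra. }
      replace (- eta * T ^ 2) with (- (eta * T ^ 2)) by ring. rewrite exp_Ropp.
      apply Rmult_le_reg_r with (exp (eta * T ^ 2)); [apply exp_pos|].
      rewrite Rmult_assoc, Rinv_l, Rmult_1_r by (pose proof (exp_pos (eta * T ^ 2)); lra).
      pose proof (exp_ineq1_le (eta * T ^ 2)).
      assert (eta * T <= eta * T ^ 2) by (simpl; nra). nra. }
    apply (rect_max g x1 x2 T); auto; try lra.
    - intros w Hw1 Hw2. unfold g. apply J_mult; [apply HJ; auto|]. apply J_cexp.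
      apply J_mult; [apply J_const|apply J_mult; apply J_id].
    - intros w Hw1 Hw2 Hor. rewrite Hg.
      assert (G1 : exp (eta * (fst w ^ 2 - snd w ^ 2)) <= exp (eta * X)).
      { apply exp_le_compat. apply Rmult_le_compat_l; [lra|]. pose proof (HX _ Hw1). pose proof (pow2_ge_0 (snd w)). lra. }
      pose proof (exp_pos (eta * (fst w ^ 2 - snd w ^ 2))).
      pose proof (Cmod_ge_0 (f w)).
      assert (Hgen : snd w ^ 2 = T ^ 2 -> Cmod (f w) * exp (eta * (fst w ^ 2 - snd w ^ 2)) <= A * exp (eta * X)).
      { intros ->. replace (eta * (fst w ^ 2 - T ^ 2)) with (eta * fst w ^ 2 + - eta * T ^ 2) by ring.
        rewrite exp_plus.
        assert (exp (eta * fst w ^ 2) <= exp (eta * X)) by (apply exp_le_compat; apply Rmult_le_compat_l; [lra|apply HX; auto]).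
        pose proof (HM w Hw1). pose proof (exp_pos (- eta * T ^ 2)). pose proof (exp_pos (eta * fst w ^ 2)).
        assert (Cmod (f w) * exp (- eta * T ^ 2) <= A) by nra.
        assert (0 <= Cmod (f w) * exp (- eta * T ^ 2)) by nra.
        replace (Cmod (f w) * (exp (eta * fst w ^ 2) * exp (- eta * T ^ 2))) with ((Cmod (f w) * exp (- eta * T ^ 2)) * exp (eta * fst w ^ 2)) by ring.
        apply Rmult_le_compat; lra. }
      destruct Hor as [E|[E|[E|E]]].
      + destruct w as [u v]; simpl in E; subst u. apply Rmult_le_compat; auto; lra.
      + destruct w as [u v]; simpl in E; subst u. apply Rmult_le_compat; auto; lra.
      + apply Hgen; rewrite E; ring.
      + apply Hgen; rewrite E; ring.
    - unfold T. pose proof (Rle_abs (snd z)). pose proof (Rle_abs (- snd z)). rewrite Rabs_Ropp in *. lra. }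
  apply Rnot_lt_le; intros Hlt.
  set (Y := X + snd z ^ 2). assert (HY : 0 <= Y) by (unfold Y; pose proof (pow2_ge_0 (snd z)); lra).
  assert (H2 : forall eta, 0 < eta -> Cmod (f z) <= A * exp (eta * Y)).
  { intros eta He. specialize (Hmain eta He).
    apply Rmult_le_reg_r with (exp (eta * (fst z ^ 2 - snd z ^ 2))); [apply exp_pos|].
    eapply Rle_trans; [exact Hmain|]. rewrite Rmult_assoc, <- exp_plus.
    apply Rmult_le_compat_l; [lra|]. apply exp_le_compat. rewrite <- Rmult_plus_distr_l.
    apply Rmult_le_compat_l; [lra|]. unfold Y. pose proof (pow2_ge_0 (fst z)). lra. }
  assert (Hl : 0 < ln (Cmod (f z) / A)).
  { rewrite <- ln_1. apply ln_increasing; [lra|]. apply Rmult_lt_reg_r with A; auto. unfold Rdiv. rewrite Rmult_assoc, Rinv_l; lra. }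
  specialize (H2 (ln (Cmod (f z) / A) / (2 * (Y + 1))) ltac:(apply Rdiv_lt_0_compat; lra)).
  assert (ln (Cmod (f z) / A) / (2 * (Y + 1)) * Y < ln (Cmod (f z) / A)).
  { apply Rle_lt_trans with (ln (Cmod (f z) / A) / (2 * (Y + 1)) * (Y + 1)).
    - apply Rmult_le_compat_l; [left; apply Rdiv_lt_0_compat; lra|lra].
    - replace (ln (Cmod (f z) / A) / (2 * (Y + 1)) * (Y + 1)) with (ln (Cmod (f z) / A) / 2) by (field; lra). lra. }
  apply exp_increasing in H. rewrite exp_ln in H by (apply Rdiv_lt_0_compat; lra).
  apply (Rmult_lt_compat_l A) in H; auto. replace (A * (Cmod (f z) / A)) with (Cmod (f z)) in H by (field; lra). lra.
Qed.

(** Division by exp(L(z)), with [L] the affine function taking the values [p] and [r] on the two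
    edges, reduces the claim to [strip_max] with bound 1. *)
Lemma three_lines (f : C -> C) (x1 x2 M p r : R) : x1 < x2 ->
  (forall z, x1 <= fst z <= x2 -> J f z) ->
  (forall z, x1 <= fst z <= x2 -> Cmod (f z) <= M) ->
  (forall y, Cmod (f (x1, y)) <= exp p) -> (forall y, Cmod (f (x2, y)) <= exp r) ->
  forall z, x1 <= fst z <= x2 ->
  Cmod (f z) <= exp (((x2 - fst z) * p + (fst z - x1) * r) / (x2 - x1)).
Proof.
  intros Hx HJ HM H1 H2 z Hz.
  set (k := (r - p) / (x2 - x1)).
  set (L := fun x => p + (x - x1) * k).
  assert (EL : forall x, L x = ((x2 - x) * p + (x - x1) * r) / (x2 - x1)) by (intros; unfold L, k; field; lra).
  rewrite <- EL.
  set (g := fun w => (f w * cexp (RtoC (- (p - x1 * k)) + RtoC (- k) * w))%C).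
  assert (Hg : forall w, Cmod (g w) = Cmod (f w) * exp (- L (fst w))).
  { intros w. unfold g. rewrite Cmod_mult, Cmod_cexp. f_equal. f_equal. unfold L; simpl. ring. }
  assert (HE : forall w, Cmod (f w) = Cmod (g w) * exp (L (fst w))).
  { intros w. rewrite Hg, Rmult_assoc, <- exp_plus. replace (- L (fst w) + L (fst w)) with 0 by ring. rewrite exp_0; ring. }
  rewrite HE. rewrite <- (Rmult_1_l (exp (L (fst z)))) at 2.
  apply Rmult_le_compat_r; [left; apply exp_pos|].
  apply (strip_max g x1 x2 (M * exp (Rabs p + Rabs r)) 1); auto; try lra.
  - intros w Hw. unfold g. apply J_mult; [auto|]. apply J_cexp. apply J_plus; [apply J_const|].
    apply J_mult; [apply J_const|apply J_id].
  - intros w Hw. rewrite Hg. apply Rmult_le_compat; [apply Cmod_ge_0|left; apply exp_pos|auto|].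
    apply exp_le_compat. rewrite EL.
    set (th := (fst w - x1) / (x2 - x1)).
    assert (0 <= th <= 1).
    { unfold th; split; [apply Rmult_le_pos; [lra|left; apply Rinv_0_lt_compat; lra]|].
      apply Rmult_le_reg_r with (x2 - x1); [lra|]. unfold Rdiv; rewrite Rmult_assoc, Rinv_l; lra. }
    replace (((x2 - fst w) * p + (fst w - x1) * r) / (x2 - x1)) with ((1 - th) * p + th * r) by (unfold th; field; lra).
    unfold Rabs; destruct Rcase_abs; destruct Rcase_abs; nra.
  - intros y. rewrite Hg. simpl. replace (L x1) with p by (unfold L; ring).
    apply Rle_trans with (exp p * exp (- p)); [apply Rmult_le_compat_r; [left; apply exp_pos|auto]|].
    rewrite <- exp_plus. right. rewrite <- exp_0. f_equal; ring.
  - intros y. rewrite Hg. simpl. replace (L x2) with r by (unfold L, k; field; lra).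
    apply Rle_trans with (exp r * exp (- r)); [apply Rmult_le_compat_r; [left; apply exp_pos|auto]|].
    rewrite <- exp_plus. right. rewrite <- exp_0. f_equal; ring.
Qed.

Lemma sum_nS (f : nat -> R) n : sum_n f (S n) = sum_n f n + f (S n).
Proof. exact (sum_Sn f n). Qed.

Lemma ex_series_Rscal (c : R) (f : nat -> R) : ex_series f -> ex_series (fun n => c * f n).
Proof. intros H. exact (ex_series_scal_l (K := R_AbsRing) c f H). Qed.

Lemma Cmod_dot_abs (z w : C) : Rabs (fst z * fst w + snd z * snd w) <= Cmod z * Cmod w.
Proof.
  pose proof (Cmod_dot z w). pose proof (Cmod_dot z (- w)%C) as H2. rewrite Cmod_opp in H2. simpl in H2.
  apply Rabs_le; split; lra.
Qed.

(** * Series and Mellin transforms *)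

Definition absconv (f : nat -> C) : Prop := ex_series (fun k => Cmod (f k)).

Lemma absconv_fst f : absconv f -> ex_series (fun k => fst (f k)).
Proof. intros H. apply (ex_series_le (K := R_AbsRing) (V := R_CompleteNormedModule) _ (fun k => Cmod (f k))); auto. intros n. apply Cmod_fst. Qed.
Lemma absconv_snd f : absconv f -> ex_series (fun k => snd (f k)).
Proof. intros H. apply (ex_series_le (K := R_AbsRing) (V := R_CompleteNormedModule) _ (fun k => Cmod (f k))); auto. intros n. apply Cmod_snd. Qed.

Lemma absconv_le f (g : nat -> R) : (forall k, Cmod (f k) <= g k) -> ex_series g -> absconv f.
Proof. intros H Hg. apply (ex_series_le (K := R_AbsRing) (V := R_CompleteNormedModule) _ g); auto.
  intros n. simpl. unfold norm; simpl. unfold abs; simpl. rewrite Rabs_pos_eq by apply Cmod_ge_0. apply H. Qed.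

Lemma absconv_plus f g : absconv f -> absconv g -> absconv (fun k => f k + g k)%C.
Proof. intros Hf Hg. apply (absconv_le _ (fun k => Cmod (f k) + Cmod (g k))).
  - intros; apply Cmod_triangle.
  - apply (ex_series_plus (V := R_NormedModule) (fun k => Cmod (f k)) (fun k => Cmod (g k))); auto. Qed.

Lemma absconv_scal c f : absconv f -> absconv (fun k => c * f k)%C.
Proof. intros Hf. apply (absconv_le _ (fun k => Cmod c * Cmod (f k))).
  - intros; rewrite Cmod_mult; lra.
  - apply ex_series_Rscal; auto. Qed.

Lemma CSeries_plus f g : absconv f -> absconv g -> CSeries (fun k => f k + g k)%C = (CSeries f + CSeries g)%C.
Proof. intros Hf Hg. unfold CSeries. apply injective_projections; simpl.
  - apply Series_plus; apply absconv_fst; auto.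
  - apply Series_plus; apply absconv_snd; auto. Qed.

Lemma CSeries_scal c f : absconv f -> CSeries (fun k => c * f k)%C = (c * CSeries f)%C.
Proof. intros Hf. pose proof (absconv_fst _ Hf) as H1; pose proof (absconv_snd _ Hf) as H2. unfold CSeries. apply injective_projections; simpl.
  - rewrite Series_minus, !Series_scal_l; auto.
    + apply ex_series_Rscal; auto.
    + apply ex_series_Rscal; auto.
  - rewrite Series_plus, !Series_scal_l; auto.
    + apply ex_series_Rscal; auto.
    + apply ex_series_Rscal; auto. Qed.

Lemma CSeries_ext f g : (forall k, f k = g k) -> CSeries f = CSeries g.
Proof. intros H. unfold CSeries. f_equal; apply Series_ext; intros; rewrite H; auto. Qed.

Lemma absconv_ext f g : (forall k, f k = g k) -> absconv f -> absconv g.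
Proof. intros H Hf. apply (ex_series_ext (fun k => Cmod (f k))); auto. intros; rewrite H; auto. Qed.

Lemma sum_n_nonneg (g : nat -> R) n : (forall k, 0 <= g k) -> 0 <= sum_n g n.
Proof. intros H; induction n; [rewrite sum_O; auto|rewrite sum_Sn; unfold plus; simpl; specialize (H (S n)); lra]. Qed.

Lemma Series_nonneg (g : nat -> R) : (forall k, 0 <= g k) -> ex_series g -> 0 <= Series g.
Proof.
  intros H [l Hl]. rewrite (is_series_unique _ _ Hl).
  apply (is_lim_seq_le (fun _ => 0) (sum_n g) 0 l); auto; [|apply is_lim_seq_const].
  intros; apply sum_n_nonneg; auto.
Qed.

(** The sum [S] is paired with itself: |S|^2 is a real series dominated by [|S| g k]. Treating the
    two coordinates separately would lose a constant factor. *)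
Lemma CSeries_bound f (g : nat -> R) : (forall k, Cmod (f k) <= g k) -> ex_series g -> Cmod (CSeries f) <= Series g.
Proof.
  intros Hfg Hg. pose proof (absconv_le _ _ Hfg Hg) as Hf.
  set (S := CSeries f).
  assert (P0 : 0 <= Series g).
  { apply Series_nonneg; auto. intros n. pose proof (Cmod_ge_0 (f n)); specialize (Hfg n); lra. }
  destruct (Req_dec (Cmod S) 0) as [E|E]; [lra|].
  pose proof (Cmod_ge_0 S). assert (Hp : 0 < Cmod S) by lra.
  apply Rmult_le_reg_l with (Cmod S); auto.
  replace (Cmod S * Cmod S) with (Cmod S ^ 2) by ring. rewrite Cmod_sqr.
  replace (fst S ^ 2 + snd S ^ 2) with (Series (fun k => fst S * fst (f k) + snd S * snd (f k))).
  2:{ rewrite Series_plus, !Series_scal_l.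
      - unfold S, CSeries; simpl; ring.
      - apply ex_series_Rscal. apply absconv_fst; auto.
      - apply ex_series_Rscal. apply absconv_snd; auto. }
  rewrite <- Series_scal_l.
  assert (Hb : forall n, Rabs (fst S * fst (f n) + snd S * snd (f n)) <= Cmod S * g n).
  { intros n. eapply Rle_trans; [apply Cmod_dot_abs|]. apply Rmult_le_compat_l; [lra|apply Hfg]. }
  assert (Hex : ex_series (fun n => Cmod S * g n)) by (apply ex_series_Rscal; auto).
  eapply Rle_trans; [apply Rle_abs|]. eapply Rle_trans; [apply Series_Rabs|].
  - apply (ex_series_le (K := R_AbsRing) (V := R_CompleteNormedModule) _ (fun n => Cmod S * g n)); auto.
    intros n. unfold norm; simpl; unfold abs; simpl. rewrite Rabs_Rabsolu. apply Hb.
  - apply Series_le; auto. intros n; split; [apply Rabs_pos|apply Hb].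
Qed.

(** Termwise differentiation: the expansions share the radius [d] and their cubic constants are
    summable, so the remainders add up to a cubic error. *)
Lemma series_jet (f : nat -> C -> C) (a b : nat -> C) (K : nat -> R) (z : C) (d : R) : 0 < d ->
  (forall k h, Cmod h < d -> Cmod (f k (z + h)%C - (f k z + a k * h + b k * (h * h)))%C <= K k * Cmod h ^ 3) ->
  ex_series K -> absconv (fun k => f k z) -> absconv a -> absconv b ->
  jet (fun w => CSeries (fun k => f k w)) z (CSeries a) (CSeries b).
Proof.
  intros Hd H HK Hf Ha Hb.
  assert (HK0 : forall k, 0 <= K k).
  { intros k. specialize (H k (RtoC (d / 2))). rewrite Cmod_real in H by lra. specialize (H ltac:(lra)).
    assert (0 < (d / 2) ^ 3) by (apply pow_lt; lra).
    apply Rmult_le_reg_r with ((d / 2) ^ 3); auto. rewrite Rmult_0_l. eapply Rle_trans; [apply Cmod_ge_0|exact H]. }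
  exists d, (Series K). split; [auto|split].
  { apply Series_nonneg; auto. }
  intros h Hh. pose proof (Cmod_ge_0 h).
  set (r := fun k => (f k (z + h)%C - (f k z + a k * h + b k * (h * h)))%C).
  set (m := fun k => (f k z + (h * a k + (h * h) * b k))%C).
  assert (Hm : absconv m).
  { unfold m. apply absconv_plus; auto. apply absconv_plus; apply absconv_scal; auto. }
  assert (Hr : forall k, Cmod (r k) <= Cmod h ^ 3 * K k) by (intros; rewrite Rmult_comm; apply H; auto).
  assert (Hex : ex_series (fun k => Cmod h ^ 3 * K k)) by (apply ex_series_Rscal; auto).
  replace (CSeries (fun k => f k (z + h)%C)) with (CSeries r + CSeries m)%C.
  2:{ assert (Har : absconv r) by (eapply absconv_le; [exact Hr|auto]).
      rewrite <- CSeries_plus by auto. apply CSeries_ext. intros; unfold r, m; ceq. }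
  replace (CSeries m) with (CSeries (fun k => f k z) + (h * CSeries a + h * h * CSeries b))%C.
  2:{ unfold m. rewrite CSeries_plus, CSeries_plus, !CSeries_scal; auto; [apply absconv_scal; auto|apply absconv_scal; auto|apply absconv_plus; apply absconv_scal; auto]. }
  match goal with |- Cmod ?X <= _ => replace X with (CSeries r) by ceq end.
  rewrite Rmult_comm, <- Series_scal_l. apply CSeries_bound; auto.
Qed.

(** * Real powers and comparison of p-series with integrals *)

Definition rpow (x p : R) : R := exp (p * ln x).

Arguments rpow x%_R_scope p%_R_scope.

Lemma rpow_pos x p : 0 < rpow x p. Proof. apply exp_pos. Qed.
Lemma rpow_plus x p q : rpow x (p + q) = rpow x p * rpow x q.
Proof. unfold rpow. rewrite <- exp_plus. f_equal; ring. Qed.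
Lemma rpow_1 p : rpow 1 p = 1.
Proof. unfold rpow. rewrite ln_1, Rmult_0_r. apply exp_0. Qed.
Lemma ln_le_compat x y : 0 < x -> x <= y -> ln x <= ln y.
Proof. intros H [L| ->]; [left; apply ln_increasing; auto|lra]. Qed.
Lemma ln_ge_0 x : 1 <= x -> 0 <= ln x.
Proof. intros. rewrite <- ln_1. apply ln_le_compat; lra. Qed.
Lemma rpow_le_base x y p : 0 < x -> x <= y -> 0 <= p -> rpow x p <= rpow y p.
Proof. intros. apply exp_le_compat. apply Rmult_le_compat_l; auto. apply ln_le_compat; auto. Qed.
Lemma rpow_le_base_neg x y p : 0 < x -> x <= y -> p <= 0 -> rpow y p <= rpow x p.
Proof. intros. apply exp_le_compat. pose proof (ln_le_compat x y H H0). nra. Qed.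
Lemma rpow_le_exp x p q : 1 <= x -> p <= q -> rpow x p <= rpow x q.
Proof. intros. apply exp_le_compat. pose proof (ln_ge_0 x H). nra. Qed.
Lemma rpow_1r x : 0 < x -> rpow x 1 = x.
Proof. intros; unfold rpow. rewrite Rmult_1_l. apply exp_ln; auto. Qed.
Lemma rpow_opp x p : rpow x (- p) = / rpow x p.
Proof. unfold rpow. rewrite <- exp_Ropp. f_equal; ring. Qed.
Lemma rpow_mult_base x y p : 0 < x -> 0 < y -> rpow (x * y) p = rpow x p * rpow y p.
Proof. intros; unfold rpow. rewrite ln_mult, <- exp_plus by auto. f_equal; ring. Qed.

Lemma is_derive_rpow p x : 0 < x -> is_derive (fun y => rpow y p) x (p * rpow x (p - 1)).
Proof.
  intros Hx. unfold rpow. auto_derive; [auto|].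
  replace ((p - 1) * ln x) with (p * ln x + - ln x) by ring. rewrite exp_plus, exp_Ropp, exp_ln by auto. field; lra.
Qed.

(** Mean value theorem for [x^-p] on [x, x + 1]: one step of the integral test. *)
Lemma rpow_step p x : 0 < p -> 0 < x -> p * rpow (x + 1) (- (1 + p)) <= rpow x (- p) - rpow (x + 1) (- p).
Proof.
  intros Hp Hx.
  destruct (MVT_gen (fun y => rpow y (- p)) x (x + 1) (fun y => - p * rpow y (- p - 1))) as (c & Hc & E).
  - intros y Hy. rewrite Rmin_left in Hy by lra. apply is_derive_rpow; lra.
  - intros y Hy. rewrite Rmin_left in Hy by lra. apply continuity_pt_filterlim.
    apply (ex_derive_continuous (fun y => rpow y (- p))). eexists; apply is_derive_rpow; lra.
  - rewrite Rmin_left, Rmax_right in Hc by lra.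
    replace (x + 1 - x) with 1 in E by ring.
    pose proof (rpow_le_base_neg c (x + 1) (- (1 + p)) ltac:(lra) ltac:(lra) ltac:(lra)).
    replace (- p - 1) with (- (1 + p)) in E by ring. nra.
Qed.

Lemma ex_series_pos_bounded (a : nat -> R) (M : R) : (forall n, 0 <= a n) ->
  (forall n, sum_n a n <= M) -> ex_series a /\ Series a <= M.
Proof.
  intros Ha HM.
  assert (Hf : ex_finite_lim_seq (sum_n a)).
  { apply ex_finite_lim_seq_incr with M; auto. intros n. rewrite sum_Sn. unfold plus; simpl. specialize (Ha (S n)); lra. }
  assert (E : ex_series a).
  { destruct Hf as [l Hl]. exists l. exact Hl. }
  split; auto.
  destruct E as [l Hl]. rewrite (is_series_unique _ _ Hl).
  apply (is_lim_seq_le (sum_n a) (fun _ => M) l M); auto. apply is_lim_seq_const.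
Qed.

(** The subtracted power is what lets the induction telescope, each step being [rpow_step]. *)
Lemma zsum_bound (p : R) : 0 < p -> forall n,
  sum_n (fun k => rpow (INR (S k)) (- (1 + p))) n <= 1 + / p - rpow (INR (S n)) (- p) / p.
Proof.
  intros Hp. assert (HI : 0 < / p) by (apply Rinv_0_lt_compat; auto).
  induction n.
  - rewrite sum_O. simpl INR. rewrite !rpow_1. right; field; lra.
  - rewrite sum_nS. cbv beta.
    pose proof (rpow_step p (INR (S n)) Hp ltac:(apply lt_0_INR; lia)) as Hs. rewrite <- S_INR in Hs.
    set (X := rpow (INR (S (S n))) (- (1 + p))) in *.
    assert (X <= (rpow (INR (S n)) (- p) - rpow (INR (S (S n))) (- p)) / p).
    { apply Rmult_le_reg_l with p; auto.
      replace (p * ((rpow (INR (S n)) (- p) - rpow (INR (S (S n))) (- p)) / p))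
        with (rpow (INR (S n)) (- p) - rpow (INR (S (S n))) (- p)) by (field; lra). exact Hs. }
    unfold Rdiv in *. lra.
Qed.

Lemma zsum_ex (p : R) : 0 < p ->
  ex_series (fun k => rpow (INR (S k)) (- (1 + p))) /\ Series (fun k => rpow (INR (S k)) (- (1 + p))) <= 1 + / p.
Proof.
  intros Hp. apply ex_series_pos_bounded.
  - intros; left; apply rpow_pos.
  - intros n. eapply Rle_trans; [apply zsum_bound; auto|].
    pose proof (rpow_pos (INR (S n)) (- p)). assert (0 < / p) by (apply Rinv_0_lt_compat; auto). unfold Rdiv. nra.
Qed.

(** * Integrals of complex functions of a real variable *)

Definition CI (F : R -> C) (a b : R) : C := (RInt (fun x => fst (F x)) a b, RInt (fun x => snd (F x)) a b).

Definition ccR (F : R -> C) (a b : R) : Prop :=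
  forall x, a <= x <= b -> continuous (fun y => fst (F y)) x /\ continuous (fun y => snd (F y)) x.

Lemma ccR_ex F a b : a <= b -> ccR F a b ->
  ex_RInt (fun x => fst (F x)) a b /\ ex_RInt (fun x => snd (F x)) a b.
Proof. intros Hab H. split; apply (ex_RInt_continuous (V := R_CompleteNormedModule)); rewrite Rmin_left, Rmax_right by auto; intros; apply H; auto. Qed.

(** The device of [CSeries_bound]: the integral is paired with itself. *)
Lemma CI_bound_int F (g : R -> R) a b : a <= b -> ccR F a b -> ex_RInt g a b ->
  (forall x, a < x < b -> Cmod (F x) <= g x) -> Cmod (CI F a b) <= RInt g a b.
Proof.
  intros Hab Hc Hg HK. destruct (ccR_ex F a b Hab Hc) as [E1 E2].
  set (S := CI F a b).
  assert (P0 : 0 <= RInt g a b).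
  { apply RInt_ge_0; auto. intros x Hx. eapply Rle_trans; [apply Cmod_ge_0|apply HK; lra]. }
  destruct (Req_dec (Cmod S) 0) as [E|E]; [lra|].
  pose proof (Cmod_ge_0 S). assert (Hp : 0 < Cmod S) by lra.
  apply Rmult_le_reg_l with (Cmod S); auto.
  replace (Cmod S * Cmod S) with (Cmod S ^ 2) by ring. rewrite Cmod_sqr.
  replace (fst S ^ 2 + snd S ^ 2) with (RInt (fun x => fst S * fst (F x) + snd S * snd (F x)) a b).
  2:{ rewrite (RInt_plus (V := R_CompleteNormedModule) (fun x => fst S * fst (F x)) (fun x => snd S * snd (F x))).
      - rewrite (RInt_scal (V := R_CompleteNormedModule) (fun x => fst (F x))), (RInt_scal (V := R_CompleteNormedModule) (fun x => snd (F x))); auto.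
        unfold S, CI, plus, scal; simpl. unfold mult; simpl. ring.
      - apply (ex_RInt_scal (V := R_CompleteNormedModule) (fun x => fst (F x))); auto.
      - apply (ex_RInt_scal (V := R_CompleteNormedModule) (fun x => snd (F x))); auto. }
  apply Rle_trans with (RInt (fun x => Cmod S * g x) a b).
  - apply RInt_le; auto.
    + apply (ex_RInt_plus (V := R_CompleteNormedModule) (fun x => fst S * fst (F x)) (fun x => snd S * snd (F x))).
      * apply (ex_RInt_scal (V := R_CompleteNormedModule) (fun x => fst (F x))); auto.
      * apply (ex_RInt_scal (V := R_CompleteNormedModule) (fun x => snd (F x))); auto.
    + apply (ex_RInt_scal (V := R_CompleteNormedModule) g); auto.
    + intros x Hx. eapply Rle_trans; [apply Cmod_dot|]. apply Rmult_le_compat_l; [lra|]. apply HK; lra.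
  - rewrite (RInt_scal (V := R_CompleteNormedModule) g) by auto. right; reflexivity.
Qed.

Lemma CI_bound F a b K : a <= b -> ccR F a b -> (forall x, a <= x <= b -> Cmod (F x) <= K) -> Cmod (CI F a b) <= K * (b - a).
Proof.
  intros Hab Hc HK.
  eapply Rle_trans; [apply (CI_bound_int F (fun _ => K)); auto|].
  - apply (ex_RInt_const (V := R_CompleteNormedModule)).
  - intros; apply HK; lra.
  - rewrite (RInt_const (V := R_CompleteNormedModule)). unfold scal; simpl; unfold mult; simpl. lra.
Qed.

Lemma CI_plus F G a b : a <= b -> ccR F a b -> ccR G a b -> CI (fun x => F x + G x)%C a b = (CI F a b + CI G a b)%C.
Proof.
  intros Hab HF HG. destruct (ccR_ex F a b Hab HF). destruct (ccR_ex G a b Hab HG).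
  unfold CI. apply injective_projections; simpl; apply (RInt_plus (V := R_CompleteNormedModule)); auto.
Qed.

Lemma CI_scal c F a b : a <= b -> ccR F a b -> CI (fun x => c * F x)%C a b = (c * CI F a b)%C.
Proof.
  intros Hab HF. destruct (ccR_ex F a b Hab HF) as [E1 E2].
  unfold CI. apply injective_projections; simpl.
  - rewrite (RInt_minus (V := R_CompleteNormedModule) (fun x => fst c * fst (F x)) (fun x => snd c * snd (F x))).
    + rewrite (RInt_scal (V := R_CompleteNormedModule) (fun x => fst (F x))), (RInt_scal (V := R_CompleteNormedModule) (fun x => snd (F x))); auto.
    + apply (ex_RInt_scal (V := R_CompleteNormedModule) (fun x => fst (F x))); auto.
    + apply (ex_RInt_scal (V := R_CompleteNormedModule) (fun x => snd (F x))); auto.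
  - rewrite (RInt_plus (V := R_CompleteNormedModule) (fun x => fst c * snd (F x)) (fun x => snd c * fst (F x))).
    + rewrite (RInt_scal (V := R_CompleteNormedModule) (fun x => fst (F x))), (RInt_scal (V := R_CompleteNormedModule) (fun x => snd (F x))); auto.
    + apply (ex_RInt_scal (V := R_CompleteNormedModule) (fun x => snd (F x))); auto.
    + apply (ex_RInt_scal (V := R_CompleteNormedModule) (fun x => fst (F x))); auto.
Qed.

Lemma CI_ext F G a b : a <= b -> (forall x, a <= x <= b -> F x = G x) -> CI F a b = CI G a b.
Proof.
  intros Hab H. unfold CI. f_equal; apply RInt_ext; rewrite Rmin_left, Rmax_right by auto; intros; rewrite H; auto; lra.
Qed.

Lemma ccR_mult F G a b : ccR F a b -> ccR G a b -> ccR (fun x => F x * G x)%C a b.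
Proof.
  intros HF HG x Hx. destruct (HF x Hx), (HG x Hx). split; simpl.
  - apply (continuous_minus (V := R_NormedModule) (fun y => fst (F y) * fst (G y)) (fun y => snd (F y) * snd (G y)));
    apply (continuous_mult (K := R_AbsRing)); auto.
  - apply (continuous_plus (V := R_NormedModule) (fun y => fst (F y) * snd (G y)) (fun y => snd (F y) * fst (G y)));
    apply (continuous_mult (K := R_AbsRing)); auto.
Qed.
Lemma ccR_plus F G a b : ccR F a b -> ccR G a b -> ccR (fun x => F x + G x)%C a b.
Proof.
  intros HF HG x Hx. destruct (HF x Hx), (HG x Hx). split; simpl;
  apply (continuous_plus (V := R_NormedModule)); auto.
Qed.
Lemma ccR_const c a b : ccR (fun _ => c) a b.
Proof. intros x Hx; split; apply continuous_const. Qed.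
Lemma ccR_real (f : R -> R) a b : (forall x, a <= x <= b -> continuous f x) -> ccR (fun x => RtoC (f x)) a b.
Proof. intros H x Hx; split; simpl; [apply H; auto|apply continuous_const]. Qed.
Lemma ccR_cexp_ln s a b : 0 < a -> ccR (fun x => cexp (s * RtoC (ln x))) a b.
Proof.
  intros Ha x Hx. split; apply (ex_derive_continuous (V := R_NormedModule)); simpl; auto_derive; lra.
Qed.

(** * Mellin transforms of piecewise continuous weights *)

Definition mterm (v : R -> R) (n : R) (s : C) : C := CI (fun x => RtoC (v x) * cexp (- s * RtoC (ln x)))%C n (n + 1).

Lemma cexp_ln_mod s x : Cmod (cexp (- s * RtoC (ln x))) = rpow x (- fst s).
Proof. rewrite Cmod_cexp. unfold rpow. f_equal. simpl. ring. Qed.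

Lemma mterm_ccR v n s : 1 <= n -> (forall x, n <= x <= n + 1 -> continuous v x) ->
  ccR (fun x => RtoC (v x) * cexp (- s * RtoC (ln x)))%C n (n + 1).
Proof. intros Hn Hv. apply ccR_mult; [apply ccR_real; auto|apply ccR_cexp_ln; lra]. Qed.

Lemma mterm_bound v n s D e : 1 <= n -> 0 <= D -> e <= 1 + fst s -> (forall x, n <= x <= n + 1 -> continuous v x) ->
  (forall x, n <= x <= n + 1 -> Rabs (v x) <= D * rpow x (e - 1)) ->
  Cmod (mterm v n s) <= D * rpow n (- (1 + (fst s - e))).
Proof.
  intros Hn HD He Hv Hb. unfold mterm.
  eapply Rle_trans; [apply (CI_bound _ n (n + 1) (D * rpow n (- (1 + (fst s - e)))))|right; ring].
  - lra.
  - apply mterm_ccR; auto.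
  - intros x Hx. rewrite Cmod_mult, cexp_ln_mod, Cmod_R.
    apply Rle_trans with (D * rpow x (e - 1) * rpow x (- fst s)).
    + apply Rmult_le_compat_r; [left; apply rpow_pos|auto].
    + rewrite Rmult_assoc, <- rpow_plus. apply Rmult_le_compat_l; auto.
      replace (e - 1 + - fst s) with (- (1 + (fst s - e))) by ring. apply rpow_le_base_neg; lra.
Qed.

(** The integral of [v(x) x^(-s)] from 1 to infinity, for the weight equal to [v n] on [n, n+1].
    Splitting at the integers leaves only proper integrals of continuous functions and an absolutely
    convergent series, whatever the jumps at the integers. *)
Definition MS (v : nat -> R -> R) (s : C) : C := CSeries (fun k => mterm (v (S k)) (INR (S k)) s).

(* [v n] is the weight on the interval [n, n+1]; it includes the factor 1/x of dx/x. *)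
Definition wgrow (v : nat -> R -> R) (D e : R) : Prop :=
  0 <= D /\ forall n x, (1 <= n)%nat -> INR n <= x <= INR n + 1 ->
    continuous (v n) x /\ Rabs (v n x) <= D * rpow x (e - 1).

Lemma INR_S_ge1 k : 1 <= INR (S k).
Proof. rewrite S_INR. pose proof (pos_INR k). lra. Qed.

Arguments mterm v n%_R_scope s%_C_scope.
Arguments MS v s%_C_scope.

Lemma MS_absconv v D e s : wgrow v D e -> e < fst s -> absconv (fun k => mterm (v (S k)) (INR (S k)) s).
Proof.
  intros [HD Hg] He. apply (absconv_le _ (fun k => D * rpow (INR (S k)) (- (1 + (fst s - e))))).
  - intros k. apply mterm_bound; auto; try lra.
    + apply INR_S_ge1.
    + intros; apply Hg; auto; lia.
    + intros; apply Hg; auto; lia.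
  - apply ex_series_Rscal. apply zsum_ex; lra.
Qed.

Lemma MS_bound v D e s : wgrow v D e -> e < fst s -> Cmod (MS v s) <= D * (1 + / (fst s - e)).
Proof.
  intros [HD Hg] He. unfold MS.
  eapply Rle_trans; [apply (CSeries_bound _ (fun k => D * rpow (INR (S k)) (- (1 + (fst s - e)))))|].
  - intros k. apply mterm_bound; auto; try lra.
    + apply INR_S_ge1.
    + intros; apply Hg; auto; lia.
    + intros; apply Hg; auto; lia.
  - apply ex_series_Rscal. apply zsum_ex; lra.
  - rewrite Series_scal_l. apply Rmult_le_compat_l; auto. apply zsum_ex; lra.
Qed.

Lemma ln_le_rpow x d : 1 <= x -> 0 < d -> ln x <= / d * rpow x d.
Proof.
  intros Hx Hd. unfold rpow. pose proof (exp_ineq1_le (d * ln x)).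
  apply Rmult_le_reg_l with d; auto. rewrite <- Rmult_assoc, Rinv_r, Rmult_1_l by lra. lra.
Qed.

(** Differentiation in [s] brings down the factor [- ln x]. It costs an arbitrarily small [d] in the
    exponent, so the half-plane of convergence does not shrink. *)
Lemma wgrow_ln v D e d : wgrow v D e -> 0 < d -> wgrow (fun n x => - ln x * v n x) (D / d) (e + d).
Proof.
  intros [HD Hg] Hd. split; [apply Rmult_le_pos; [auto|left; apply Rinv_0_lt_compat; auto]|].
  intros n x Hn Hx. destruct (Hg n x Hn Hx) as [Hc Hb].
  assert (1 <= INR n) by (apply (le_INR 1); auto).
  split.
  - apply (continuous_mult (K := R_AbsRing) (fun y => - ln y)); auto.
    apply (ex_derive_continuous (V := R_NormedModule) (fun y => - ln y)). auto_derive; lra.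
  - rewrite Rabs_mult, Rabs_Ropp, (Rabs_pos_eq (ln x)) by (apply ln_ge_0; lra).
    pose proof (ln_le_rpow x d ltac:(lra) Hd). pose proof (ln_ge_0 x ltac:(lra)).
    replace (e + d - 1) with (d + (e - 1)) by ring. rewrite rpow_plus.
    replace (D / d * (rpow x d * rpow x (e - 1))) with ((/ d * rpow x d) * (D * rpow x (e - 1))) by (field; lra).
    apply Rmult_le_compat; auto. apply Rabs_pos.
Qed.

Lemma wgrow_scal v D e c : wgrow v D e -> wgrow (fun n x => c * v n x) (Rabs c * D) e.
Proof.
  intros [HD Hg]. split; [apply Rmult_le_pos; [apply Rabs_pos|auto]|].
  intros n x Hn Hx. destruct (Hg n x Hn Hx) as [Hc Hb]. split.
  - apply (continuous_mult (K := R_AbsRing) (fun _ => c)); auto. apply continuous_const.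
  - rewrite Rabs_mult, Rmult_assoc. apply Rmult_le_compat_l; auto. apply Rabs_pos.
Qed.

Definition lnw (v : nat -> R -> R) : nat -> R -> R := fun n x => - ln x * v n x.

(** The remainder under the integral is [cE3 (- h ln x)]. With [rho] the distance to the abscissa
    [e], a power [x^(rho/4)] absorbs the cube of the logarithm and another one absorbs [x^|h|],
    which leaves [x^(-1-rho/2)] for convergence. *)
Lemma MS_jet v D e s : wgrow v D e -> e < fst s ->
  jet (MS v) s (MS (lnw v) s) (MS (fun n x => / 2 * lnw (lnw v) n x) s).
Proof.
  intros Hw He. set (rho := fst s - e). assert (Hr : 0 < rho) by (unfold rho; lra).
  pose proof (wgrow_ln _ _ _ (rho / 4) Hw ltac:(lra)) as Hw1.
  pose proof (wgrow_ln _ _ _ (rho / 4) Hw1 ltac:(lra)) as Hw2. pose proof (wgrow_scal _ _ _ (/ 2) Hw2) as Hw3.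
  pose proof Hw as [HD Hg].
  unfold MS. apply (series_jet _ _ _ (fun k => (D * (12 / rho) ^ 3) * rpow (INR (S k)) (- (1 + rho / 2))) s (rho / 4)).
  - lra.
  - intros k h Hh. set (n := INR (S k)). assert (Hn : 1 <= n) by apply INR_S_ge1.
    assert (Hv : forall x, n <= x <= n + 1 -> continuous (v (S k)) x) by (intros; apply Hg; auto; lia).
    set (E := fun x => (RtoC (v (S k) x) * cexp (- s * RtoC (ln x)) * cE3 (- h * RtoC (ln x)))%C).
    assert (HE : (mterm (v (S k)) n (s + h) - (mterm (v (S k)) n s + mterm (lnw v (S k)) n s * h + mterm (fun x => (/ 2 * lnw (lnw v) (S k) x)%R) n s * (h * h)))%C = CI E n (n + 1)).
    { assert (C1 : ccR (fun x => RtoC (v (S k) x) * cexp (- (s + h) * RtoC (ln x)))%C n (n + 1)) by (apply mterm_ccR; auto).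
      assert (C2 : ccR (fun x => RtoC (v (S k) x) * cexp (- s * RtoC (ln x)))%C n (n + 1)) by (apply mterm_ccR; auto).
      assert (C3 : ccR (fun x => RtoC (lnw v (S k) x) * cexp (- s * RtoC (ln x)))%C n (n + 1)).
      { apply mterm_ccR; auto. intros; apply Hw1; auto; lia. }
      assert (C4 : ccR (fun x => RtoC (/ 2 * lnw (lnw v) (S k) x)%R * cexp (- s * RtoC (ln x)))%C n (n + 1)).
      { apply mterm_ccR; auto. intros; apply Hw3; auto; lia. }
      unfold mterm.
      rewrite (CI_ext E (fun x => RtoC (v (S k) x) * cexp (- (s + h) * RtoC (ln x)) + ((RtoC (-1)) * (RtoC (v (S k) x) * cexp (- s * RtoC (ln x))) + ((- h) * (RtoC (lnw v (S k) x) * cexp (- s * RtoC (ln x))) + (- (h * h)) * (RtoC (/ 2 * lnw (lnw v) (S k) x)%R * cexp (- s * RtoC (ln x))))))%C); try lra.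
      - rewrite !CI_plus, !CI_scal; auto; try lra; repeat apply ccR_plus; auto; try (apply ccR_mult; auto; apply ccR_const). ceq.
      - intros x Hx. unfold E, cE3.
        replace (- (s + h) * RtoC (ln x))%C with (- s * RtoC (ln x) + - h * RtoC (ln x))%C by ceq. rewrite cexp_plus.
        unfold lnw. generalize (cexp (- s * RtoC (ln x))) (cexp (- h * RtoC (ln x))). intros u w. ceq; field. }
    fold n. rewrite HE.
    assert (CE : ccR E n (n + 1)).
    { unfold E. apply ccR_mult; [apply mterm_ccR; auto|]. unfold cE3, Cminus.
      assert (Cl : ccR (fun x => RtoC (ln x)) n (n + 1)).
      { apply ccR_real. intros x Hx. apply (ex_derive_continuous (V := R_NormedModule)). auto_derive; lra. }
      assert (Ch : ccR (fun x => - h * RtoC (ln x))%C n (n + 1)) by (apply ccR_mult; auto; apply ccR_const).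
      assert (Copp : forall F, ccR F n (n + 1) -> ccR (fun x => - F x)%C n (n + 1)).
      { intros F HF x Hx. destruct (HF x Hx). split; simpl; apply (continuous_opp (V := R_NormedModule)); auto. }
      repeat apply ccR_plus; try apply ccR_const.
      - apply ccR_cexp_ln; lra.
      - apply Copp; auto.
      - apply Copp. apply ccR_mult; [apply ccR_mult; auto|apply ccR_const]. }
    eapply Rle_trans; [apply (CI_bound E n (n + 1) (D * (12 / rho) ^ 3 * rpow n (- (1 + rho / 2)) * Cmod h ^ 3)); auto; try lra|right; ring].
    intros x Hx. unfold E. rewrite !Cmod_mult, cexp_ln_mod, Cmod_R.
    destruct (Hg (S k) x ltac:(lia) Hx) as [_ Hb].
    pose proof (cE3_bound (- h * RtoC (ln x))) as B3. rewrite Cmod_mult, Cmod_opp, Cmod_R in B3.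
    assert (Hl : 0 <= ln x) by (apply ln_ge_0; lra). rewrite (Rabs_pos_eq (ln x)) in B3 by auto.
    pose proof (Cmod_ge_0 h) as Hh0.
    assert (B4 : (Cmod h * ln x) ^ 3 * exp (Cmod h * ln x) <= Cmod h ^ 3 * ((12 / rho) ^ 3 * rpow x (rho / 2))).
    { rewrite Rpow_mult_distr, Rmult_assoc. apply Rmult_le_compat_l; [apply pow_le; auto|].
      replace (rho / 2) with (rho / 4 + rho / 4) by field. rewrite rpow_plus, <- Rmult_assoc.
      assert (0 <= (12 / rho) ^ 3). { apply pow_le. left; apply Rdiv_lt_0_compat; lra. }
      apply Rmult_le_compat; [apply pow_le; auto|left; apply exp_pos| |].
      - assert (E1 : rpow x (rho / 4) = rpow x (rho / 12) ^ 3).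
        { replace (rho / 4) with (rho / 12 + (rho / 12 + rho / 12)) by field. rewrite !rpow_plus. ring. }
        rewrite E1, <- Rpow_mult_distr. apply pow_incr. split; auto.
        pose proof (ln_le_rpow x (rho / 12) ltac:(lra) ltac:(lra)) as Hll.
        replace (12 / rho) with (/ (rho / 12)) by (field; lra). auto.
      - unfold rpow. apply exp_le_compat. apply Rmult_le_compat_r; lra. }
    pose proof (rpow_pos x (- fst s)). pose proof (Rabs_pos (v (S k) x)).
    pose proof (Cmod_ge_0 (cE3 (- h * ln x))).
    apply Rle_trans with ((D * rpow x (e - 1) * rpow x (- fst s)) * (Cmod h ^ 3 * ((12 / rho) ^ 3 * rpow x (rho / 2)))).
    { apply Rmult_le_compat; auto; [nra| |lra]. apply Rmult_le_compat_r; lra. }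
    replace (D * rpow x (e - 1) * rpow x (- fst s) * (Cmod h ^ 3 * ((12 / rho) ^ 3 * rpow x (rho / 2))))
      with (D * (12 / rho) ^ 3 * (rpow x (e - 1) * rpow x (- fst s) * rpow x (rho / 2)) * Cmod h ^ 3) by ring.
    rewrite <- !rpow_plus. apply Rmult_le_compat_r; [apply pow_le; auto|].
    apply Rmult_le_compat_l.
    { apply Rmult_le_pos; auto. apply pow_le. left; apply Rdiv_lt_0_compat; lra. }
    replace (e - 1 + - fst s + rho / 2) with (- (1 + rho / 2)) by (unfold rho; field). apply rpow_le_base_neg; lra.
  - apply ex_series_Rscal. apply zsum_ex; lra.
  - eapply MS_absconv; eauto.
  - eapply (MS_absconv (lnw v)); [exact Hw1|unfold rho; lra].
  - eapply (MS_absconv (fun n x => / 2 * lnw (lnw v) n x)); [exact Hw3|unfold rho; lra].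
Qed.

(** * Real derivatives of complex functions and complex powers *)

Definition cder (F : R -> C) (F' : C) (x : R) : Prop :=
  is_derive (fun y => fst (F y)) x (fst F') /\ is_derive (fun y => snd (F y)) x (snd F').

Lemma cder_plus F G F' G' x : cder F F' x -> cder G G' x -> cder (fun y => F y + G y)%C (F' + G')%C x.
Proof. intros [H1 H2] [H3 H4]. split; simpl; apply (is_derive_plus (V := R_NormedModule)); auto. Qed.
Lemma cder_mult F G F' G' x : cder F F' x -> cder G G' x -> cder (fun y => F y * G y)%C (F' * G x + F x * G')%C x.
Proof.
  intros [H1 H2] [H3 H4]. split; simpl.
  - replace (_ + _) with ((fst F' * fst (G x) + fst (F x) * fst G') - (snd F' * snd (G x) + snd (F x) * snd G')) by ring.
    apply (is_derive_minus (V := R_NormedModule) (fun y => fst (F y) * fst (G y)) (fun y => snd (F y) * snd (G y)));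
    apply (is_derive_mult (K := R_AbsRing)); auto; intros; apply Rmult_comm.
  - replace (_ + _) with ((fst F' * snd (G x) + fst (F x) * snd G') + (snd F' * fst (G x) + snd (F x) * fst G')) by ring.
    apply (is_derive_plus (V := R_NormedModule) (fun y => fst (F y) * snd (G y)) (fun y => snd (F y) * fst (G y)));
    apply (is_derive_mult (K := R_AbsRing)); auto; intros; apply Rmult_comm.
Qed.
Lemma cder_const c x : cder (fun _ => c) 0 x.
Proof. split; simpl; apply (is_derive_const (K := R_AbsRing) (V := R_NormedModule)). Qed.
Lemma cder_real (f : R -> R) l x : is_derive f x l -> cder (fun y => RtoC (f y)) (RtoC l) x.
Proof. intros; split; simpl; auto. apply (is_derive_const (K := R_AbsRing) (V := R_NormedModule)). Qed.
Lemma cder_cexp F F' x : cder F F' x -> cder (fun y => cexp (F y)) (F' * cexp (F x))%C x.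
Proof.
  intros [H1 H2]. split; unfold cexp; simpl.
  - replace (_ - _) with (fst F' * exp (fst (F x)) * cos (snd (F x)) + exp (fst (F x)) * (snd F' * - sin (snd (F x)))) by ring.
    apply (is_derive_mult (K := R_AbsRing) (fun y => exp (fst (F y))) (fun y => cos (snd (F y)))).
    + apply (is_derive_comp exp (fun y => fst (F y))); auto. apply is_derive_exp.
    + apply (is_derive_comp cos (fun y => snd (F y))); auto. apply is_derive_cos.
    + intros; apply Rmult_comm.
  - replace (_ + _) with (fst F' * exp (fst (F x)) * sin (snd (F x)) + exp (fst (F x)) * (snd F' * cos (snd (F x)))) by ring.
    apply (is_derive_mult (K := R_AbsRing) (fun y => exp (fst (F y))) (fun y => sin (snd (F y)))).
    + apply (is_derive_comp exp (fun y => fst (F y))); auto. apply is_derive_exp.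
    + apply (is_derive_comp sin (fun y => snd (F y))); auto. apply is_derive_sin.
    + intros; apply Rmult_comm.
Qed.
Lemma cder_eq F F' G' x : F' = G' -> cder F F' x -> cder F G' x.
Proof. intros ->; auto. Qed.

Definition kpow (s : C) (x : R) : C := cexp (s * RtoC (ln x)).
Arguments kpow s%_C_scope x%_R_scope.

Lemma kpow_mod s x : Cmod (kpow s x) = rpow x (fst s).
Proof. unfold kpow. rewrite Cmod_cexp. unfold rpow. f_equal. simpl. ring. Qed.
Lemma kpow_plus s w x : kpow (s + w) x = (kpow s x * kpow w x)%C.
Proof. unfold kpow. rewrite <- cexp_plus. f_equal. ceq. Qed.
Lemma kpow_1 s : kpow s 1 = 1.
Proof. unfold kpow. rewrite ln_1. replace (s * RtoC 0)%C with (RtoC 0) by ceq. apply cexp_0. Qed.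
Lemma kpow_real p x : kpow (RtoC p) x = RtoC (rpow x p).
Proof. unfold kpow, rpow. rewrite <- cexp_RtoC. f_equal. ceq. Qed.
Lemma kpow_one x : 0 < x -> kpow 1 x = RtoC x.
Proof. intros. rewrite kpow_real, rpow_1r; auto. Qed.
Lemma kpow_m1 x : 0 < x -> kpow (- (1)) x = RtoC (/ x).
Proof. intros. replace (- (1))%C with (RtoC (-1)) by ceq. rewrite kpow_real. f_equal. rewrite <- (rpow_1r x H) at 2. rewrite <- rpow_opp. f_equal; ring. Qed.
Lemma kpow_mult_base s x y : 0 < x -> 0 < y -> kpow s (x * y) = (kpow s x * kpow s y)%C.
Proof. intros. unfold kpow. rewrite ln_mult, <- cexp_plus by auto. f_equal. ceq. Qed.

Lemma npow_kpow n s : npow n s = kpow s (INR n).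
Proof. unfold npow, kpow, cexp. apply injective_projections; simpl; f_equal; f_equal; ring. Qed.

Lemma cder_kpow s x : 0 < x -> cder (kpow s) (s * kpow (s - 1) x)%C x.
Proof.
  intros Hx. unfold kpow. apply (cder_eq _ ((s * RtoC (/ x)) * cexp (s * RtoC (ln x)))%C).
  - fold (kpow s x). fold (kpow (s - 1) x). unfold Cminus. rewrite kpow_plus, kpow_m1 by auto. ring.
  - apply (cder_cexp (fun y => s * RtoC (ln y))%C (s * RtoC (/ x))%C x).
    apply (cder_eq _ (0 * RtoC (ln x) + s * RtoC (/ x))%C); [ring|].
    apply (cder_mult (fun _ => s) (fun y => RtoC (ln y))); [apply cder_const|apply cder_real]. auto_derive; auto. field; lra.
Qed.

Lemma CI_FTC F G a b : a <= b -> (forall x, a <= x <= b -> cder G (F x) x) -> ccR F a b -> CI F a b = (G b - G a)%C.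
Proof.
  intros Hab Hd Hc. unfold CI. apply injective_projections; simpl.
  - apply is_RInt_unique. apply (is_RInt_derive (V := R_CompleteNormedModule) (fun y => fst (G y))); rewrite Rmin_left, Rmax_right by auto; intros.
    + apply Hd; auto.
    + apply Hc; auto.
  - apply is_RInt_unique. apply (is_RInt_derive (V := R_CompleteNormedModule) (fun y => snd (G y))); rewrite Rmin_left, Rmax_right by auto; intros.
    + apply Hd; auto.
    + apply Hc; auto.
Qed.

(** * The zeta function *)

(** With {x} the fractional part, this is [(1 - {x}) / x] on [n, n+1). So [B s] is the integral of
    [(1 - {x}) x^(-s-1)] from 1 to infinity, and zeta(s) = 1/(s-1) + s B(s). *)
Definition wB (n : nat) (x : R) : R := (INR n + 1 - x) / x.
Definition B (s : C) : C := MS wB s.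
Arguments B s%_C_scope : simpl never.

Lemma wB_grow : wgrow wB 1 0.
Proof.
  split; [lra|]. intros n x Hn Hx. assert (1 <= INR n) by (apply (le_INR 1); auto). split.
  - apply (ex_derive_continuous (V := R_NormedModule)). unfold wB. auto_derive. lra.
  - unfold wB. replace (0 - 1) with (- (1)) by ring. rewrite rpow_opp, rpow_1r by lra.
    unfold Rdiv. rewrite Rabs_mult, Rmult_1_l, (Rabs_pos_eq (/ x)) by (left; apply Rinv_0_lt_compat; lra).
    rewrite <- (Rmult_1_l (/ x)) at 2. apply Rmult_le_compat_r; [left; apply Rinv_0_lt_compat; lra|].
    apply Rabs_le; lra.
Qed.

Lemma C1_neq (s : C) : s <> RtoC 1 -> (s - 1)%C <> 0.
Proof. intros H E. apply H. replace s with (s - 1 + 1)%C by ring. rewrite E. ring. Qed.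

Lemma Cneq_fst (s : C) : 0 < fst s -> s <> 0.
Proof. intros H ->. simpl in H. lra. Qed.

(** Integration by parts, in the form of the explicit antiderivative
    [- (n + 1 - x) x^(-s) + x^(1-s) / (s-1)]. The left side is a summand of the series defining
    [zeta]. *)
Lemma zeta_term n s : (1 <= n)%nat -> s <> RtoC 1 ->
  (kpow (- s) (INR n) - (kpow (1 - s) (INR n) - kpow (1 - s) (INR n + 1)) / (s - 1))%C = (s * mterm (wB n) (INR n) s)%C.
Proof.
  intros Hn Hs. assert (Hn1 : 1 <= INR n) by (apply (le_INR 1); auto).
  pose proof (C1_neq s Hs) as Hs1.
  unfold mterm.
  assert (Cc : ccR (fun x => RtoC (wB n x) * cexp (- s * RtoC (ln x)))%C (INR n) (INR n + 1)).
  { apply mterm_ccR; auto. intros; apply wB_grow; auto. }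
  rewrite <- CI_scal by (auto; lra).
  rewrite (CI_FTC _ (fun x => RtoC (- (INR n + 1 - x)) * kpow (- s) x + kpow (1 - s) x / (s - 1))%C).
  - replace (- (INR n + 1 - (INR n + 1))) with 0 by ring. replace (- (INR n + 1 - INR n)) with (-1) by ring.
    generalize (kpow (- s) (INR n)) (kpow (1 - s) (INR n)) (kpow (1 - s) (INR n + 1)) (kpow (- s) (INR n + 1)).
    intros a b c d. replace (RtoC (-1)) with (- (1))%C by ceq. field. auto.
  - lra.
  - intros x Hx. assert (Hx0 : 0 < x) by lra.
    apply (cder_eq _ ((RtoC 1 * kpow (- s) x + RtoC (- (INR n + 1 - x)) * (- s * kpow (- s - 1) x)) + (((1 - s) * kpow (1 - s - 1) x) * / (s - 1) + kpow (1 - s) x * 0))%C).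
    + fold (kpow (- s) x). unfold wB. replace (1 - s - 1)%C with (- s)%C by ring.
      replace (- s - 1)%C with (- s + - (1))%C by ring. rewrite (kpow_plus (- s)), kpow_m1 by auto.
      replace (RtoC ((INR n + 1 - x) / x)) with (RtoC (INR n + 1 - x)%R * RtoC (/ x)%R)%C by (rewrite <- RtoC_mult; reflexivity).
      replace (RtoC (- (INR n + 1 - x))) with (- RtoC (INR n + 1 - x)%R)%C by (rewrite <- RtoC_opp; reflexivity).
      generalize (kpow (- s) x) (RtoC (INR n + 1 - x)%R) (RtoC (/ x)%R). intros u v w. field. auto.
    + apply (cder_plus (fun y => RtoC (- (INR n + 1 - y)) * kpow (- s) y)%C (fun y => kpow (1 - s) y * / (s - 1))%C).
      * apply (cder_mult (fun y => RtoC (- (INR n + 1 - y))) (kpow (- s))); [|apply cder_kpow; auto]. apply (cder_real (fun y => - (INR n + 1 - y))). auto_derive; auto; ring.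
      * apply (cder_mult (kpow (1 - s)) (fun _ => / (s - 1))%C); [apply cder_kpow; auto|apply cder_const].
  - apply ccR_mult; auto. apply ccR_const.
Qed.

Lemma zeta_B s : 0 < fst s -> s <> RtoC 1 -> zeta s = (/ (s - 1) + s * B s)%C.
Proof.
  intros H0 H1. unfold zeta. f_equal. unfold B, MS. rewrite <- CSeries_scal by (apply (MS_absconv wB 1 0); [apply wB_grow|lra]).
  apply CSeries_ext. intros k. rewrite !npow_kpow. rewrite <- zeta_term by (auto; lia).
  rewrite <- (S_INR (S k)). reflexivity.
Qed.

(* [(1 - 1/s) zeta s], written so that it is also regular at [s = 1], where it equals 1. *)
Definition zreg (s : C) : C := (/ s + (s - 1) * B s)%C.
Definition dzreg (s : C) : C := (- (/ s * / s) + (B s + (s - 1) * MS (lnw wB) s))%C.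
Arguments zreg s%_C_scope : simpl never.
Arguments dzreg s%_C_scope : simpl never.

Lemma zreg_zeta s : 0 < fst s -> s <> RtoC 1 -> zreg s = ((1 - / s) * zeta s)%C.
Proof.
  intros H0 H1. rewrite zeta_B by auto. unfold zreg. pose proof (C1_neq s H1). pose proof (Cneq_fst s H0). field. auto.
Qed.

Lemma zreg_1 : zreg 1 = 1.
Proof. unfold zreg. field. Qed.

Lemma B_bound s : 0 < fst s -> Cmod (B s) <= 1 + / fst s.
Proof. intros H. pose proof (MS_bound wB 1 0 s wB_grow H) as Hb. rewrite Rmult_1_l, Rminus_0_r in Hb. exact Hb. Qed.

Lemma fst_le_Cmod (s : C) : fst s <= Cmod s.
Proof. eapply Rle_trans; [apply Rle_abs|apply Cmod_fst]. Qed.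

Lemma zreg_bound s : 0 < fst s -> Cmod (zreg s) <= (1 + / fst s) * (1 + Cmod (s - 1)).
Proof.
  intros H. unfold zreg. pose proof (B_bound s H). pose proof (Cneq_fst s H).
  assert (0 < / fst s) by (apply Rinv_0_lt_compat; auto).
  eapply Rle_trans; [apply Cmod_triangle|]. rewrite Cmod_inv, Cmod_mult by auto.
  assert (/ Cmod s <= / fst s) by (apply Rinv_le_contravar; auto; apply fst_le_Cmod).
  pose proof (Cmod_ge_0 (s - 1)). nra.
Qed.

Lemma zreg_jet s : 0 < fst s -> exists b, jet zreg s (dzreg s) b.
Proof.
  intros H. pose proof (Cneq_fst s H).
  pose proof (MS_jet wB 1 0 s wB_grow H) as HB.
  pose proof (jet_mult (fun w => w - 1)%C (MS wB) s _ _ _ _ (jet_plus _ _ _ _ _ _ _ (jet_id s) (jet_const (-(1))%C s)) HB) as H2.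
  pose proof (jet_plus _ _ _ _ _ _ _ (jet_inv s H0) H2) as H3.
  eexists. unfold zreg, B.
  match type of H3 with jet _ _ ?A _ => replace (dzreg s) with A; [exact H3|] end.
  unfold dzreg, B. ring.
Qed.

Lemma zreg_J s : 0 < fst s -> J zreg s.
Proof. intros H. destruct (zreg_jet s H) as [b Hb]. do 2 eexists; eauto. Qed.

Lemma B_J s : 0 < fst s -> J B s.
Proof. intros H. do 2 eexists. apply (MS_jet wB 1 0 s wB_grow H). Qed.

Lemma MS_J v D e s : wgrow v D e -> e < fst s -> J (MS v) s.
Proof. intros. do 2 eexists. eapply MS_jet; eauto. Qed.

Lemma dzreg_J s : 0 < fst s -> J dzreg s.
Proof.
  intros H. pose proof (Cneq_fst s H). unfold dzreg.
  apply J_plus; [apply J_opp; apply J_mult; apply J_inv; auto; apply J_id|].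
  apply J_plus; [apply B_J; auto|]. apply J_mult; [apply J_minus; [apply J_id|apply J_const]|].
  apply (MS_J _ (1 / (fst s / 2)) (0 + fst s / 2)); [apply (wgrow_ln wB); [apply wB_grow|lra]|lra].
Qed.

(** The two expansions are compared at a small real increment. This identifies [dzreg], found from
    the integral [B], with the derivative found from the Dirichlet series. *)
Lemma jet_unique f z a b a' b' : jet f z a b -> jet f z a' b' -> a = a'.
Proof.
  intros (d & K & Hd & HK & H) (d' & K' & Hd' & HK' & H').
  destruct (Req_dec (Cmod (a - a')) 0) as [E|E].
  { apply Cmod_eq_0 in E. replace a with (a - a' + a')%C by ring. rewrite E. ring. }
  pose proof (Cmod_ge_0 (a - a')). set (m := Cmod (a - a')) in *. assert (Hm : 0 < m) by lra. exfalso.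
  set (Q := Cmod (b' - b) + K + K' + 1). pose proof (Cmod_ge_0 (b' - b)).
  set (t := Rmin (Rmin (d / 2) (d' / 2)) (Rmin 1 (m / (2 * Q)))).
  assert (HQ : 0 < Q) by (unfold Q; lra).
  assert (Hq : 0 < m / (2 * Q)) by (apply Rdiv_lt_0_compat; lra).
  assert (Ht : 0 < t /\ t <= d / 2 /\ t <= d' / 2 /\ t <= 1 /\ t <= m / (2 * Q)).
  { unfold t, Rmin; repeat destruct Rle_dec; lra. }
  assert (Et : Cmod (RtoC t) = t) by (apply Cmod_real; lra).
  specialize (H (RtoC t) ltac:(lra)). specialize (H' (RtoC t) ltac:(lra)). rewrite Et in *.
  assert (m * t <= Cmod (b' - b) * (t * t) + (K * t ^ 3 + K' * t ^ 3)).
  { unfold m. rewrite <- Et at 1. rewrite <- Cmod_mult.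
    replace ((a - a') * t)%C with ((b' - b) * (t * t) + ((f (z + t)%C - (f z + a' * t + b' * (t * t))) - (f (z + t)%C - (f z + a * t + b * (t * t)))))%C by ring.
    eapply Rle_trans; [apply Cmod_triangle|]. rewrite !Cmod_mult, Et.
    apply Rplus_le_compat_l. eapply Rle_trans; [apply Cmod_minus_le|]. lra. }
  assert (Hmt : t * Q <= m / 2).
  { destruct Ht as (_ & _ & _ & _ & Ht). apply (Rmult_le_compat_r Q) in Ht; [|lra].
    replace (m / (2 * Q) * Q) with (m / 2) in Ht by (field; lra). auto. }
  assert (t ^ 3 <= t * t) by (simpl; nra).
  assert (m * t <= t * t * Q). { unfold Q. nra. }
  assert (m <= t * Q) by (apply Rmult_le_reg_r with t; lra). lra.
Qed.

(** * Dirichlet series and their agreement with [zeta] for Re s > 1 *)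

Definition DS (f : nat -> R) (s : C) : C := CSeries (fun k => RtoC (f (S k)) * kpow (- s) (INR (S k)))%C.
Arguments DS f s%_C_scope : simpl never.
Definition dgrow (f : nat -> R) (D e : R) : Prop := 0 <= D /\ forall n, (1 <= n)%nat -> Rabs (f n) <= D * rpow (INR n) e.

Lemma DS_term_bound f D e s k : dgrow f D e ->
  Cmod (RtoC (f (S k)) * kpow (- s) (INR (S k))) <= D * rpow (INR (S k)) (- (1 + (fst s - 1 - e))).
Proof.
  intros [HD Hf]. rewrite Cmod_mult, kpow_mod, Cmod_R.
  replace (- (1 + (fst s - 1 - e))) with (e + fst (- s)%C) by (simpl; ring). rewrite rpow_plus, <- Rmult_assoc.
  apply Rmult_le_compat_r; [left; apply rpow_pos|]. apply Hf; lia.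
Qed.

Lemma DS_absconv f D e s : dgrow f D e -> 1 + e < fst s -> absconv (fun k => RtoC (f (S k)) * kpow (- s) (INR (S k)))%C.
Proof.
  intros Hf He. eapply absconv_le; [intros k; apply (DS_term_bound f D e s k Hf)|].
  apply ex_series_Rscal. apply zsum_ex; lra.
Qed.

Lemma DS_bound f D e s : dgrow f D e -> 1 + e < fst s -> Cmod (DS f s) <= D * (1 + / (fst s - 1 - e)).
Proof.
  intros Hf He. unfold DS. eapply Rle_trans; [apply (CSeries_bound _ _ (fun k => DS_term_bound f D e s k Hf))|].
  - apply ex_series_Rscal. apply zsum_ex; lra.
  - rewrite Series_scal_l. apply Rmult_le_compat_l; [apply Hf|]. apply zsum_ex; lra.
Qed.

Definition lnf (f : nat -> R) : nat -> R := fun n => - ln (INR n) * f n.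

Lemma dgrow_ln f D e d : dgrow f D e -> 0 < d -> dgrow (lnf f) (D / d) (e + d).
Proof.
  intros [HD Hf] Hd. split; [apply Rmult_le_pos; [auto|left; apply Rinv_0_lt_compat; auto]|].
  intros n Hn. assert (1 <= INR n) by (apply (le_INR 1); auto). unfold lnf.
  rewrite Rabs_mult, Rabs_Ropp, (Rabs_pos_eq (ln (INR n))) by (apply ln_ge_0; lra).
  pose proof (ln_le_rpow (INR n) d ltac:(lra) Hd). pose proof (ln_ge_0 (INR n) ltac:(lra)).
  rewrite Rplus_comm, rpow_plus.
  replace (D / d * (rpow (INR n) d * rpow (INR n) e)) with ((/ d * rpow (INR n) d) * (D * rpow (INR n) e)) by (field; lra).
  apply Rmult_le_compat; auto. apply Rabs_pos.
Qed.

(** The argument of [MS_jet] with sums in place of integrals and the same division of [rho]. *)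
Lemma DS_jet f D e s : dgrow f D e -> 1 + e < fst s -> exists b, jet (DS f) s (DS (lnf f) s) b.
Proof.
  intros Hf He. set (rho := fst s - 1 - e). assert (Hr : 0 < rho) by (unfold rho; lra).
  pose proof (dgrow_ln _ _ _ (rho / 4) Hf ltac:(lra)) as Hf1.
  pose proof (dgrow_ln _ _ _ (rho / 4) Hf1 ltac:(lra)) as Hf2.
  exists (CSeries (fun k => / 2 * (RtoC (lnf (lnf f) (S k)) * kpow (- s) (INR (S k))))%C).
  unfold DS. apply (series_jet _ _ _ (fun k => (D * (12 / rho) ^ 3) * rpow (INR (S k)) (- (1 + rho / 2))) s (rho / 4)).
  - lra.
  - intros k h Hh. set (n := INR (S k)). assert (Hn : 1 <= n) by apply INR_S_ge1.
    replace (- (s + h))%C with (- s + - h)%C by ring. rewrite kpow_plus.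
    replace (RtoC (f (S k)) * (kpow (- s) n * kpow (- h) n) -
      (RtoC (f (S k)) * kpow (- s) n + RtoC (lnf f (S k)) * kpow (- s) n * h + / 2 * (RtoC (lnf (lnf f) (S k)) * kpow (- s) n) * (h * h)))%C
      with (RtoC (f (S k)) * kpow (- s) n * cE3 (- h * RtoC (ln n)))%C.
    2:{ unfold cE3, lnf. fold n. fold (kpow (- h) n). generalize (kpow (- s) n) (kpow (- h) n). intros u w. ceq; field. }
    rewrite !Cmod_mult, kpow_mod, Cmod_R. simpl (fst (- s)%C).
    destruct Hf as [HD Hf]. pose proof (Hf (S k) ltac:(lia)) as Hb. fold n in Hb.
    pose proof (cE3_bound (- h * RtoC (ln n))) as B3. rewrite Cmod_mult, Cmod_opp, Cmod_R in B3.
    assert (Hl : 0 <= ln n) by (apply ln_ge_0; lra). rewrite (Rabs_pos_eq (ln n)) in B3 by auto.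
    pose proof (Cmod_ge_0 h) as Hh0.
    assert (B4 : (Cmod h * ln n) ^ 3 * exp (Cmod h * ln n) <= Cmod h ^ 3 * ((12 / rho) ^ 3 * rpow n (rho / 2))).
    { rewrite Rpow_mult_distr, Rmult_assoc. apply Rmult_le_compat_l; [apply pow_le; auto|].
      replace (rho / 2) with (rho / 4 + rho / 4) by field. rewrite rpow_plus, <- Rmult_assoc.
      assert (0 <= (12 / rho) ^ 3). { apply pow_le. left; apply Rdiv_lt_0_compat; lra. }
      apply Rmult_le_compat; [apply pow_le; auto|left; apply exp_pos| |].
      - assert (E1 : rpow n (rho / 4) = rpow n (rho / 12) ^ 3).
        { replace (rho / 4) with (rho / 12 + (rho / 12 + rho / 12)) by field. rewrite !rpow_plus. ring. }
        rewrite E1, <- Rpow_mult_distr. apply pow_incr. split; auto.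
        pose proof (ln_le_rpow n (rho / 12) ltac:(lra) ltac:(lra)) as Hll.
        replace (12 / rho) with (/ (rho / 12)) by (field; lra). auto.
      - unfold rpow. apply exp_le_compat. apply Rmult_le_compat_r; lra. }
    pose proof (rpow_pos n (- fst s)). pose proof (Rabs_pos (f (S k))).
    pose proof (Cmod_ge_0 (cE3 (- h * ln n))).
    apply Rle_trans with ((D * rpow n e * rpow n (- fst s)) * (Cmod h ^ 3 * ((12 / rho) ^ 3 * rpow n (rho / 2)))).
    { apply Rmult_le_compat; auto; [nra| |lra]. apply Rmult_le_compat_r; lra. }
    replace (D * rpow n e * rpow n (- fst s) * (Cmod h ^ 3 * ((12 / rho) ^ 3 * rpow n (rho / 2))))
      with (D * (12 / rho) ^ 3 * (rpow n e * rpow n (- fst s) * rpow n (rho / 2)) * Cmod h ^ 3) by ring.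
    rewrite <- !rpow_plus. apply Rmult_le_compat_r; [apply pow_le; auto|].
    apply Rmult_le_compat_l.
    { apply Rmult_le_pos; auto. apply pow_le. left; apply Rdiv_lt_0_compat; lra. }
    right. f_equal. unfold rho; field.
  - apply ex_series_Rscal. apply zsum_ex; lra.
  - eapply DS_absconv; eauto.
  - eapply (DS_absconv (lnf f)); [exact Hf1|unfold rho; lra].
  - apply absconv_scal. eapply (DS_absconv (lnf (lnf f))); [exact Hf2|unfold rho; lra].
Qed.

Lemma rpow_lim p : 0 < p -> is_lim_seq (fun n => rpow (INR (S n)) (- p)) 0.
Proof.
  intros Hp. unfold rpow. apply is_lim_seq_incr_1 with (u := fun n => exp (- p * ln (INR n))).
  apply (is_lim_comp_seq exp (fun n => - p * ln (INR n)) m_infty 0).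
  - apply is_lim_exp_m.
  - exists 0%nat; intros; discriminate.
  - assert (E : Rbar_mult (- p) p_infty = m_infty).
    { simpl. destruct (Rle_dec 0 (- p)) as [H|H]; [exfalso; lra|]. auto. }
    rewrite <- E.
    apply is_lim_seq_scal_l. apply (is_lim_comp_seq ln INR p_infty p_infty).
    + apply is_lim_ln_p.
    + exists 0%nat; intros; discriminate.
    + apply is_lim_seq_INR.
Qed.

Lemma squeeze0 (u v : nat -> R) : (forall n, Rabs (u n) <= v n) -> is_lim_seq v 0 -> is_lim_seq u 0.
Proof.
  intros H Hv. apply (is_lim_seq_le_le (fun n => - v n) u v).
  - intros n. specialize (H n). apply Rabs_le_between in H. lra.
  - replace (Finite 0) with (Rbar_opp 0) by (simpl; f_equal; ring). apply is_lim_seq_opp in Hv. exact Hv.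
  - auto.
Qed.

Lemma telescope_R (u : nat -> R) : is_lim_seq u 0 -> is_series (fun k => u k - u (S k)) (u 0%nat).
Proof.
  intros Hu. assert (H : is_lim_seq (sum_n (fun k => u k - u (S k))) (u 0%nat)); [|exact H].
  apply (is_lim_seq_ext (fun n => u 0%nat - u (S n))).
  - induction n; [rewrite sum_O; reflexivity|rewrite sum_nS, <- IHn; ring].
  - replace (Finite (u 0%nat)) with (Finite (u 0%nat - 0)) by (f_equal; ring).
    apply is_lim_seq_minus'; [apply is_lim_seq_const|]. apply (is_lim_seq_incr_1 u). auto.
Qed.

Lemma telescope_C (g : nat -> C) (v : nat -> R) : (forall n, Cmod (g n) <= v n) -> is_lim_seq v 0 ->
  CSeries (fun k => g k - g (S k))%C = g 0%nat.
Proof.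
  intros Hg Hv. unfold CSeries. apply injective_projections; simpl; apply is_series_unique.
  - apply (telescope_R (fun k => fst (g k))). apply (squeeze0 _ v); auto.
    intros n. eapply Rle_trans; [apply Cmod_fst|apply Hg].
  - apply (telescope_R (fun k => snd (g k))). apply (squeeze0 _ v); auto.
    intros n. eapply Rle_trans; [apply Cmod_snd|apply Hg].
Qed.

Definition cst1 (n : nat) : R := 1.
Lemma cst1_grow : dgrow cst1 1 0.
Proof. split; [lra|]. intros n Hn. unfold cst1, rpow. rewrite Rmult_0_l, exp_0, Rabs_R1. lra. Qed.

(** For Re s > 1 the integrals subtracted in the series for [zeta] telescope to 1/(s-1) in total,
    which cancels the polar term. *)
Lemma zeta_DS s : 1 < fst s -> zeta s = DS cst1 s.
Proof.
  intros Hs. assert (H1 : s <> RtoC 1) by (intros ->; simpl in Hs; lra). pose proof (C1_neq s H1).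
  set (g := fun k => (kpow (1 - s) (INR (S k)) / (s - 1))%C).
  assert (Ha : absconv (fun k => s * mterm (wB (S k)) (INR (S k)) s)%C).
  { apply absconv_scal. apply (MS_absconv wB 1 0); [apply wB_grow|lra]. }
  assert (Hb : absconv (fun k => RtoC (cst1 (S k)) * kpow (- s) (INR (S k)))%C) by (apply (DS_absconv cst1 1 0); [apply cst1_grow|lra]).
  assert (Hg : CSeries (fun k => g k - g (S k))%C = g 0%nat).
  { apply (telescope_C _ (fun n => / Cmod (s - 1) * rpow (INR (S n)) (- (fst s - 1)))).
    - intros n. unfold g. rewrite Cmod_div, kpow_mod by auto. unfold Rdiv. rewrite Rmult_comm. right. f_equal. f_equal. simpl; ring.
    - replace (Finite 0) with (Rbar_mult (/ Cmod (s - 1)) 0) by (simpl; f_equal; ring).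
      apply is_lim_seq_scal_l. apply rpow_lim. lra. }
  assert (E0 : g 0%nat = (/ (s - 1))%C).
  { unfold g. simpl INR. rewrite kpow_1. unfold Cdiv. ring. }
  rewrite zeta_B by (auto; lra). rewrite <- E0, <- Hg. unfold B, MS. rewrite <- CSeries_scal.
  2: apply (MS_absconv wB 1 0); [apply wB_grow|lra].
  rewrite <- CSeries_plus; auto.
  - unfold DS. apply CSeries_ext. intros k. rewrite <- zeta_term by (auto; lia).
    unfold g. rewrite (S_INR (S k)). unfold cst1. field. auto.
  - apply (absconv_ext (fun k => RtoC (cst1 (S k)) * kpow (- s) (INR (S k)) + RtoC (-1) * (s * mterm (wB (S k)) (INR (S k)) s))%C).
    + intros k. rewrite <- zeta_term by (auto; lia). unfold g. rewrite (S_INR (S k)). unfold cst1. replace (RtoC (-1)) with (- (1))%C by ceq. field; auto.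
    + apply absconv_plus; auto. apply absconv_scal; auto.
Qed.

(** * Moebius and von Mangoldt functions *)

(** Von Mangoldt's function: [primes n] lists the distinct prime divisors, so a one-element list
    means a prime power. *)
Definition Lam (n : nat) : R :=
  match prime.primes n with (p :: nil)%list => ln (INR p) | _ => 0 end.

(** * Values of [mobius] and [Lam] when a prime factor is split off *)

Module MobLam.
Import ssreflect ssrfun ssrbool eqtype ssrnat seq path div prime zify.

Lemma mobius_1 : mobius 1 = 1.
Proof. by rewrite /mobius /=; ring. Qed.

Lemma mobius_abs n : Rabs (mobius n) <= 1.
Proof.
rewrite /mobius; case: (Nat.eqb n 0); first by rewrite Rabs_R0; lra.
case: (all _ _); last by rewrite Rabs_R0; lra.
by rewrite pow_1_abs; lra.
Qed.

Lemma primes_pmul p e : prime p -> (0 < e)%N -> ~~ (p %| e) -> perm_eq (primes (p * e)) (p :: primes e).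
Proof.
move=> pp e0 npe; have p0 := prime_gt0 pp.
apply: uniq_perm; first exact: primes_uniq.
  by rewrite /= primes_uniq andbT mem_primes pp e0 /= (negbTE npe).
move=> q; rewrite primesM // primes_prime // !inE; done.
Qed.

Lemma mobius_pmul p e : prime p -> (0 < e)%N -> ~~ (p %| e) -> mobius (p * e) = - mobius e.
Proof.
move=> pp e0 npe; have p0 := prime_gt0 pp.
rewrite /mobius.
have -> : Nat.eqb (p * e) 0 = false by apply/negbTE/negP => /PeanoNat.Nat.eqb_eq; move: p0 e0; clear; nia.
have -> : Nat.eqb e 0 = false by apply/negbTE/negP => /PeanoNat.Nat.eqb_eq; move: e0; clear; lia.
have Hp := primes_pmul p e pp e0 npe.
rewrite (perm_all _ Hp) (perm_size Hp) /=.
have -> : logn p (p * e) = 1%N by rewrite lognM // logn_prime // eqxx (lognE p e) (negbTE npe) andbF andbF.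
rewrite /=.
have -> : all (fun q => Nat.eqb (logn q (p * e)) 1) (primes e) = all (fun q => Nat.eqb (logn q e) 1) (primes e).
  apply: eq_in_all => q; rewrite mem_primes => /and3P [pq _ qe].
  rewrite lognM // logn_prime //.
  case: eqP => // E; by move: npe; rewrite -E qe.
by case: (all _ _); ring.
Qed.

Lemma mobius_psq p e : prime p -> (0 < e)%N -> p %| e -> mobius (p * e) = 0.
Proof.
move=> pp e0 pe; have p0 := prime_gt0 pp.
rewrite /mobius.
case: (Nat.eqb _ _) => //.
case: allP => // H; exfalso.
have Hin : p \in primes (p * e) by rewrite mem_primes pp muln_gt0 p0 e0 dvdn_mulr.
move: (H p Hin) => /PeanoNat.Nat.eqb_eq.
rewrite lognM // logn_prime // eqxx.
have : (0 < logn p e)%N by rewrite logn_gt0 mem_primes pp e0 pe.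
by lia.
Qed.

Lemma Lam_1 : Lam 1 = 0.
Proof. by []. Qed.

Lemma Lam_p p : prime p -> Lam (p * 1) = ln (INR p).
Proof. by move=> pp; rewrite muln1 /Lam primes_prime. Qed.

Lemma Lam_pmul p e : prime p -> (1 < e)%N -> ~~ (p %| e) -> Lam (p * e) = 0.
Proof.
move=> pp e1 npe; rewrite /Lam.
have e0 : (0 < e)%N by lia.
have := perm_size (primes_pmul p e pp e0 npe) => /=.
have : (0 < size (primes e))%N.
  have : pdiv e \in primes e by rewrite mem_primes pdiv_prime // e0 pdiv_dvd.
  by case: (primes e).
case: (primes e) => //= a l _.
by case: (primes (p * e)) => //= b [].
Qed.

Lemma Lam_psq p e : prime p -> (0 < e)%N -> p %| e -> Lam (p * e) = Lam e.
Proof.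
move=> pp e0 pe; rewrite /Lam; have p0 := prime_gt0 pp.
suff -> : primes (p * e) = primes e by [].
apply: (irr_sorted_eq ltn_trans ltnn); [exact: sorted_primes| exact: sorted_primes|].
move=> q; rewrite primesM // primes_prime // !inE.
case: eqP => // ->; by rewrite mem_primes pp e0 pe.
Qed.

Lemma Lam_nonneg n : 0 <= Lam n.
Proof.
rewrite /Lam; case E: (primes n) => [|p [|q l]]; try lra.
have : p \in primes n by rewrite E inE.
rewrite mem_primes => /and3P [pp _ _].
apply: ln_ge_0; apply: (le_INR 1); have := prime_gt0 pp; lia.
Qed.

Lemma Lam_le n : (0 < n)%N -> Lam n <= ln (INR n).
Proof.
move=> n0; have H0 : 0 <= ln (INR n) by apply: ln_ge_0; apply: (le_INR 1); lia.
rewrite /Lam; case E: (primes n) => [|p [|q l]] //.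
have : p \in primes n by rewrite E inE.
rewrite mem_primes => /and3P [pp _ pn].
apply: ln_le_compat; first by apply: lt_0_INR; have := prime_gt0 pp; lia.
apply: le_INR; have := dvdn_leq n0 pn; lia.
Qed.

Definition sprime (p : nat) : Prop := is_true (prime p).

Lemma sprime_gt1 p : sprime p -> (1 < p)%coq_nat.
Proof. by move/prime_gt1; lia. Qed.

Lemma ex_sprime_factor n : (1 < n)%coq_nat -> exists p m, sprime p /\ n = Nat.mul p m /\ (0 < m)%coq_nat /\ (m < n)%coq_nat.
Proof.
move=> Hn; have n1 : (1 < n)%N by lia.
exists (pdiv n), (n %/ pdiv n); have pp := pdiv_prime n1; have pd := pdiv_dvd n.
have E := divnK pd.
have p1 := prime_gt1 pp.
split=> //; split; first by rewrite -{1}E; lia.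
by split; nia.
Qed.

Lemma sprime_dvd p a b : sprime p -> Nat.divide p (Nat.mul a b) -> Nat.divide p a \/ Nat.divide p b.
Proof.
move=> pp [c Hc].
have : p %| a * b by apply/dvdnP; exists c; lia.
rewrite Euclid_dvdM // => /orP [/dvdnP [k Hk]|/dvdnP [k Hk]]; [left|right]; exists k; lia.
Qed.

Lemma dvd_conv p e : Nat.divide p e <-> p %| e.
Proof. by split=> [[c Hc]|/dvdnP [k Hk]]; [apply/dvdnP; exists c; lia|exists k; lia]. Qed.

Lemma ndvd_conv p e : ~ Nat.divide p e <-> ~~ (p %| e).
Proof. by rewrite dvd_conv; split=> [/negP|/negP]. Qed.

Lemma mob_pmul p e : sprime p -> (0 < e)%coq_nat -> ~ Nat.divide p e -> mobius (Nat.mul p e) = - mobius e.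
Proof. by move=> pp e0 /ndvd_conv npe; apply: mobius_pmul => //; lia. Qed.
Lemma mob_psq p e : sprime p -> (0 < e)%coq_nat -> Nat.divide p e -> mobius (Nat.mul p e) = 0.
Proof. by move=> pp e0 /dvd_conv npe; apply: mobius_psq => //; lia. Qed.
Lemma lam_p p : sprime p -> Lam (Nat.mul p 1) = ln (INR p).
Proof. exact: Lam_p. Qed.
Lemma lam_pmul p e : sprime p -> (1 < e)%coq_nat -> ~ Nat.divide p e -> Lam (Nat.mul p e) = 0.
Proof. by move=> pp e0 /ndvd_conv npe; apply: Lam_pmul => //; lia. Qed.
Lemma lam_psq p e : sprime p -> (0 < e)%coq_nat -> Nat.divide p e -> Lam (Nat.mul p e) = Lam e.
Proof. by move=> pp e0 /dvd_conv npe; apply: Lam_psq => //; lia. Qed.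
Lemma lam_le n : (0 < n)%coq_nat -> Lam n <= ln (INR n).
Proof. by move=> n0; apply: Lam_le; lia. Qed.
End MobLam.

(** * Divisor sums of [mobius] and [Lam] *)

Fixpoint rsum (f : nat -> R) (N : nat) : R := match N with O => 0 | S n => rsum f n + f (S n) end.

Lemma rsum_ext f g N : (forall n, (1 <= n <= N)%nat -> f n = g n) -> rsum f N = rsum g N.
Proof. induction N; intros H; simpl; auto. rewrite IHN, H; auto; try lia. intros; apply H; lia. Qed.
Lemma rsum_plus f g N : rsum (fun n => f n + g n) N = rsum f N + rsum g N.
Proof. induction N; simpl; [ring|rewrite IHN; ring]. Qed.
Lemma rsum_zero f N : (forall n, (1 <= n <= N)%nat -> f n = 0) -> rsum f N = 0.
Proof. induction N; intros H; simpl; auto. rewrite IHN, H; try lia; try lra. intros; apply H; lia. Qed.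
Lemma rsum_ext_range f N M : (N <= M)%nat -> (forall n, (N < n <= M)%nat -> f n = 0) -> rsum f M = rsum f N.
Proof.
  induction 1; intros Hz; auto. simpl. rewrite IHle, Hz; try lia; try lra. intros; apply Hz; lia.
Qed.

Definition dv (d m : nat) : bool := Nat.eqb (m mod d) 0.
Lemma dv_spec d m : (0 < d)%nat -> dv d m = true <-> Nat.divide d m.
Proof. intros Hd. unfold dv. rewrite Nat.eqb_eq. apply Nat.Lcm0.mod_divide. Qed.
Lemma dv_false d m : (0 < d)%nat -> dv d m = false <-> ~ Nat.divide d m.
Proof. intros Hd. rewrite <- dv_spec by auto. destruct (dv d m); split; congruence. Qed.

(** The sum of [f] over the divisors of [m], that is the Dirichlet convolution of [f] with the
    constant 1. *)
Definition gsum (f : nat -> R) (m : nat) : R := rsum (fun d => if dv d m then f d else 0) m.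

Lemma rsum_mult (F : nat -> R) p M : (0 < p)%nat ->
  rsum (fun d => if dv p d then F d else 0) (p * M) = rsum (fun e => F (p * e)%nat) M.
Proof.
  intros Hp. induction M.
  - rewrite Nat.mul_0_r. reflexivity.
  - assert (Hj : forall j, (j < p)%nat -> rsum (fun d => if dv p d then F d else 0) (p * M + j) = rsum (fun d => if dv p d then F d else 0) (p * M)).
    { intros j Hj. apply rsum_ext_range; [lia|]. intros n Hn.
      destruct (dv p n) eqn:E; auto. apply dv_spec in E; auto. destruct E as [c Hc]. exfalso.
      destruct (Nat.le_gt_cases c M) as [L|L]; [pose proof (Nat.mul_le_mono_r _ _ p L)|pose proof (Nat.mul_le_mono_r (S M) c p L)]; lia. }
    assert (E0 : (p * S M = S (p * M + (p - 1)))%nat) by nia. rewrite E0.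
    change (rsum (fun d => if dv p d then F d else 0) (S (p * M + (p - 1))))
      with (rsum (fun d => if dv p d then F d else 0) (p * M + (p - 1)) + (if dv p (S (p * M + (p - 1))) then F (S (p * M + (p - 1))) else 0)).
    rewrite (Hj (p - 1)%nat), IHM, <- E0 by lia. simpl.
    destruct (dv p (p * S M)) eqn:E; auto. apply dv_false in E; auto. exfalso; apply E. exists (S M); lia.
Qed.

(** A divisor of [p m] that is not a multiple of [p] divides [m]; every other one is [p] times a
    divisor of [m]. *)
Lemma gsum_split (f : nat -> R) p m : MobLam.sprime p -> (0 < m)%nat ->
  gsum f (p * m) = rsum (fun d => if dv d m then (if dv p d then 0 else f d) else 0) m
                 + rsum (fun e => if dv e m then f (p * e)%nat else 0) m.
Proof.
  intros Hp Hm. pose proof (MobLam.sprime_gt1 p Hp) as Hp1.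
  unfold gsum.
  rewrite (rsum_ext _ (fun d => (if dv d (p * m) then (if dv p d then 0 else f d) else 0) + (if dv p d then (if dv d (p * m) then f d else 0) else 0))).
  2:{ intros n Hn. destruct (dv n (p * m)), (dv p n); ring. }
  rewrite rsum_plus. f_equal.
  - rewrite (rsum_ext _ (fun d => if dv d m then (if dv p d then 0 else f d) else 0)).
    + apply rsum_ext_range; [nia|]. intros n Hn. destruct (dv n m) eqn:E; auto.
      apply dv_spec in E; [|lia]. apply Nat.divide_pos_le in E; lia.
    + intros n Hn. destruct (dv p n) eqn:E; [destruct (dv n (p * m)), (dv n m); auto|].
      destruct (dv n m) eqn:E1.
      * apply dv_spec in E1; [|lia]. replace (dv n (p * m)) with true; auto. symmetry. apply dv_spec; [lia|].
        apply Nat.divide_mul_r; auto.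
      * replace (dv n (p * m)) with false; auto. symmetry. apply dv_false; [lia|]. intros [c Hc].
        apply dv_false in E; [|lia]. apply dv_false in E1; [|lia].
        destruct (MobLam.sprime_dvd p c n Hp) as [[c' Hc']|H]; auto.
        { exists m. lia. }
        apply E1. exists c'. subst c. assert (p * m = p * (c' * n))%nat by lia. nia.
  - rewrite rsum_mult by lia. apply rsum_ext. intros n Hn.
    destruct (dv n m) eqn:E1.
    + apply dv_spec in E1; [|lia]. destruct E1 as [c Hc]. replace (dv (p * n) (p * m)) with true; auto. symmetry. apply dv_spec; [nia|]. exists c. nia.
    + apply dv_false in E1; [|lia]. replace (dv (p * n) (p * m)) with false; auto. symmetry. apply dv_false; [nia|].
      intros [c Hc]. apply E1. exists c. nia.
Qed.

(** After a prime [p] is split off, the terms at [n] and [p n] cancel if [p] does not divide [n]; if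
    it does, [n] is left out of the first sum and [mobius (p n) = 0]. *)
Lemma gsum_mobius m : (0 < m)%nat -> gsum mobius m = if Nat.eqb m 1 then 1 else 0.
Proof.
  intros Hm. destruct (Nat.eqb m 1) eqn:E.
  - apply Nat.eqb_eq in E; subst m. unfold gsum; simpl. rewrite MobLam.mobius_1. lra.
  - apply Nat.eqb_neq in E. destruct (MobLam.ex_sprime_factor m) as (p & e & Hp & -> & He & _); [lia|].
    pose proof (MobLam.sprime_gt1 p Hp).
    rewrite gsum_split by auto. rewrite <- rsum_plus. apply rsum_zero. intros n Hn.
    destruct (dv n e); [|ring]. destruct (dv p n) eqn:E2.
    + apply dv_spec in E2; [|lia]. rewrite MobLam.mob_psq by (auto; lia). ring.
    + apply dv_false in E2; [|lia]. rewrite MobLam.mob_pmul by (auto; lia). ring.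
Qed.

(** Splitting a prime [p] off [p e] adds exactly [ln p], contributed by [n = 1]. For [n > 1] the
    terms at [n] and [p n] together always give [Lam n]. *)
Lemma gsum_Lam m : (0 < m)%nat -> gsum Lam m = ln (INR m).
Proof.
  induction m as [m IH] using (well_founded_induction Wf_nat.lt_wf). intros Hm.
  destruct (Nat.eq_dec m 1) as [->|E].
  { unfold gsum; simpl. rewrite MobLam.Lam_1, ln_1. lra. }
  destruct (MobLam.ex_sprime_factor m) as (p & e & Hp & -> & He & Hlt); [lia|].
  pose proof (MobLam.sprime_gt1 p Hp).
  rewrite gsum_split by auto. rewrite mult_INR, ln_mult by (apply lt_0_INR; lia).
  rewrite <- (IH e Hlt He). unfold gsum.
  rewrite <- rsum_plus.
  rewrite (rsum_ext _ (fun n => (if Nat.eqb n 1 then ln (INR p) else 0) + (if dv n e then Lam n else 0))).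
  - rewrite rsum_plus. f_equal.
    rewrite (rsum_ext_range _ 1 e); [|lia|].
    + simpl. lra.
    + intros n Hn. replace (Nat.eqb n 1) with false; auto. symmetry; apply Nat.eqb_neq; lia.
  - intros n Hn. destruct (Nat.eqb n 1) eqn:E1.
    + apply Nat.eqb_eq in E1; subst n. replace (dv 1 e) with true by (symmetry; apply dv_spec; [lia|apply Nat.divide_1_l]).
      rewrite MobLam.lam_p by auto. replace (dv p 1) with false; [rewrite MobLam.Lam_1; ring|].
      symmetry; apply dv_false; [lia|]. intros H1. apply Nat.divide_1_r in H1. lia.
    + apply Nat.eqb_neq in E1. destruct (dv n e); [|ring]. destruct (dv p n) eqn:E2.
      * apply dv_spec in E2; [|lia]. rewrite MobLam.lam_psq by (auto; lia). ring.
      * apply dv_false in E2; [|lia]. rewrite MobLam.lam_pmul by (auto; lia). ring.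
Qed.

(** * Multiplication of Dirichlet series by [zeta] *)

Fixpoint csum (f : nat -> C) (N : nat) : C := match N with O => RtoC 0 | S n => (csum f n + f (S n))%C end.

Lemma csum_S f N : csum f (S N) = (csum f N + f (S N))%C.
Proof. reflexivity. Qed.

Lemma csum_ext f g N : (forall n, (1 <= n <= N)%nat -> f n = g n) -> csum f N = csum g N.
Proof. induction N; intros H; simpl; auto. rewrite IHN, H; auto; try lia. intros; apply H; lia. Qed.
Lemma csum_plus f g N : csum (fun n => f n + g n)%C N = (csum f N + csum g N)%C.
Proof. induction N; simpl; [ring|rewrite IHN; ring]. Qed.
Lemma csum_scal c f N : csum (fun n => c * f n)%C N = (c * csum f N)%C.
Proof. induction N; simpl; [ring|rewrite IHN; ring]. Qed.
Lemma csum_bound f g N : (forall n, (1 <= n <= N)%nat -> Cmod (f n) <= g n) -> Cmod (csum f N) <= rsum g N.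
Proof. induction N; intros H; simpl; [rewrite Cmod_0; lra|].
  eapply Rle_trans; [apply Cmod_triangle|]. apply Rplus_le_compat; [apply IHN; intros; apply H; lia|apply H; lia]. Qed.
Lemma csum_RtoC (f : nat -> R) c N : csum (fun n => RtoC (f n) * c)%C N = (RtoC (rsum f N) * c)%C.
Proof. induction N; simpl; [ring|rewrite IHN, RtoC_plus; ring]. Qed.

Lemma csum_sum_n f N : fst (csum f (S N)) = sum_n (fun k => fst (f (S k))) N /\ snd (csum f (S N)) = sum_n (fun k => snd (f (S k))) N.
Proof.
  induction N.
  - rewrite !sum_O. simpl. split; ring.
  - rewrite !sum_nS. destruct IHN as [I1 I2]. rewrite <- I1, <- I2. split; reflexivity.
Qed.

Lemma csum_tail (f : nat -> C) (g : nat -> R) N : (forall k, Cmod (f (S k)) <= g k) -> ex_series g ->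
  Cmod (CSeries (fun k => f (S k)) - csum f N) <= Series (fun k => g (N + k)%nat).
Proof.
  intros Hfg Hg. assert (Ha : absconv (fun k => f (S k))) by (eapply absconv_le; eauto).
  replace (CSeries (fun k => f (S k)) - csum f N)%C with (CSeries (fun k => f (S (N + k)))).
  - apply CSeries_bound; [intros; apply Hfg|]. apply (ex_series_incr_n (V := R_NormedModule) g N); auto.
  - destruct N as [|N].
    { simpl csum. simpl. ring. }
    destruct (csum_sum_n f N) as [E1 E2].
    unfold CSeries. apply injective_projections; simpl fst; simpl snd.
    + rewrite (Series_incr_n (fun k => fst (f (S k))) (S N)); [|lia|apply absconv_fst; auto].
      simpl in E1. simpl pred. rewrite <- sum_n_Reals, <- E1. simpl. ring.
    + rewrite (Series_incr_n (fun k => snd (f (S k))) (S N)); [|lia|apply absconv_snd; auto].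
      simpl in E2. simpl pred. rewrite <- sum_n_Reals, <- E2. simpl. ring.
Qed.

Lemma div_step n N : (0 < n)%nat -> (S N / n = N / n + (if dv n (S N) then 1 else 0))%nat.
Proof.
  intros Hn. pose proof (Nat.div_mod N n ltac:(lia)) as E. pose proof (Nat.mod_upper_bound N n ltac:(lia)) as U.
  set (q := (N / n)%nat) in *. set (r := (N mod n)%nat) in *.
  destruct (dv n (S N)) eqn:D.
  - apply dv_spec in D; auto. destruct D as [c Hc].
    assert (c = q + 1)%nat by nia. subst c. symmetry. apply (Nat.div_unique _ _ _ 0); lia.
  - apply dv_false in D; auto. symmetry. apply (Nat.div_unique _ _ _ (r + 1)); [|lia].
    assert (r + 1 <> n)%nat; [|lia]. intros E2. apply D. exists (q + 1)%nat. nia.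
Qed.

Definition zterm (s : C) (n : nat) : C := kpow (- s) (INR n).

(** Both sides sum [f(d) (d k)^(-s)] over the pairs with [d k <= N]. Passing from [N] to [N + 1]
    adds the pairs with [d k = N + 1], which [div_step] detects. *)
Lemma hyperbola (f : nat -> R) (s : C) N :
  csum (fun n => RtoC (f n) * zterm s n * csum (zterm s) (N / n))%C N = csum (fun m => RtoC (gsum f m) * zterm s m)%C N.
Proof.
  induction N; [reflexivity|].
  rewrite csum_S, (csum_S (fun m => RtoC (gsum f m) * zterm s m)%C), <- IHN.
  rewrite (csum_ext (fun n => (RtoC (f n) * zterm s n * csum (zterm s) (S N / n))%C)
    (fun n => (RtoC (f n) * zterm s n * csum (zterm s) (N / n)) + RtoC (if dv n (S N) then f n else 0) * zterm s (S N))%C).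
  - rewrite csum_plus, csum_RtoC. unfold gsum. simpl rsum.
    rewrite Nat.div_same by lia. replace (dv (S N) (S N)) with true by (symmetry; apply dv_spec; [lia|apply Nat.divide_refl]).
    simpl (csum (zterm s) 1). replace (zterm s 1) with (RtoC 1) by (unfold zterm; simpl INR; rewrite kpow_1; auto).
    rewrite RtoC_plus. ring.
  - intros n Hn. rewrite div_step by lia. destruct (dv n (S N)) eqn:D.
    + rewrite Nat.add_1_r, csum_S, Cmult_plus_distr_l. f_equal.
      apply dv_spec in D; [|lia]. destruct D as [c Hc].
      assert (E : (S (N / n) = c)%nat).
      { rewrite <- Nat.add_1_r. replace 1%nat with (if dv n (S N) then 1 else 0)%nat.
        - rewrite <- div_step by lia. rewrite Hc. apply Nat.div_mul; lia.
        - replace (dv n (S N)) with true; auto. symmetry; apply dv_spec; [lia|exists c; auto]. }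
      rewrite E, <- Cmult_assoc. f_equal. unfold zterm. rewrite <- kpow_mult_base.
      * rewrite <- mult_INR. f_equal. f_equal. lia.
      * apply lt_0_INR; lia.
      * apply lt_0_INR. destruct c; lia.
    + rewrite Nat.add_0_r. ring.
Qed.

Lemma ztail (p : R) N : 0 < p -> (1 <= N)%nat ->
  ex_series (fun k => rpow (INR (S (N + k))) (- (1 + p))) /\
  Series (fun k => rpow (INR (S (N + k))) (- (1 + p))) <= rpow (INR N) (- p) / p.
Proof.
  intros Hp HN. assert (HI : 0 < / p) by (apply Rinv_0_lt_compat; auto).
  apply ex_series_pos_bounded; [intros; left; apply rpow_pos|].
  assert (Hst : forall n, (1 <= n)%nat -> rpow (INR (S n)) (- (1 + p)) <= (rpow (INR n) (- p) - rpow (INR (S n)) (- p)) / p).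
  { intros n Hn. pose proof (rpow_step p (INR n) Hp ltac:(apply lt_0_INR; lia)) as Hs. rewrite <- S_INR in Hs.
    apply Rmult_le_reg_l with p; auto.
    replace (p * ((rpow (INR n) (- p) - rpow (INR (S n)) (- p)) / p)) with (rpow (INR n) (- p) - rpow (INR (S n)) (- p)) by (field; lra). exact Hs. }
  assert (H : forall n, sum_n (fun k => rpow (INR (S (N + k))) (- (1 + p))) n <= rpow (INR N) (- p) / p - rpow (INR (S (N + n))) (- p) / p).
  { induction n.
    - rewrite sum_O, Nat.add_0_r. specialize (Hst N HN). unfold Rdiv in *. lra.
    - rewrite sum_nS. cbv beta. replace (N + S n)%nat with (S (N + n)) by lia.
      specialize (Hst (S (N + n)) ltac:(lia)). unfold Rdiv in *. lra. }
  intros n. eapply Rle_trans; [apply H|]. pose proof (rpow_pos (INR (S (N + n))) (- p)). unfold Rdiv. nra.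
Qed.

Lemma DS_tail f D e s N : dgrow f D e -> 1 + e < fst s -> (1 <= N)%nat ->
  Cmod (DS f s - csum (fun n => RtoC (f n) * zterm s n)%C N) <= D * (rpow (INR N) (- (fst s - 1 - e)) / (fst s - 1 - e)).
Proof.
  intros Hf He HN. unfold DS.
  eapply Rle_trans; [apply (csum_tail (fun n => RtoC (f n) * zterm s n)%C (fun k => D * rpow (INR (S k)) (- (1 + (fst s - 1 - e)))))|].
  - intros k. apply DS_term_bound; auto.
  - apply ex_series_Rscal. apply zsum_ex; lra.
  - rewrite Series_scal_l. apply Rmult_le_compat_l; [apply Hf|]. apply ztail; auto; lra.
Qed.

Lemma rsum_scal c f N : rsum (fun n => c * f n) N = c * rsum f N.
Proof. induction N; simpl; [ring|rewrite IHN; ring]. Qed.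
Lemma rsum_sum_n f N : rsum f (S N) = sum_n (fun k => f (S k)) N.
Proof. induction N; [rewrite sum_O; simpl; ring|rewrite sum_nS, <- IHN; reflexivity]. Qed.

Lemma rsum_zeta p N : 0 < p -> rsum (fun n => rpow (INR n) (- (1 + p))) N <= 1 + / p.
Proof.
  intros Hp. assert (HI : 0 < / p) by (apply Rinv_0_lt_compat; auto). destruct N; [simpl; lra|].
  rewrite rsum_sum_n. eapply Rle_trans; [apply zsum_bound; auto|].
  pose proof (rpow_pos (INR (S N)) (- p)). unfold Rdiv. nra.
Qed.

(** A quotient that is at least 1 is at most twice its integer part. *)
Lemma INR_div_lower n N : (1 <= n <= N)%nat -> INR N / (2 * INR n) <= INR (N / n).
Proof.
  intros [Hn HN]. assert (0 < INR n) by (apply lt_0_INR; lia).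
  pose proof (Nat.div_mod N n ltac:(lia)) as E. pose proof (Nat.mod_upper_bound N n ltac:(lia)) as U.
  pose proof (Nat.div_str_pos N n ltac:(lia)) as P.
  assert (L : (N <= 2 * n * (N / n))%nat) by nia.
  apply le_INR in L. rewrite !mult_INR in L. simpl (INR 2) in L.
  apply Rmult_le_reg_r with (2 * INR n); [lra|]. unfold Rdiv. rewrite Rmult_assoc, Rinv_l by lra. lra.
Qed.

Lemma lim0_bound c (v : nat -> R) : (forall n, (1 <= n)%nat -> c <= v n) -> is_lim_seq v 0 -> c <= 0.
Proof.
  intros H Hv. apply (is_lim_seq_incr_1 v) in Hv.
  apply (is_lim_seq_le (fun _ => c) (fun n => v (S n)) c 0); auto; [|apply is_lim_seq_const].
  intros; apply H; lia.
Qed.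

Lemma rpow_lim' a p : 0 < p -> is_lim_seq (fun n => a * rpow (INR n) (- p)) 0.
Proof.
  intros Hp. replace (Finite 0) with (Rbar_mult a 0) by (simpl; f_equal; ring).
  apply is_lim_seq_scal_l. apply is_lim_seq_incr_1. apply rpow_lim; auto.
Qed.

(* Expanding the truncated product by the hyperbola identity, the error is a tail of the zeta sum over [m > N/n]. *)
Lemma dirichlet_conv f D e D' e' s : 0 <= e -> dgrow f D e -> 1 + e < fst s -> dgrow (gsum f) D' e' -> 1 + e' < fst s ->
  (zeta s * DS f s)%C = DS (gsum f) s.
Proof.
  intros He0 Hf He Hg He'. set (p := fst s - 1). assert (Hp : 0 < p) by (unfold p; lra).
  (* Half of [p - e] pays for summability in [n], half for decay in [N]:
     [n^(e-1) N^(-p) <= n^(-1-kap) N^(-kap)] for [n <= N], since [e + kap >= 0]. *)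
  set (kap := (p - e) / 2). assert (Hk : 0 < kap) by (unfold kap, p; lra).
  pose proof (proj1 Hf) as HD.
  assert (Hmain : forall N, (1 <= N)%nat ->
     Cmod (zeta s * csum (fun n => RtoC (f n) * zterm s n) N - csum (fun m => RtoC (gsum f m) * zterm s m) N)%C
     <= (D * (rpow 2 p / p) * (1 + / kap)) * rpow (INR N) (- kap)).
  { intros N HN. rewrite <- hyperbola, <- csum_scal.
    replace (csum (fun n => zeta s * (RtoC (f n) * zterm s n)) N - csum (fun n => RtoC (f n) * zterm s n * csum (zterm s) (N / n)) N)%C
      with (csum (fun n => RtoC (f n) * zterm s n * (zeta s - csum (zterm s) (N / n))) N)%C.
    2:{ rewrite (csum_ext _ (fun n => zeta s * (RtoC (f n) * zterm s n) + RtoC (-1) * (RtoC (f n) * zterm s n * csum (zterm s) (N / n)))%C).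
        - rewrite csum_plus, (csum_scal (RtoC (-1))). replace (RtoC (-1)) with (- (1))%C by ceq. ring.
        - intros. replace (RtoC (-1)) with (- (1))%C by ceq. ring. }
    eapply Rle_trans; [apply (csum_bound _ (fun n => (D * (rpow 2 p / p)) * rpow (INR N) (- kap) * rpow (INR n) (- (1 + kap))))|].
    - intros n Hn. assert (Hn0 : 0 < INR n) by (apply lt_0_INR; lia). assert (HN0 : 0 < INR N) by (apply lt_0_INR; lia).
      rewrite !Cmod_mult, Cmod_R. unfold zterm at 1. rewrite kpow_mod.
      pose proof (proj2 Hf n ltac:(lia)) as Hfn.
      assert (HK : (1 <= N / n)%nat) by (apply Nat.div_le_lower_bound; lia).
      pose proof (DS_tail cst1 1 0 s (N / n) cst1_grow ltac:(lra) HK) as Ht.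
      rewrite <- zeta_DS in Ht by lra. rewrite Rmult_1_l in Ht.
      replace (csum (fun n0 => RtoC (cst1 n0) * zterm s n0)%C (N / n)) with (csum (zterm s) (N / n)) in Ht.
      2:{ apply csum_ext. intros; unfold cst1; ring. }
      replace (fst s - 1 - 0) with p in Ht by (unfold p; ring).
      pose proof (INR_div_lower n N Hn) as HL.
      assert (HQ : 0 < INR N / (2 * INR n)) by (apply Rdiv_lt_0_compat; lra).
      assert (Ht2 : Cmod (zeta s - csum (zterm s) (N / n)) <= rpow 2 p / p * (rpow (INR n) p * rpow (INR N) (- p))).
      { eapply Rle_trans; [exact Ht|].
        pose proof (rpow_le_base_neg _ _ (- p) HQ HL ltac:(lra)) as H1.
        replace (rpow (INR N / (2 * INR n)) (- p)) with (rpow 2 p * (rpow (INR n) p * rpow (INR N) (- p))) in H1.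
        - unfold Rdiv. rewrite (Rmult_comm (rpow 2 p)), Rmult_assoc, Rmult_comm. apply Rmult_le_compat_l; [left; apply Rinv_0_lt_compat; auto|auto].
        - unfold Rdiv. rewrite rpow_mult_base by (auto; apply Rinv_0_lt_compat; lra).
          replace (rpow (/ (2 * INR n)) (- p)) with (rpow (2 * INR n) p).
          + rewrite rpow_mult_base by lra. ring.
          + unfold rpow. rewrite ln_Rinv by lra. f_equal. ring. }
      pose proof (Rabs_pos (f n)). pose proof (rpow_pos (INR n) (fst (- s)%C)). pose proof (rpow_pos 2 p).
      assert (0 < rpow 2 p / p) by (apply Rdiv_lt_0_compat; auto).
      apply Rle_trans with ((D * rpow (INR n) e * rpow (INR n) (fst (- s)%C)) * (rpow 2 p / p * (rpow (INR n) p * rpow (INR N) (- p)))).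
      { apply Rmult_le_compat; auto; [nra|apply Cmod_ge_0|]. apply Rmult_le_compat_r; lra. }
      replace (D * rpow (INR n) e * rpow (INR n) (fst (- s)%C) * (rpow 2 p / p * (rpow (INR n) p * rpow (INR N) (- p))))
        with (D * (rpow 2 p / p) * ((rpow (INR n) e * rpow (INR n) (fst (- s)%C) * rpow (INR n) p) * rpow (INR N) (- p))) by ring.
      rewrite !Rmult_assoc. apply Rmult_le_compat_l; auto. apply Rmult_le_compat_l; [lra|].
      rewrite <- Rmult_assoc, <- rpow_plus, <- Rmult_assoc, <- rpow_plus.
      assert (A1 : rpow (INR n) (e + fst (- s)%C + p) = rpow (INR n) (- (1 + kap)) * rpow (INR n) (e + kap)).
      { rewrite <- rpow_plus. f_equal. unfold p; simpl; ring. }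
      assert (A2 : rpow (INR N) (- kap) = rpow (INR N) (e + kap) * rpow (INR N) (- p)).
      { rewrite <- rpow_plus. f_equal. unfold kap; field. }
      rewrite A1, A2. pose proof (rpow_pos (INR n) (- (1 + kap))). pose proof (rpow_pos (INR N) (- p)).
      assert (rpow (INR n) (e + kap) <= rpow (INR N) (e + kap)). { apply rpow_le_base; [auto|apply le_INR; lia|lra]. }
      set (X1 := rpow (INR n) (- (1 + kap))) in *. set (X2 := rpow (INR N) (- p)) in *.
      set (Y1 := rpow (INR n) (e + kap)) in *. set (Y2 := rpow (INR N) (e + kap)) in *.
      replace (X1 * Y1 * X2) with (X1 * X2 * Y1) by ring. replace (Y2 * X2 * X1) with (X1 * X2 * Y2) by ring.
      apply Rmult_le_compat_l; auto. apply Rmult_le_pos; lra.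
    - rewrite (rsum_scal (D * (rpow 2 p / p) * rpow (INR N) (- kap)) (fun n => rpow (INR n) (- (1 + kap)))).
      pose proof (rsum_zeta kap N Hk). pose proof (rpow_pos (INR N) (- kap)). pose proof (rpow_pos 2 p).
      assert (0 < rpow 2 p / p) by (apply Rdiv_lt_0_compat; auto).
      assert (0 <= D * (rpow 2 p / p) * rpow (INR N) (- kap)) by (apply Rmult_le_pos; [apply Rmult_le_pos; lra|lra]).
      replace (D * (rpow 2 p / p) * (1 + / kap) * rpow (INR N) (- kap)) with (D * (rpow 2 p / p) * rpow (INR N) (- kap) * (1 + / kap)) by ring.
      apply Rmult_le_compat_l; auto. }
  assert (HX : Cmod (zeta s * DS f s - DS (gsum f) s) <= 0).
  { apply (lim0_bound _ (fun N => (Cmod (zeta s) * (D / (fst s - 1 - e))) * rpow (INR N) (- (fst s - 1 - e))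
       + (D * (rpow 2 p / p) * (1 + / kap)) * rpow (INR N) (- kap) + (D' / (fst s - 1 - e')) * rpow (INR N) (- (fst s - 1 - e')))).
    - intros N HN.
      pose proof (DS_tail f D e s N Hf He HN) as T1. pose proof (DS_tail _ D' e' s N Hg He' HN) as T2. specialize (Hmain N HN).
      set (cf := csum (fun n => RtoC (f n) * zterm s n)%C N) in *. set (cg := csum (fun m => RtoC (gsum f m) * zterm s m)%C N) in *.
      replace (zeta s * DS f s - DS (gsum f) s)%C with (zeta s * (DS f s - cf) + (zeta s * cf - cg) + (cg - DS (gsum f) s))%C by ring.
      eapply Rle_trans; [apply Cmod_triangle|]. eapply Rle_trans; [apply Rplus_le_compat_r, Cmod_triangle|].
      rewrite Cmod_mult, (Cmod_sub_sym cg). pose proof (Cmod_ge_0 (zeta s)).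
      apply Rplus_le_compat; [apply Rplus_le_compat; auto|].
      + eapply Rle_trans; [apply Rmult_le_compat_l; [auto|exact T1]|]. right. unfold Rdiv. ring.
      + eapply Rle_trans; [exact T2|]. right. unfold Rdiv. ring.
    - replace (Finite 0) with (Finite (0 + 0 + 0)) by (f_equal; ring).
      apply is_lim_seq_plus'; [apply is_lim_seq_plus'|]; apply rpow_lim'; lra. }
  pose proof (Cmod_ge_0 (zeta s * DS f s - DS (gsum f) s)).
  assert (E : (zeta s * DS f s - DS (gsum f) s)%C = 0) by (apply Cmod_eq_0; lra).
  replace (DS (gsum f) s) with (DS (gsum f) s + (zeta s * DS f s - DS (gsum f) s))%C by (rewrite E; ring). ring.
Qed.

Lemma mobius_grow : dgrow mobius 1 0.
Proof. split; [lra|]. intros n Hn. unfold rpow. rewrite Rmult_0_l, exp_0. pose proof (MobLam.mobius_abs n). lra. Qed.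

Lemma DS_ext f g s : (forall n, (1 <= n)%nat -> f n = g n) -> DS f s = DS g s.
Proof. intros H. unfold DS. apply CSeries_ext. intros k. rewrite H by lia. auto. Qed.

Definition dirac (n : nat) : R := if Nat.eqb n 1 then 1 else 0.

Lemma CSeries_single (f : nat -> C) : (forall k, (1 <= k)%nat -> f k = 0) -> CSeries f = f 0%nat.
Proof.
  intros H. unfold CSeries. apply injective_projections; simpl; apply is_series_unique.
  - assert (X : is_lim_seq (sum_n (fun k => fst (f k))) (fst (f 0%nat))); [|exact X].
    apply (is_lim_seq_ext (fun _ => fst (f 0%nat))); [|apply is_lim_seq_const].
    induction n; [rewrite sum_O; auto|rewrite sum_nS, <- IHn, (H (S n)) by lia; simpl; ring].
  - assert (X : is_lim_seq (sum_n (fun k => snd (f k))) (snd (f 0%nat))); [|exact X].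
    apply (is_lim_seq_ext (fun _ => snd (f 0%nat))); [|apply is_lim_seq_const].
    induction n; [rewrite sum_O; auto|rewrite sum_nS, <- IHn, (H (S n)) by lia; simpl; ring].
Qed.

Lemma zeta_mu s : 1 < fst s -> (zeta s * DS mobius s)%C = 1.
Proof.
  intros Hs. rewrite (dirichlet_conv mobius 1 0 1 0); auto; try lra.
  - rewrite (DS_ext _ dirac). 2:{ intros n Hn. apply gsum_mobius; lia. }
    unfold DS. rewrite CSeries_single.
    + unfold dirac. simpl Nat.eqb. simpl INR. rewrite kpow_1. ring.
    + intros k Hk. unfold dirac. destruct k; [lia|]. change (Nat.eqb (S (S k)) 1) with false. cbv iota. ring.
  - apply mobius_grow.
  - split; [lra|]. intros n Hn. rewrite gsum_mobius by lia. unfold rpow. rewrite Rmult_0_l, exp_0.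
    destruct (Nat.eqb n 1); rewrite ?Rabs_R1, ?Rabs_R0; lra.
Qed.

Lemma zeta_neq_0_right s : 1 < fst s -> zeta s <> 0.
Proof. intros Hs E. pose proof (zeta_mu s Hs) as H. rewrite E, Cmult_0_l in H. apply RtoC_inj in H. lra. Qed.

Lemma Lam_grow d : 0 < d -> dgrow Lam (1 / d) (0 + d).
Proof.
  intros Hd. split; [apply Rlt_le, Rdiv_lt_0_compat; lra|]. intros n Hn.
  pose proof (MobLam.Lam_nonneg n). pose proof (MobLam.lam_le n ltac:(lia)).
  assert (1 <= INR n) by (apply (le_INR 1); auto).
  rewrite Rabs_pos_eq by auto. pose proof (ln_le_rpow (INR n) d ltac:(lra) Hd).
  unfold Rdiv. rewrite Rmult_1_l, Rplus_0_l. lra.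
Qed.

(** The left side is the derivative of zeta, so this is the formula for - zeta'/zeta as the
    Dirichlet series of [Lam]; it rests on [gsum_Lam]. *)
Lemma zeta_Lam s : 1 < fst s -> DS (lnf cst1) s = (- (zeta s * DS Lam s))%C.
Proof.
  intros Hs. set (d := (fst s - 1) / 2). assert (Hd : 0 < d) by (unfold d; lra).
  assert (Hg : dgrow (gsum Lam) (1 / d) (0 + d)).
  { split; [apply Rlt_le, Rdiv_lt_0_compat; lra|]. intros n Hn. rewrite gsum_Lam by lia.
    assert (1 <= INR n) by (apply (le_INR 1); auto). rewrite Rabs_pos_eq by (apply ln_ge_0; auto).
    pose proof (ln_le_rpow (INR n) d ltac:(lra) Hd). unfold Rdiv. rewrite Rmult_1_l, Rplus_0_l. lra. }
  rewrite (dirichlet_conv Lam (1 / d) (0 + d) (1 / d) (0 + d)); auto; try (unfold d; lra).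
  - replace (- DS (gsum Lam) s)%C with (RtoC (-1) * DS (gsum Lam) s)%C by (replace (RtoC (-1)) with (- (1))%C by ceq; ring).
    unfold DS. rewrite <- CSeries_scal.
    2:{ apply (DS_absconv _ _ _ s Hg). unfold d; lra. }
    apply CSeries_ext. intros k. rewrite gsum_Lam by lia. unfold lnf, cst1. rewrite !RtoC_mult, RtoC_opp.
    replace (RtoC (-1)) with (- (1))%C by ceq. ring.
  - apply Lam_grow; auto.
Qed.

(** Logarithmic derivative of (1 - 1/s) zeta(s), the first factor contributing 1/(s (s-1)).
    Uniqueness of expansions identifies [dzreg] with the derivative of this product. *)
Lemma zreg_ratio s : 1 < fst s -> zreg s <> 0 /\ (dzreg s / zreg s)%C = (/ (s * (s - 1)) - DS Lam s)%C.
Proof.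
  intros Hs. assert (H1 : s <> RtoC 1) by (intros ->; simpl in Hs; lra).
  pose proof (C1_neq s H1) as Hs1. pose proof (Cneq_fst s ltac:(lra)) as Hs0.
  pose proof (zeta_neq_0_right s Hs) as Hz.
  assert (EZ : zreg s = ((s - 1) / s * zeta s)%C). { rewrite zreg_zeta by (auto; lra). field. auto. }
  assert (HZ : zreg s <> 0). { rewrite EZ. apply Cmult_neq_0; auto. apply Cmult_neq_0; auto. intros E.
    apply Hs0. assert (E2 : (s * / s = 1)%C) by (field; auto). rewrite E, Cmult_0_r in E2. apply RtoC_inj in E2. lra. }
  split; auto.
  destruct (zreg_jet s ltac:(lra)) as [b Hb].
  destruct (DS_jet cst1 1 0 s cst1_grow ltac:(lra)) as [b' Hb'].
  pose proof (jet_mult (fun w => 1 + - (1) * / w)%C (DS cst1) s _ _ _ _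
     (jet_plus _ _ _ _ _ _ _ (jet_const 1 s) (jet_mult _ _ _ _ _ _ _ (jet_const (- (1)) s) (jet_inv s Hs0))) Hb') as HJ.
  assert (Hloc : forall h, Cmod h < fst s - 1 -> ((fun w => (1 + - (1) * / w) * DS cst1 w) (s + h) = zreg (s + h))%C).
  { intros h Hh. assert (H : 1 < fst (s + h)%C).
    { pose proof (Cmod_fst h) as Q. pose proof (Rle_abs (- fst h)) as Q2. rewrite Rabs_Ropp in Q2. simpl. lra. }
    rewrite zreg_zeta; [rewrite zeta_DS by auto; ring|lra|intros EE; rewrite EE in H; simpl in H; lra]. }
  pose proof (jet_ext_loc _ zreg s _ _ (fst s - 1) ltac:(lra) Hloc HJ) as HJ2.
  pose proof (jet_unique _ _ _ _ _ _ Hb HJ2) as EU.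
  assert (EU2 : dzreg s = (zeta s * (/ s * / s) + (1 - / s) * - (zeta s * DS Lam s))%C).
  { rewrite EU, <- zeta_DS, zeta_Lam by auto. ring. }
  rewrite EU2, EZ. field. auto.
Qed.

(** * Non-vanishing for [Re s > 1/2] and the logarithm *)

Lemma is_derive_quad (g : R -> R) (x l K d : R) : 0 < d -> 0 <= K ->
  (forall h, Rabs h < d -> Rabs (g (x + h) - (g x + l * h)) <= K * h ^ 2) -> is_derive g x l.
Proof.
  intros Hd HK H. apply is_derive_Reals. intros e He.
  set (dd := Rmin d (e / (K + 1))).
  assert (He2 : 0 < e / (K + 1)) by (apply Rdiv_lt_0_compat; lra).
  assert (Hdd : 0 < dd) by (apply Rmin_glb_lt; auto).
  exists (mkposreal dd Hdd). simpl. intros h Hh0 Hh. pose proof (Rmin_l d (e / (K + 1))); pose proof (Rmin_r d (e / (K + 1))).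
  specialize (H h ltac:(unfold dd in *; lra)).
  assert (Hp : 0 < Rabs h) by (apply Rabs_pos_lt; auto).
  replace ((g (x + h) - g x) / h - l) with ((g (x + h) - (g x + l * h)) / h) by (field; auto).
  unfold Rdiv. rewrite Rabs_mult, Rabs_inv.
  apply Rmult_lt_reg_r with (Rabs h); auto. rewrite Rmult_assoc, Rinv_l, Rmult_1_r by lra.
  eapply Rle_lt_trans; [exact H|]. rewrite <- pow2_abs. simpl. rewrite Rmult_1_r, <- Rmult_assoc.
  apply Rmult_lt_compat_r; auto.
  apply Rle_lt_trans with (K * (e / (K + 1))).
  - apply Rmult_le_compat_l; auto. unfold dd in *; lra.
  - apply Rmult_lt_reg_r with (K + 1); [lra|]. replace (K * (e / (K + 1)) * (K + 1)) with (K * e) by (field; lra). nra.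
Qed.

Lemma jet_quad f z a b : jet f z a b -> exists d K, 0 < d /\ 0 <= K /\
  forall h, Cmod h < d -> Cmod (f (z + h)%C - (f z + a * h))%C <= K * Cmod h ^ 2.
Proof.
  intros (d & K & Hd & HK & H). exists (Rmin d 1), (Cmod b + K). pose proof (Cmod_ge_0 b).
  split; [apply Rmin_glb_lt; lra|split; [lra|]].
  intros h Hh. pose proof (Rmin_l d 1); pose proof (Rmin_r d 1). specialize (H h ltac:(lra)).
  replace (f (z + h) - (f z + a * h))%C with ((f (z + h) - (f z + a * h + b * (h * h))) + b * (h * h))%C by ring.
  eapply Rle_trans; [apply Cmod_triangle|]. rewrite !Cmod_mult. pose proof (Cmod_ge_0 h).
  assert (Cmod h ^ 3 <= Cmod h ^ 2) by (simpl; nra). nra.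
Qed.

Lemma jet_dx f x y a b : jet f (x, y) a b -> cder (fun u => f (u, y)) a x.
Proof.
  intros H. destruct (jet_quad _ _ _ _ H) as (d & K & Hd & HK & Hq).
  split; apply (is_derive_quad _ x _ K d); auto; intros h Hh; specialize (Hq (RtoC h));
  rewrite Cmod_R, pow2_abs in Hq; specialize (Hq Hh); replace ((x, y) + RtoC h)%C with ((x + h, y) : C) in Hq by (apply injective_projections; simpl; ring).
  - eapply Rle_trans; [|exact Hq]. eapply Rle_trans; [|apply Cmod_fst]. right. f_equal. simpl. ring.
  - eapply Rle_trans; [|exact Hq]. eapply Rle_trans; [|apply Cmod_snd]. right. f_equal. simpl. ring.
Qed.

(** Together with [jet_dx] these are the Cauchy-Riemann equations. *)
Lemma jet_dy f x y a b : jet f (x, y) a b -> cder (fun v => f (x, v)) (Ci * a)%C y.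
Proof.
  intros H. destruct (jet_quad _ _ _ _ H) as (d & K & Hd & HK & Hq).
  assert (E : forall h, Cmod (0, h) = Rabs h).
  { intros h. unfold Cmod; simpl. replace (0 * (0 * 1) + h * (h * 1)) with (Rsqr h) by (unfold Rsqr; ring). apply sqrt_Rsqr_abs. }
  split; apply (is_derive_quad _ y _ K d); auto; intros h Hh; specialize (Hq (0, h));
  rewrite E, pow2_abs in Hq; specialize (Hq Hh); replace (Cplus (x, y) (0, h)) with ((x, y + h) : C) in Hq by (apply injective_projections; simpl; ring).
  - eapply Rle_trans; [|exact Hq]. eapply Rle_trans; [|apply Cmod_fst]. right. f_equal. simpl. ring.
  - eapply Rle_trans; [|exact Hq]. eapply Rle_trans; [|apply Cmod_snd]. right. f_equal. simpl. ring.
Qed.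

(** The derivative of ln |F| is Re (F'/F). It is computed from half the logarithm of |F|^2, which
    requires no branch of the complex logarithm. *)
Lemma is_derive_ln_Cmod (F : R -> C) (a : C) (x : R) : F x <> 0 -> cder F (a * F x)%C x ->
  is_derive (fun u => ln (Cmod (F u))) x (fst a).
Proof.
  intros Hz [H1 H2]. pose proof (proj1 (Cmod_gt_0 _) Hz) as Hp.
  assert (Hq : 0 < fst (F x) ^ 2 + snd (F x) ^ 2). { rewrite <- Cmod_sqr. apply pow_lt; auto. }
  apply (is_derive_ext (fun u => / 2 * ln (fst (F u) ^ 2 + snd (F u) ^ 2))).
  - intros u. unfold Cmod.
    destruct (Rlt_dec 0 (fst (F u) ^ 2 + snd (F u) ^ 2)) as [L|L].
    + rewrite <- Rpower_sqrt by auto. unfold Rpower. rewrite ln_exp. auto.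
    (* At a zero of [F] both expressions are 0, by the convention [ln 0 = 0]. *)
    + assert (E : fst (F u) ^ 2 + snd (F u) ^ 2 = 0). { pose proof (pow2_ge_0 (fst (F u))). pose proof (pow2_ge_0 (snd (F u))). lra. }
      assert (L0 : ln 0 = 0) by (unfold ln; destruct (Rlt_dec 0 0); [exfalso; lra|reflexivity]). rewrite E, sqrt_0, L0. rewrite Rmult_0_r. reflexivity.
  - set (q := fst (F x) ^ 2 + snd (F x) ^ 2) in *.
    replace (fst a) with (/ 2 * ((2 * fst (F x) * fst (a * F x)%C + 2 * snd (F x) * snd (a * F x)%C) * / q)).
    2:{ unfold q in *. simpl. field. simpl in Hq. lra. }
    apply is_derive_scal.
    apply (is_derive_comp ln (fun u => fst (F u) ^ 2 + snd (F u) ^ 2)).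
    + apply is_derive_ln; auto.
    + apply (is_derive_plus (V := R_NormedModule) (fun u => fst (F u) ^ 2) (fun u => snd (F u) ^ 2)).
      * replace (2 * fst (F x) * fst (a * F x)%C) with (INR 2 * fst (a * F x)%C * fst (F x) ^ pred 2) by (simpl; ring).
        apply (is_derive_pow (fun u => fst (F u)) 2); auto.
      * replace (2 * snd (F x) * snd (a * F x)%C) with (INR 2 * snd (a * F x)%C * snd (F x) ^ pred 2) by (simpl; ring).
        apply (is_derive_pow (fun u => snd (F u)) 2); auto.
Qed.

Lemma zeta_jet_right s : 1 < fst s -> exists b, jet zeta s (- (DS Lam s) * zeta s)%C b.
Proof.
  intros Hs. destruct (DS_jet cst1 1 0 s cst1_grow ltac:(lra)) as [b Hb].
  rewrite zeta_Lam in Hb by auto. exists b.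
  replace (- DS Lam s * zeta s)%C with (- (zeta s * DS Lam s))%C by ring.
  apply (jet_ext_loc (DS cst1) zeta s _ _ (fst s - 1)); auto; [lra|].
  intros h Hh. rewrite zeta_DS; auto.
  pose proof (Cmod_fst h) as Q. pose proof (Rle_abs (- fst h)) as Q2. rewrite Rabs_Ropp in Q2. simpl. lra.
Qed.

Lemma ln_zeta_deriv x y : 1 < x -> is_derive (fun u => ln (Cmod (zeta (u, y)))) x (- fst (DS Lam (x, y))).
Proof.
  intros Hx. destruct (zeta_jet_right (x, y) Hx) as [b Hb]. apply jet_dx in Hb.
  apply (is_derive_ln_Cmod (fun u => zeta (u, y)) (- DS Lam (x, y))%C x); auto.
  apply zeta_neq_0_right; auto.
Qed.

Lemma DS_Lam_absconv s : 1 < fst s -> absconv (fun k => RtoC (Lam (S k)) * kpow (- s) (INR (S k)))%C.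
Proof.
  intros Hs. apply (DS_absconv _ _ _ _ (Lam_grow ((fst s - 1) / 2) ltac:(lra))). lra.
Qed.

Lemma fst_term q x y n : fst (RtoC q * kpow (- (x, y)) n)%C = q * (rpow n (- x) * cos (y * ln n)).
Proof.
  unfold kpow, cexp, rpow. simpl.
  replace (- x * ln n - - y * 0) with (- x * ln n) by ring.
  replace (- x * 0 + - y * ln n) with (- (y * ln n)) by ring. rewrite cos_neg. ring.
Qed.

(** Termwise, since 3 + 4 cos y + cos 2y = 2 (1 + cos y)^2. *)
Lemma three_four_one x t : 1 < x ->
  0 <= 3 * fst (DS Lam (x, 0)) + 4 * fst (DS Lam (x, t)) + fst (DS Lam (x, 2 * t)).
Proof.
  intros Hx.
  pose proof (absconv_fst _ (DS_Lam_absconv (x, 0) Hx)) as A0.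
  pose proof (absconv_fst _ (DS_Lam_absconv (x, t) Hx)) as A1.
  pose proof (absconv_fst _ (DS_Lam_absconv (x, 2 * t) Hx)) as A2.
  unfold DS, CSeries. cbn [fst]. rewrite <- !Series_scal_l.
  rewrite <- Series_plus by (apply ex_series_Rscal; auto).
  rewrite <- Series_plus; auto.
  2:{ apply (ex_series_plus (V := R_NormedModule)); apply ex_series_Rscal; auto. }
  apply Series_nonneg.
  - intros k. rewrite !fst_term.
    set (l := ln (INR (S k))). set (q := Lam (S k)). pose proof (MobLam.Lam_nonneg (S k)) as Hq. fold q in Hq.
    rewrite Rmult_0_l, cos_0. replace (2 * t * l) with (2 * (t * l)) by ring. rewrite cos_2a_cos. set (c := cos (t * l)).
    pose proof (rpow_pos (INR (S k)) (- x)). set (e := rpow (INR (S k)) (- x)) in *.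
    assert (0 <= q * e * (2 * (1 + c) ^ 2)). { apply Rmult_le_pos; [nra|]. pose proof (pow2_ge_0 (1 + c)). lra. }
    nra.
  - apply (ex_series_plus (V := R_NormedModule)); auto. apply (ex_series_plus (V := R_NormedModule)); apply ex_series_Rscal; auto.
Qed.

(** The combination decreases in [x], its derivative being minus the sum in [three_four_one]. Any
    lower bound that does not depend on [x] will do; the value at 4 serves. *)
Lemma mertens_mono x t : 1 < x <= 4 ->
  3 * ln (Cmod (zeta (4, 0))) + 4 * ln (Cmod (zeta (4, t))) + ln (Cmod (zeta (4, 2 * t)))
  <= 3 * ln (Cmod (zeta (x, 0))) + 4 * ln (Cmod (zeta (x, t))) + ln (Cmod (zeta (x, 2 * t))).
Proof.
  intros Hx.
  set (f := fun u => 3 * ln (Cmod (zeta (u, 0))) + 4 * ln (Cmod (zeta (u, t))) + ln (Cmod (zeta (u, 2 * t)))).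
  assert (Hd : forall u, 1 < u -> is_derive f u (3 * - fst (DS Lam (u, 0)) + 4 * - fst (DS Lam (u, t)) + - fst (DS Lam (u, 2 * t)))).
  { intros u Hu. unfold f.
    apply (is_derive_plus (V := R_NormedModule) (fun u => 3 * ln (Cmod (zeta (u, 0))) + 4 * ln (Cmod (zeta (u, t)))) (fun u => ln (Cmod (zeta (u, 2 * t))))).
    - apply (is_derive_plus (V := R_NormedModule) (fun u => 3 * ln (Cmod (zeta (u, 0)))) (fun u => 4 * ln (Cmod (zeta (u, t))))); apply is_derive_scal; apply ln_zeta_deriv; auto.
    - apply ln_zeta_deriv; auto. }
  destruct (MVT_gen f x 4 (fun u => 3 * - fst (DS Lam (u, 0)) + 4 * - fst (DS Lam (u, t)) + - fst (DS Lam (u, 2 * t)))) as (c & Hc & E).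
  - intros u Hu. rewrite Rmin_left in Hu by lra. apply Hd; lra.
  - intros u Hu. rewrite Rmin_left in Hu by lra. apply continuity_pt_filterlim. apply (ex_derive_continuous (V := R_NormedModule) f). eexists; apply Hd; lra.
  - rewrite Rmin_left, Rmax_right in Hc by lra. pose proof (three_four_one c t ltac:(lra)). fold (f 4) (f x). unfold f in E |- *. nra.
Qed.

(** Mertens' argument. Near a zero at 1 + it the term 4 ln |zeta(1+r+it)| is at most 4 ln r + O(1),
    while the pole contributes only - 3 ln r + O(1). The remaining ln r contradicts the lower bound
    of [mertens_mono] as [r] tends to 0. *)
Lemma zreg_line1 t : zreg (1, t) <> 0.
Proof.
  destruct (Req_dec t 0) as [->|Ht].
  { change (1, 0) with (RtoC 1). rewrite zreg_1. intros E. apply RtoC_inj in E. lra. }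
  intros Hz0.
  assert (Habs : 0 < Rabs t) by (apply Rabs_pos_lt; auto).
  destruct (zreg_jet (1, t) ltac:(simpl; lra)) as [b Hb].
  destruct (jet_lip _ _ _ _ Hb) as (d & K & Hd & HK & Hl).
  set (c0 := 3 * ln (Cmod (zeta (4, 0))) + 4 * ln (Cmod (zeta (4, t))) + ln (Cmod (zeta (4, 2 * t)))).
  (* |zeta| = |zreg| |s| / |s-1| on the two vertical shifts *)
  assert (Hs : forall r y, 0 < r <= 1 -> y <> 0 -> Cmod (zeta (1 + r, y)) <= Cmod (zreg (1 + r, y)) * ((2 + Rabs y) / Rabs y)).
  { intros r y Hr Hy. assert (Hyp : 0 < Rabs y) by (apply Rabs_pos_lt; auto).
    set (s := (1 + r, y) : C).
    assert (Hs1 : s <> RtoC 1) by (unfold s; intros E; inversion E; lra).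
    pose proof (C1_neq s Hs1) as Hs2. pose proof (Cneq_fst s ltac:(unfold s; simpl; lra)) as Hs3.
    replace (zeta s) with (zreg s * (s / (s - 1)))%C.
    2:{ rewrite zreg_zeta by (auto; unfold s; simpl; lra). field. split; auto. }
    rewrite Cmod_mult, Cmod_div by auto. apply Rmult_le_compat_l; [apply Cmod_ge_0|].
    assert (L1 : Rabs y <= Cmod (s - 1)).
    { eapply Rle_trans; [|apply Cmod_snd]. unfold s; simpl. right; f_equal; ring. }
    assert (L2 : Cmod s <= 2 + Rabs y).
    { eapply Rle_trans; [apply Cmod_le_sum|]. unfold s; simpl. rewrite (Rabs_pos_eq (1 + r)) by lra. lra. }
    unfold Rdiv. apply Rmult_le_compat; auto; [apply Cmod_ge_0|left; apply Rinv_0_lt_compat; lra|apply Rinv_le_contravar; auto]. }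
  assert (Hpos : forall r y, 0 < r -> 0 < Cmod (zeta (1 + r, y))).
  { intros. apply Cmod_gt_0. apply zeta_neq_0_right. simpl; lra. }
  set (K1 := (K + 1) * ((2 + Rabs t) / Rabs t)).
  set (M := (2 * (2 + Rabs (2 * t)) + 1) * ((2 + Rabs (2 * t)) / Rabs (2 * t))).
  assert (Habs2 : 0 < Rabs (2 * t)) by (apply Rabs_pos_lt; lra).
  assert (HK1 : 0 < K1). { unfold K1. apply Rmult_lt_0_compat; [lra|apply Rdiv_lt_0_compat; lra]. }
  assert (HM : 0 < M). { unfold M. apply Rmult_lt_0_compat; [lra|apply Rdiv_lt_0_compat; lra]. }
  assert (Hmain : forall r, 0 < r <= 1 -> r < d -> c0 <= ln r + (3 * ln 2 + 4 * ln K1 + ln M)).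
  { intros r Hr Hrd. pose proof (mertens_mono (1 + r) t ltac:(lra)) as Hm. fold c0 in Hm.
    eapply Rle_trans; [exact Hm|].
    assert (B0 : ln (Cmod (zeta (1 + r, 0))) <= ln 2 - ln r).
    { rewrite <- ln_div by lra. apply ln_le_compat; [apply Hpos; lra|].
      rewrite zeta_DS by (simpl; lra).
      eapply Rle_trans; [apply (DS_bound cst1 1 0); [apply cst1_grow|simpl; lra]|]. simpl fst.
      replace (1 + r - 1 - 0) with r by ring. apply Rmult_le_reg_r with r; [lra|].
      replace (1 * (1 + / r) * r) with (r + 1) by (field; lra). replace (2 / r * r) with 2 by (field; lra). lra. }
    assert (B1 : ln (Cmod (zeta (1 + r, t))) <= ln K1 + ln r).
    { rewrite <- ln_mult by lra. apply ln_le_compat; [apply Hpos; lra|].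
      eapply Rle_trans; [apply Hs; auto; lra|].
      specialize (Hl (RtoC r)). rewrite Cmod_real in Hl by lra. specialize (Hl Hrd).
      replace ((1, t) + RtoC r)%C with ((1 + r, t) : C) in Hl by (apply injective_projections; simpl; ring).
      rewrite Hz0 in Hl. replace (Cminus (zreg (1 + r, t)) 0) with (zreg (1 + r, t)) in Hl by (unfold Cminus; ring).
      assert (0 < (2 + Rabs t) / Rabs t) by (apply Rdiv_lt_0_compat; lra).
      unfold K1. assert (Cmod (zreg (1 + r, t)) <= (K + 1) * r) by nra. nra. }
    assert (B2 : ln (Cmod (zeta (1 + r, 2 * t))) <= ln M).
    { apply ln_le_compat; [apply Hpos; lra|]. eapply Rle_trans; [apply Hs; lra|].
      unfold M. apply Rmult_le_compat_r; [left; apply Rdiv_lt_0_compat; lra|].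
      set (s2 := (1 + r, 2 * t) : C).
      eapply Rle_trans; [apply zreg_bound; simpl; lra|]. change (fst s2) with (1 + r).
      assert (/ (1 + r) <= 1). { rewrite <- Rinv_1. apply Rinv_le_contravar; lra. }
      assert (Cmod (s2 - 1) <= 1 + Rabs (2 * t)).
      { eapply Rle_trans; [apply Cmod_le_sum|]. unfold s2; simpl. replace (1 + r + - (1)) with r by ring. replace (2 * t + - 0) with (2 * t) by ring. rewrite (Rabs_pos_eq r) by lra. lra. }
      pose proof (Cmod_ge_0 (s2 - 1)).
      assert (0 < / (1 + r)) by (apply Rinv_0_lt_compat; lra).
      nra. }
    lra. }
  set (cc := c0 - (3 * ln 2 + 4 * ln K1 + ln M)) in *.
  (* At this [r] the inequality [Hmain] would give [cc <= ln r <= cc - 1]. *)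
  set (r := Rmin (Rmin 1 (d / 2)) (exp (cc - 1))).
  assert (Hr : 0 < r /\ r <= 1 /\ r <= d / 2 /\ r <= exp (cc - 1)).
  { pose proof (exp_pos (cc - 1)). unfold r, Rmin; repeat destruct Rle_dec; lra. }
  specialize (Hmain r ltac:(lra) ltac:(lra)).
  assert (ln r <= cc - 1). { rewrite <- (ln_exp (cc - 1)). apply ln_le_compat; lra. }
  unfold cc in *. lra.
Qed.

Lemma zreg_neq_0 : RH -> forall s, 1 / 2 < fst s -> zreg s <> 0.
Proof.
  intros HR s Hs.
  destruct (Rlt_dec 1 (fst s)) as [H1|H1]; [apply zreg_ratio; auto|].
  destruct (Req_dec (fst s) 1) as [E|E].
  { destruct s as [x y]; simpl in E; subst x. apply zreg_line1. }
  assert (Hlt : fst s < 1) by lra.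
  assert (Hs1 : s <> RtoC 1) by (intros ->; simpl in *; lra).
  pose proof (C1_neq s Hs1). pose proof (Cneq_fst s ltac:(lra)).
  rewrite zreg_zeta by (auto; lra). apply Cmult_neq_0.
  - intros E2. apply H. replace (s - 1)%C with (s * (1 - / s))%C by (field; auto). rewrite E2. ring.
  - intros E2. pose proof (HR s ltac:(lra) E2). lra.
Qed.

(** * The logarithm of [zreg] for 1/2 < Re s < 4 *)

Lemma cpolar (z : C) : 0 < fst z -> cexp (ln (Cmod z), atan (snd z / fst z)) = z.
Proof.
  intros Hx. destruct z as [x y]. simpl in *.
  assert (Hm : Cmod (x, y) = x * sqrt (1 + (y / x)²)).
  { unfold Cmod. simpl. rewrite <- (sqrt_Rsqr x) at 3 by lra. rewrite <- sqrt_mult_alt by (apply Rle_0_sqr).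
    f_equal. unfold Rsqr. field. lra. }
  assert (Hs : 0 < sqrt (1 + (y / x)²)). { apply sqrt_lt_R0. pose proof (Rle_0_sqr (y / x)). lra. }
  unfold cexp. simpl. rewrite exp_ln by (rewrite Hm; nra). rewrite cos_atan, sin_atan, Hm.
  apply injective_projections; simpl; field; try lra; try (split; lra).
Qed.

Lemma cexp_small (k : C) : Cmod k <= 1 / 8 ->
  Cmod (cE2 k) <= 2 * Cmod k ^ 2 /\ Cmod (cE3 k) <= 2 * Cmod k ^ 3.
Proof.
  intros Hk. pose proof (Cmod_ge_0 k).
  assert (He : exp (Cmod k) <= 2).
  { apply Rle_trans with (exp (1 / 8)); [apply exp_le_compat; auto|].
    apply Rle_trans with (exp (/ 2)); [apply exp_le_compat; lra|].
    assert (exp (/ 2) * exp (/ 2) <= 4). { rewrite <- exp_plus. replace (/ 2 + / 2) with 1 by field. pose proof exp_le_3. lra. }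
    pose proof (exp_pos (/ 2)). nra. }
  split.
  - eapply Rle_trans; [apply cE2_bound|]. rewrite Rmult_comm. apply Rmult_le_compat_r; auto. apply pow_le; auto.
  - eapply Rle_trans; [apply cE3_bound|]. rewrite Rmult_comm. apply Rmult_le_compat_r; auto. apply pow_le; auto.
Qed.

(** Continuity keeps the increment [k] of [h] below 1/8, which excludes a jump to another branch.
    Then [u = exp k - 1] is the relative increment of [f], and [k = u - u^2/2 + O(u^3)] transfers
    its expansion to [h]. *)
Lemma log_branch_J (h f : C -> C) (z : C) (d : R) : 0 < d -> ccont h z -> f z <> 0 -> J f z ->
  (forall w, Cmod w < d -> cexp (h (z + w)%C) = f (z + w)%C) -> J h z.
Proof.
  intros Hd Hc Hz Hf He.
  destruct (Hc (1 / 8) ltac:(lra)) as (d1 & Hd1 & Hc1).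
  set (v := fun w => (f w / f z - 1)%C).
  assert (Jv : J v z). { unfold v. apply J_minus; [|apply J_const]. apply J_div; auto. apply J_const. }
  assert (Jp : J (fun w => v w - v w * v w / 2)%C z).
  { apply J_minus; auto. apply J_mult; [apply J_mult; auto|apply J_const]. }
  destruct Jp as (a & b & dp & Kp & Hdp & HKp & Hp).
  destruct Jv as (a' & b' & Jv). destruct (jet_lip _ _ _ _ Jv) as (dl & L & Hdl & HL & Hl).
  assert (Ev : v z = 0). { unfold v. field. auto. }
  exists a, b, (Rmin (Rmin d d1) (Rmin dp dl)), (Kp + 40 * L ^ 3).
  assert (0 <= L ^ 3) by (apply pow_le; auto).
  split; [repeat apply Rmin_glb_lt; auto|split; [lra|]].
  intros w Hw.
  assert (Hw' : Cmod w < d /\ Cmod w < d1 /\ Cmod w < dp /\ Cmod w < dl).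
  { revert Hw. unfold Rmin; repeat destruct Rle_dec; lra. }
  destruct Hw' as (W1 & W2 & W3 & W4).
  specialize (Hc1 w W2). specialize (Hp w W3). specialize (Hl w W4). cbv beta in Hp.
  rewrite Ev in Hl, Hp. set (k := (h (z + w) - h z)%C) in *.
  assert (Ek : (cexp k = v (z + w) + 1)%C).
  { unfold v, k. rewrite <- He by auto.
    assert (Ez : f z = cexp (h z)). { specialize (He 0). replace (z + 0)%C with z in He by ring. symmetry; apply He. rewrite Cmod_0; lra. }
    rewrite Ez. replace (h (z + w) - h z)%C with (h (z + w) + - h z)%C by ring. rewrite cexp_plus.
    pose proof (cexp_opp (h z)) as Ho. pose proof (cexp_neq_0 (h z)) as Hn.
    replace (cexp (- h z)) with (/ cexp (h z))%C. 2:{ replace (/ cexp (h z))%C with (/ cexp (h z) * (cexp (h z) * cexp (- h z)))%C by (rewrite Ho; ring). field. auto. }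
    field. auto. }
  set (u := v (z + w)%C) in *.
  destruct (cexp_small k ltac:(lra)) as [B2 B3].
  assert (E2 : u = (k + cE2 k)%C). { unfold cE2. rewrite Ek. ring. }
  assert (E3 : cE3 k = (u - k - k * k / 2)%C). { unfold cE3. rewrite Ek. ring. }
  pose proof (Cmod_ge_0 k) as K0. pose proof (Cmod_ge_0 u) as U0.
  assert (Hku : Cmod k <= 2 * Cmod u).
  { assert (Cmod k <= Cmod u + Cmod (cE2 k)). { replace k with (u - cE2 k)%C at 1 by (rewrite E2; ring). apply Cmod_minus_le. }
    assert (2 * Cmod k ^ 2 <= Cmod k / 4) by (simpl; nra). lra. }
  assert (Hdiff : Cmod (k - (u - u * u / 2)) <= 40 * Cmod u ^ 3).
  { replace (k - (u - u * u / 2))%C with ((u - k) * (u + k) * / 2 + - cE3 k)%C by (rewrite E3; field).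
    eapply Rle_trans; [apply Cmod_triangle|]. rewrite Cmod_opp, !Cmod_mult.
    replace (Cmod (/ 2)) with (/ 2). 2:{ rewrite <- RtoC_inv by lra. rewrite Cmod_real; lra. }
    assert (Cmod (u - k) <= 8 * Cmod u ^ 2).
    { replace (u - k)%C with (cE2 k) by (rewrite E2; ring). eapply Rle_trans; [exact B2|]. simpl; nra. }
    assert (Cmod (u + k) <= 3 * Cmod u). { eapply Rle_trans; [apply Cmod_triangle|]. lra. }
    assert (Cmod (u - k) * Cmod (u + k) <= (8 * Cmod u ^ 2) * (3 * Cmod u)) by (apply Rmult_le_compat; auto; apply Cmod_ge_0).
    assert (Cmod k ^ 3 <= (2 * Cmod u) ^ 3) by (apply pow_incr; lra).
    simpl in *. nra. }
  replace (h (z + w) - (h z + a * w + b * (w * w)))%C with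
    ((k - (u - u * u / 2)) + (u - u * u / 2 - (0 - 0 * 0 / 2 + a * w + b * (w * w))))%C by (unfold k; field).
  eapply Rle_trans; [apply Cmod_triangle|].
  assert (Hu : Cmod u <= L * Cmod w). { replace u with (u - 0)%C by ring. exact Hl. }
  assert (Cmod u ^ 3 <= L ^ 3 * Cmod w ^ 3). { rewrite <- Rpow_mult_distr. apply pow_incr; lra. }
  fold u in Hp. lra.
Qed.

Definition qlog (s : C) : C := (dzreg s / zreg s)%C.
Arguments qlog s : simpl never.

Lemma qlog_J (HRH : RH) s : 1 / 2 < fst s -> J qlog s.
Proof. intros Hs. apply J_div; [apply dzreg_J; lra|apply zreg_J; lra|apply zreg_neq_0; auto]. Qed.

(** The principal logarithm of [zreg] on Re s = 4. There the real part is at least 1/3 by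
    [zreg4_fst], so [atan] of the quotient is the argument. *)
Definition clog4 (y : R) : C := (ln (Cmod (zreg (4, y))), atan (snd (zreg (4, y)) / fst (zreg (4, y)))).
(* The branch of [log (zreg s)] continued horizontally from the line [Re s = 4]. *)
Definition hlog (s : C) : C := (clog4 (snd s) - CI (fun a => qlog (a, snd s)) (fst s) 4)%C.

Arguments clog4 y : simpl never.
Arguments hlog s : simpl never.

Lemma DS_cst1_right s : 4 <= fst s -> Cmod (zeta s - 1) <= 1 / 3.
Proof.
  intros Hs. rewrite zeta_DS by lra.
  pose proof (DS_tail cst1 1 0 s 1 cst1_grow ltac:(lra) ltac:(lia)) as H.
  replace (csum (fun n => RtoC (cst1 n) * zterm s n)%C 1) with (RtoC 1) in H.
  2:{ unfold csum, zterm, cst1. simpl INR. rewrite kpow_1. ring. }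
  eapply Rle_trans; [exact H|]. simpl INR. rewrite rpow_1, Rmult_1_l. unfold Rdiv. rewrite !Rmult_1_l.
  apply Rinv_le_contravar; lra.
Qed.

Lemma zreg4_near y : Cmod (zreg (4, y) - 1) <= 2 / 3.
Proof.
  set (s := (4, y) : C). assert (Hs : fst s = 4) by reflexivity.
  assert (Hs1 : s <> RtoC 1) by (intros E; rewrite E in Hs; simpl in Hs; lra).
  pose proof (Cneq_fst s ltac:(lra)) as Hs0.
  rewrite zreg_zeta by (auto; lra). pose proof (DS_cst1_right s ltac:(lra)) as H.
  replace ((1 - / s) * zeta s - 1)%C with ((zeta s - 1) * (1 - / s) + - / s)%C by ring.
  assert (Hi : Cmod (/ s) <= / 4).
  { rewrite Cmod_inv by auto. apply Rinv_le_contravar; [lra|]. rewrite <- Hs. apply fst_le_Cmod. }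
  eapply Rle_trans; [apply Cmod_triangle|]. rewrite Cmod_opp, Cmod_mult.
  assert (Cmod (1 - / s) <= 5 / 4). { eapply Rle_trans; [apply Cmod_minus_le|]. rewrite Cmod_1. lra. }
  pose proof (Cmod_ge_0 (zeta s - 1)). pose proof (Cmod_ge_0 (1 - / s)). nra.
Qed.

Lemma zreg4_fst y : 1 / 3 <= fst (zreg (4, y)).
Proof.
  pose proof (zreg4_near y) as H. pose proof (Cmod_fst (zreg (4, y) - 1)) as H1.
  change (fst (zreg (4, y) - 1)%C) with (fst (zreg (4, y)) + - (1)) in H1.
  pose proof (Rle_abs (- (fst (zreg (4, y)) + - (1)))) as H2. rewrite Rabs_Ropp in H2. lra.
Qed.

Lemma cexp_clog4 y : cexp (clog4 y) = zreg (4, y).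
Proof. apply cpolar. pose proof (zreg4_fst y). lra. Qed.

Lemma qlog_cont (HRH : RH) x y : 1 / 2 < x -> continuity_2d_pt (fun u v => fst (qlog (u, v))) x y /\ continuity_2d_pt (fun u v => snd (qlog (u, v))) x y.
Proof. intros Hx. pose proof (J_ccont _ _ (qlog_J HRH (x, y) Hx)). split; [apply ccont_fst|apply ccont_snd]; auto. Qed.

Lemma cont2_fst (f : R -> R -> R) x y : continuity_2d_pt f x y -> continuous (fun u => f u y) x.
Proof.
  intros H. apply continuity_pt_filterlim. intros e He. destruct (H (mkposreal e He)) as (d & Hd).
  exists d. split; [apply cond_pos|]. intros w [_ Hw]. simpl in *. unfold Rdist in *. apply Hd; auto.
  rewrite Rminus_diag, Rabs_R0. apply cond_pos.
Qed.

Lemma qlog_ccR (HRH : RH) y a b : 1 / 2 < a -> ccR (fun u => qlog (u, y)) a b.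
Proof.
  intros Ha x Hx. destruct (qlog_cont HRH x y ltac:(lra)).
  split; [apply (cont2_fst (fun u v => fst (qlog (u, v))))|apply (cont2_fst (fun u v => snd (qlog (u, v))))]; auto.
Qed.

Lemma is_derive_RInt_lower (f : R -> R) b x : 1 / 2 < x -> (forall u, 1 / 2 < u -> continuous f u) ->
  1 / 2 < b -> is_derive (fun u => RInt f u b) x (- f x).
Proof.
  intros Hx Hf Hb.
  apply (is_derive_RInt' (V := R_NormedModule) f (fun u => RInt f u b) x b).
  - assert (He : 0 < x - 1 / 2) by lra. exists (mkposreal _ He). intros u Hu.
    apply (RInt_correct (V := R_CompleteNormedModule)). apply (ex_RInt_continuous (V := R_CompleteNormedModule)).
    intros w Hw. apply Hf. unfold ball in Hu; simpl in Hu; unfold AbsRing_ball, abs, minus, plus, opp in Hu; simpl in Hu.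
    apply Rabs_def2 in Hu. revert Hw. unfold Rmin. destruct Rle_dec; lra.
  - apply Hf; auto.
Qed.

Lemma hlog_cder (HRH : RH) x y : 1 / 2 < x -> cder (fun u => hlog (u, y)) (qlog (x, y)) x.
Proof.
  intros Hx. unfold hlog. cbn [fst snd].
  assert (Hc : forall u, 1 / 2 < u -> continuous (fun a => fst (qlog (a, y))) u /\ continuous (fun a => snd (qlog (a, y))) u).
  { intros u Hu. destruct (qlog_ccR HRH y u u Hu u ltac:(lra)). auto. }
  apply (cder_eq _ (0 + - - qlog (x, y))%C); [ring|].
  apply (cder_plus (fun _ => clog4 y) (fun u => - CI (fun a => qlog (a, y)) u 4)%C); [apply cder_const|].
  split; cbn [fst snd Copp CI].
  - apply (is_derive_opp (V := R_NormedModule) (fun u => RInt (fun a => fst (qlog (a, y))) u 4) x (- fst (qlog (x, y)))).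
    apply (is_derive_RInt_lower (fun a => fst (qlog (a, y)))); auto; [apply Hc|lra].
  - apply (is_derive_opp (V := R_NormedModule) (fun u => RInt (fun a => snd (qlog (a, y))) u 4) x (- snd (qlog (x, y)))).
    apply (is_derive_RInt_lower (fun a => snd (qlog (a, y)))); auto; [apply Hc|lra].
Qed.

(** Along a horizontal line [zreg * exp (- hlog)] has derivative 0, and it equals 1 at Re s = 4. *)
Lemma cexp_hlog (HRH : RH) s : 1 / 2 < fst s <= 4 -> cexp (hlog s) = zreg s.
Proof.
  destruct s as [x y]. cbn [fst]. intros Hx.
  set (W := fun u => (zreg (u, y) * cexp (- hlog (u, y)))%C).
  assert (HW : W 4 = 1).
  { unfold W. rewrite <- cexp_clog4. unfold hlog. cbn [fst snd].
    replace (CI (fun a => qlog (a, y)) 4 4) with (RtoC 0).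
    - replace (- (clog4 y - 0))%C with (- clog4 y)%C by ring. apply cexp_opp.
    - unfold CI. rewrite !(RInt_point (V := R_CompleteNormedModule)). reflexivity. }
  assert (HW2 : Cmod (W 4 - W x) <= 0 * (4 - x)).
  { assert (HD : forall u, x <= u <= 4 -> cder W 0 u).
    { intros u Hu. destruct (zreg_jet (u, y) ltac:(simpl; lra)) as [b Hb]. apply jet_dx in Hb.
      pose proof (hlog_cder HRH u y ltac:(lra)) as Hh.
      apply (cder_eq _ (dzreg (u, y) * cexp (- hlog (u, y)) + zreg (u, y) * ((0 * hlog (u, y) + - (1) * qlog (u, y)) * cexp (- hlog (u, y))))%C).
      - unfold qlog. field. apply zreg_neq_0; auto. simpl; lra.
      - apply (cder_mult (fun u => zreg (u, y)) (fun u => cexp (- hlog (u, y)))); auto.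
        pose proof (cder_cexp (fun u => (- (1)) * hlog (u, y))%C _ u (cder_mult (fun _ => (- (1))%C) _ _ _ u (cder_const _ u) Hh)) as H2.
        replace (- hlog (u, y))%C with ((- (1)) * hlog (u, y))%C by ring.
        destruct H2 as [H2 H3]. split.
        + eapply is_derive_ext; [|exact H2]. intros t. cbv beta. f_equal. f_equal. ring.
        + eapply is_derive_ext; [|exact H3]. intros t. cbv beta. f_equal. f_equal. ring. }
    apply (cmvt W (fun _ => RtoC 0)); [lra|intros; apply HD; auto|intros; apply HD; auto|intros; rewrite Cmod_0; lra]. }
  rewrite Rmult_0_l in HW2. pose proof (Cmod_ge_0 (W 4 - W x)).
  assert (E : (W 4 - W x)%C = 0) by (apply Cmod_eq_0; lra).
  assert (E1 : W x = 1). { rewrite <- HW. replace (W x) with (W 4 - (W 4 - W x))%C by ring. rewrite E. ring. }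
  unfold W in E1. pose proof (cexp_opp (hlog (x, y))) as E2.
  replace (zreg (x, y)) with (zreg (x, y) * (cexp (hlog (x, y)) * cexp (- hlog (x, y))))%C by (rewrite E2; ring).
  rewrite <- (Cmult_1_r (cexp (hlog (x, y)))) at 1. rewrite <- E1. ring.
Qed.

Lemma clog4_cont y : forall eps, 0 < eps -> exists d, 0 < d /\ forall v, Rabs (v - y) < d -> Cmod (clog4 v - clog4 y) < eps.
Proof.
  intros eps He. pose proof (J_ccont _ _ (zreg_J (4, y) ltac:(simpl; lra))) as Hc.
  assert (Hcy : forall g, continuity_2d_pt g 4 y -> continuous (fun v => g 4 v) y).
  { intros g H. apply continuity_pt_filterlim. intros e He'. destruct (H (mkposreal e He')) as (d & Hd).
    exists d. split; [apply cond_pos|]. intros w [_ Hw]. simpl in *. unfold Rdist in *. apply Hd; auto.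
    rewrite Rminus_diag, Rabs_R0. apply cond_pos. }
  pose proof (Hcy _ (ccont_fst _ _ _ Hc)) as C1. pose proof (Hcy _ (ccont_snd _ _ _ Hc)) as C2. cbv beta in C1, C2.
  pose proof (zreg4_fst y) as Hf.
  assert (Hq : 0 < fst (zreg (4, y)) ^ 2 + snd (zreg (4, y)) ^ 2). { pose proof (pow2_ge_0 (snd (zreg (4, y)))). nra. }
  assert (C3 : continuous (fun v => fst (clog4 v)) y).
  { unfold clog4; simpl. unfold Cmod.
    apply (continuous_comp (fun v => sqrt (fst (zreg (4, v)) ^ 2 + snd (zreg (4, v)) ^ 2)) ln).
    - apply (continuous_comp (fun v => fst (zreg (4, v)) ^ 2 + snd (zreg (4, v)) ^ 2) sqrt).
      + apply (continuous_plus (V := R_NormedModule) (fun v => fst (zreg (4, v)) ^ 2) (fun v => snd (zreg (4, v)) ^ 2)).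
        * apply (continuous_comp (fun v => fst (zreg (4, v))) (fun t => t ^ 2)); auto. apply (ex_derive_continuous (V := R_NormedModule)). auto_derive; auto.
        * apply (continuous_comp (fun v => snd (zreg (4, v))) (fun t => t ^ 2)); auto. apply (ex_derive_continuous (V := R_NormedModule)). auto_derive; auto.
      + apply continuity_pt_filterlim. apply continuity_pt_sqrt. apply Rlt_le; exact Hq.
    - apply (ex_derive_continuous (V := R_NormedModule)). eexists. apply is_derive_ln. apply sqrt_lt_R0; auto. }
  assert (C4 : continuous (fun v => snd (clog4 v)) y).
  { unfold clog4; simpl.
    apply (continuous_comp (fun v => snd (zreg (4, v)) / fst (zreg (4, v))) atan).
    - apply (continuous_mult (K := R_AbsRing) (fun v => snd (zreg (4, v))) (fun v => / fst (zreg (4, v)))); auto.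
      apply (continuous_comp (fun v => fst (zreg (4, v))) Rinv); auto. apply (ex_derive_continuous (V := R_NormedModule)). auto_derive; apply Rgt_not_eq, Rlt_gt; eapply Rlt_le_trans; [|exact Hf]; lra.
    - apply (ex_derive_continuous (V := R_NormedModule)). auto_derive; auto. }
  apply continuity_pt_filterlim in C3. apply continuity_pt_filterlim in C4.
  destruct (C3 (eps / 2) ltac:(lra)) as (d1 & Hd1 & H1). destruct (C4 (eps / 2) ltac:(lra)) as (d2 & Hd2 & H2).
  simpl in H1, H2. unfold Rdist, D_x, no_cond in H1, H2.
  exists (Rmin d1 d2). split; [apply Rmin_glb_lt; lra|]. intros v Hv.
  destruct (Req_dec v y) as [->|Hne].
  { replace (clog4 y - clog4 y)%C with (RtoC 0) by ring. rewrite Cmod_0; auto. }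
  pose proof (Rmin_l d1 d2); pose proof (Rmin_r d1 d2).
  specialize (H1 v ltac:(repeat split; auto; lra)). specialize (H2 v ltac:(repeat split; auto; lra)).
  eapply Rle_lt_trans; [apply Cmod_le_sum|]. simpl. simpl in H1, H2. unfold Rminus in *. lra.
Qed.

(** [hlog] is built by horizontal integration only. Joint continuity combines its differentiability
    in [x], the continuity of the initial value [clog4], and the uniform continuity of [qlog] near
    the segment of integration. *)
Lemma hlog_ccont (HRH : RH) x y : 1 / 2 < x < 4 -> ccont hlog (x, y).
Proof.
  intros Hx eps He. set (xl := (x + 1 / 2) / 2).
  destruct (clog4_cont y (eps / 4) ltac:(lra)) as (d0 & Hd0 & H0).
  assert (He1 : 0 < eps / 32) by lra.
  destruct (uniform_continuity_2d_1d (fun u v => fst (qlog (u, v))) xl 4 y (fun u Hu => proj1 (qlog_cont HRH u y ltac:(unfold xl in *; lra))) (mkposreal _ He1)) as (d1 & H1).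
  destruct (uniform_continuity_2d_1d (fun u v => snd (qlog (u, v))) xl 4 y (fun u Hu => proj2 (qlog_cont HRH u y ltac:(unfold xl in *; lra))) (mkposreal _ He1)) as (d2 & H2).
  assert (H3 : exists d3, 0 < d3 /\ forall u, Rabs (u - x) < d3 -> Cmod (hlog (u, y) - hlog (x, y)) < eps / 4).
  { pose proof (hlog_cder HRH x y ltac:(lra)) as [D1 D2].
    assert (C1 : continuous (fun u => fst (hlog (u, y))) x) by (apply (ex_derive_continuous (V := R_NormedModule)); eexists; exact D1).
    assert (C2 : continuous (fun u => snd (hlog (u, y))) x) by (apply (ex_derive_continuous (V := R_NormedModule)); eexists; exact D2).
    apply continuity_pt_filterlim in C1. apply continuity_pt_filterlim in C2.
    destruct (C1 (eps / 8) ltac:(lra)) as (e1 & He1' & G1). destruct (C2 (eps / 8) ltac:(lra)) as (e2 & He2' & G2).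
    simpl in G1, G2. unfold Rdist, D_x, no_cond in G1, G2.
    exists (Rmin e1 e2). split; [apply Rmin_glb_lt; lra|]. intros u Hu.
    destruct (Req_dec u x) as [->|Hne].
    { replace (hlog (x, y) - hlog (x, y))%C with (RtoC 0) by ring. rewrite Cmod_0; lra. }
    pose proof (Rmin_l e1 e2); pose proof (Rmin_r e1 e2).
    specialize (G1 u ltac:(repeat split; auto; lra)). specialize (G2 u ltac:(repeat split; auto; lra)).
    eapply Rle_lt_trans; [apply Cmod_le_sum|].
    change (fst (hlog (u, y) - hlog (x, y))%C) with (fst (hlog (u, y)) - fst (hlog (x, y))).
    change (snd (hlog (u, y) - hlog (x, y))%C) with (snd (hlog (u, y)) - snd (hlog (x, y))). apply Rlt_le_trans with (eps / 8 + eps / 8); [apply Rplus_lt_compat; [exact G1|exact G2]|lra]. }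
  destruct H3 as (d3 & Hd3 & H3).
  set (D := Rmin (Rmin (Rmin d0 d1) (Rmin d2 d3)) (Rmin (x - xl) (4 - x))).
  assert (HD : 0 < D /\ D <= d0 /\ D <= d1 /\ D <= d2 /\ D <= d3 /\ D <= x - xl /\ D <= 4 - x).
  { pose proof (cond_pos d1); pose proof (cond_pos d2). unfold D, xl in *. unfold Rmin; repeat destruct Rle_dec; lra. }
  exists D. split; [lra|]. intros [h k] Hh.
  pose proof (Cmod_fst (h, k)) as F1. pose proof (Cmod_snd (h, k)) as F2. simpl in F1, F2.
  replace (Cplus (x, y) (h, k)) with ((x + h, y + k) : C) by (apply injective_projections; simpl; ring).
  assert (Hh1 : Rabs h < D) by lra. assert (Hk1 : Rabs k < D) by lra.
  specialize (H3 (x + h) ltac:(replace (x + h - x) with h by ring; lra)).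
  specialize (H0 (y + k) ltac:(replace (y + k - y) with k by ring; lra)).
  apply Rabs_def2 in Hh1. apply Rabs_def2 in Hk1.
  replace (hlog ((x + h)%R, (y + k)%R) - hlog (x, y))%C with
    ((hlog ((x + h)%R, y) - hlog (x, y)) + (clog4 (y + k)%R - clog4 y + - CI (fun a => qlog (a, (y + k)%R) - qlog (a, y))%C (x + h)%R 4))%C.
  2:{ unfold hlog. cbn [fst snd].
      replace (CI (fun a => qlog (a, (y + k)%R) - qlog (a, y))%C (x + h) 4)
        with (CI (fun a => qlog (a, (y + k)%R)) (x + h)%R 4 - CI (fun a => qlog (a, y)) (x + h)%R 4)%C.
      - ring.
      - unfold Cminus. replace (- CI (fun a => qlog (a, y)) (x + h)%R 4)%C with (CI (fun a => - (1) * qlog (a, y))%C (x + h) 4).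
        + rewrite <- CI_plus; [|lra|apply (qlog_ccR HRH); unfold xl in *; lra|apply ccR_mult; [apply ccR_const|apply (qlog_ccR HRH); unfold xl in *; lra]].
          apply CI_ext; [lra|]. intros; ring.
        + rewrite CI_scal; [ring|lra|apply (qlog_ccR HRH); unfold xl in *; lra]. }
  eapply Rle_lt_trans; [apply Cmod_triangle|].
  assert (HCI : Cmod (CI (fun a => qlog (a, (y + k)%R) - qlog (a, y))%C (x + h) 4) <= eps / 16 * (4 - (x + h))).
  { apply CI_bound; [lra| |].
    - unfold Cminus. apply ccR_plus; [apply (qlog_ccR HRH); unfold xl in *; lra|].
      intros u Hu. destruct (qlog_ccR HRH y (x + h) 4 ltac:(unfold xl in *; lra) u Hu).
      split; simpl; apply (continuous_opp (V := R_NormedModule)); auto.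
    - intros a Ha. pose proof (cond_pos d1); pose proof (cond_pos d2).
      assert (Hy : Rabs (a - a) < d1 /\ Rabs (a - a) < d2) by (rewrite Rminus_diag, Rabs_R0; lra).
      pose proof (H1 a y a (y + k) ltac:(lra) ltac:(lra) ltac:(lra) ltac:(lra) (proj1 Hy)) as U1.
      pose proof (H2 a y a (y + k) ltac:(lra) ltac:(lra) ltac:(lra) ltac:(lra) (proj2 Hy)) as U2.
      simpl in U1, U2. eapply Rle_trans; [apply Cmod_le_sum|].
      change (fst (qlog (a, (y + k)%R) - qlog (a, y))%C) with (fst (qlog (a, y + k)) - fst (qlog (a, y))).
      change (snd (qlog (a, (y + k)%R) - qlog (a, y))%C) with (snd (qlog (a, y + k)) - snd (qlog (a, y))). apply Rle_trans with (eps / 32 + eps / 32); [apply Rplus_le_compat; apply Rlt_le; [exact U1|exact U2]|lra]. }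
  pose proof (Cmod_triangle (clog4 (y + k)%R - clog4 y) (- CI (fun a => qlog (a, (y + k)%R) - qlog (a, y))%C (x + h)%R 4)) as T. rewrite Cmod_opp in T.
  assert (eps / 16 * (4 - (x + h)) <= eps / 4).
  { replace (eps / 4) with (eps / 16 * 4) by field. apply Rmult_le_compat_l; [lra|]. unfold xl in *; lra. }
  lra.
Qed.

(** No independence of the path is shown: a continuous function whose exponential is [zreg] is
    regular by [log_branch_J]. *)
Lemma hlog_J (HRH : RH) s : 1 / 2 < fst s < 4 -> J hlog s.
Proof.
  intros Hs. set (d := Rmin (fst s - 1 / 2) (4 - fst s)).
  assert (Hd : 0 < d) by (unfold d; apply Rmin_glb_lt; lra).
  apply (log_branch_J hlog zreg s d); auto.
  - destruct s as [x y]. apply (hlog_ccont HRH); auto.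
  - apply zreg_neq_0; auto; lra.
  - apply zreg_J; lra.
  - intros w Hw. apply (cexp_hlog HRH). pose proof (Cmod_fst w) as F1.
    assert (F2 : Rabs (fst w) < d) by lra. apply Rabs_def2 in F2. simpl.
    pose proof (Rmin_l (fst s - 1 / 2) (4 - fst s)); pose proof (Rmin_r (fst s - 1 / 2) (4 - fst s)). unfold d in *. lra.
Qed.

Lemma exp1_lower : 61 / 25 <= exp 1.
Proof.
  assert (H : 5 / 4 <= exp (1 / 4)). { pose proof (exp_ineq1_le (1 / 4)). lra. }
  replace 1 with (1 / 4 + 1 / 4 + (1 / 4 + 1 / 4)) by field. rewrite !exp_plus.
  assert (25 / 16 <= exp (1 / 4) * exp (1 / 4)) by nra. nra.
Qed.

Lemma ln_bound (x y : R) : 0 < x -> x <= exp y -> ln x <= y.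
Proof. intros Hx H. rewrite <- (ln_exp y). apply ln_le_compat; auto. Qed.

Lemma Lam_abs_series x : 1 < x -> ex_series (fun k => Lam (S k) * rpow (INR (S k)) (- x)) /\
  fst (DS Lam (x, 0)) = Series (fun k => Lam (S k) * rpow (INR (S k)) (- x)).
Proof.
  intros Hx. pose proof (absconv_fst _ (DS_Lam_absconv (x, 0) Hx)) as A.
  assert (E : forall k, fst (RtoC (Lam (S k)) * kpow (- (x, 0)) (INR (S k)))%C = Lam (S k) * rpow (INR (S k)) (- x)).
  { intros k. rewrite fst_term, Rmult_0_l, cos_0. ring. }
  split.
  - eapply ex_series_ext; [|exact A]. intros k. apply E.
  - unfold DS, CSeries. cbn [fst]. apply Series_ext. apply E.
Qed.

Lemma DS_Lam_bound s : 1 < fst s -> Cmod (DS Lam s) <= fst (DS Lam (fst s, 0)).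
Proof.
  intros Hs. destruct (Lam_abs_series (fst s) Hs) as [Hex ->].
  unfold DS. apply CSeries_bound; auto. intros k.
  rewrite Cmod_mult, kpow_mod, Cmod_R, Rabs_pos_eq by apply MobLam.Lam_nonneg. simpl fst. lra.
Qed.

Lemma DS_Lam_J s : 1 < fst s -> J (DS Lam) s.
Proof.
  intros Hs. destruct (DS_jet Lam _ _ s (Lam_grow ((fst s - 1) / 2) ltac:(lra)) ltac:(lra)) as [b Hb].
  do 2 eexists; eauto.
Qed.

(** On Re s = a the logarithmic derivative is at most [g a], a value on the real axis, and [g] is
    the derivative of the explicit [G]. So the integral over [3/2, 4] is at most
    [G 4 - G (3/2) <= 3], and the initial value [clog4] is at most 7/2. *)
Lemma hlog_right y : Cmod (hlog (3 / 2, y)) <= 13 / 2.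
Proof.
  set (g := fun a => / (a * (a - 1)) + fst (DS Lam (a, 0))).
  set (G := fun a => ln ((a - 1) / a) - ln (Cmod (zeta (a, 0)))).
  assert (Hg : forall a, 3 / 2 <= a <= 4 -> continuous g a).
  { intros a Ha. unfold g. apply (continuous_plus (V := R_NormedModule) (fun a => / (a * (a - 1))) (fun a => fst (DS Lam (a, 0)))).
    - apply (ex_derive_continuous (V := R_NormedModule)). auto_derive. apply Rgt_not_eq. nra.
    - apply (cont2_fst (fun u v => fst (DS Lam (u, v)))). apply ccont_fst. apply J_ccont. apply DS_Lam_J. simpl; lra. }
  assert (HG : forall a, 3 / 2 <= a <= 4 -> is_derive G a (g a)).
  { intros a Ha. unfold G, g. replace (/ (a * (a - 1)) + fst (DS Lam (a, 0))) with (/ (a * (a - 1)) - - fst (DS Lam (a, 0))) by ring.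
    apply (is_derive_minus (V := R_NormedModule) (fun a => ln ((a - 1) / a)) (fun a => ln (Cmod (zeta (a, 0))))).
    - auto_derive; [split; [lra|split; [|auto]]; apply Rdiv_lt_0_compat; lra|]. field. lra.
    - apply ln_zeta_deriv; lra. }
  assert (Hint : RInt g (3 / 2) 4 = G 4 - G (3 / 2)).
  { apply is_RInt_unique. apply (is_RInt_derive (V := R_CompleteNormedModule) G g); rewrite Rmin_left, Rmax_right by lra; auto. }
  assert (HCI : Cmod (CI (fun a => qlog (a, y)) (3 / 2) 4) <= G 4 - G (3 / 2)).
  { rewrite <- Hint. apply CI_bound_int; [lra| | |].
    - intros a Ha. assert (J (fun s => dzreg s / zreg s)%C (a, y)).
      { apply J_div; [apply dzreg_J; simpl; lra|apply zreg_J; simpl; lra|]. apply zreg_ratio. simpl; lra. }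
      pose proof (J_ccont _ _ H) as Hc.
      split; [apply (cont2_fst (fun u v => fst (qlog (u, v)))); apply (ccont_fst _ _ _ Hc)|apply (cont2_fst (fun u v => snd (qlog (u, v)))); apply (ccont_snd _ _ _ Hc)].
    - apply (ex_RInt_continuous (V := R_CompleteNormedModule)). rewrite Rmin_left, Rmax_right by lra. auto.
    - intros a Ha. set (s := (a, y) : C). unfold qlog. destruct (zreg_ratio s ltac:(unfold s; simpl; lra)) as [_ ->].
      eapply Rle_trans; [apply Cmod_minus_le|]. unfold g.
      apply Rplus_le_compat; [|apply (DS_Lam_bound s); unfold s; simpl; lra].
      assert (N0 : a <= Cmod s) by (apply (fst_le_Cmod s)).
      assert (N1 : a - 1 <= Cmod (s - 1)) by (apply (fst_le_Cmod (s - 1)%C)).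
      rewrite Cmod_inv.
      + rewrite Cmod_mult. apply Rinv_le_contravar; [nra|]. apply Rmult_le_compat; lra.
      + apply Cmult_neq_0; apply Cneq_0_Cmod; lra. }
  unfold hlog. cbn [fst snd].
  eapply Rle_trans; [apply Cmod_minus_le|].
  pose proof exp1_lower as He.
  assert (Hz : forall z, Cmod (z - 1) <= 2 / 3 -> 1 / 3 <= Cmod z <= 5 / 3).
  { intros z Hz. pose proof (Cmod_sub_triangle 1 z). rewrite (Cmod_sub_sym 1 z), Cmod_1 in H.
    pose proof (Cmod_sub_triangle z 1). rewrite Cmod_1 in H0. lra. }
  assert (G4 : G 4 - G (3 / 2) <= 3).
  { unfold G. replace ((4 - 1) / 4) with (3 / 4) by field. replace ((3 / 2 - 1) / (3 / 2)) with (1 / 3) by field.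
    assert (Z4 : 2 / 3 <= Cmod (zeta (4, 0))).
    { pose proof (DS_cst1_right (4, 0) ltac:(simpl; lra)). pose proof (Cmod_sub_triangle 1 (zeta (4, 0))) as H1. rewrite Cmod_sub_sym, Cmod_1 in H1. lra. }
    assert (Z3 : Cmod (zeta (3 / 2, 0)) <= 3).
    { rewrite zeta_DS by (simpl; lra). eapply Rle_trans; [apply (DS_bound cst1 1 0); [apply cst1_grow|simpl; lra]|]. simpl fst. right. field. }
    assert (Z3p : 0 < Cmod (zeta (3 / 2, 0))). { apply Cmod_gt_0. apply zeta_neq_0_right. simpl; lra. }
    apply ln_le_compat in Z4; [|lra]. apply ln_le_compat in Z3; auto.
    assert (L : ln (3 / 4) - ln (2 / 3) - (ln (1 / 3) - ln 3) <= 3).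
    { rewrite <- (ln_div (3 / 4) (2 / 3)), <- (ln_div (1 / 3) 3), <- ln_div by lra. apply ln_bound; [lra|].
      replace (exp 3) with (exp (1 + 1 + 1)) by (f_equal; ring). rewrite !exp_plus. assert (5 <= exp 1 * exp 1) by nra. nra. }
    lra. }
  assert (H4 : Cmod (clog4 y) <= 7 / 2).
  { eapply Rle_trans; [apply Cmod_le_sum|]. unfold clog4. cbn [fst snd].
    pose proof (Hz _ (zreg4_near y)) as [Z1 Z2].
    assert (B1 : Rabs (ln (Cmod (zreg (4, y)))) <= 3 / 2).
    { assert (E3 : 3 <= exp (3 / 2)).
      { assert (E0 : 3 / 2 <= exp (1 / 2)) by (pose proof (exp_ineq1_le (1 / 2)); lra). replace (3 / 2) with (1 + 1 / 2) by field. rewrite exp_plus. nra. }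
      apply Rabs_le. split.
      - apply Rle_trans with (ln (1 / 3)); [|apply ln_le_compat; auto; lra].
        replace (1 / 3) with (/ 3) by field. rewrite ln_Rinv by lra. apply Ropp_le_contravar. apply ln_bound; lra.
      - apply ln_bound; [lra|]. lra. }
    pose proof (atan_bound (snd (zreg (4, y)) / fst (zreg (4, y)))) as Hat. pose proof PI_4.
    assert (B2 : Rabs (atan (snd (zreg (4, y)) / fst (zreg (4, y)))) <= 2) by (apply Rabs_le; lra).
    lra. }
  lra.
Qed.

(** * Bounds for [1/zeta] under RH *)

Lemma Cmod_shift_gauss (k : R) (s0 s : C) :
  Cmod (cexp (RtoC k * ((s - s0) * (s - s0)))) = exp (k * ((fst s - fst s0) ^ 2 - (snd s - snd s0) ^ 2)).
Proof. rewrite Cmod_cexp. f_equal. simpl. ring. Qed.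

Lemma J_gauss (k : R) (s0 s : C) : J (fun w => cexp (RtoC k * ((w - s0) * (w - s0)))%C) s.
Proof.
  apply J_cexp. apply J_mult; [apply J_const|]. apply J_mult; apply J_minus; try apply J_id; apply J_const.
Qed.

Lemma exp_neg_bound x : 0 <= x -> exp (- x) * (1 + x) <= 1.
Proof.
  intros Hx. pose proof (exp_ineq1_le x). pose proof (exp_pos (- x)).
  assert (exp (- x) * exp x = 1) by (rewrite <- exp_plus; replace (- x + x) with 0 by ring; apply exp_0). nra.
Qed.

(* Borel--Caratheodory in a strip: Re h <= S makes phi = h/(2S - h) a self-map of the disc,
   and phi is small on the right edge. *)
Lemma log_bound_step (b c eps S : R) : RH -> 1 / 2 < b -> b < c < 3 / 2 -> 0 < eps <= 1 / 10000 -> 7 <= S ->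
  (forall t, Cmod (zreg (b, t)) <= exp (S + eps * t ^ 2)) ->
  ln 7 + 1 / 100 <= (c - b) / (3 / 2 - b) * ln ((2 * S - 7) / 7) ->
  forall t, Cmod (hlog (c, t)) <= (S + 2 * eps * t ^ 2) / 3 + 2 * eps.
Proof.
  intros HR Hb Hc He HS HP Hq t0.
  (* The term [2 eps (s - s0)^2] turns the bound [S + eps t^2] on the left edge into the constant
     [S'], because [t^2 - 2 (t - t0)^2 = 2 t0^2 - (t - 2 t0)^2]. *)
  set (s0 := (b, t0) : C). set (S' := S + 2 * eps * t0 ^ 2).
  assert (HS' : S <= S'). { unfold S'. pose proof (pow2_ge_0 t0). nra. }
  set (ht := fun s => (hlog s + RtoC (2 * eps) * ((s - s0) * (s - s0)))%C).
  assert (Eht : forall s, b <= fst s <= 3 / 2 -> cexp (ht s) = (zreg s * cexp (RtoC (2 * eps) * ((s - s0) * (s - s0))))%C).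
  { intros s Hs. unfold ht. rewrite cexp_plus, cexp_hlog by (auto; lra). auto. }
  assert (Jht : forall s, b <= fst s <= 3 / 2 -> J ht s).
  { intros s Hs. unfold ht. apply J_plus; [apply hlog_J; auto; lra|]. apply J_mult; [apply J_const|]. apply J_mult; apply J_minus; try apply J_id; apply J_const. }
  assert (HR1 : forall t, Cmod (ht (3 / 2, t)) <= 13 / 2 + 2 * eps * (1 + (t - t0) ^ 2)).
  { intros t. unfold ht. eapply Rle_trans; [apply Cmod_triangle|]. apply Rplus_le_compat; [apply hlog_right|].
    rewrite !Cmod_mult, Cmod_real by lra. apply Rmult_le_compat_l; [lra|].
    replace (Cmod ((3 / 2, t) - s0) * Cmod ((3 / 2, t) - s0)) with (Cmod ((3 / 2, t) - s0) ^ 2) by ring.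
    rewrite Cmod_sqr. unfold s0. simpl. unfold Rdiv. nra. }
  assert (HR2 : forall t, fst (ht (3 / 2, t)) <= 7).
  { intros t. unfold ht.
    replace (fst _) with (fst (hlog (3 / 2, t)) + 2 * eps * ((3 / 2 - b) ^ 2 - (t - t0) ^ 2)) by (unfold s0; simpl; ring).
    pose proof (fst_le_Cmod (hlog (3 / 2, t))). pose proof (hlog_right t). pose proof (pow2_ge_0 (t - t0)).
    assert ((3 / 2 - b) ^ 2 <= 1) by (simpl; nra). nra. }
  assert (HL : forall t, fst (ht (b, t)) <= S').
  { intros t.
    assert (H1 : exp (fst (ht (b, t))) <= exp S').
    { rewrite <- Cmod_cexp, Eht by (simpl; lra). rewrite Cmod_mult, Cmod_shift_gauss. unfold s0. cbn [fst snd].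
      eapply Rle_trans; [apply Rmult_le_compat_r; [left; apply exp_pos|apply HP]|]. rewrite <- exp_plus. apply exp_le_compat.
      unfold S'. pose proof (pow2_ge_0 (t - 2 * t0)). simpl in *. nra. }
    apply Rnot_lt_le; intros Hlt. apply exp_increasing in Hlt. lra. }
  (* The maximum principle for exp(ht) carries the bound from the two edges to the strip. The large
     constant passed to [strip_max] only witnesses boundedness: linear growth of [zreg] against the
     Gaussian. *)
  assert (HI : forall s, b <= fst s <= 3 / 2 -> fst (ht s) <= S').
  { intros s Hs.
    assert (H1 : exp (fst (ht s)) <= exp S').
    { rewrite <- Cmod_cexp.
      apply (strip_max (fun w => cexp (ht w)) b (3 / 2) (3 * (3 + Rabs t0 + / (2 * eps)) * exp 1)); auto; [lra|apply exp_pos| | | |].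
      - intros w Hw. apply J_cexp. auto.
      - intros w Hw. rewrite Eht by auto. rewrite Cmod_mult, Cmod_shift_gauss.
        set (v := snd w - snd s0).
        assert (A1 : Cmod (zreg w) <= 3 * (3 + Rabs t0 + Rabs v)).
        { eapply Rle_trans; [apply zreg_bound; lra|].
          assert (/ fst w <= 2). { replace 2 with (/ (1 / 2)) by field. apply Rinv_le_contravar; lra. }
          assert (0 < / fst w) by (apply Rinv_0_lt_compat; lra).
          assert (Cmod (w - 1) <= 1 + (Rabs t0 + Rabs v)).
          { eapply Rle_trans; [apply Cmod_le_sum|]. apply Rplus_le_compat.
            - simpl. apply Rabs_le. lra.
            - simpl. replace (snd w + - 0) with (t0 + v) by (unfold v, s0; simpl; ring). apply Rabs_triang. }
          pose proof (Cmod_ge_0 (w - 1)). nra. }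
        assert (A2 : exp (2 * eps * ((fst w - fst s0) ^ 2 - v ^ 2)) <= exp 1 * exp (- (2 * eps * v ^ 2))).
        { rewrite <- exp_plus. apply exp_le_compat. assert ((fst w - fst s0) ^ 2 <= 1) by (unfold s0; simpl; nra). nra. }
        pose proof (exp_neg_bound (2 * eps * v ^ 2) ltac:(pose proof (pow2_ge_0 v); nra)) as A3.
        pose proof (exp_pos (- (2 * eps * v ^ 2))) as A4. pose proof (exp_pos 1) as A5.
        set (g := exp (- (2 * eps * v ^ 2))) in *.
        assert (A6 : g <= 1). { pose proof (pow2_ge_0 v). assert (0 <= 2 * eps * v ^ 2) by nra. nra. }
        assert (A7 : Rabs v * g <= / (2 * eps)).
        { assert (Rabs v <= 1 + v ^ 2). { rewrite <- pow2_abs. pose proof (Rabs_pos v). simpl. nra. }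
          apply Rmult_le_reg_l with (2 * eps); [lra|]. rewrite Rinv_r by lra.
          assert (2 * eps * Rabs v <= 1 + 2 * eps * v ^ 2) by nra. pose proof (Rabs_pos v). nra. }
        pose proof (Rabs_pos t0). pose proof (Rabs_pos v).
        apply Rle_trans with (3 * (3 + Rabs t0 + Rabs v) * (exp 1 * g)).
        { apply Rmult_le_compat; auto; [apply Cmod_ge_0|left; apply exp_pos]. }
        assert ((3 + Rabs t0 + Rabs v) * g <= 3 + Rabs t0 + / (2 * eps)) by nra.
        assert (exp 1 * ((3 + Rabs t0 + Rabs v) * g) <= exp 1 * (3 + Rabs t0 + / (2 * eps))) by (apply Rmult_le_compat_l; lra).
        lra.
      - intros t. rewrite Cmod_cexp. apply exp_le_compat. apply HL.
      - intros t. rewrite Cmod_cexp. apply exp_le_compat. eapply Rle_trans; [apply HR2|lra]. }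
    apply Rnot_lt_le; intros Hlt. apply exp_increasing in Hlt. lra. }
  assert (Edef : forall s, hlog s = (ht s - RtoC (2 * eps) * ((s - s0) * (s - s0)))%C) by (intros; unfold ht; ring).
  clearbody ht.
  set (den := fun s => (RtoC (2 * S') - ht s)%C).
  assert (Hden : forall s, b <= fst s <= 3 / 2 -> S' <= Cmod (den s) /\ Cmod (ht s) <= Cmod (den s)).
  { intros s Hs. specialize (HI s Hs). split.
    - eapply Rle_trans; [|apply fst_le_Cmod]. unfold den. simpl. lra.
    - apply Rsqr_incr_0_var; [|apply Cmod_ge_0]. rewrite !Rsqr_pow2, !Cmod_sqr. unfold den. simpl. nra. }
  set (sc := (c, t0) : C).
  (* This second Gaussian, centred at c + i t0, compensates the term [2 eps (t - t0)^2] in the bound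
     for [ht] on the right edge. It costs at most the factor exp(1/100). *)
  set (phi := fun s => (ht s / den s * cexp (RtoC (1 / 100) * ((s - sc) * (s - sc))))%C).
  assert (Hphi : forall s, b <= fst s <= 3 / 2 -> Cmod (phi s) = Cmod (ht s) / Cmod (den s) * exp (1 / 100 * ((fst s - c) ^ 2 - (snd s - t0) ^ 2))).
  { intros s Hs. unfold phi. destruct (Hden s Hs). rewrite Cmod_mult, Cmod_div by (apply Cneq_0_Cmod; lra). rewrite Cmod_shift_gauss. reflexivity. }
  assert (Hr1 : forall s, b <= fst s <= 3 / 2 -> 0 <= Cmod (ht s) / Cmod (den s) <= 1).
  { intros s Hs. destruct (Hden s Hs). split.
    - apply Rmult_le_pos; [apply Cmod_ge_0|left; apply Rinv_0_lt_compat; lra].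
    - apply Rmult_le_reg_r with (Cmod (den s)); [lra|]. unfold Rdiv. rewrite Rmult_assoc, Rinv_l; lra. }
  assert (Hg1 : forall s, b <= fst s <= 3 / 2 -> exp (1 / 100 * ((fst s - c) ^ 2 - (snd s - t0) ^ 2)) <= exp (1 / 100)).
  { intros s Hs. apply exp_le_compat. pose proof (pow2_ge_0 (snd s - t0)). assert ((fst s - c) ^ 2 <= 1) by (simpl; nra). lra. }
  assert (Hb1 : forall s, b <= fst s <= 3 / 2 -> Cmod (phi s) <= exp (1 / 100)).
  { intros s Hs. rewrite Hphi by auto. pose proof (Hr1 s Hs). pose proof (Hg1 s Hs).
    pose proof (exp_pos (1 / 100 * ((fst s - c) ^ 2 - (snd s - t0) ^ 2))). nra. }
  assert (E100 : exp (1 / 100) <= 102 / 100).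
  { pose proof (exp_neg_bound (1 / 100) ltac:(lra)) as H.
    pose proof (exp_ineq1_le (- (1 / 100))) as H1. pose proof (exp_pos (1 / 100)).
    assert (exp (1 / 100) * exp (- (1 / 100)) = 1) by (rewrite <- exp_plus; replace (1 / 100 + - (1 / 100)) with 0 by ring; apply exp_0).
    nra. }
  assert (Hedge : forall y, Cmod (phi (3 / 2, y)) <= exp (- ln ((2 * S - 7) / 7))).
  { intros y. assert (Hs : b <= fst (3 / 2, y) <= 3 / 2) by (simpl; lra). rewrite Hphi by auto.
    rewrite exp_Ropp, exp_ln by (apply Rdiv_lt_0_compat; lra).
    cbn [fst snd]. set (v := y - t0).
    assert (D1 : 2 * S - 7 <= Cmod (den (3 / 2, y))).
    { eapply Rle_trans; [|apply fst_le_Cmod]. unfold den. pose proof (HR2 y). simpl. lra. }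
    pose proof (HR1 y) as N1. fold v in N1.
    assert (G1 : exp (1 / 100 * ((3 / 2 - c) ^ 2 - v ^ 2)) <= exp (1 / 100) * exp (- (1 / 100 * v ^ 2))).
    { rewrite <- exp_plus. apply exp_le_compat. assert ((3 / 2 - c) ^ 2 <= 1) by (simpl; nra). lra. }
    pose proof (exp_neg_bound (1 / 100 * v ^ 2) ltac:(pose proof (pow2_ge_0 v); lra)) as G2.
    pose proof (exp_pos (- (1 / 100 * v ^ 2))) as G3. set (g := exp (- (1 / 100 * v ^ 2))) in *.
    pose proof (pow2_ge_0 v) as V0.
    assert (G4 : g <= 1) by nra.
    assert (G5 : (13 / 2 + 2 * eps * (1 + v ^ 2)) * g <= 13 / 2 + 3 / 100).
    { assert (v ^ 2 * g <= 100) by nra. assert (2 * eps * (v ^ 2 * g) <= 2 / 100) by nra. nra. }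
    replace (/ ((2 * S - 7) / 7)) with (7 / (2 * S - 7)) by (field; lra).
    assert (F1 : 0 < 2 * S - 7) by lra.
    assert (F2 : Cmod (ht (3 / 2, y)) * exp (1 / 100 * ((3 / 2 - c) ^ 2 - v ^ 2)) <= 7).
    { apply Rle_trans with ((13 / 2 + 2 * eps * (1 + v ^ 2)) * (exp (1 / 100) * g)).
      - apply Rmult_le_compat; auto; [apply Cmod_ge_0|left; apply exp_pos].
      - pose proof (exp_pos (1 / 100)). nra. }
    apply Rmult_le_reg_r with (2 * S - 7); auto. replace (7 / (2 * S - 7) * (2 * S - 7)) with 7 by (field; lra).
    eapply Rle_trans; [|exact F2].
    set (A := Cmod (ht (3 / 2, y))) in *. set (E := exp (1 / 100 * ((3 / 2 - c) ^ 2 - v ^ 2))) in *. set (Dn := Cmod (den (3 / 2, y))) in *.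
    assert (0 <= A) by apply Cmod_ge_0. assert (0 < E) by apply exp_pos.
    replace (A / Dn * E * (2 * S - 7)) with (A * E * ((2 * S - 7) / Dn)) by (field; lra).
    rewrite <- (Rmult_1_r (A * E)) at 2. apply Rmult_le_compat_l; [nra|].
    apply Rmult_le_reg_r with Dn; [lra|]. unfold Rdiv. rewrite Rmult_assoc, Rinv_l; lra. }
  pose proof (three_lines phi b (3 / 2) (exp (1 / 100)) (1 / 100) (- ln ((2 * S - 7) / 7)) ltac:(lra)) as TL.
  assert (Hphic : Cmod (phi sc) <= 1 / 7).
  { eapply Rle_trans; [apply TL|]; auto.
    - intros s Hs. unfold phi. destruct (Hden s Hs). apply J_mult; [|apply J_gauss].
      apply J_div; [auto| |apply Cneq_0_Cmod; lra]. unfold den. apply J_minus; [apply J_const|auto].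
    - intros y. apply Hb1. simpl; lra.
    - unfold sc; simpl; lra.
    - unfold sc. cbn [fst]. replace (1 / 7) with (exp (- ln 7)) by (rewrite exp_Ropp, exp_ln; lra).
      apply exp_le_compat. set (th := (c - b) / (3 / 2 - b)) in *.
      replace (((3 / 2 - c) * (1 / 100) + (c - b) * - ln ((2 * S - 7) / 7)) / (3 / 2 - b)) with ((1 - th) * (1 / 100) - th * ln ((2 * S - 7) / 7)) by (unfold th; field; lra).
      assert (0 <= th). { unfold th. apply Rmult_le_pos; [lra|left; apply Rinv_0_lt_compat; lra]. }
      lra. }
  assert (Hsc : b <= fst sc <= 3 / 2) by (unfold sc; simpl; lra).
  rewrite Hphi in Hphic by auto. unfold sc in Hphic at 3 4. cbn [fst snd] in Hphic.
  replace (1 / 100 * ((c - c) ^ 2 - (t0 - t0) ^ 2)) with 0 in Hphic by ring. rewrite exp_0, Rmult_1_r in Hphic.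
  destruct (Hden sc Hsc) as [Hd1 Hd2].
  (* From |phi| <= 1/7 follows |ht| <= (2 S' + |ht|)/7, hence the bound S'/3. The value 7 in the
     hypothesis [Hq] is chosen for this factor 1/3. *)
  assert (Hht : Cmod (ht sc) <= S' / 3).
  { assert (Cmod (ht sc) <= 1 / 7 * Cmod (den sc)).
    { apply Rmult_le_reg_r with (/ Cmod (den sc)); [apply Rinv_0_lt_compat; lra|]. rewrite Rmult_assoc, Rinv_r by lra. unfold Rdiv in *. lra. }
    assert (Cmod (den sc) <= 2 * S' + Cmod (ht sc)). { unfold den. eapply Rle_trans; [apply Cmod_minus_le|]. rewrite Cmod_real by lra. lra. }
    lra. }
  fold sc. rewrite Edef.
  eapply Rle_trans; [apply Cmod_minus_le|]. unfold S' in Hht. apply Rplus_le_compat; auto.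
  rewrite !Cmod_mult, Cmod_real by lra. rewrite <- (Rmult_1_r (2 * eps)) at 2. apply Rmult_le_compat_l; [lra|].
  replace (Cmod (sc - s0) * Cmod (sc - s0)) with (Cmod (sc - s0) ^ 2) by ring. rewrite Cmod_sqr. unfold sc, s0. simpl. nra.
Qed.

(** With [z = |t| / T] this reduces to [1 <= exp (z^2)] and [z <= exp (z^2)]: against a Gaussian of
    width [T], linear growth counts as the constant [2 + T]. *)
Lemma gauss_sup (T t : R) : 0 < T -> (2 + Rabs t) <= (2 + T) * exp (/ T ^ 2 * t ^ 2).
Proof.
  intros HT. pose proof (Rabs_pos t).
  assert (HT2 : 0 < / T ^ 2) by (apply Rinv_0_lt_compat, pow_lt; auto).
  assert (H1 : 1 + / T ^ 2 * t ^ 2 <= exp (/ T ^ 2 * t ^ 2)) by apply exp_ineq1_le.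
  set (z := Rabs t / T). assert (Ez : / T ^ 2 * t ^ 2 = z ^ 2). { unfold z. rewrite <- (pow2_abs t). field. lra. }
  rewrite Ez in *. assert (Et : Rabs t = z * T) by (unfold z; field; lra).
  assert (Hz : 0 <= z) by (unfold z; apply Rmult_le_pos; [lra|left; apply Rinv_0_lt_compat; lra]).
  assert (H2 : z <= exp (z ^ 2)) by (simpl in *; nra). pose proof (pow2_ge_0 z). rewrite Et. nra.
Qed.

(* The exponent that the three lines theorem, applied between [Re s = 1/50] and [Re s = c], contributes on [Re s = b]. *)
Definition tau (b c T : R) : R := (c - b) / (c - 1 / 50) * (ln T + 6).

Lemma convexity_step (b c T S : R) : RH -> 1 / 2 < b -> b < c < 3 / 2 -> 100 <= T -> 7 <= S ->
  (forall t, Cmod (zreg (b, t)) <= exp (S + / T ^ 2 * t ^ 2)) ->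
  ln 7 + 1 / 100 <= (c - b) / (3 / 2 - b) * ln ((2 * S - 7) / 7) ->
  forall t, Cmod (zreg (b, t)) <= exp (tau b c T + S / 3 + 1 / 100 + / T ^ 2 * t ^ 2).
Proof.
  intros HR Hb Hc HT HS HP Hq.
  set (eps := / T ^ 2) in *.
  assert (He : 0 < eps <= 1 / 10000).
  { unfold eps. split; [apply Rinv_0_lt_compat, pow_lt; lra|]. replace (1 / 10000) with (/ 100 ^ 2) by field.
    apply Rinv_le_contravar; [apply pow_lt; lra|apply pow_incr; lra]. }
  pose proof (log_bound_step b c eps S HR Hb Hc He HS HP Hq) as Hh.
  set (g := fun s => (zreg s * cexp (RtoC eps * ((s - 0) * (s - 0))))%C).
  assert (Hg : forall s, Cmod (g s) = Cmod (zreg s) * exp (eps * (fst s ^ 2 - snd s ^ 2))).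
  { intros s. unfold g. rewrite Cmod_mult, Cmod_shift_gauss. simpl. f_equal. f_equal. ring. }
  assert (HL6 : 52 * 2 <= exp 6).
  { pose proof exp1_lower as H1. replace 6 with (1 + 1 + 1 + (1 + 1 + 1)) by ring. rewrite !exp_plus.
    assert (H2 : 11 <= exp 1 * exp 1 * exp 1) by nra. nra. }
  (* The left edge is near 0 to keep the interpolation factor (c-b)/(c-1/50) small, yet [zreg] is
     still at most [51 (2 + |t|)] there, whence [ln T + 6]. On the right edge the growth
     [2 eps y^2 / 3] allowed by [log_bound_step] is outweighed by the damping [eps y^2]. *)
  pose proof (three_lines g (1 / 50) c (51 * (4 + T) * exp 1) (ln T + 6) (S / 3 + 1 / 100) ltac:(lra)) as TL.
  intros t. specialize (TL) .
  assert (Hz : forall s, 1 / 50 <= fst s <= c -> Cmod (zreg s) <= 51 * (2 + Rabs (snd s))).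
  { intros s Hs. eapply Rle_trans; [apply zreg_bound; lra|].
    assert (/ fst s <= 50). { replace 50 with (/ (1 / 50)) by field. apply Rinv_le_contravar; lra. }
    assert (0 < / fst s) by (apply Rinv_0_lt_compat; lra).
    assert (Cmod (s - 1) <= 1 + Rabs (snd s)).
    { eapply Rle_trans; [apply Cmod_le_sum|]. simpl. replace (snd s + - 0) with (snd s) by ring. apply Rplus_le_compat_r. apply Rabs_le. lra. }
    pose proof (Cmod_ge_0 (s - 1)). nra. }
  assert (Hbase : forall s, 1 / 50 <= fst s <= c -> Cmod (g s) <= 51 * (2 + T) * exp (eps * fst s ^ 2)).
  { intros s Hs. rewrite Hg. pose proof (gauss_sup T (snd s) ltac:(lra)) as Hgs. fold eps in Hgs.
    replace (eps * (fst s ^ 2 - snd s ^ 2)) with (eps * fst s ^ 2 + - (eps * snd s ^ 2)) by ring. rewrite exp_plus, exp_Ropp.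
    pose proof (exp_pos (eps * fst s ^ 2)) as P1. pose proof (exp_pos (eps * snd s ^ 2)) as P2. pose proof (Hz s Hs).
    assert (P3 : Cmod (zreg s) * / exp (eps * snd s ^ 2) <= 51 * (2 + T)).
    { apply Rmult_le_reg_r with (exp (eps * snd s ^ 2)); auto. rewrite Rmult_assoc, Rinv_l, Rmult_1_r by lra. lra. }
    replace (Cmod (zreg s) * (exp (eps * fst s ^ 2) * / exp (eps * snd s ^ 2))) with ((Cmod (zreg s) * / exp (eps * snd s ^ 2)) * exp (eps * fst s ^ 2)) by ring.
    apply Rmult_le_compat_r; lra. }
  assert (Hb2 : Cmod (g (b, t)) <= exp (((c - b) * (ln T + 6) + (b - 1 / 50) * (S / 3 + 1 / 100)) / (c - 1 / 50))).
  { apply (TL); simpl; try lra.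
    - intros s Hs. unfold g. apply J_mult; [apply zreg_J; lra|apply J_gauss].
    - intros s Hs. eapply Rle_trans; [apply Hbase; auto|].
      assert (exp (eps * fst s ^ 2) <= exp 1). { apply exp_le_compat. assert (fst s ^ 2 <= 4) by (simpl; nra). pose proof (pow2_ge_0 (fst s)). nra. }
      pose proof (exp_pos 1). pose proof (exp_pos (eps * fst s ^ 2)). apply Rmult_le_compat; lra.
    - intros y. eapply Rle_trans; [apply Hbase; simpl; lra|]. cbn [fst].
      rewrite exp_plus, exp_ln by lra.
      assert (E1 : exp (eps * (1 / 50) ^ 2) <= 101 / 100).
      { apply Rle_trans with (exp (1 / 1000)); [apply exp_le_compat; simpl; lra|].
        pose proof (exp_neg_bound (1 / 1000) ltac:(lra)). pose proof (exp_ineq1_le (- (1 / 1000))). pose proof (exp_pos (1 / 1000)).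
        assert (exp (1 / 1000) * exp (- (1 / 1000)) = 1) by (rewrite <- exp_plus; replace (1 / 1000 + - (1 / 1000)) with 0 by ring; apply exp_0). nra. }
      pose proof (exp_pos (eps * (1 / 50) ^ 2)). nra.
    - intros y. rewrite Hg. cbn [fst snd].
      assert (Hzc : Cmod (zreg (c, y)) <= exp ((S + 2 * eps * y ^ 2) / 3 + 2 * eps)).
      { rewrite <- (cexp_hlog HR (c, y)) by (simpl; lra). rewrite Cmod_cexp. apply exp_le_compat.
        eapply Rle_trans; [apply fst_le_Cmod|apply Hh]. }
      eapply Rle_trans; [apply Rmult_le_compat_r; [left; apply exp_pos|exact Hzc]|].
      rewrite <- exp_plus. apply exp_le_compat. pose proof (pow2_ge_0 y). assert (c ^ 2 <= 9 / 4) by (simpl; nra). pose proof (pow2_ge_0 c). nra. }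
  rewrite Hg in Hb2. cbn [fst snd] in Hb2.
  replace (eps * (b ^ 2 - t ^ 2)) with (eps * b ^ 2 + - (eps * t ^ 2)) in Hb2 by ring. rewrite exp_plus, exp_Ropp in Hb2.
  assert (B1 : 1 <= exp (eps * b ^ 2)). { pose proof (exp_ineq1_le (eps * b ^ 2)). pose proof (pow2_ge_0 b). nra. }
  set (X := ((c - b) * (ln T + 6) + (b - 1 / 50) * (S / 3 + 1 / 100)) / (c - 1 / 50)) in *.
  assert (HX : X <= tau b c T + S / 3 + 1 / 100).
  { unfold X, tau. replace (((c - b) * (ln T + 6) + (b - 1 / 50) * (S / 3 + 1 / 100)) / (c - 1 / 50))
      with ((c - b) / (c - 1 / 50) * (ln T + 6) + (b - 1 / 50) / (c - 1 / 50) * (S / 3 + 1 / 100)) by (field; lra).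
    assert ((b - 1 / 50) / (c - 1 / 50) <= 1). { apply Rmult_le_reg_r with (c - 1 / 50); [lra|]. unfold Rdiv. rewrite Rmult_assoc, Rinv_l; lra. }
    nra. }
  rewrite exp_plus. pose proof (exp_pos (eps * t ^ 2)) as P2.
  apply Rle_trans with (exp X * exp (eps * t ^ 2)).
  2:{ apply Rmult_le_compat_r; [lra|apply exp_le_compat; auto]. }
  apply Rmult_le_reg_r with (/ exp (eps * t ^ 2)); [apply Rinv_0_lt_compat; auto|].
  rewrite (Rmult_assoc (exp X)), Rinv_r, Rmult_1_r by lra.
  eapply Rle_trans; [|exact Hb2]. pose proof (Cmod_ge_0 (zreg (b, t))).
  assert (0 < / exp (eps * t ^ 2)) by (apply Rinv_0_lt_compat; auto).
  apply Rmult_le_compat_l; [auto|]. nra.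
Qed.

(* The fixed point of [S |-> tau + S/3 + 1/100], the improvement of the exponent in [convexity_step]. *)
Definition Sstar (b c T : R) : R := 3 / 2 * (tau b c T + 1 / 100).

(** Each application of [convexity_step] divides the excess over the fixed point [Sstar] by 3. The
    iteration starts from the linear bound for [zreg]; its values never drop below [Sstar], so the
    logarithmic hypothesis, monotone in [S], holds throughout. *)
Lemma zreg_line_bound (b c T : R) : RH -> 1 / 2 < b -> b < c < 3 / 2 -> 100 <= T -> 7 <= Sstar b c T ->
  ln 7 + 1 / 100 <= (c - b) / (3 / 2 - b) * ln ((2 * Sstar b c T - 7) / 7) ->
  forall t, Cmod (zreg (b, t)) <= exp (Sstar b c T + / T ^ 2 * t ^ 2).
Proof.
  intros HR Hb Hc HT HS Hq t.
  set (S0 := Rmax (Sstar b c T) (ln (3 * (2 + T)))).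
  assert (Hn : forall n t, Cmod (zreg (b, t)) <= exp (Sstar b c T + (/ 3) ^ n * (S0 - Sstar b c T) + / T ^ 2 * t ^ 2)).
  { pose proof (Rmax_l (Sstar b c T) (ln (3 * (2 + T)))) as M1. pose proof (Rmax_r (Sstar b c T) (ln (3 * (2 + T)))) as M2. fold S0 in M1, M2.
    induction n; intros y.
    - rewrite pow_O, Rmult_1_l. replace (Sstar b c T + (S0 - Sstar b c T)) with S0 by ring.
      rewrite exp_plus. apply Rle_trans with (3 * (2 + T) * exp (/ T ^ 2 * y ^ 2)).
      + eapply Rle_trans; [apply zreg_bound; simpl; lra|]. cbn [fst].
        pose proof (gauss_sup T y ltac:(lra)).
        assert (/ b <= 2). { replace 2 with (/ (1 / 2)) by field. apply Rinv_le_contravar; lra. }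
        assert (0 < / b) by (apply Rinv_0_lt_compat; lra).
        set (s := (b, y) : C).
        assert (Cmod (s - 1) <= 1 + Rabs y).
        { eapply Rle_trans; [apply Cmod_le_sum|]. unfold s. simpl. replace (y + - 0) with y by ring. apply Rplus_le_compat_r. apply Rabs_le. lra. }
        pose proof (Cmod_ge_0 (s - 1)). nra.
      + apply Rmult_le_compat_r; [left; apply exp_pos|]. rewrite <- (exp_ln (3 * (2 + T))) by lra. apply exp_le_compat; auto.
    - set (Sn := Sstar b c T + (/ 3) ^ n * (S0 - Sstar b c T)) in *.
      assert (HSn : Sstar b c T <= Sn). { unfold Sn. assert (0 <= (/ 3) ^ n) by (apply pow_le; lra). nra. }
      pose proof (convexity_step b c T Sn HR Hb Hc HT ltac:(lra) IHn) as Hstep.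
      assert (Hq2 : ln 7 + 1 / 100 <= (c - b) / (3 / 2 - b) * ln ((2 * Sn - 7) / 7)).
      { eapply Rle_trans; [exact Hq|]. apply Rmult_le_compat_l; [apply Rmult_le_pos; [lra|left; apply Rinv_0_lt_compat; lra]|].
        apply ln_le_compat; lra. }
      specialize (Hstep Hq2 y). eapply Rle_trans; [exact Hstep|]. apply exp_le_compat. apply Rplus_le_compat_r.
      unfold Sn. simpl pow. unfold Sstar. right. field. }
  set (E := / T ^ 2 * t ^ 2) in *. set (A := Cmod (zreg (b, t))) in *.
  destruct (Rle_dec A 0) as [HA|HA]; [pose proof (exp_pos (Sstar b c T + E)); lra|].
  assert (HlA : forall n, ln A - (Sstar b c T + E) <= (/ 3) ^ n * (S0 - Sstar b c T)).
  { intros n. specialize (Hn n t). fold E A in Hn. apply ln_bound in Hn; lra. }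
  assert (Hlim : ln A - (Sstar b c T + E) <= 0).
  { apply (is_lim_seq_le (fun _ => ln A - (Sstar b c T + E)) (fun n => (/ 3) ^ n * (S0 - Sstar b c T)) (ln A - (Sstar b c T + E)) 0); auto.
    - apply is_lim_seq_const.
    - replace (Finite 0) with (Rbar_mult 0 (S0 - Sstar b c T)) by (simpl; f_equal; ring).
      apply is_lim_seq_scal_r. apply is_lim_seq_geom. rewrite Rabs_pos_eq; lra. }
  rewrite <- (exp_ln A) by lra. apply exp_le_compat. lra.
Qed.

(** [log_bound_step] at the fixed point: a third of [Sstar] is tau/2 + 1/200, and for |t| <= T the
    Gaussian excess adds at most 2/3 plus 2/10000. *)
Lemma inv_zreg_bound (b c T : R) : RH -> 1 / 2 < b -> b < c < 3 / 2 -> 100 <= T -> 7 <= Sstar b c T ->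
  ln 7 + 1 / 100 <= (c - b) / (3 / 2 - b) * ln ((2 * Sstar b c T - 7) / 7) ->
  forall t, Rabs t <= T -> Cmod (/ zreg (c, t)) <= exp (tau b c T / 2 + 1).
Proof.
  intros HR Hb Hc HT HS Hq t Ht.
  assert (He : 0 < / T ^ 2 <= 1 / 10000).
  { split; [apply Rinv_0_lt_compat, pow_lt; lra|]. replace (1 / 10000) with (/ 100 ^ 2) by field.
    apply Rinv_le_contravar; [apply pow_lt; lra|apply pow_incr; lra]. }
  pose proof (log_bound_step b c (/ T ^ 2) _ HR Hb Hc He HS (zreg_line_bound b c T HR Hb Hc HT HS Hq) Hq t) as Hh.
  assert (Hz : zreg (c, t) <> 0) by (apply zreg_neq_0; auto; simpl; lra).
  rewrite Cmod_inv by auto. rewrite <- (cexp_hlog HR (c, t)) by (simpl; lra). rewrite Cmod_cexp, <- exp_Ropp.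
  apply exp_le_compat. pose proof (Cmod_fst (hlog (c, t))). pose proof (Rle_abs (- fst (hlog (c, t)))) as H1. rewrite Rabs_Ropp in H1.
  assert (/ T ^ 2 * t ^ 2 <= 1).
  { rewrite <- (pow2_abs t). apply Rmult_le_reg_l with (T ^ 2); [apply pow_lt; lra|]. rewrite <- Rmult_assoc, Rinv_r, Rmult_1_l, Rmult_1_r.
    - apply pow_incr. split; [apply Rabs_pos|auto].
    - apply Rgt_not_eq, pow_lt; lra. }
  unfold Sstar in *. lra.
Qed.

(** * Perron's formula with a Cesaro kernel *)

Lemma ccont_const c z : ccont (fun _ => c) z.
Proof. apply J_ccont, J_const. Qed.
Lemma ccont_plus f g z : ccont f z -> ccont g z -> ccont (fun w => f w + g w)%C z.
Proof.
  intros Hf Hg e He. destruct (Hf (e / 2) ltac:(lra)) as (d1 & Hd1 & H1). destruct (Hg (e / 2) ltac:(lra)) as (d2 & Hd2 & H2).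
  exists (Rmin d1 d2). split; [apply Rmin_glb_lt; auto|]. intros h Hh. pose proof (Rmin_l d1 d2); pose proof (Rmin_r d1 d2).
  specialize (H1 h ltac:(lra)). specialize (H2 h ltac:(lra)).
  replace (f (z + h) + g (z + h) - (f z + g z))%C with ((f (z + h) - f z) + (g (z + h) - g z))%C by ring.
  eapply Rle_lt_trans; [apply Cmod_triangle|lra].
Qed.
Lemma ccont_mult f g z : ccont f z -> ccont g z -> ccont (fun w => f w * g w)%C z.
Proof.
  intros Hf Hg e He. set (A := Cmod (f z)). set (B := Cmod (g z)).
  assert (HA : 0 <= A) by apply Cmod_ge_0. assert (HB : 0 <= B) by apply Cmod_ge_0.
  set (e1 := Rmin 1 (e / (A + B + 2))).
  assert (He0 : 0 < e / (A + B + 2)) by (apply Rdiv_lt_0_compat; lra).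
  assert (He1 : 0 < e1 /\ e1 <= 1 /\ e1 <= e / (A + B + 2)) by (unfold e1, Rmin; destruct Rle_dec; lra).
  destruct (Hf e1 ltac:(lra)) as (d1 & Hd1 & H1). destruct (Hg e1 ltac:(lra)) as (d2 & Hd2 & H2).
  exists (Rmin d1 d2). split; [apply Rmin_glb_lt; auto|]. intros h Hh. pose proof (Rmin_l d1 d2); pose proof (Rmin_r d1 d2).
  specialize (H1 h ltac:(lra)). specialize (H2 h ltac:(lra)).
  replace (f (z + h) * g (z + h) - f z * g z)%C with ((f (z + h) - f z) * (g (z + h) - g z) + ((f (z + h) - f z) * g z + f z * (g (z + h) - g z)))%C by ring.
  pose proof (Cmod_ge_0 (f (z + h)%C - f z)). pose proof (Cmod_ge_0 (g (z + h)%C - g z)).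
  apply Rle_lt_trans with (e1 * e1 + (e1 * B + A * e1)).
  - eapply Rle_trans; [apply Cmod_triangle|]. apply Rplus_le_compat.
    + rewrite Cmod_mult. apply Rmult_le_compat; auto; apply Rlt_le; auto.
    + eapply Rle_trans; [apply Cmod_triangle|]. rewrite !Cmod_mult. fold A B. nra.
  - assert (e1 * (A + B + 2) <= e). { destruct He1 as (_ & _ & L). apply (Rmult_le_compat_r (A + B + 2)) in L; [|lra]. replace (e / (A + B + 2) * (A + B + 2)) with e in L by (field; lra). auto. }
    nra.
Qed.

(** Regularity with a continuous derivative. The continuity, which an expansion at each point does
    not state, is used to differentiate under the integral in [VI_derive]. *)
Definition HD (f : C -> C) (U : C -> Prop) : Prop :=
  exists f', forall z, U z -> (exists b, jet f z (f' z) b) /\ ccont f' z.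

Lemma HD_J f U z : HD f U -> U z -> J f z.
Proof. intros [f' H] Hz. destruct (H z Hz) as [[b Hb] _]. do 2 eexists; eauto. Qed.
Lemma HD_const c U : HD (fun _ => c) U.
Proof. exists (fun _ => RtoC 0). intros z _. split; [exists (RtoC 0); apply jet_const|apply ccont_const]. Qed.
Lemma HD_id U : HD (fun z => z) U.
Proof. exists (fun _ => RtoC 1). intros z _. split; [exists (RtoC 0); apply jet_id|apply ccont_const]. Qed.
Lemma HD_plus f g U : HD f U -> HD g U -> HD (fun z => f z + g z)%C U.
Proof.
  intros [f' Hf] [g' Hg]. exists (fun z => f' z + g' z)%C. intros z Hz.
  destruct (Hf z Hz) as [[b Hb] Cf]. destruct (Hg z Hz) as [[b' Hb'] Cg].
  split; [eexists; eapply jet_plus; eauto|apply ccont_plus; auto].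
Qed.
Lemma HD_mult f g U : HD f U -> HD g U -> HD (fun z => f z * g z)%C U.
Proof.
  intros HF HG. pose proof HF as [f' Hf]. pose proof HG as [g' Hg]. exists (fun z => f' z * g z + f z * g' z)%C. intros z Hz.
  destruct (Hf z Hz) as [[b Hb] Cf]. destruct (Hg z Hz) as [[b' Hb'] Cg].
  pose proof (J_ccont _ _ (HD_J _ _ _ HF Hz)). pose proof (J_ccont _ _ (HD_J _ _ _ HG Hz)).
  split; [eexists; eapply jet_mult; eauto|apply ccont_plus; apply ccont_mult; auto].
Qed.
Lemma HD_inv f U : HD f U -> (forall z, U z -> f z <> 0) -> HD (fun z => / f z)%C U.
Proof.
  intros HF Hz0. pose proof HF as [f' Hf]. exists (fun z => - (/ f z * / f z) * f' z)%C. intros z Hz.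
  destruct (Hf z Hz) as [[b Hb] Cf].
  assert (Ci : ccont (fun w => / f w)%C z) by (apply J_ccont, J_inv; [eapply HD_J; eauto|auto]).
  split.
  - eexists. apply (jet_comp f Cinv); [exact Hb|apply jet_inv; auto].
  - apply ccont_mult; auto. assert (X : ccont (fun w => - (1) * (/ f w * / f w))%C z).
    { apply ccont_mult; [apply ccont_const|apply ccont_mult; auto]. }
    intros e He. destruct (X e He) as (d & Hd & H). exists d. split; auto. intros h Hh. specialize (H h Hh).
    match goal with |- Cmod ?Y < _ => match type of H with Cmod ?W < _ => replace Y with W by ring end end. auto.
Qed.
Lemma HD_ext f g U : (forall z, f z = g z) -> HD f U -> HD g U.
Proof. intros E [f' Hf]. exists f'. intros z Hz. destruct (Hf z Hz) as [[b Hb] Cf]. split; auto. exists b. eapply jet_ext; eauto. Qed.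
Lemma HD_kpow x U : HD (fun s => kpow s x) U.
Proof.
  exists (fun s => kpow s x * RtoC (ln x))%C. intros z _.
  assert (Jl : jet (fun s => s * RtoC (ln x))%C z (1 * RtoC (ln x) + z * 0)%C (0 * RtoC (ln x) + 1 * 0 + z * 0)%C) by (apply jet_mult; [apply jet_id|apply jet_const]).
  split.
  - pose proof (jet_comp _ _ _ _ _ _ _ Jl (jet_cexp (z * RtoC (ln x))%C)) as H.
    eexists. match type of H with jet _ _ ?A ?B => replace (kpow z x * RtoC (ln x))%C with A; [exact H|] end.
    unfold kpow. ring.
  - apply J_ccont. apply J_mult; [|apply J_const]. unfold kpow. apply J_cexp. do 2 eexists; exact Jl.
Qed.
Lemma HD_sub f (U V : C -> Prop) : HD f U -> (forall z, V z -> U z) -> HD f V.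
Proof. intros [f' Hf] H. exists f'. auto. Qed.

Definition strip (x1 x2 : R) (z : C) : Prop := x1 < fst z < x2.

(* Only the real part of a vertical integral is kept: the sums to be recovered are real. *)
Definition VI (F : C -> C) (Y x : R) : R := RInt (fun t => fst (F (x, t))) (- Y) Y.

Lemma cont2_snd (f : R -> R -> R) x y : continuity_2d_pt f x y -> continuous (fun v => f x v) y.
Proof.
  intros H. apply continuity_pt_filterlim. intros e He. destruct (H (mkposreal e He)) as (d & Hd).
  exists d. split; [apply cond_pos|]. intros w [_ Hw]. simpl in *. unfold Rdist in *. apply Hd; auto.
  rewrite Rminus_diag, Rabs_R0. apply cond_pos.
Qed.

Lemma VI_ex F Y x U : HD F U -> (forall t, U (x, t)) -> ex_RInt (fun t => fst (F (x, t))) (- Y) Y.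
Proof.
  intros HF HU. apply (ex_RInt_continuous (V := R_CompleteNormedModule)). intros t _.
  apply (cont2_snd (fun u v => fst (F (u, v)))). apply ccont_fst. apply J_ccont. eapply HD_J; eauto.
Qed.

(** By Cauchy-Riemann the derivative of Re F in x is the derivative of Im F in t, which integrates
    to the difference of its end values. *)
Lemma VI_derive F Y y1 y2 x : 0 < Y -> HD F (strip y1 y2) -> y1 < x < y2 ->
  is_derive (VI F Y) x (snd (F (x, Y)) - snd (F (x, - Y))).
Proof.
  intros HR HF Hx. pose proof HF as [F' Hd].
  assert (He : 0 < Rmin (x - y1) (y2 - x)) by (apply Rmin_glb_lt; lra).
  assert (Hnear : locally x (fun u => y1 < u < y2)).
  { exists (mkposreal _ He). intros u Hu. unfold ball in Hu; simpl in Hu; unfold AbsRing_ball, abs, minus, plus, opp in Hu; simpl in Hu.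
    pose proof (Rmin_l (x - y1) (y2 - x)); pose proof (Rmin_r (x - y1) (y2 - x)). apply Rabs_def2 in Hu. lra. }
  assert (Hdx : forall u t, y1 < u < y2 -> is_derive (fun z => fst (F (z, t))) u (fst (F' (u, t)))).
  { intros u t Hu. destruct (Hd (u, t) Hu) as [[b Hb] _]. apply jet_dx in Hb. apply Hb. }
  assert (Hdt : forall t, is_derive (fun t => snd (F (x, t))) t (fst (F' (x, t)))).
  { intros t. destruct (Hd (x, t) Hx) as [[b Hb] _]. apply jet_dy in Hb. destruct Hb as [_ Hb].
    replace (fst (F' (x, t))) with (snd (Ci * F' (x, t))%C) by (simpl; ring). exact Hb. }
  assert (HC : forall u t, y1 < u < y2 -> continuity_2d_pt (fun u v => fst (F' (u, v))) u t).
  { intros u t Hu. apply ccont_fst. apply (Hd (u, t) Hu). }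
  replace (snd (F (x, Y)) - snd (F (x, - Y))) with (RInt (fun t => Derive (fun u => fst (F (u, t))) x) (- Y) Y).
  - unfold VI. apply (is_derive_RInt_param (fun u t => fst (F (u, t))) (- Y) Y x).
    + revert Hnear. apply filter_imp. intros u Hu t _. eexists; apply Hdx; auto.
    + intros t _. apply (continuity_2d_pt_ext_loc (fun u v => fst (F' (u, v)))).
      * exists (mkposreal _ He). intros u v Hu _. simpl in Hu. symmetry. apply is_derive_unique. apply Hdx.
        pose proof (Rmin_l (x - y1) (y2 - x)); pose proof (Rmin_r (x - y1) (y2 - x)). apply Rabs_def2 in Hu. lra.
      * apply HC; auto.
    + revert Hnear. apply filter_imp. intros u Hu. apply (VI_ex F Y u (strip y1 y2)); auto.
  - transitivity (RInt (fun t => fst (F' (x, t))) (- Y) Y).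
    + apply RInt_ext. intros t _. apply is_derive_unique. apply Hdx; auto.
    + apply is_RInt_unique. apply (is_RInt_derive (V := R_CompleteNormedModule) (fun t => snd (F (x, t))) (fun t => fst (F' (x, t)))).
      * intros t _. apply Hdt.
      * intros t _. apply (cont2_snd (fun u v => fst (F' (u, v)))). apply HC; auto.
Qed.

(** Cauchy's theorem for a rectangle, obtained from [VI_derive] by the mean value theorem in the
    abscissa. *)
Lemma VI_shift F Y y1 y2 x1 x2 K : 0 < Y -> HD F (strip y1 y2) -> y1 < x1 -> x1 <= x2 -> x2 < y2 ->
  (forall x, x1 <= x <= x2 -> Cmod (F (x, Y)) <= K /\ Cmod (F (x, - Y)) <= K) ->
  Rabs (VI F Y x2 - VI F Y x1) <= 2 * K * (x2 - x1).
Proof.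
  intros HR HF H1 H12 H2 HK.
  destruct (MVT_gen (VI F Y) x1 x2 (fun x => snd (F (x, Y)) - snd (F (x, - Y)))) as (c & Hc & E).
  - intros x Hx. rewrite Rmin_left, Rmax_right in Hx by lra. apply (VI_derive F Y y1 y2); auto; lra.
  - intros x Hx. rewrite Rmin_left, Rmax_right in Hx by lra. apply continuity_pt_filterlim.
    apply (ex_derive_continuous (V := R_NormedModule) (VI F Y)). eexists. apply (VI_derive F Y y1 y2); auto; lra.
  - rewrite Rmin_left, Rmax_right in Hc by lra. rewrite E, Rabs_mult, (Rabs_pos_eq (x2 - x1)) by lra.
    apply Rmult_le_compat_r; [lra|]. destruct (HK c Hc) as [K1 K2].
    pose proof (Cmod_snd (F (c, Y))). pose proof (Cmod_snd (F (c, - Y))).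
    eapply Rle_trans; [apply Rabs_triang|]. rewrite Rabs_Ropp. lra.
Qed.

Lemma VI_bound F Y x U K : 0 <= Y -> HD F U -> (forall t, U (x, t)) -> (forall t, - Y <= t <= Y -> Cmod (F (x, t)) <= K) -> Rabs (VI F Y x) <= 2 * Y * K.
Proof.
  intros HR HF HU HK. unfold VI. replace (2 * Y * K) with ((Y - - Y) * K) by ring.
  apply (abs_RInt_le_const (fun t => fst (F (x, t)))); [lra|eapply VI_ex; eauto|].
  intros t Ht. eapply Rle_trans; [apply Cmod_fst|auto].
Qed.

(** * The kernel [ker] and its inverse transform *)

(* The Perron kernel of first order: its inverse Mellin transform is [max (w - 1) 0]. *)
Definition ker (w : R) (s : C) : C := (kpow (s + 1) w * / (s * (s + 1)))%C.
Arguments ker w%_R_scope s%_C_scope.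

Lemma ker_HD w (U : C -> Prop) : (forall z : C, U z -> z <> 0 /\ (z + 1)%C <> 0) -> HD (ker w) U.
Proof.
  intros HU. unfold ker. apply HD_mult.
  - apply (HD_ext (fun s => kpow s w * kpow 1 w)%C); [intros; rewrite kpow_plus; auto|].
    apply HD_mult; [apply HD_kpow|apply HD_const].
  - apply HD_inv; [apply HD_mult; [apply HD_id|apply HD_plus; [apply HD_id|apply HD_const]]|].
    intros z Hz. destruct (HU z Hz). apply Cmult_neq_0; auto.
Qed.

Lemma ker_bound w s A B : 0 < w -> 0 < A -> 0 < B -> A <= Cmod s -> B <= Cmod (s + 1) -> Cmod (ker w s) <= rpow w (fst s + 1) / (A * B).
Proof.
  intros Hw HA HB H1 H2. unfold ker. rewrite Cmod_mult, kpow_mod, Cmod_inv, Cmod_mult by (apply Cmult_neq_0; apply Cneq_0_Cmod; lra).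
  change (fst (s + 1)%C) with (fst s + 1). unfold Rdiv. apply Rmult_le_compat_l; [left; apply rpow_pos|].
  apply Rinv_le_contravar; [nra|]. apply Rmult_le_compat; lra.
Qed.

Lemma Cmod_ge_abs_snd x t : Rabs t <= Cmod (x, t).
Proof. apply (Cmod_snd (x, t)). Qed.
Lemma Cmod_ge_abs_fst x t : Rabs x <= Cmod (x, t).
Proof. apply (Cmod_fst (x, t)). Qed.
Lemma pair_plus1 x t : ((x, t) + 1)%C = (x + 1, t).
Proof. apply injective_projections; simpl; ring. Qed.

Lemma ker_hor w x t Y : 0 < w -> 0 < Y -> Rabs t = Y -> Cmod (ker w (x, t)) <= rpow w (x + 1) / (Y * Y).
Proof.
  intros Hw HR Ht. apply (ker_bound w (x, t) Y Y); auto.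
  - rewrite <- Ht. apply Cmod_ge_abs_snd.
  - rewrite pair_plus1, <- Ht. apply Cmod_ge_abs_snd.
Qed.

(** For [w <= 1] the contour moves right to Re s = Y; it meets no pole and [w^(x+1)] does not
    increase. *)
Lemma ker_integral_small w Y : 0 < w <= 1 -> 2 <= Y -> Rabs (VI (ker w) Y 2) <= 4 * rpow w 3 / Y.
Proof.
  intros Hw HR.
  assert (HF : HD (ker w) (strip 1 (Y + 1))).
  { apply ker_HD. intros z Hz. unfold strip in Hz. split; apply Cneq_fst; simpl; lra. }
  assert (Hmono : forall x, 2 <= x -> rpow w (x + 1) <= rpow w 3).
  { intros x Hx. unfold rpow. apply exp_le_compat. assert (ln w <= 0) by (rewrite <- ln_1; apply ln_le_compat; lra). nra. }
  pose proof (rpow_pos w 3) as Hp.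
  assert (HRR : 0 < Y * Y) by nra. assert (HiR : 0 < / (Y * Y)) by (apply Rinv_0_lt_compat; auto).
  assert (S1 : Rabs (VI (ker w) Y Y - VI (ker w) Y 2) <= 2 * (rpow w 3 / (Y * Y)) * (Y - 2)).
  { apply (VI_shift _ Y 1 (Y + 1)); auto; try lra. intros x Hx.
    split; (eapply Rle_trans; [apply (ker_hor w x _ Y); try lra|apply Rmult_le_compat_r; [lra|apply Hmono; lra]]).
    - apply Rabs_pos_eq; lra.
    - rewrite Rabs_Ropp; apply Rabs_pos_eq; lra. }
  assert (S2 : Rabs (VI (ker w) Y Y) <= 2 * Y * (rpow w 3 / (Y * Y))).
  { apply (VI_bound _ Y Y (strip 1 (Y + 1))); auto; [lra|unfold strip; simpl; intros; lra|]. intros t Ht.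
    eapply Rle_trans; [apply (ker_bound w (Y, t) Y Y); try lra|].
    - eapply Rle_trans; [|apply Cmod_ge_abs_fst]. apply Rle_abs.
    - rewrite pair_plus1. eapply Rle_trans; [|apply Cmod_ge_abs_fst]. rewrite Rabs_pos_eq; lra.
    - apply Rmult_le_compat_r; [lra|apply Hmono; simpl; lra]. }
  replace (VI (ker w) Y 2) with (VI (ker w) Y Y - (VI (ker w) Y Y - VI (ker w) Y 2)) by ring.
  eapply Rle_trans; [apply Rabs_triang|]. rewrite Rabs_Ropp.
  apply Rle_trans with (2 * Y * (rpow w 3 / (Y * Y)) + 2 * (rpow w 3 / (Y * Y)) * (Y - 2)); [lra|].
  assert (0 <= rpow w 3 / (Y * Y)) by (apply Rmult_le_pos; lra).
  replace (4 * rpow w 3 / Y) with (4 * Y * (rpow w 3 / (Y * Y))) by (field; lra). nra.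
Qed.

(** For [w >= 1] a contour already to the left of both poles moves on to Re s = -Y, where the kernel
    is of order 1/Y^2. *)
Lemma ker_integral_left w Y : 1 <= w -> 4 <= Y -> Rabs (VI (ker w) Y (-3)) <= 8 / Y.
Proof.
  intros Hw HR.
  assert (HF : HD (ker w) (strip (- Y - 1) (-2))).
  { apply ker_HD. intros z Hz. unfold strip in Hz. split; intros E; apply (f_equal fst) in E; simpl in E; lra. }
  assert (Hmono : forall x, x <= -3 -> rpow w (x + 1) <= 1).
  { intros x Hx. unfold rpow. apply Rle_trans with (exp 0); [|rewrite exp_0; lra]. apply exp_le_compat. assert (0 <= ln w) by (apply ln_ge_0; lra). nra. }
  assert (HRR : 0 < Y * Y) by nra. assert (HiR : 0 < / (Y * Y)) by (apply Rinv_0_lt_compat; auto).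
  assert (S1 : Rabs (VI (ker w) Y (-3) - VI (ker w) Y (- Y)) <= 2 * (1 / (Y * Y)) * (-3 - - Y)).
  { apply (VI_shift _ Y (- Y - 1) (-2)); auto; try lra. intros x Hx.
    split; (eapply Rle_trans; [apply (ker_hor w x _ Y); try lra|apply Rmult_le_compat_r; [lra|apply Hmono; lra]]).
    - apply Rabs_pos_eq; lra.
    - rewrite Rabs_Ropp; apply Rabs_pos_eq; lra. }
  assert (S2 : Rabs (VI (ker w) Y (- Y)) <= 2 * Y * (2 / (Y * Y))).
  { apply (VI_bound _ Y (- Y) (strip (- Y - 1) (-2))); auto; [lra|unfold strip; simpl; intros; lra|]. intros t Ht.
    eapply Rle_trans; [apply (ker_bound w (- Y, t) Y (Y / 2)); try lra|].
    - eapply Rle_trans; [|apply Cmod_ge_abs_fst]. rewrite Rabs_Ropp. apply Rle_abs.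
    - rewrite pair_plus1. eapply Rle_trans; [|apply Cmod_ge_abs_fst]. rewrite Rabs_left; lra.
    - simpl fst. replace (2 / (Y * Y)) with (1 / (Y * (Y / 2))) by (field; lra).
      apply Rmult_le_compat_r; [left; apply Rinv_0_lt_compat; nra|apply Hmono; lra]. }
  replace (VI (ker w) Y (-3)) with (VI (ker w) Y (- Y) + (VI (ker w) Y (-3) - VI (ker w) Y (- Y))) by ring.
  eapply Rle_trans; [apply Rabs_triang|].
  apply Rle_trans with (2 * Y * (2 / (Y * Y)) + 2 * (1 / (Y * Y)) * (-3 - - Y)); [lra|].
  replace (8 / Y) with (2 * Y * (2 / (Y * Y)) + 2 * (1 / (Y * Y)) * (2 * Y)) by (field; lra).
  apply Rplus_le_compat_l. apply Rmult_le_compat_l; [|lra]. unfold Rdiv. lra.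
Qed.

Definition fmellin (v : R -> R) (w : R) (s : C) : C := CI (fun x => RtoC (v x) * kpow s x)%C 1 w.
Arguments fmellin v w%_R_scope s%_C_scope.

Lemma fmellin_ccR v w s : (forall x, 1 <= x <= w -> continuous v x) -> ccR (fun x => RtoC (v x) * kpow s x)%C 1 w.
Proof. intros Hv. apply ccR_mult; [apply ccR_real; auto|apply ccR_cexp_ln; lra]. Qed.

(** On the compact range [ln x <= ln w], so the cubic remainder is controlled at every [s] and the
    transform is entire. *)
Lemma fmellin_jet v w V s : 1 <= w -> (forall x, 1 <= x <= w -> continuous v x /\ Rabs (v x) <= V) ->
  exists b, jet (fmellin v w) s (fmellin (fun x => ln x * v x) w s) b.
Proof.
  intros Hw Hv.
  assert (HV : 0 <= V). { eapply Rle_trans; [apply Rabs_pos|apply (Hv 1); lra]. }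
  set (G := ln w). assert (HG : 0 <= G) by (apply ln_ge_0; auto).
  assert (Hln : forall x, 1 <= x <= w -> continuous ln x).
  { intros x Hx. apply (ex_derive_continuous (V := R_NormedModule)). eexists. apply is_derive_ln. lra. }
  assert (Hv1 : forall x, 1 <= x <= w -> continuous (fun x => ln x * v x) x).
  { intros x Hx. apply (continuous_mult (K := R_AbsRing)); auto. apply Hv; auto. }
  assert (Hv2 : forall x, 1 <= x <= w -> continuous (fun x => / 2 * (ln x * (ln x * v x))) x).
  { intros x Hx. apply (continuous_mult (K := R_AbsRing)); [apply continuous_const|]. apply (continuous_mult (K := R_AbsRing)); auto. }
  exists (fmellin (fun x => / 2 * (ln x * (ln x * v x))) w s).
  exists 1, (V * exp (Rabs (fst s) * G) * (G ^ 3 * exp G) * (w - 1)).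
  pose proof (exp_pos G). pose proof (exp_pos (Rabs (fst s) * G)).
  assert (0 <= G ^ 3) by (apply pow_le; auto).
  split; [lra|split].
  { repeat apply Rmult_le_pos; lra. }
  intros h Hh. pose proof (Cmod_ge_0 h).
  pose proof (fmellin_ccR v w (s + h)%C (fun x Hx => proj1 (Hv x Hx))) as C1.
  pose proof (fmellin_ccR v w s (fun x Hx => proj1 (Hv x Hx))) as C2.
  pose proof (fmellin_ccR _ w s Hv1) as C3. pose proof (fmellin_ccR _ w s Hv2) as C4.
  set (E := fun x => (RtoC (v x) * kpow s x * cE3 (h * RtoC (ln x)))%C).
  replace (fmellin v w (s + h) - _)%C with (CI E 1 w).
  2:{ unfold fmellin.
      rewrite (CI_ext E (fun x => RtoC (v x) * kpow (s + h) x + ((- (1)) * (RtoC (v x) * kpow s x) + ((- h) * (RtoC (ln x * v x)%R * kpow s x) + (- (h * h)) * (RtoC (/ 2 * (ln x * (ln x * v x)))%R * kpow s x))))%C); auto.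
      - rewrite !CI_plus, !CI_scal; auto; repeat apply ccR_plus; auto; try (apply ccR_mult; auto; apply ccR_const). ring.
      - intros x Hx. unfold E, cE3. rewrite kpow_plus. rewrite !RtoC_mult, RtoC_inv by lra.
        fold (kpow h x). generalize (kpow s x) (kpow h x). intros u z. field. }
  assert (CE : ccR E 1 w).
  { unfold E. apply ccR_mult; auto. unfold cE3, Cminus.
    assert (Cl : ccR (fun x => RtoC (ln x)) 1 w) by (apply ccR_real; auto).
    assert (Ch : ccR (fun x => h * RtoC (ln x))%C 1 w) by (apply ccR_mult; auto; apply ccR_const).
    assert (Copp : forall F, ccR F 1 w -> ccR (fun x => - F x)%C 1 w).
    { intros F HF x Hx. destruct (HF x Hx). split; simpl; apply (continuous_opp (V := R_NormedModule)); auto. }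
    repeat apply ccR_plus; try apply ccR_const.
    - apply ccR_cexp_ln; lra.
    - apply Copp; auto.
    - apply Copp. apply ccR_mult; [apply ccR_mult; auto|apply ccR_const]. }
  eapply Rle_trans; [apply (CI_bound E 1 w (V * exp (Rabs (fst s) * G) * (Cmod h ^ 3 * (G ^ 3 * exp G)))); auto|right; ring].
  intros x Hx. unfold E. rewrite !Cmod_mult, Cmod_R, kpow_mod.
  assert (L0 : 0 <= ln x) by (apply ln_ge_0; lra). assert (L1 : ln x <= G) by (apply ln_le_compat; lra).
  assert (K1 : rpow x (fst s) <= exp (Rabs (fst s) * G)).
  { unfold rpow. apply exp_le_compat. pose proof (Rle_abs (fst s)). pose proof (Rabs_pos (fst s)). nra. }
  pose proof (cE3_bound (h * RtoC (ln x))) as B3. rewrite Cmod_mult, Cmod_R, (Rabs_pos_eq (ln x)) in B3 by auto.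
  assert (B4 : (Cmod h * ln x) ^ 3 * exp (Cmod h * ln x) <= Cmod h ^ 3 * (G ^ 3 * exp G)).
  { rewrite Rpow_mult_distr, Rmult_assoc. apply Rmult_le_compat_l; [apply pow_le; auto|].
    apply Rmult_le_compat; [apply pow_le; auto|left; apply exp_pos|apply pow_incr; lra|apply exp_le_compat; nra]. }
  destruct (Hv x Hx) as [_ Hvx].
  apply Rmult_le_compat; [apply Rmult_le_pos; [apply Rabs_pos|left; apply rpow_pos]|apply Cmod_ge_0| |lra].
  apply Rmult_le_compat; auto; [apply Rabs_pos|left; apply rpow_pos].
Qed.

Definition vE (w x : R) : R := (w - x) / x.

Lemma vE_ok w : 1 <= w -> forall x, 1 <= x <= w -> continuous (vE w) x /\ Rabs (vE w x) <= w.
Proof.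
  intros Hw x Hx. split.
  - apply (ex_derive_continuous (V := R_NormedModule)). unfold vE. auto_derive. lra.
  - unfold vE. rewrite Rabs_pos_eq.
    + apply Rmult_le_reg_r with x; [lra|]. unfold Rdiv. rewrite Rmult_assoc, Rinv_l by lra. nra.
    + apply Rmult_le_pos; [lra|left; apply Rinv_0_lt_compat; lra].
Qed.

(* [ker w] minus its polar parts at 0 and -1, as an entire function; this replaces the residue theorem. *)
Definition Efun (w : R) (s : C) : C := fmellin (vE w) w s.

Lemma Efun_HD w U : 1 <= w -> HD (Efun w) U.
Proof.
  intros Hw. exists (fmellin (fun x => ln x * vE w x) w). intros z _. split.
  - apply (fmellin_jet (vE w) w w); auto. apply vE_ok; auto.
  - apply J_ccont. destruct (fmellin_jet (fun x => ln x * vE w x) w (ln w * w) z Hw) as [b Hb].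
    + intros x Hx. destruct (vE_ok w Hw x Hx). split.
      * apply (continuous_mult (K := R_AbsRing)); auto. apply (ex_derive_continuous (V := R_NormedModule)). eexists. apply is_derive_ln. lra.
      * rewrite Rabs_mult. assert (0 <= ln x) by (apply ln_ge_0; lra). rewrite (Rabs_pos_eq (ln x)) by auto.
        apply Rmult_le_compat; auto; [apply Rabs_pos|apply ln_le_compat; lra].
    + do 2 eexists; exact Hb.
Qed.

(** The integrand [(w - x) x^(s-1)] has the antiderivative [w x^s / s - x^(s+1) / (s+1)]. Its value
    at [w] is the kernel, its value at 1 the polar parts. *)
Lemma Efun_eq (w : R) (s : C) : 1 <= w -> s <> 0 -> (s + 1)%C <> 0 -> Efun w s = (ker w s - (RtoC w * / s - / (s + 1)))%C.
Proof.
  intros Hw H0 H1. unfold Efun, fmellin.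
  rewrite (CI_FTC _ (fun x => RtoC w * / s * kpow s x + - (/ (s + 1)) * kpow (s + 1) x)%C); auto.
  - rewrite !kpow_1. unfold ker. rewrite (kpow_plus s 1 w), kpow_one by lra. field. split; [exact H1|exact H0].
  - intros x Hx. apply (cder_eq _ ((0 * kpow s x + RtoC w * / s * (s * kpow (s - 1) x)) + (0 * kpow (s + 1) x + - / (s + 1) * ((s + 1) * kpow (s + 1 - 1) x)))%C).
    + unfold vE. replace (s - 1)%C with (s + - (1))%C by ring. replace (s + 1 - 1)%C with s by ring.
      rewrite kpow_plus, kpow_m1 by lra. unfold Rdiv. rewrite RtoC_mult, RtoC_minus.
      assert (Ex : (RtoC x * RtoC (/ x))%C = 1). { rewrite <- RtoC_mult, Rinv_r by lra. auto. }
      transitivity ((RtoC w * RtoC (/ x) - RtoC x * RtoC (/ x)) * kpow s x)%C; [|ring].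
      rewrite Ex. field. auto.
    + apply (cder_plus (fun x => RtoC w * / s * kpow s x)%C (fun x => - (/ (s + 1)) * kpow (s + 1) x)%C).
      * apply (cder_mult (fun _ => RtoC w * / s)%C (kpow s)); [apply cder_const|apply cder_kpow; lra].
      * apply (cder_mult (fun _ => - / (s + 1))%C (kpow (s + 1))); [apply cder_const|apply cder_kpow; lra].
  - apply fmellin_ccR. intros; apply vE_ok; auto.
Qed.

Lemma RInt_inv_vert c Y : c <> 0 -> 0 < Y -> is_RInt (fun t => fst (/ (c, t))%C) (- Y) Y (2 * atan (Y / c)).
Proof.
  intros Hc HY. replace (2 * atan (Y / c)) with (minus (atan (Y / c)) (atan (- Y / c))).
  2:{ replace (- Y / c) with (- (Y / c)) by (field; auto). rewrite atan_opp. unfold minus, plus, opp; simpl. ring. }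
  apply (is_RInt_derive (V := R_CompleteNormedModule) (fun t => atan (t / c)) (fun t => fst (/ (c, t))%C)).
  - intros t _. simpl. auto_derive; auto. field. split; auto. apply Rgt_not_eq.
    assert (0 < c * c) by nra. nra.
  - intros t _. simpl. apply (ex_derive_continuous (V := R_NormedModule)). auto_derive. apply Rgt_not_eq.
    assert (0 < c * c) by nra. nra.
Qed.

(** Reflection gives atan (Y/k) = PI/2 - atan (k/Y), and atan y <= y for y > 0. *)
Lemma atan_near k Y : 0 < k -> 0 < Y -> PI / 2 - k / Y <= atan (Y / k) <= PI / 2.
Proof.
  intros Hk HY. pose proof (atan_bound (Y / k)). split; [|lra].
  assert (Hq : 0 < Y / k) by (apply Rdiv_lt_0_compat; auto).
  assert (Hi : / (Y / k) = k / Y) by (field; lra).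
  pose proof (atan_inv (Y / k) Hq) as E. rewrite Hi in E.
  assert (Hq2 : 0 < k / Y) by (apply Rdiv_lt_0_compat; auto).
  assert (atan (k / Y) <= k / Y).
  { pose proof (atan_increasing 0 (k / Y) Hq2) as A0. rewrite atan_0 in A0.
    pose proof (atan_bound (k / Y)) as A1.
    assert (Ht : tan (atan (k / Y)) = k / Y) by apply tan_atan.
    set (z := atan (k / Y)) in *. rewrite <- Ht.
    assert (Hc : 0 < cos z) by (apply cos_gt_0; lra).
    pose proof (sin_lt_x z A0).
    (* z <= tan z through the derivative of tan *)
    destruct (MVT_gen (fun y => tan y - y) 0 z (fun y => tan y ^ 2)) as (c & Hcc & Em).
    - intros y Hy. rewrite Rmin_left, Rmax_right in Hy by lra.
      apply (is_derive_ext (fun y => tan y - y)); auto.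
      replace (tan y ^ 2) with ((tan y ^ 2 + 1) - 1) by ring.
      apply (is_derive_minus (V := R_NormedModule) tan (fun y => y)); [|apply (is_derive_id (K := R_AbsRing))].
      apply is_derive_tan. apply Rgt_not_eq. apply cos_gt_0; lra.
    - intros y Hy. rewrite Rmin_left, Rmax_right in Hy by lra. apply continuity_pt_filterlim.
      apply (ex_derive_continuous (V := R_NormedModule) (fun y => tan y - y)). eexists.
      apply (is_derive_minus (V := R_NormedModule) tan (fun y => y)); [|apply (is_derive_id (K := R_AbsRing))].
      apply is_derive_tan. apply Rgt_not_eq. apply cos_gt_0; lra.
    - rewrite tan_0 in Em. pose proof (pow2_ge_0 (tan c)). nra. }
  lra.
Qed.

Lemma is_RInt_VI F Y x U : HD F U -> (forall t, U (x, t)) -> is_RInt (fun t => fst (F (x, t))) (- Y) Y (VI F Y x).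
Proof. intros HF HU. apply (RInt_correct (V := R_CompleteNormedModule)). eapply VI_ex; eauto. Qed.

Lemma VI_ker_E w Y c : 1 <= w -> 0 < Y -> c <> 0 -> c + 1 <> 0 ->
  VI (ker w) Y c = VI (Efun w) Y c + (w * (2 * atan (Y / c)) - 2 * atan (Y / (c + 1))).
Proof.
  intros Hw HY Hc Hc1.
  assert (Hn : forall t, (c, t) <> RtoC 0) by (intros t E; apply (f_equal fst) in E; simpl in E; auto).
  assert (Hn1 : forall t, ((c, t) + 1)%C <> RtoC 0) by (intros t E; apply (f_equal fst) in E; simpl in E; auto).
  unfold VI at 1. apply is_RInt_unique.
  apply (is_RInt_ext (fun t => plus (fst (Efun w (c, t))) (minus (scal w (fst (/ (c, t))%C)) (fst (/ ((c + 1)%R, t))%C)))).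
  - intros t _. rewrite Efun_eq by auto. rewrite pair_plus1.
    generalize (ker w (c, t)) (/ (c, t))%C (/ ((c + 1)%R, t))%C. intros p q r.
    change (fst (p - (RtoC w * q - r))%C + (w * fst q - fst r) = fst p). simpl. ring.
  - apply (is_RInt_plus (V := R_NormedModule)).
    + apply (is_RInt_VI (Efun w) Y c (fun _ => True)); [apply Efun_HD; auto|auto].
    + apply (is_RInt_minus (V := R_NormedModule)).
      * apply (is_RInt_scal (V := R_NormedModule)). apply RInt_inv_vert; auto.
      * apply RInt_inv_vert; auto.
Qed.

(** From Re s = 2 to Re s = -3 the entire part changes by O(1/Y). The arctangents from the polar
    parts change sign as the poles are passed, and this jump supplies 2 PI w and - 2 PI. *)
Lemma ker_integral_large w : 1 <= w -> exists K, forall Y, 4 <= Y -> Rabs (VI (ker w) Y 2 - 2 * PI * (w - 1)) <= K / Y.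
Proof.
  intros Hw.
  set (M := rpow w 3 + w + 1). pose proof (rpow_pos w 3).
  exists (10 * M + 8 + 40 * (w + 1)). intros Y HY.
  assert (HiY : 0 < / Y) by (apply Rinv_0_lt_compat; lra).
  pose proof (ker_integral_left w Y Hw HY) as HL.
  assert (HE : Rabs (VI (Efun w) Y 2 - VI (Efun w) Y (-3)) <= 2 * (M / Y) * (2 - -3)).
  { apply (VI_shift _ Y (-4) 3); try lra; [apply Efun_HD; auto|].
    assert (Hgen : forall x t, -3 <= x <= 2 -> Rabs t = Y -> Cmod (Efun w (x, t)) <= M / Y).
    { intros x t Hx Ht.
      assert (N0 : Y <= Cmod (x, t)) by (rewrite <- Ht; apply Cmod_ge_abs_snd).
      assert (N1 : Y <= Cmod ((x, t) + 1)) by (rewrite pair_plus1, <- Ht; apply Cmod_ge_abs_snd).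
      assert (Z0 : (x, t) <> RtoC 0) by (apply Cneq_0_Cmod; lra).
      assert (Z1 : ((x, t) + 1)%C <> 0) by (apply Cneq_0_Cmod; lra).
      rewrite Efun_eq by auto.
      eapply Rle_trans; [apply Cmod_minus_le|].
      assert (T1 : Cmod (ker w (x, t)) <= rpow w 3 / Y).
      { eapply Rle_trans; [apply (ker_hor w x t Y); auto; lra|].
        assert (rpow w (x + 1) <= rpow w 3) by (apply rpow_le_exp; lra).
        pose proof (rpow_pos w (x + 1)).
        unfold Rdiv. apply Rmult_le_compat; auto; [lra|left; apply Rinv_0_lt_compat; nra|apply Rinv_le_contravar; nra]. }
      assert (T2 : Cmod (RtoC w * / (x, t) - / ((x, t) + 1)) <= (w + 1) / Y).
      { eapply Rle_trans; [apply Cmod_minus_le|]. rewrite Cmod_mult, !Cmod_inv, Cmod_real by (auto; lra).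
        assert (/ Cmod (x, t) <= / Y) by (apply Rinv_le_contravar; lra).
        assert (/ Cmod ((x, t) + 1) <= / Y) by (apply Rinv_le_contravar; lra).
        unfold Rdiv. nra. }
      unfold M, Rdiv in *. lra. }
    intros x Hx. split; apply Hgen; auto; [apply Rabs_pos_eq; lra|rewrite Rabs_Ropp; apply Rabs_pos_eq; lra]. }
  pose proof (VI_ker_E w Y 2 Hw ltac:(lra) ltac:(lra) ltac:(lra)) as E2.
  pose proof (VI_ker_E w Y (-3) Hw ltac:(lra) ltac:(lra) ltac:(lra)) as E3.
  replace (Y / -3) with (- (Y / 3)) in E3 by field. replace (Y / (-3 + 1)) with (- (Y / 2)) in E3 by field.
  replace (Y / (2 + 1)) with (Y / 3) in E2 by field. rewrite !atan_opp in E3.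
  pose proof (atan_near 2 Y ltac:(lra) ltac:(lra)) as A2. pose proof (atan_near 3 Y ltac:(lra) ltac:(lra)) as A3.
  set (t2 := atan (Y / 2)) in *. set (t3 := atan (Y / 3)) in *.
  replace ((10 * M + 8 + 40 * (w + 1)) / Y) with (2 * (M / Y) * (2 - -3) + 8 / Y + 4 * (w + 1) * (2 / Y + 3 / Y) + 20 * (w + 1) * / Y) by (field; lra).
  apply Rabs_le_between in HL. apply Rabs_le_between in HE.
  assert (Hk : 0 < 2 / Y /\ 0 < 3 / Y) by (split; apply Rdiv_lt_0_compat; lra).
  set (d2 := PI / 2 - t2). set (d3 := PI / 2 - t3).
  assert (D2 : 0 <= d2 <= 2 / Y) by (unfold d2; lra). assert (D3 : 0 <= d3 <= 3 / Y) by (unfold d3; lra).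
  assert (Emain : VI (ker w) Y 2 - 2 * PI * (w - 1) = (VI (Efun w) Y 2 - VI (Efun w) Y (-3)) + VI (ker w) Y (-3) - 2 * (w - 1) * (d2 + d3)).
  { rewrite E2, E3. unfold d2, d3. lra. }
  rewrite Emain. apply Rabs_le.
  assert (0 <= (w - 1) * (d2 + d3)) by (apply Rmult_le_pos; lra).
  assert ((w - 1) * (d2 + d3) <= (w + 1) * (2 / Y + 3 / Y)) by (apply Rmult_le_compat; lra).
  assert (0 <= 20 * (w + 1) * / Y) by (apply Rmult_le_pos; lra).
  split; lra.
Qed.

(** * Perron's formula for the Cesaro mean *)

(* [1/zeta s] on [Re s > 1/2], with the value 0 at the pole. *)
Definition m0 (s : C) : C := ((1 - / s) * / zreg s)%C.
Arguments m0 s%_C_scope : simpl never.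

Lemma m0_right s : 1 < fst s -> m0 s = DS mobius s.
Proof.
  intros Hs. assert (H1 : s <> RtoC 1) by (intros ->; simpl in Hs; lra).
  pose proof (C1_neq s H1) as Hs1. pose proof (Cneq_fst s ltac:(lra)) as Hs0.
  pose proof (zeta_neq_0_right s Hs) as Hz.
  assert (Hf : (1 - / s)%C <> 0). { intros E. apply Hs1. replace (s - 1)%C with (s * (1 - / s))%C by (field; auto). rewrite E. ring. }
  unfold m0. rewrite zreg_zeta by (auto; lra).
  replace ((1 - / s) * / ((1 - / s) * zeta s))%C with (/ zeta s)%C.
  - replace (/ zeta s)%C with (/ zeta s * (zeta s * DS mobius s))%C by (rewrite zeta_mu by auto; ring). field; auto.
  - field. repeat split; auto.
Qed.

Lemma m0_HD : RH -> HD m0 (fun s => 1 / 2 < fst s).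
Proof.
  intros HR. unfold m0. apply HD_mult.
  - apply (HD_ext (fun s => 1 + - (1) * / s)%C); [intros; ring|].
    apply HD_plus; [apply HD_const|]. apply HD_mult; [apply HD_const|]. apply HD_inv; [apply HD_id|]. intros z Hz. apply Cneq_fst. lra.
  - apply HD_inv; [|apply zreg_neq_0; auto]. exists dzreg. intros z Hz. split; [apply zreg_jet; lra|apply J_ccont, dzreg_J; lra].
Qed.

Lemma ker_split N n s : 0 < N -> 0 < n -> (ker N s * kpow (- s) n)%C = (RtoC n * ker (N / n) s)%C.
Proof.
  intros HN Hn. unfold ker.
  assert (E : (kpow (s + 1) N * kpow (- s) n)%C = (RtoC n * kpow (s + 1) (N / n))%C).
  { replace (kpow (s + 1) N) with (kpow (s + 1) (N / n) * kpow (s + 1) n)%C.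
    - rewrite <- Cmult_assoc, <- kpow_plus. replace (s + 1 + - s)%C with (RtoC 1) by ring. rewrite kpow_one by auto. ring.
    - rewrite <- kpow_mult_base by (auto; apply Rdiv_lt_0_compat; auto). f_equal. field. lra. }
  transitivity (kpow (s + 1) N * kpow (- s) n * / (s * (s + 1)))%C; [ring|]. rewrite E. ring.
Qed.

Lemma ker_HD_right w : HD (ker w) (fun s => 1 / 2 < fst s).
Proof. apply ker_HD. intros z Hz. split; apply Cneq_fst; simpl; lra. Qed.

Lemma partial_perron (N : R) Y Q : 0 < N ->
  is_RInt (fun t => fst (ker N (2, t) * csum (fun n => RtoC (mobius n) * zterm (2, t) n) Q)%C) (- Y) Y
    (rsum (fun n => mobius n * INR n * VI (ker (N / INR n)) Y 2) Q).
Proof.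
  intros HN. induction Q.
  - apply (is_RInt_ext (fun _ => 0)); [intros t _; cbn [csum]; rewrite Cmult_0_r; reflexivity|]. simpl rsum.
    pose proof (is_RInt_const (V := R_NormedModule) (- Y) Y 0) as H0.
    replace (scal (Y - - Y) (0 : R_NormedModule)) with 0 in H0; [exact H0|]. unfold scal; simpl; unfold mult; simpl. ring.
  - assert (Hn : 0 < INR (S Q)) by (apply lt_0_INR; lia).
    apply (is_RInt_ext (fun t => plus (fst (ker N (2, t) * csum (fun n => RtoC (mobius n) * zterm (2, t) n) Q)%C)
       (scal (mobius (S Q) * INR (S Q)) (fst (ker (N / INR (S Q)) (2, t)))))).
    + intros t _. rewrite csum_S.
      replace (ker N (2, t) * (csum (fun n => RtoC (mobius n) * zterm (2, t) n) Q + RtoC (mobius (S Q)) * zterm (2, t) (S Q)))%C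
        with (ker N (2, t) * csum (fun n => RtoC (mobius n) * zterm (2, t) n) Q + RtoC (mobius (S Q)) * (ker N (2, t) * kpow (- (2, t)) (INR (S Q))))%C by (unfold zterm; ring).
      rewrite ker_split by auto. rewrite Cmult_assoc, <- RtoC_mult.
      generalize (ker N (2, t) * csum (fun n => RtoC (mobius n) * zterm (2, t) n) Q)%C (ker (N / INR (S Q)) (2, t)) (mobius (S Q) * INR (S Q)).
      intros p q r. transitivity (fst p + r * fst q); [reflexivity|]. simpl. ring.
    + change (rsum (fun n => mobius n * INR n * VI (ker (N / INR n)) Y 2) (S Q)) with
        (plus (rsum (fun n => mobius n * INR n * VI (ker (N / INR n)) Y 2) Q) (scal (mobius (S Q) * INR (S Q)) (VI (ker (N / INR (S Q))) Y 2))).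
      apply (is_RInt_plus (V := R_NormedModule)); auto. apply (is_RInt_scal (V := R_NormedModule)).
      apply (is_RInt_VI (ker (N / INR (S Q))) Y 2 (fun s => 1 / 2 < fst s)); [apply ker_HD_right|]. intros; simpl; lra.
Qed.

Lemma rsum_diff f g N j : (forall n, (N < n)%nat -> Rabs (f n) <= g n) -> (forall n, 0 <= g n) ->
  Rabs (rsum f (N + j) - rsum f N) <= rsum g (N + j).
Proof.
  intros H Hg. induction j.
  - rewrite Nat.add_0_r, Rminus_diag, Rabs_R0. clear H. induction N; simpl; [lra|]. specialize (Hg (S N)). lra.
  - rewrite Nat.add_succ_r. simpl.
    replace (rsum f (N + j) + f (S (N + j)) - rsum f N) with ((rsum f (N + j) - rsum f N) + f (S (N + j))) by ring.
    eapply Rle_trans; [apply Rabs_triang|]. apply Rplus_le_compat; auto. apply H. lia.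
Qed.

(** The Cesaro mean of the Moebius function, equal to the sum of M(n) over n < N. It is what [ker]
    recovers, as [n max(N/n - 1, 0) = max(N - n, 0)]. *)
Definition Asum (N : nat) : R := rsum (fun n => mobius n * (INR N - INR n)) N.
Definition FN (N : R) (s : C) : C := (ker N s * m0 s)%C.

Lemma FN_HD N : RH -> HD (FN N) (fun s => 1 / 2 < fst s).
Proof. intros HR. unfold FN. apply HD_mult; [apply ker_HD_right|apply m0_HD; auto]. Qed.

Lemma ker_line2 N t : 0 < N -> Cmod (ker N (2, t)) <= rpow N 3 / 4.
Proof.
  intros HN. eapply Rle_trans; [apply (ker_bound N (2, t) 2 2); auto; try lra|].
  - apply (fst_le_Cmod (2, t)).
  - rewrite pair_plus1. pose proof (fst_le_Cmod (2 + 1, t)) as H. simpl in H. lra.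
  - simpl fst. right. replace (2 + 1) with 3 by ring. field.
Qed.

(** On Re s = 2 the function [m0] is replaced by N + Q terms of its Dirichlet series. A term with n
    <= N gives 2 PI mobius(n) (N - n) up to O(1/Y); the terms with n > N give O(1/Y) with constants
    summable like n^(-2). Then Q tends to infinity for fixed Y. *)
Lemma perron_sum N : RH -> (1 <= N)%nat -> exists K, forall Y, 4 <= Y ->
  Rabs (VI (FN (INR N)) Y 2 - 2 * PI * Asum N) <= K / Y.
Proof.
  intros HR HN. assert (HN1 : 1 <= INR N) by (apply (le_INR 1); auto).
  set (x := INR N) in *.
  set (f := fun Y n => mobius n * INR n * VI (ker (x / INR n)) Y 2).
  assert (HK : forall M, (M <= N)%nat -> exists K, 0 <= K /\ forall Y, 4 <= Y ->
     Rabs (rsum (f Y) M - 2 * PI * rsum (fun n => mobius n * (x - INR n)) M) <= K / Y).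
  { induction M; intros HM.
    - exists 0. split; [lra|]. intros Y HY. simpl. rewrite Rmult_0_r, Rminus_diag, Rabs_R0. unfold Rdiv; lra.
    - destruct IHM as (K & HK0 & HK); [lia|].
      assert (Hn : 0 < INR (S M)) by (apply lt_0_INR; lia).
      assert (Hw : 1 <= x / INR (S M)).
      { apply Rmult_le_reg_r with (INR (S M)); auto. unfold Rdiv. rewrite Rmult_assoc, Rinv_l, Rmult_1_l, Rmult_1_r by lra. apply le_INR; auto. }
      destruct (ker_integral_large _ Hw) as (K2 & HK2).
      assert (HK20 : 0 <= K2).
      { specialize (HK2 4 ltac:(lra)). pose proof (Rabs_pos (VI (ker (x / INR (S M))) 4 2 - 2 * PI * (x / INR (S M) - 1))). lra. }
      exists (K + INR (S M) * K2). split; [nra|]. intros Y HY. specialize (HK Y HY). specialize (HK2 Y HY).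
      cbn [rsum]. cbv beta. set (rf := rsum (f Y) M) in *. set (rg := rsum (fun n => mobius n * (x - INR n)) M) in *.
      replace (rf + f Y (S M) - 2 * PI * (rg + mobius (S M) * (x - INR (S M))))
        with ((rf - 2 * PI * rg) + mobius (S M) * (INR (S M) * (VI (ker (x / INR (S M))) Y 2 - 2 * PI * (x / INR (S M) - 1)))) by (unfold f; field; lra).
      eapply Rle_trans; [apply Rabs_triang|]. replace ((K + INR (S M) * K2) / Y) with (K / Y + INR (S M) * (K2 / Y)) by (unfold Rdiv; ring). apply Rplus_le_compat; [exact HK|].
      rewrite !Rabs_mult, (Rabs_pos_eq (INR (S M))) by lra. pose proof (MobLam.mobius_abs (S M)). pose proof (Rabs_pos (mobius (S M))).
      set (e := Rabs (VI (ker (x / INR (S M))) Y 2 - 2 * PI * (x / INR (S M) - 1))) in *.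
      assert (0 <= e) by apply Rabs_pos.
      rewrite <- (Rmult_1_l (INR (S M) * (K2 / Y))).
      apply Rmult_le_compat; auto; [nra|]. apply Rmult_le_compat_l; lra. }
  destruct (HK N (Nat.le_refl N)) as (K & HK0 & HKN). clear HK.
  exists (K + 8 * rpow x 3). intros Y HY. specialize (HKN Y HY). fold (Asum N) in HKN.
  assert (HiY : 0 < / Y) by (apply Rinv_0_lt_compat; lra).
  pose proof (rpow_pos x 3) as Hx3.
  assert (Hb : forall Q, (1 <= Q)%nat -> Rabs (VI (FN x) Y 2 - 2 * PI * Asum N) - (K + 8 * rpow x 3) / Y <= (2 * Y * (rpow x 3 / 4)) * rpow (INR Q) (- (1))).
  { intros Q HQ.
    set (Q' := (N + Q)%nat).
    assert (E1 : Rabs (VI (FN x) Y 2 - rsum (f Y) Q') <= 2 * Y * (rpow x 3 / 4) * rpow (INR Q) (- (1))).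
    { pose proof (partial_perron x Y Q' ltac:(lra)) as HP. fold (f Y) in HP.
      pose proof (is_RInt_VI (FN x) Y 2 (fun s => 1 / 2 < fst s) (FN_HD x HR) (fun t => ltac:(simpl; lra))) as HV.
      pose proof (is_RInt_minus (V := R_NormedModule) _ _ _ _ _ _ HV HP) as HD.
      replace (2 * Y * (rpow x 3 / 4) * rpow (INR Q) (- (1))) with ((Y - - Y) * (rpow x 3 / 4 * rpow (INR Q) (- (1)))) by ring.
      rewrite <- (is_RInt_unique _ _ _ _ HD : _ = VI (FN x) Y 2 - rsum (f Y) Q').
      apply abs_RInt_le_const; [lra|eexists; exact HD|].
      intros t Ht. unfold minus, plus, opp; cbn -[fst].
      set (s := (2, t) : C). unfold FN.
      set (cs := csum (fun n => RtoC (mobius n) * zterm s n)%C Q').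
      apply Rle_trans with (Cmod (ker x s * (m0 s - cs))).
      - replace (ker x s * (m0 s - cs))%C with (ker x s * m0 s - ker x s * cs)%C by ring. apply (Cmod_fst (ker x s * m0 s - ker x s * cs)%C).
      - rewrite Cmod_mult. apply Rmult_le_compat; try apply Cmod_ge_0; [apply ker_line2; lra|].
        rewrite m0_right by (unfold s; simpl; lra).
        eapply Rle_trans; [apply (DS_tail mobius 1 0 s Q' mobius_grow); [unfold s; simpl; lra|unfold Q'; lia]|].
        unfold s. simpl fst. replace (2 - 1 - 0) with 1 by ring. unfold Rdiv. rewrite Rinv_1, !Rmult_1_r, Rmult_1_l.
        apply rpow_le_base_neg; [apply lt_0_INR; lia|apply le_INR; unfold Q'; lia|lra]. }
    assert (E2 : Rabs (rsum (f Y) Q' - rsum (f Y) N) <= 8 * rpow x 3 / Y).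
    { eapply Rle_trans; [apply (rsum_diff _ (fun n => 4 * rpow x 3 / Y * rpow (INR n) (- (1 + 1))))|].
      - intros n Hn. assert (Hn0 : 0 < INR n) by (apply lt_0_INR; lia).
        assert (Hw : 0 < x / INR n <= 1).
        { split; [apply Rdiv_lt_0_compat; lra|]. apply Rmult_le_reg_r with (INR n); auto. unfold Rdiv. rewrite Rmult_assoc, Rinv_l, Rmult_1_l, Rmult_1_r by lra. apply le_INR; lia. }
        pose proof (ker_integral_small (x / INR n) Y Hw ltac:(lra)) as HJ.
        unfold f. rewrite !Rabs_mult, (Rabs_pos_eq (INR n)) by lra. pose proof (MobLam.mobius_abs n). pose proof (Rabs_pos (mobius n)).
        pose proof (Rabs_pos (VI (ker (x / INR n)) Y 2)).
        apply Rle_trans with (1 * INR n * (4 * rpow (x / INR n) 3 / Y)).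
        { apply Rmult_le_compat; auto; [nra|]. apply Rmult_le_compat_r; lra. }
        right. replace (rpow (INR n) (- (1 + 1))) with (INR n * rpow (/ INR n) 3).
        + unfold Rdiv. rewrite rpow_mult_base by (try lra; apply Rinv_0_lt_compat; lra). ring.
        + rewrite <- (rpow_1r (INR n)) at 1 by auto. unfold rpow. rewrite ln_Rinv, <- exp_plus by auto. f_equal. ring.
      - intros n. apply Rmult_le_pos; [|left; apply rpow_pos]. unfold Rdiv. apply Rmult_le_pos; lra.
      - rewrite rsum_scal. pose proof (rsum_zeta 1 Q' ltac:(lra)) as Hz. replace (1 + / 1) with 2 in Hz by field.
        replace (8 * rpow x 3 / Y) with (4 * rpow x 3 / Y * 2) by (unfold Rdiv; ring). apply Rmult_le_compat_l; auto.
        unfold Rdiv. apply Rmult_le_pos; lra. }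
    assert (E3 : Rabs (rsum (f Y) N - 2 * PI * Asum N) <= K / Y) by exact HKN.
    replace (VI (FN x) Y 2 - 2 * PI * Asum N) with ((VI (FN x) Y 2 - rsum (f Y) Q') + (rsum (f Y) Q' - rsum (f Y) N) + (rsum (f Y) N - 2 * PI * Asum N)) by ring.
    pose proof (Rabs_triang ((VI (FN x) Y 2 - rsum (f Y) Q') + (rsum (f Y) Q' - rsum (f Y) N)) (rsum (f Y) N - 2 * PI * Asum N)).
    pose proof (Rabs_triang (VI (FN x) Y 2 - rsum (f Y) Q') (rsum (f Y) Q' - rsum (f Y) N)).
    replace ((K + 8 * rpow x 3) / Y) with (K / Y + 8 * rpow x 3 / Y) by (field; lra). lra. }
  pose proof (lim0_bound _ _ Hb (rpow_lim' _ 1 ltac:(lra))). lra.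
Qed.

Definition Mert (N : nat) : R := rsum mobius N.

(* [Asum] grows by about [h * Mert N] over [N, N + h], which is how a bound on [Asum] yields one on [Mert]. *)
Lemma Asum_diff N h : Rabs (Asum (N + h) - Asum N - INR h * Mert N) <= INR h * INR h.
Proof.
  assert (H : forall j, (j <= h)%nat -> Rabs (rsum (fun n => mobius n * (INR (N + h) - INR n)) (N + j) - Asum N - INR h * Mert N) <= INR j * INR h).
  { induction j; intros Hj.
    - rewrite Nat.add_0_r. simpl (INR 0). rewrite Rmult_0_l. right.
      replace (rsum (fun n => mobius n * (INR (N + h) - INR n)) N) with (Asum N + INR h * Mert N).
      + replace (Asum N + INR h * Mert N - Asum N - INR h * Mert N) with 0 by ring. apply Rabs_R0.
      + unfold Asum, Mert. rewrite <- rsum_scal, <- rsum_plus. apply rsum_ext. intros n Hn. rewrite plus_INR. ring.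
    - rewrite Nat.add_succ_r. cbn [rsum]. cbv beta. specialize (IHj ltac:(lia)).
      set (r := rsum (fun n => mobius n * (INR (N + h) - INR n)) (N + j)) in *.
      replace (r + mobius (S (N + j)) * (INR (N + h) - INR (S (N + j))) - Asum N - INR h * Mert N) with
        ((r - Asum N - INR h * Mert N) + mobius (S (N + j)) * (INR (N + h) - INR (S (N + j)))) by ring.
      eapply Rle_trans; [apply Rabs_triang|]. rewrite (S_INR j), Rmult_plus_distr_r, Rmult_1_l. apply Rplus_le_compat; auto.
      rewrite Rabs_mult. pose proof (MobLam.mobius_abs (S (N + j))). pose proof (Rabs_pos (mobius (S (N + j)))).
      assert (0 <= INR (N + h) - INR (S (N + j)) <= INR h).
      { rewrite <- minus_INR by lia. split; [apply pos_INR|apply le_INR; lia]. }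
      rewrite (Rabs_pos_eq (INR (N + h) - _)) by lra. nra. }
  apply H. lia.
Qed.

(** * The Dirichlet series of the Moebius function *)

Definition mu_sum (s : C) (N : nat) : C := csum (fun n => RtoC (mobius n) * zterm s n)%C N.

Lemma mu_sum_S s N : mu_sum s (S N) = (mu_sum s N + (RtoC (Mert (S N)) - RtoC (Mert N)) * zterm s (S N))%C.
Proof.
  unfold mu_sum. rewrite csum_S. f_equal. f_equal. rewrite <- RtoC_minus. f_equal.
  unfold Mert. cbn [rsum]. ring.
Qed.

Lemma Mert_trivial N : Rabs (Mert N) <= INR N.
Proof.
  unfold Mert. induction N as [|N IH]; [simpl; rewrite Rabs_R0; lra|]. cbn [rsum]. rewrite S_INR.
  eapply Rle_trans; [apply Rabs_triang|]. pose proof (MobLam.mobius_abs (S N)). lra.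
Qed.

Definition wM (n : nat) (x : R) : R := Mert n / x.

Lemma wM_grow K al : 0 <= K -> 0 <= al -> (forall n, (1 <= n)%nat -> Rabs (Mert n) <= K * rpow (INR n) al) -> wgrow wM K al.
Proof.
  intros HK Hal H. split; auto. intros n x Hn Hx. assert (1 <= INR n) by (apply (le_INR 1); auto). split.
  - apply (ex_derive_continuous (V := R_NormedModule)). unfold wM. auto_derive. lra.
  - unfold wM, Rdiv. rewrite Rabs_mult, (Rabs_pos_eq (/ x)) by (left; apply Rinv_0_lt_compat; lra).
    replace (al - 1) with (al + - (1)) by ring. rewrite rpow_plus, rpow_opp, rpow_1r, <- Rmult_assoc by lra.
    apply Rmult_le_compat_r; [left; apply Rinv_0_lt_compat; lra|].
    eapply Rle_trans; [apply H; auto|]. apply Rmult_le_compat_l; auto. apply rpow_le_base; lra.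
Qed.

Lemma kpow_step_int s a b : 0 < a -> a <= b -> (s * CI (kpow (- s - 1)) a b)%C = (kpow (- s) a - kpow (- s) b)%C.
Proof.
  intros Ha Hab.
  assert (Cc : ccR (kpow (- s - 1)) a b) by (apply (ccR_cexp_ln (- s - 1)); auto).
  replace (kpow (- s) a - kpow (- s) b)%C with (- (kpow (- s) b - kpow (- s) a))%C by ring.
  rewrite <- (CI_FTC (fun x => (- s) * kpow (- s - 1) x)%C (kpow (- s)) a b); auto.
  - rewrite CI_scal by auto. ring.
  - intros x Hx. apply cder_kpow. lra.
  - apply ccR_mult; auto. apply ccR_const.
Qed.

Lemma mterm_wM n s : (1 <= n)%nat ->
  (s * mterm (wM n) (INR n) s)%C = (RtoC (Mert n) * (kpow (- s) (INR n) - kpow (- s) (INR (S n))))%C.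
Proof.
  intros Hn. assert (Hn1 : 1 <= INR n) by (apply (le_INR 1); auto).
  rewrite S_INR, <- kpow_step_int by lra. unfold mterm.
  rewrite (CI_ext _ (fun x => RtoC (Mert n) * kpow (- s - 1) x)%C).
  - rewrite CI_scal; [ring|lra|]. apply (ccR_cexp_ln (- s - 1)); lra.
  - lra.
  - intros x Hx. fold (kpow (- s) x). unfold wM, Rdiv. replace (- s - 1)%C with (- s + - (1))%C by ring.
    rewrite kpow_plus, kpow_m1, RtoC_mult by lra. ring.
Qed.

Lemma mu_sum_abel s N : mu_sum s (S N) =
  (RtoC (Mert (S N)) * zterm s (S N) + s * csum (fun n => mterm (wM n) (INR n) s) N)%C.
Proof.
  induction N as [|N IH].
  - rewrite mu_sum_S. replace (Mert 0) with 0 by reflexivity. unfold mu_sum. simpl csum. ring.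
  - rewrite mu_sum_S, IH, csum_S. rewrite Cmult_plus_distr_l, mterm_wM by lia. unfold zterm. ring.
Qed.

(** The Dirichlet series of the Moebius function after Abel summation, s times the integral of M(x)
    x^(-s-1). Any growth exponent of M is an abscissa of convergence for it. *)
Definition mser (s : C) : C := (s * MS wM s)%C.

Lemma mu_sum_mser K al s N : 0 <= K -> 0 <= al -> (forall n, (1 <= n)%nat -> Rabs (Mert n) <= K * rpow (INR n) al) -> al < fst s ->
  (1 <= N)%nat -> Cmod (mu_sum s (S N) - mser s) <= (K + Cmod s * (K / (fst s - al))) * rpow (INR N) (- (fst s - al)).
Proof.
  intros HK Hal HM Hs HN. assert (HN1 : 1 <= INR N) by (apply (le_INR 1); auto).
  pose proof (wM_grow K al HK Hal HM) as Hw. rewrite mu_sum_abel. unfold mser.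
  set (c := csum _ _).
  replace (RtoC (Mert (S N)) * zterm s (S N) + s * c - s * MS wM s)%C with (RtoC (Mert (S N)) * zterm s (S N) + - (s * (MS wM s - c)))%C by ring.
  eapply Rle_trans; [apply Cmod_triangle|]. rewrite Cmod_opp, Rmult_plus_distr_r. apply Rplus_le_compat.
  - rewrite Cmod_mult, Cmod_R. unfold zterm. rewrite kpow_mod. simpl (fst (- s)%C).
    apply Rle_trans with (K * rpow (INR (S N)) al * rpow (INR (S N)) (- fst s)).
    + apply Rmult_le_compat_r; [left; apply rpow_pos|apply HM; lia].
    + rewrite Rmult_assoc, <- rpow_plus. apply Rmult_le_compat_l; auto. replace (al + - fst s) with (- (fst s - al)) by ring.
      apply rpow_le_base_neg; try lra. rewrite S_INR; lra.
  - rewrite Cmod_mult, Rmult_assoc. apply Rmult_le_compat_l; [apply Cmod_ge_0|].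
    unfold MS, c. eapply Rle_trans; [apply (csum_tail (fun n => mterm (wM n) (INR n) s) (fun k => K * rpow (INR (S k)) (- (1 + (fst s - al)))))|].
    + intros k. apply mterm_bound; auto; try lra; [apply INR_S_ge1|intros; apply Hw; auto; lia|intros; apply Hw; auto; lia].
    + apply ex_series_Rscal. apply zsum_ex; lra.
    + rewrite Series_scal_l. unfold Rdiv. rewrite Rmult_assoc. apply Rmult_le_compat_l; auto.
      eapply Rle_trans; [apply ztail; auto; lra|]. right. field. lra.
Qed.

Lemma Clim_unique (u : nat -> C) (a b : C) (K1 K2 p : R) : 0 < p ->
  (forall n, (1 <= n)%nat -> Cmod (u n - a) <= K1 * rpow (INR n) (- p)) ->
  (forall n, (1 <= n)%nat -> Cmod (u n - b) <= K2 * rpow (INR n) (- p)) -> a = b.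
Proof.
  intros Hp Ha Hb.
  assert (H : Cmod (a - b) <= 0).
  { apply (lim0_bound _ (fun n => (K1 + K2) * rpow (INR n) (- p))); [|apply rpow_lim'; auto].
    intros n Hn. replace (a - b)%C with ((u n - b) - (u n - a))%C by ring.
    eapply Rle_trans; [apply Cmod_minus_le|]. specialize (Ha n Hn). specialize (Hb n Hn). lra. }
  pose proof (Cmod_ge_0 (a - b)). assert (E : (a - b)%C = 0) by (apply Cmod_eq_0; lra).
  replace a with (a - b + b)%C by ring. rewrite E. ring.
Qed.

Lemma mser_right K al s : 0 <= K -> 0 <= al -> (forall n, (1 <= n)%nat -> Rabs (Mert n) <= K * rpow (INR n) al) ->
  al < fst s -> 1 < fst s -> mser s = DS mobius s.
Proof.
  intros HK Hal HM Ha H1. set (p := Rmin (fst s - al) (fst s - 1)).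
  assert (Hp : 0 < p) by (apply Rmin_pos; lra). pose proof (Rmin_l (fst s - al) (fst s - 1)). pose proof (Rmin_r (fst s - al) (fst s - 1)). fold p in H, H0.
  pose proof (Cmod_ge_0 s) as Hs0.
  apply (Clim_unique (fun n => mu_sum s (S n)) _ _ (K + Cmod s * (K / (fst s - al))) (1 / (fst s - 1)) p); auto; intros n Hn.
  - eapply Rle_trans; [apply (mu_sum_mser K al); auto|]. apply Rmult_le_compat_l.
    + assert (0 <= K / (fst s - al)); [|nra]. apply Rmult_le_pos; auto. left; apply Rinv_0_lt_compat; lra.
    + apply rpow_le_exp; [apply (le_INR 1); auto|lra].
  - replace (mu_sum s (S n) - DS mobius s)%C with (- (DS mobius s - mu_sum s (S n)))%C by ring. rewrite Cmod_opp.
    eapply Rle_trans; [apply (DS_tail mobius 1 0 s); [apply mobius_grow|lra|lia]|].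
    rewrite Rmult_1_l. replace (fst s - 1 - 0) with (fst s - 1) by ring. unfold Rdiv. rewrite Rmult_1_l, Rmult_comm.
    apply Rmult_le_compat_l; [left; apply Rinv_0_lt_compat; lra|].
    apply Rle_trans with (rpow (INR n) (- (fst s - 1))).
    + apply rpow_le_base_neg; [apply lt_0_INR; lia|rewrite S_INR; lra|lra].
    + apply rpow_le_exp; [apply (le_INR 1); auto|lra].
Qed.

Lemma damped_bound r K : 0 <= r -> 0 <= K -> (3 * K * (r * (2 + r)) + 3) * exp (- r ^ 2) <= 9 * K + 3.
Proof.
  intros Hr HK. pose proof (exp_neg_bound (r ^ 2) (pow2_ge_0 r)) as H. set (E := exp (- r ^ 2)) in *.
  assert (0 < E) by apply exp_pos. assert (r * (2 + r) <= 3 * (1 + r ^ 2)) by nra.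
  apply Rle_trans with ((3 * K * (3 * (1 + r ^ 2)) + 3) * E).
  - apply Rmult_le_compat_r; [lra|]. apply Rplus_le_compat_r. apply Rmult_le_compat_l; lra.
  - assert (E <= 1) by nra. assert (K * (E * (1 + r ^ 2)) <= K * 1) by (apply Rmult_le_compat_l; auto). nra.
Qed.

(* The difference vanishes for [Re s > 1]; the three lines theorem with an arbitrarily small bound on the line [Re s = 3/2] extends this to the left. *)
Lemma mser_m0 K al s : RH -> 0 <= K -> 1 / 2 <= al -> (forall n, (1 <= n)%nat -> Rabs (Mert n) <= K * rpow (INR n) al) ->
  al < fst s -> mser s = m0 s.
Proof.
  intros HR HK Hal HM Hs. destruct (Rlt_dec 1 (fst s)) as [L|L].
  { rewrite (mser_right K al); auto; try lra. rewrite m0_right; auto. }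
  pose proof (wM_grow K al HK ltac:(lra) HM) as Hw.
  set (x1 := (al + fst s) / 2). assert (Hx1 : al < x1 < fst s) by (unfold x1; lra).
  (* The identity to be proved, multiplied by [zreg] so that nothing is divided. The factor exp(z^2)
     outweighs the polynomial growth of the rest, as the three lines theorem requires
     boundedness. *)
  set (f := fun z => ((z * MS wM z * zreg z + (/ z + - (1))) * cexp (z * z))%C).
  set (D := K * (1 + / (x1 - al))). assert (HD : 0 <= D). { apply Rmult_le_pos; auto. assert (0 < / (x1 - al)) by (apply Rinv_0_lt_compat; lra). lra. }
  set (M := exp (9 / 2) * (9 * D + 3)).
  assert (HJ : forall z, x1 <= fst z <= 3 / 2 -> J f z).
  { intros z Hz. pose proof (Cneq_fst z ltac:(lra)). unfold f. apply J_mult.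
    - apply J_plus; [|apply J_plus; [apply J_inv; auto; apply J_id|apply J_const]].
      apply J_mult; [|apply zreg_J; lra]. apply J_mult; [apply J_id|]. apply (MS_J wM K al); auto. lra.
    - apply J_cexp, J_mult; apply J_id. }
  assert (HB : forall z, x1 <= fst z <= 3 / 2 -> Cmod (f z) <= M).
  { intros z Hz. pose proof (Cneq_fst z ltac:(lra)) as Hz0. unfold f. set (r := Cmod z).
    assert (Hr : fst z <= r) by apply fst_le_Cmod.
    assert (B1 : Cmod (MS wM z) <= D).
    { eapply Rle_trans; [apply (MS_bound wM K al); auto; lra|]. apply Rmult_le_compat_l; auto. apply Rplus_le_compat_l. apply Rinv_le_contravar; lra. }
    assert (B0 : / fst z <= 2). { replace 2 with (/ (1 / 2)) by field. apply Rinv_le_contravar; lra. }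
    assert (B2 : Cmod (zreg z) <= 3 * (2 + r)).
    { eapply Rle_trans; [apply zreg_bound; lra|]. assert (Cmod (z - 1) <= r + 1) by (eapply Rle_trans; [apply Cmod_minus_le|rewrite Cmod_1; fold r; lra]).
      apply Rmult_le_compat; try lra; try (pose proof (Cmod_ge_0 (z - 1)); lra). assert (0 < / fst z) by (apply Rinv_0_lt_compat; lra). lra. }
    assert (B3 : Cmod (/ z + - (1)) <= 3).
    { eapply Rle_trans; [apply Cmod_triangle|]. rewrite Cmod_opp, Cmod_1, Cmod_inv by auto. fold r.
      assert (/ r <= / fst z) by (apply Rinv_le_contravar; lra). lra. }
    rewrite Cmod_mult, Cmod_cexp.
    replace (fst (z * z)%C) with (2 * fst z ^ 2 + - r ^ 2) by (unfold r; rewrite Cmod_sqr; simpl; ring).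
    rewrite exp_plus.
    assert (B4 : exp (2 * fst z ^ 2) <= exp (9 / 2)) by (apply exp_le_compat; nra).
    assert (B5 : Cmod (z * MS wM z * zreg z + (/ z + - (1))) <= 3 * D * (r * (2 + r)) + 3).
    { eapply Rle_trans; [apply Cmod_triangle|]. apply Rplus_le_compat; auto. rewrite !Cmod_mult. fold r.
      replace (3 * D * (r * (2 + r))) with (r * D * (3 * (2 + r))) by ring.
      apply Rmult_le_compat; auto; try apply Cmod_ge_0; [apply Rmult_le_pos; [lra|apply Cmod_ge_0]|]. apply Rmult_le_compat_l; auto; lra. }
    apply Rle_trans with ((3 * D * (r * (2 + r)) + 3) * (exp (9 / 2) * exp (- r ^ 2))).
    - apply Rmult_le_compat; auto; [apply Cmod_ge_0|left; apply Rmult_lt_0_compat; apply exp_pos|].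
      apply Rmult_le_compat_r; auto. left; apply exp_pos.
    - unfold M. pose proof (damped_bound r D ltac:(lra) HD). pose proof (exp_pos (9 / 2)). nra. }
  assert (H0 : f s = 0).
  { apply Cmod_eq_0. destruct (Req_dec (Cmod (f s)) 0) as [E|E]; auto. exfalso. pose proof (Cmod_ge_0 (f s)).
    (* As [f] vanishes on Re s = 3/2, exp(r) bounds it there for every [r]. This [r] makes the
       interpolated exponent at [s] equal to ln |f s| - 1, a contradiction. *)
    set (r := ((ln (Cmod (f s)) - 1) * (3 / 2 - x1) - (3 / 2 - fst s) * M) / (fst s - x1)).
    pose proof (three_lines f x1 (3 / 2) M M r ltac:(lra) HJ HB) as H3.
    assert (P1 : forall y, Cmod (f (x1, y)) <= exp M).
    { intros y. eapply Rle_trans; [apply HB; simpl; lra|]. pose proof (exp_ineq1_le M). lra. }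
    assert (P2 : forall y, Cmod (f (3 / 2, y)) <= exp r).
    { intros y. replace (f (3 / 2, y)) with (RtoC 0); [rewrite Cmod_0; left; apply exp_pos|].
      unfold f. fold (mser (3 / 2, y)). rewrite (mser_right K al) by (auto; simpl; lra). rewrite <- m0_right by (simpl; lra). unfold m0.
      pose proof (zreg_neq_0 HR (3 / 2, y) ltac:(simpl; lra)).
      pose proof (Cneq_fst (3 / 2, y) ltac:(simpl; lra)). field. auto. }
    specialize (H3 P1 P2 s ltac:(lra)).
    replace (((3 / 2 - fst s) * M + (fst s - x1) * r) / (3 / 2 - x1)) with (ln (Cmod (f s)) - 1) in H3 by (unfold r; field; lra).
    assert (exp (ln (Cmod (f s)) - 1) < Cmod (f s)); [|lra]. rewrite <- (exp_ln (Cmod (f s))) at 2 by lra. apply exp_increasing. lra. }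
  unfold f in H0. fold (mser s) in H0.
  assert (E : (mser s * zreg s + (/ s + - (1)))%C = 0).
  { destruct (Ceq_dec (mser s * zreg s + (/ s + - (1))) 0) as [E|E]; auto. exfalso.
    apply (Cmult_neq_0 _ (cexp (s * s)) E); auto. apply Cneq_0_Cmod. rewrite Cmod_cexp. apply exp_pos. }
  pose proof (zreg_neq_0 HR s ltac:(lra)) as Hz. unfold m0.
  replace (1 - / s)%C with (mser s * zreg s)%C; [field; auto|].
  replace (mser s * zreg s)%C with (mser s * zreg s + (/ s + - (1)) + (1 - / s))%C by ring. rewrite E. ring.
Qed.

Lemma m0_inv_zeta (s : C) : RH -> 1 / 2 < fst s -> m0 s = inv_zeta s.
Proof.
  intros HR Hs. assert (Hs0 : s <> RtoC 0) by (apply Cneq_fst; lra).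
  assert (Hgen : s <> RtoC 1 -> m0 s = Cinv (zeta s)).
  { intros H1. pose proof (zreg_neq_0 HR s Hs) as HZ. unfold m0. rewrite zreg_zeta in * by (auto; lra).
    assert (H2 : (1 - / s)%C <> RtoC 0) by (intros E; apply HZ; rewrite E; ring).
    assert (H3 : zeta s <> RtoC 0) by (intros E; apply HZ; rewrite E; ring).
    field. repeat split; auto. apply C1_neq; auto. }
  unfold inv_zeta. destruct (Req_EM_T (fst s) 1) as [E1|E1]; [destruct (Req_EM_T (snd s) 0) as [E2|E2]|].
  - replace s with (RtoC 1) by (apply injective_projections; simpl; auto). unfold m0. field.
    rewrite zreg_1. intros E. apply RtoC_inj in E. lra.
  - apply Hgen. intros ->. apply E2. reflexivity.
  - apply Hgen. intros ->. apply E1. reflexivity.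
Qed.

(** The difference is [s] times the integral of [v^(-s-1)]. Under the integral [K <= a^al <= v^al],
    which leaves the integrable power [v^(al - sigma - 1)]. *)
Lemma kpow_step_bound s al a b K : 0 <= al < fst s -> 0 < a -> a <= b -> 0 <= K <= rpow a al ->
  K * Cmod (kpow (- s) a - kpow (- s) b) <= Cmod s / (fst s - al) * (rpow a (- (fst s - al)) - rpow b (- (fst s - al))).
Proof.
  intros Hal Ha Hab HK. set (q := fst s - al). assert (Hq : 0 < q) by (unfold q; lra).
  rewrite <- kpow_step_int by auto. rewrite Cmod_mult.
  assert (HI : is_RInt (fun v => rpow v (- q - 1)) a b ((rpow a (- q) - rpow b (- q)) / q)).
  { replace ((rpow a (- q) - rpow b (- q)) / q) with (minus (- rpow b (- q) / q) (- rpow a (- q) / q)) by (unfold minus, plus, opp; simpl; field; lra).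
    apply (is_RInt_derive (V := R_CompleteNormedModule) (fun v => - rpow v (- q) / q)); rewrite Rmin_left, Rmax_right by auto; intros v Hv.
    - evar_last; [apply (is_derive_scal_l (K := R_AbsRing) (V := R_NormedModule) (fun v => - rpow v (- q)) v); apply (is_derive_opp (K := R_AbsRing) (V := R_NormedModule) (fun v => rpow v (- q))); apply is_derive_rpow; lra|].
      unfold scal, opp; simpl; unfold mult; simpl. field. lra.
    - apply (ex_derive_continuous (V := R_NormedModule)). unfold rpow. auto_derive. lra. }
  set (c := CI (kpow (- s - 1)) a b).
  assert (Hc : K * Cmod c <= (rpow a (- q) - rpow b (- q)) / q).
  { replace (K * Cmod c) with (Cmod (RtoC K * c)) by (rewrite Cmod_mult, Cmod_R, Rabs_pos_eq; lra).
    unfold c. assert (Cc : ccR (kpow (- s - 1)) a b) by (apply (ccR_cexp_ln (- s - 1)); auto).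
    rewrite <- CI_scal by auto. rewrite <- (is_RInt_unique _ _ _ _ HI).
    apply CI_bound_int; auto; [apply ccR_mult; auto; apply ccR_const|eexists; exact HI|].
    intros v Hv. rewrite Cmod_mult, Cmod_R, Rabs_pos_eq, kpow_mod by lra.
    replace (fst (- s - 1)%C) with (- fst s - 1) by (simpl; ring).
    apply Rle_trans with (rpow v al * rpow v (- fst s - 1)).
    - apply Rmult_le_compat_r; [left; apply rpow_pos|]. apply Rle_trans with (rpow a al); [lra|]. apply rpow_le_base; lra.
    - rewrite <- rpow_plus. right. f_equal. unfold q. ring. }
  pose proof (Cmod_ge_0 s).
  replace (K * (Cmod s * Cmod c)) with (Cmod s * (K * Cmod c)) by ring.
  replace (Cmod s / q * (rpow a (- q) - rpow b (- q))) with (Cmod s * ((rpow a (- q) - rpow b (- q)) / q)) by (field; lra).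
  apply Rmult_le_compat_l; auto.
Qed.

(** Abel summation started at the real point [x] instead of [n0], which is possible because M is
    constant on [n0, n0 + 1). Thus the final bound contains a power of [x] itself. The pieces
    telescope. *)
Lemma mu_sum_block s al n0 x j : 0 <= al < fst s -> (1 <= n0)%nat -> INR n0 <= x <= INR n0 + 1 ->
  (forall k, (n0 <= k)%nat -> Rabs (Mert k) <= rpow (INR k) al) ->
  Cmod (mu_sum s (S n0 + j) - mu_sum s n0 - RtoC (Mert (S n0 + j)) * zterm s (S n0 + j) + RtoC (Mert n0) * kpow (- s) x)
  <= Cmod s / (fst s - al) * (rpow x (- (fst s - al)) - rpow (INR (S n0 + j)) (- (fst s - al))).
Proof.
  intros Hal Hn Hx HM. assert (Hn1 : 1 <= INR n0) by (apply (le_INR 1); auto).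
  induction j as [|j IH].
  - rewrite Nat.add_0_r, mu_sum_S.
    replace (mu_sum s n0 + (RtoC (Mert (S n0)) - RtoC (Mert n0)) * zterm s (S n0) - mu_sum s n0 - RtoC (Mert (S n0)) * zterm s (S n0) + RtoC (Mert n0) * kpow (- s) x)%C
      with (RtoC (Mert n0) * (kpow (- s) x - kpow (- s) (INR (S n0))))%C by (unfold zterm; ring).
    rewrite Cmod_mult, Cmod_R. apply kpow_step_bound; auto; try lra; [rewrite S_INR; lra|].
    split; [apply Rabs_pos|]. eapply Rle_trans; [apply HM; auto|]. apply rpow_le_base; lra.
  - rewrite Nat.add_succ_r. set (N := (S n0 + j)%nat) in *. rewrite mu_sum_S.
    assert (HN : 0 < INR N) by (apply lt_0_INR; unfold N; lia).
    replace (mu_sum s N + (RtoC (Mert (S N)) - RtoC (Mert N)) * zterm s (S N) - mu_sum s n0 - RtoC (Mert (S N)) * zterm s (S N) + RtoC (Mert n0) * kpow (- s) x)%C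
      with ((mu_sum s N - mu_sum s n0 - RtoC (Mert N) * zterm s N + RtoC (Mert n0) * kpow (- s) x) + RtoC (Mert N) * (kpow (- s) (INR N) - kpow (- s) (INR (S N))))%C by (unfold zterm; ring).
    eapply Rle_trans; [apply Cmod_triangle|]. rewrite (Cmod_mult (RtoC (Mert N))), Cmod_R.
    pose proof (kpow_step_bound s al (INR N) (INR (S N)) (Rabs (Mert N)) Hal HN ltac:(rewrite S_INR; lra) ltac:(split; [apply Rabs_pos|apply HM; unfold N; lia])).
    lra.
Qed.

(** The limit of [mu_sum_block] as j tends to infinity: the boundary term at [x] gives the summand
    1, the integral gives |s|/(sigma - al). *)
Lemma mu_sum_tail s al n0 x : RH -> 1 / 2 <= al < fst s -> (1 <= n0)%nat -> INR n0 <= x <= INR n0 + 1 ->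
  (forall k, (n0 <= k)%nat -> Rabs (Mert k) <= rpow (INR k) al) ->
  Cmod (mu_sum s n0 - inv_zeta s) <= (1 + Cmod s / (fst s - al)) * rpow x (- (fst s - al)).
Proof.
  intros HR Hal Hn Hx HM. assert (Hn1 : 1 <= INR n0) by (apply (le_INR 1); auto).
  (* To identify the limit, a bound for all M(n) with some constant suffices. [n0] works: below [n0]
     by the trivial estimate, from [n0] on by [HM]. *)
  assert (HMK : forall n, (1 <= n)%nat -> Rabs (Mert n) <= INR n0 * rpow (INR n) al).
  { intros n Hn'. assert (1 <= INR n) by (apply (le_INR 1); auto). pose proof (rpow_le_exp (INR n) 0 al H ltac:(lra)) as P0.
    unfold rpow at 1 in P0. rewrite Rmult_0_l, exp_0 in P0.
    destruct (le_lt_dec n0 n) as [L|L].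
    - eapply Rle_trans; [apply HM; auto|]. nra.
    - eapply Rle_trans; [apply Mert_trivial|]. assert (INR n <= INR n0) by (apply le_INR; lia). nra. }
  rewrite <- m0_inv_zeta, <- (mser_m0 (INR n0) al) by (auto; lra).
  set (q := fst s - al). assert (Hq : 0 < q) by (unfold q; lra).
  set (C0 := INR n0 + Cmod s * (INR n0 / q)).
  assert (HC0 : 0 <= C0). { unfold C0. assert (0 <= Cmod s * (INR n0 / q)); [|lra]. apply Rmult_le_pos; [apply Cmod_ge_0|]. apply Rmult_le_pos; [lra|]. left; apply Rinv_0_lt_compat; auto. }
  set (T := (1 + Cmod s / q) * rpow x (- q)).
  assert (H : Cmod (mu_sum s n0 - mser s) - T <= 0); [|lra].
  apply (lim0_bound _ (fun j => (C0 + 1) * rpow (INR j) (- q))); [|apply rpow_lim'; auto].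
  intros j Hj. assert (Hj1 : 1 <= INR j) by (apply (le_INR 1); auto).
  pose proof (mu_sum_block s al n0 x j ltac:(lra) Hn Hx HM) as HB. fold q in HB.
  pose proof (mu_sum_mser (INR n0) al s (n0 + j) ltac:(lra) ltac:(lra) HMK ltac:(lra) ltac:(lia)) as HL. fold q in HL. fold C0 in HL.
  change (S (n0 + j)) with (S n0 + j)%nat in HL. set (N := (S n0 + j)%nat) in *.
  assert (HjN : INR j <= INR (n0 + j)) by (apply le_INR; lia). assert (HjN' : INR j <= INR N) by (apply le_INR; unfold N; lia).
  assert (L1 : rpow (INR (n0 + j)) (- q) <= rpow (INR j) (- q)) by (apply rpow_le_base_neg; lra).
  assert (L2 : rpow (INR N) (- q) <= rpow (INR j) (- q)) by (apply rpow_le_base_neg; lra).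
  assert (HZ : Cmod (RtoC (Mert N) * zterm s N) <= rpow (INR N) (- q)).
  { rewrite Cmod_mult, Cmod_R. unfold zterm. rewrite kpow_mod. replace (- q) with (al + - fst s) by (unfold q; ring). rewrite rpow_plus.
    apply Rmult_le_compat_r; [left; apply rpow_pos|]. apply HM. unfold N; lia. }
  assert (HX : Cmod (RtoC (Mert n0) * kpow (- s) x) <= rpow x (- q)).
  { rewrite Cmod_mult, Cmod_R. rewrite kpow_mod. replace (- q) with (al + - fst s) by (unfold q; ring). rewrite rpow_plus.
    apply Rmult_le_compat_r; [left; apply rpow_pos|]. eapply Rle_trans; [apply HM; auto|]. apply rpow_le_base; lra. }
  set (A := (mu_sum s N - mu_sum s n0 - RtoC (Mert N) * zterm s N + RtoC (Mert n0) * kpow (- s) x)%C) in *.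
  assert (HA : Cmod A <= Cmod s / q * rpow x (- q)).
  { eapply Rle_trans; [exact HB|]. apply Rmult_le_compat_l; [apply Rmult_le_pos; [apply Cmod_ge_0|left; apply Rinv_0_lt_compat; auto]|].
    pose proof (rpow_pos (INR N) (- q)). lra. }
  replace (mu_sum s n0 - mser s)%C with ((mu_sum s N - mser s) - A + (RtoC (Mert n0) * kpow (- s) x - RtoC (Mert N) * zterm s N))%C by (unfold A; ring).
  pose proof (Cmod_triangle ((mu_sum s N - mser s) - A) (RtoC (Mert n0) * kpow (- s) x - RtoC (Mert N) * zterm s N)) as T1.
  pose proof (Cmod_minus_le (mu_sum s N - mser s) A) as T2.
  pose proof (Cmod_minus_le (RtoC (Mert n0) * kpow (- s) x) (RtoC (Mert N) * zterm s N)) as T3.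
  assert (C0 * rpow (INR (n0 + j)) (- q) <= C0 * rpow (INR j) (- q)) by (apply Rmult_le_compat_l; auto).
  unfold T. lra.
Qed.

Lemma mob_partial_csum x s N : mob_partial N x s =
  csum (fun n => if Rle_dec (INR n) x then RtoC (mobius n) * zterm s n else 0)%C N.
Proof.
  induction N as [|N IH]; [reflexivity|]. cbn [mob_partial csum]. rewrite IH. f_equal.
  destruct (Rle_dec (INR (S N)) x); auto. rewrite npow_kpow. reflexivity.
Qed.

Lemma mob_sum_mu_sum x s : 1 <= x -> exists n0, (1 <= n0)%nat /\ INR n0 <= x < INR n0 + 1 /\ mob_sum x s = mu_sum s n0.
Proof.
  intros Hx. destruct (archimed x) as [A1 A2].
  assert (Hup : (1 < up x)%Z) by (apply lt_IZR; lra).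
  set (N := Z.to_nat (up x)). assert (EN : INR N = IZR (up x)) by (unfold N; rewrite INR_IZR_INZ, Z2Nat.id; auto; lia).
  assert (HN : (2 <= N)%nat) by (unfold N; lia).
  destruct N as [|n0] eqn:E; [lia|]. rewrite S_INR in EN.
  exists n0. split; [lia|]. split; [lra|].
  unfold mob_sum. fold N. rewrite mob_partial_csum. rewrite E. rewrite csum_S.
  destruct (Rle_dec (INR (S n0)) x) as [L'|L']; [exfalso; rewrite S_INR in L'; lra|].
  unfold mu_sum. rewrite Cplus_0_r. apply csum_ext. intros n Hn.
  destruct (Rle_dec (INR n) x) as [L2|L2]; auto. exfalso. apply L2.
  assert (INR n <= INR n0) by (apply le_INR; lia). lra.
Qed.

(** * The bound for the summatory function of [mobius] *)

(** The conditions on the parameters in [inv_zreg_bound]. They persist when [c] and [T] grow, so one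
    check yields bounds on every line between c and 3/2 and at all heights. *)
Definition admissible (b c T : R) : Prop :=
  1 / 2 < b /\ b < c < 3 / 2 /\ 100 <= T /\ 7 <= Sstar b c T /\
  ln 7 + 1 / 100 <= (c - b) / (3 / 2 - b) * ln ((2 * Sstar b c T - 7) / 7).

Lemma tau_mono b c T c' T' : 1 / 2 < b -> b < c -> 1 <= T -> c <= c' -> T <= T' -> tau b c T <= tau b c' T'.
Proof.
  intros Hb Hc HT Hc' HT'. unfold tau.
  assert (0 <= ln T) by (apply ln_ge_0; auto). assert (ln T <= ln T') by (apply ln_le_compat; lra).
  apply Rmult_le_compat; try lra; [apply Rmult_le_pos; [lra|left; apply Rinv_0_lt_compat; lra]|].
  apply Rmult_le_reg_r with ((c - 1 / 50) * (c' - 1 / 50)); [nra|].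
  replace ((c - b) / (c - 1 / 50) * ((c - 1 / 50) * (c' - 1 / 50))) with ((c - b) * (c' - 1 / 50)) by (field; lra).
  replace ((c' - b) / (c' - 1 / 50) * ((c - 1 / 50) * (c' - 1 / 50))) with ((c' - b) * (c - 1 / 50)) by (field; lra).
  nra.
Qed.

Lemma admissible_mono b c T c' T' : admissible b c T -> c <= c' < 3 / 2 -> T <= T' -> admissible b c' T'.
Proof.
  intros (Hb & Hc & HT & HS & Hq) Hc' HT'.
  pose proof (tau_mono b c T c' T' Hb ltac:(lra) ltac:(lra) ltac:(lra) HT') as Ht.
  assert (HSS : Sstar b c T <= Sstar b c' T') by (unfold Sstar; lra).
  repeat split; try lra. eapply Rle_trans; [exact Hq|].
  assert (L0 : 0 <= ln ((2 * Sstar b c T - 7) / 7)) by (apply ln_ge_0; lra).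
  apply Rmult_le_compat; auto.
  - apply Rmult_le_pos; [lra|left; apply Rinv_0_lt_compat; lra].
  - apply Rmult_le_compat_r; [left; apply Rinv_0_lt_compat; lra|lra].
  - apply ln_le_compat; lra.
Qed.

Lemma m0_line b c T t : RH -> admissible b c T -> Rabs t <= T -> Cmod (m0 (c, t)) <= 3 * exp (tau b c T / 2 + 1).
Proof.
  intros HR (Hb & Hc & HT & HS & Hq) Ht. unfold m0. rewrite Cmod_mult.
  apply Rmult_le_compat; try apply Cmod_ge_0.
  - eapply Rle_trans; [apply Cmod_minus_le|]. rewrite Cmod_1.
    assert (L : c <= Cmod (c, t)) by apply (fst_le_Cmod (c, t)).
    rewrite Cmod_inv by (apply Cneq_0_Cmod; lra).
    assert (/ Cmod (c, t) <= / (1 / 2)) by (apply Rinv_le_contravar; lra). lra.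
  - apply inv_zreg_bound; auto.
Qed.

(** A crude bound of order sqrt T, meant for the horizontal sides of the contour: [admissible_mono]
    up to Re s = 3/2, the Dirichlet series beyond. *)
Lemma m0_region b c T x t : RH -> admissible b c T -> c <= x <= 2 -> Rabs t <= T -> Cmod (m0 (x, t)) <= 3 * exp ((ln T + 6) / 2 + 1).
Proof.
  intros HR HA Hx Ht. pose proof HA as (Hb & Hc & HT & HS & Hq).
  assert (L0 : 0 <= ln T) by (apply ln_ge_0; lra).
  destruct (Rlt_dec x (3 / 2)) as [L|L].
  - eapply Rle_trans; [apply (m0_line b x T); auto; apply (admissible_mono b c T); auto; lra|].
    apply Rmult_le_compat_l; [lra|]. apply exp_le_compat. unfold tau.
    assert ((x - b) / (x - 1 / 50) <= 1). { apply Rmult_le_reg_r with (x - 1 / 50); [lra|]. unfold Rdiv. rewrite Rmult_assoc, Rinv_l; lra. }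
    nra.
  - rewrite m0_right by (simpl; lra).
    eapply Rle_trans; [apply (DS_bound mobius 1 0); [apply mobius_grow|simpl; lra]|]. simpl fst.
    assert (/ (x - 1 - 0) <= / (1 / 2)) by (apply Rinv_le_contravar; lra).
    pose proof (exp_ineq1_le ((ln T + 6) / 2 + 1)). lra.
Qed.

Lemma kpow_diff s N h : 0 < N -> 0 <= h -> 0 <= fst s ->
  Cmod (kpow (s + 1) (N + h)%R - kpow (s + 1) N) <= Cmod (s + 1) * rpow (N + h) (fst s) * h.
Proof.
  intros HN Hh Hs. replace h with (N + h - N) at 3 by ring.
  assert (HD : forall x, N <= x <= N + h -> cder (kpow (s + 1)) ((s + 1) * kpow s x)%C x).
  { intros x Hx. apply (cder_eq _ ((s + 1) * kpow (s + 1 - 1) x)%C); [|apply cder_kpow; lra]. f_equal. f_equal. ring. }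
  apply (cmvt (kpow (s + 1)) (fun x => (s + 1) * kpow s x)%C); [lra|apply HD|apply HD|].
  intros x Hx. rewrite Cmod_mult, kpow_mod. apply Rmult_le_compat_l; [apply Cmod_ge_0|]. apply rpow_le_base; lra.
Qed.

(** [sg] is the sign of [t] on the interval, so both half-lines are treated at once. *)
Lemma RInt_tail (sg p x1 x2 : R) : sg * sg = 1 -> 0 < p -> x1 <= x2 -> (forall t, x1 <= t <= x2 -> 0 <= sg * t) ->
  is_RInt (fun t => rpow (1 + sg * t) (- (1 + p))) x1 x2 (sg * (rpow (1 + sg * x1) (- p) - rpow (1 + sg * x2) (- p)) / p).
Proof.
  intros Hsg Hp HY Ht0.
  replace (sg * (rpow (1 + sg * x1) (- p) - rpow (1 + sg * x2) (- p)) / p) with (minus (- sg * rpow (1 + sg * x2) (- p) / p) (- sg * rpow (1 + sg * x1) (- p) / p)).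
  2:{ unfold minus, plus, opp; simpl. field; lra. }
  apply (is_RInt_derive (V := R_CompleteNormedModule) (fun t => - sg * rpow (1 + sg * t) (- p) / p)); rewrite Rmin_left, Rmax_right by lra; intros t Ht; specialize (Ht0 t Ht).
  - unfold rpow. auto_derive; [lra|].
    replace (- (1 + p) * ln (1 + sg * t)) with (- p * ln (1 + sg * t) + - ln (1 + sg * t)) by ring.
    rewrite exp_plus, exp_Ropp, exp_ln by lra.
    set (E := exp _). set (w := 1 + sg * t). transitivity ((sg * sg) * (E * / w)); [field; unfold w; lra|]. rewrite Hsg. ring.
  - apply (ex_derive_continuous (V := R_NormedModule)). unfold rpow. auto_derive. lra.
Qed.

Lemma RInt_decay (f : R -> R) G p Y : 0 < p -> 0 <= Y -> 0 <= G -> (forall t, continuous f t) ->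
  (forall t, Rabs (f t) <= G * rpow (1 + Rabs t) (- (1 + p))) -> Rabs (RInt f (- Y) Y) <= 2 * G / p.
Proof.
  intros Hp HY HG Hf Hb.
  assert (Hex : forall a b, ex_RInt f a b) by (intros; apply (ex_RInt_continuous (V := R_CompleteNormedModule)); auto).
  rewrite <- (RInt_Chasles (V := R_CompleteNormedModule) f (- Y) 0 Y) by auto.
  change (Rabs (RInt f (- Y) 0 + RInt f 0 Y) <= 2 * G / p).
  assert (Hgen : forall sg x1 x2, sg * sg = 1 -> x1 <= x2 -> (forall t, x1 <= t <= x2 -> sg * t = Rabs t) ->
     Rabs (RInt f x1 x2) <= G * (sg * (rpow (1 + sg * x1) (- p) - rpow (1 + sg * x2) (- p)) / p)).
  { intros sg x1 x2 Hsg H12 Hs.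
    assert (HI : is_RInt (fun t => rpow (1 + sg * t) (- (1 + p))) x1 x2 (sg * (rpow (1 + sg * x1) (- p) - rpow (1 + sg * x2) (- p)) / p)).
    { apply RInt_tail; auto. intros t Ht. rewrite Hs by auto. apply Rabs_pos. }
    pose proof (is_RInt_scal (V := R_NormedModule) _ _ _ G _ HI) as HI2.
    rewrite <- (is_RInt_unique _ _ _ _ HI2 : _ = G * (sg * (rpow (1 + sg * x1) (- p) - rpow (1 + sg * x2) (- p)) / p)).
    eapply Rle_trans; [apply abs_RInt_le; auto|].
    apply RInt_le; auto; [|eexists; exact HI2|].
    - apply (ex_RInt_continuous (V := R_CompleteNormedModule)). intros t _. apply (continuous_comp f Rabs); auto. apply continuous_Rabs.
    - intros t Ht. eapply Rle_trans; [apply Hb|]. right. rewrite Hs by lra. reflexivity. }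
  pose proof (Hgen (-1) (- Y) 0 ltac:(lra) ltac:(lra) (fun t Ht => ltac:(rewrite Rabs_left1; lra))) as H1.
  pose proof (Hgen 1 0 Y ltac:(lra) ltac:(lra) (fun t Ht => ltac:(rewrite Rabs_pos_eq; lra))) as H2.
  replace (1 + -1 * - Y) with (1 + Y) in H1 by ring. replace (1 + -1 * 0) with 1 in H1 by ring.
  replace (1 + 1 * Y) with (1 + Y) in H2 by ring. replace (1 + 1 * 0) with 1 in H2 by ring. rewrite rpow_1 in H1, H2.
  eapply Rle_trans; [apply Rabs_triang|]. pose proof (rpow_pos (1 + Y) (- p)).
  assert (0 < / p) by (apply Rinv_0_lt_compat; auto). unfold Rdiv in *.
  assert (G * (1 * (1 - rpow (1 + Y) (- p)) * / p) <= G * / p).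
  { apply Rmult_le_compat_l; auto. nra. }
  assert (G * (-1 * (rpow (1 + Y) (- p) - 1) * / p) <= G * / p).
  { apply Rmult_le_compat_l; auto. nra. }
  lra.
Qed.

(** The exponent of [T] in the bound for 1/zeta on Re s = c, since [tau b c T / 2] equals
    [slope b c * (ln T + 6)]. *)
Definition slope (b c : R) : R := (c - b) / (c - 1 / 50) / 2.

Lemma slope_range b c : 1 / 2 < b -> b < c -> 0 < slope b c <= 1 / 2.
Proof.
  intros Hb Hc. unfold slope. split.
  - apply Rmult_lt_0_compat; [apply Rdiv_lt_0_compat; lra|lra].
  - assert ((c - b) / (c - 1 / 50) <= 1). { apply Rmult_le_reg_r with (c - 1 / 50); [lra|]. unfold Rdiv. rewrite Rmult_assoc, Rinv_l; lra. }
    lra.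
Qed.

Lemma exp4_le : exp 4 <= 81.
Proof.
  pose proof exp_le_3. pose proof (exp_pos 1). replace 4 with (1 + 1 + (1 + 1)) by ring. rewrite !exp_plus.
  assert (exp 1 * exp 1 <= 9) by nra. nra.
Qed.

(** [m0_line] at the height max(T, |t|), permitted by [admissible_mono], so that all [t] are
    covered. The constant is 243 = 3 * 81, from [exp (6 slope + 1) <= exp 4 <= 81]. *)
Lemma m0_line_power b c T t : RH -> admissible b c T -> Cmod (m0 (c, t)) <= 243 * rpow (Rmax T (Rabs t)) (slope b c).
Proof.
  intros HR HA. pose proof HA as (Hb & Hc & HT & HS & Hq).
  pose proof (Rmax_l T (Rabs t)); pose proof (Rmax_r T (Rabs t)). set (T' := Rmax T (Rabs t)) in *.
  eapply Rle_trans; [apply (m0_line b c T'); auto; apply (admissible_mono b c T); auto; lra|].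
  pose proof (slope_range b c ltac:(lra) ltac:(lra)) as Hsl.
  assert (E : tau b c T' / 2 + 1 = slope b c * ln T' + (6 * slope b c + 1)) by (unfold tau, slope; field; lra).
  rewrite E, exp_plus. fold (rpow T' (slope b c)). pose proof (rpow_pos T' (slope b c)).
  assert (exp (6 * slope b c + 1) <= 81). { eapply Rle_trans; [|apply exp4_le]. apply exp_le_compat. lra. }
  nra.
Qed.

(** Two bounds for the difference of the kernels: h N^c / |t| from the derivative in N, and N^(c+1)
    / t^2 from the triangle inequality. They cross near |t| = N/h, which is at most [T]. A factor
    T^p is given away to gain the integrable decay (1 + |t|)^(-1-p); the constant is 8748 = 36 *
    243. *)
Lemma FN_diff_bound b c T (N h : nat) p t : RH -> admissible b c T -> (1 <= h <= N)%nat -> INR N <= INR h * T ->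
  0 < p <= 1 / 2 ->
  Cmod (FN (INR (N + h)) (c, t) - FN (INR N) (c, t)) <=
  (8748 * rpow (2 * INR N) c * INR h * rpow T (slope b c + p)) * rpow (1 + Rabs t) (- (1 + p)).
Proof.
  intros HR HA Hh HNT Hp. pose proof HA as (Hb & Hc & HT & HS & Hq).
  assert (Hh0 : 1 <= INR h) by (apply (le_INR 1); lia). assert (HhN : INR h <= INR N) by (apply le_INR; lia).
  set (s := (c, t) : C). set (r := Cmod s).
  assert (Hr1 : c <= r) by apply (fst_le_Cmod s). assert (Hr2 : Rabs t <= r) by apply (Cmod_snd s).
  assert (Hs0 : s <> 0) by (apply Cneq_0_Cmod; fold r; lra).
  assert (Hr3 : r <= Cmod (s + 1)).
  { apply Rsqr_incr_0_var; [|apply Cmod_ge_0]. unfold r. rewrite !Rsqr_pow2, !Cmod_sqr. unfold s; simpl. nra. }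
  assert (Hs1 : (s + 1)%C <> 0) by (apply Cneq_0_Cmod; fold r; lra).
  pose proof (Rabs_pos t) as Ht0.
  set (z := 1 + Rabs t). assert (Hz : z <= 3 * r) by (unfold z; lra). assert (Hz1 : 1 <= z) by (unfold z; lra).
  pose proof (m0_line_power b c T t HR HA) as Hm. fold s in Hm.
  pose proof (slope_range b c ltac:(lra) ltac:(lra)) as Hsl. set (be := slope b c) in *.
  unfold FN.
  replace (ker (INR (N + h)) s * m0 s - ker (INR N) s * m0 s)%C with ((kpow (s + 1) (INR (N + h)) - kpow (s + 1) (INR N)) * / (s * (s + 1)) * m0 s)%C by (unfold ker; ring).
  rewrite !Cmod_mult, Cmod_inv, Cmod_mult by (apply Cmult_neq_0; auto). fold r.
  set (r1 := Cmod (s + 1)) in *.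
  set (D := Cmod (kpow (s + 1) (INR (N + h)) - kpow (s + 1) (INR N))).
  pose proof (rpow_pos (2 * INR N) c) as HP. set (P := rpow (2 * INR N) c) in *.
  assert (HN2 : INR (N + h) <= 2 * INR N) by (rewrite plus_INR; lra).
  assert (HNh0 : 0 < INR (N + h)) by (rewrite plus_INR; lra).
  assert (D1 : D <= r1 * P * INR h).
  { unfold D. rewrite plus_INR. eapply Rle_trans; [apply kpow_diff; simpl; lra|]. fold r1.
    apply Rmult_le_compat_r; [lra|]. apply Rmult_le_compat_l; [lra|]. apply rpow_le_base; simpl; try lra. }
  assert (D2 : D <= 4 * P * (INR h * T)).
  { unfold D. eapply Rle_trans; [apply Cmod_minus_le|]. rewrite !kpow_mod. change (fst (s + 1)%C) with (c + 1).
    rewrite !rpow_plus, !rpow_1r by lra.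
    assert (rpow (INR (N + h)) c <= P) by (apply rpow_le_base; lra).
    assert (rpow (INR N) c <= P) by (apply rpow_le_base; lra).
    pose proof (rpow_pos (INR (N + h)) c). pose proof (rpow_pos (INR N) c).
    apply Rle_trans with (P * (2 * INR N) + P * INR N); [apply Rplus_le_compat; apply Rmult_le_compat; lra|].
    assert (P * INR N <= P * (INR h * T)) by (apply Rmult_le_compat_l; lra). nra. }
  assert (HD0 : 0 <= D) by apply Cmod_ge_0.
  pose proof (Cmod_ge_0 (m0 s)) as Hm0.
  (* D / (r r1) <= 36 P h min(1/z, T/z^2) *)
  assert (X1 : D * / (r * r1) <= 3 * P * INR h * / z).
  { apply Rle_trans with (P * INR h * / r).
    - apply Rmult_le_reg_r with (r * r1); [nra|]. rewrite Rmult_assoc, Rinv_l, Rmult_1_r by nra.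
      replace (P * INR h * / r * (r * r1)) with (r1 * P * INR h) by (field; lra). exact D1.
    - assert (/ r <= 3 * / z). { apply Rmult_le_reg_r with (r * z); [nra|]. replace (/ r * (r * z)) with z by (field; lra). replace (3 * / z * (r * z)) with (3 * r) by (field; lra). exact Hz. }
      assert (0 <= P * INR h) by nra. nra. }
  assert (X2 : D * / (r * r1) <= 36 * P * INR h * T * / (z * z)).
  { apply Rle_trans with (4 * P * (INR h * T) * / (r * r)).
    - apply Rmult_le_compat; auto; [left; apply Rinv_0_lt_compat; nra|apply Rinv_le_contravar; nra].
    - assert (/ (r * r) <= 9 * / (z * z)).
      { apply Rmult_le_reg_r with ((r * r) * (z * z)); [apply Rmult_lt_0_compat; nra|].
        replace (/ (r * r) * (r * r * (z * z))) with (z * z) by (field; lra).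
        replace (9 * / (z * z) * (r * r * (z * z))) with (9 * (r * r)) by (field; lra). nra. }
      assert (0 <= 4 * P * (INR h * T)) by (apply Rmult_le_pos; nra). nra. }
  pose proof (rpow_pos T (be + p)) as HTp. pose proof (rpow_pos z (- (1 + p))) as Hzp.
  assert (HPh : 0 < P * INR h) by nra.
  destruct (Rle_dec (Rabs t) T) as [Lt|Lt].
  - replace (Rmax T (Rabs t)) with T in Hm by (rewrite Rmax_left; auto).
    assert (Y1 : / z <= 2 * rpow T p * rpow z (- (1 + p))).
    { replace (- (1 + p)) with (- p + - (1)) by ring. rewrite rpow_plus. rewrite (rpow_opp z 1), rpow_1r by lra.
      rewrite rpow_opp. pose proof (rpow_pos z p). assert (0 < / z) by (apply Rinv_0_lt_compat; lra).
      assert (rpow z p <= 2 * rpow T p).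
      { apply Rle_trans with (rpow (2 * T) p); [apply rpow_le_base; unfold z in *; lra|]. rewrite rpow_mult_base by lra.
        apply Rmult_le_compat_r; [left; apply rpow_pos|]. rewrite <- (rpow_1r 2) at 2 by lra. apply rpow_le_exp; lra. }
      assert (1 <= 2 * rpow T p * / rpow z p). { apply Rmult_le_reg_r with (rpow z p); auto. rewrite Rmult_assoc, Rinv_l; lra. }
      nra. }
    apply Rle_trans with ((3 * P * INR h * (2 * rpow T p * rpow z (- (1 + p)))) * (243 * rpow T be)).
    + apply Rmult_le_compat; auto.
      * apply Rmult_le_pos; auto. left; apply Rinv_0_lt_compat; nra.
      * eapply Rle_trans; [exact X1|]. apply Rmult_le_compat_l; nra.
    + rewrite rpow_plus. pose proof (rpow_pos T be). pose proof (rpow_pos T p).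
      assert (0 <= P * INR h * (rpow T be * rpow T p) * rpow z (- (1 + p))).
      { repeat apply Rmult_le_pos; lra. }
      nra.
  - assert (Lt' : T < Rabs t) by lra. replace (Rmax T (Rabs t)) with (Rabs t) in Hm by (rewrite Rmax_right; lra).
    assert (Y2 : T * / (z * z) * rpow (Rabs t) be <= rpow T (be + p) * rpow z (- (1 + p))).
    { apply Rle_trans with (T * / (z * z) * rpow z be).
      - apply Rmult_le_compat_l; [apply Rmult_le_pos; [lra|left; apply Rinv_0_lt_compat; nra]|]. apply rpow_le_base; unfold z; lra.
      - replace (/ (z * z)) with (rpow z (- (2))).
        2:{ replace (- (2)) with (- (1) + - (1)) by ring. rewrite rpow_plus, rpow_opp, rpow_1r by lra. field. lra. }
        replace (be + p) with (1 + (be + p - 1)) by ring. rewrite (rpow_plus T 1), rpow_1r by lra.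
        rewrite !Rmult_assoc. apply Rmult_le_compat_l; [lra|]. rewrite <- rpow_plus.
        replace (- (2) + be) with ((be + p - 1) + - (1 + p)) by ring. rewrite rpow_plus.
        apply Rmult_le_compat_r; [lra|]. apply rpow_le_base_neg; unfold z; lra. }
    apply Rle_trans with ((36 * P * INR h * T * / (z * z)) * (243 * rpow (Rabs t) be)).
    + apply Rmult_le_compat; auto. apply Rmult_le_pos; auto. left; apply Rinv_0_lt_compat; nra.
    + replace (36 * P * INR h * T * / (z * z) * (243 * rpow (Rabs t) be)) with ((8748 * (P * INR h)) * (T * / (z * z) * rpow (Rabs t) be)) by ring.
      replace (8748 * P * INR h * rpow T (be + p) * rpow z (- (1 + p))) with ((8748 * (P * INR h)) * (rpow T (be + p) * rpow z (- (1 + p)))) by ring.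
      apply Rmult_le_compat_l; [lra|exact Y2].
Qed.

(** Up to h^2, [h M(N)] is the difference of the Cesaro means at N + h and N. This is a Perron
    integral, moved from Re s = 2 to Re s = c; the horizontal sides vanish as Y tends to infinity.
    Division by h, with PI >= 3, yields 2916 = 8748/3. *)
Lemma Mert_bound_abs b c T (N h : nat) p : RH -> admissible b c T -> (1 <= h <= N)%nat -> INR N <= INR h * T ->
  0 < p <= 1 / 2 ->
  Rabs (Mert N) <= INR h + 2916 * rpow (2 * INR N) c * rpow T (slope b c + p) / p.
Proof.
  intros HR HA Hh HNT Hp. pose proof HA as (Hb & Hc & HT & HS & Hq).
  assert (Hh0 : 1 <= INR h) by (apply (le_INR 1); lia). assert (HhN : INR h <= INR N) by (apply le_INR; lia).
  set (G := 8748 * rpow (2 * INR N) c * INR h * rpow T (slope b c + p)).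
  assert (HG : 0 <= G). { unfold G. pose proof (rpow_pos (2 * INR N) c). pose proof (rpow_pos T (slope b c + p)). repeat apply Rmult_le_pos; lra. }
  set (F := fun s => (FN (INR (N + h)) s - FN (INR N) s)%C).
  assert (HF : HD F (fun s => 1 / 2 < fst s)).
  { apply (HD_ext (fun s => FN (INR (N + h)) s + (- (1)) * FN (INR N) s)%C); [intros; unfold F; ring|].
    apply HD_plus; [apply FN_HD; auto|]. apply HD_mult; [apply HD_const|apply FN_HD; auto]. }
  assert (Hint : forall Y, 0 <= Y -> Rabs (VI F Y c) <= 2 * G / p).
  { intros Y HY. unfold VI. apply RInt_decay; auto; try lra.
    - intros t. apply (cont2_snd (fun u v => fst (F (u, v)))). apply ccont_fst, J_ccont. eapply HD_J; [exact HF|simpl; lra].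
    - intros t. eapply Rle_trans; [apply Cmod_fst|]. apply FN_diff_bound; auto. }
  destruct (perron_sum (N + h) HR ltac:(lia)) as (K1 & HK1). destruct (perron_sum N HR ltac:(lia)) as (K2 & HK2).
  set (x := INR (N + h)) in *.
  assert (Hx : 1 <= x) by (unfold x; rewrite plus_INR; lra).
  set (K3 := 6 * exp 4 * rpow x 3).
  assert (HK30 : 0 <= K3). { unfold K3. pose proof (exp_pos 4). pose proof (rpow_pos x 3). repeat apply Rmult_le_pos; lra. }
  assert (Hshift : forall Y, T <= Y -> Rabs (VI F Y 2 - VI F Y c) <= 2 * (K3 / Y) * (2 - c)).
  { intros Y HY.
    assert (HY1 : 1 <= Y) by lra.
    apply (VI_shift F Y (1 / 2) 3); try lra.
    { apply (HD_sub F (fun s => 1 / 2 < fst s)); auto. unfold strip. intros; lra. }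
    assert (Hgen : forall u t, c <= u <= 2 -> Rabs t = Y -> Cmod (F (u, t)) <= K3 / Y).
    { intros u t Hu Ht.
      pose proof (m0_region b c Y u t HR (admissible_mono b c T c Y HA ltac:(lra) HY) Hu ltac:(lra)) as Hm.
      replace ((ln Y + 6) / 2 + 1) with (ln Y * / 2 + 4) in Hm by field. rewrite exp_plus in Hm.
      assert (EY : exp (ln Y * / 2) <= Y). { rewrite <- (exp_ln Y) at 2 by lra. apply exp_le_compat. assert (0 <= ln Y) by (apply ln_ge_0; lra). lra. }
      assert (Hk : forall w, 1 <= w <= x -> Cmod (ker w (u, t)) <= rpow x 3 / (Y * Y)).
      { intros w Hw. eapply Rle_trans; [apply (ker_hor w u t Y); auto; lra|].
        apply Rmult_le_compat_r; [left; apply Rinv_0_lt_compat; nra|].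
        apply Rle_trans with (rpow w 3); [apply rpow_le_exp; lra|apply rpow_le_base; lra]. }
      unfold F, FN.
      replace (ker x (u, t) * m0 (u, t) - ker (INR N) (u, t) * m0 (u, t))%C with ((ker x (u, t) - ker (INR N) (u, t)) * m0 (u, t))%C by ring.
      rewrite Cmod_mult.
      assert (HNx : 1 <= INR N <= x) by (unfold x; rewrite plus_INR; lra).
      apply Rle_trans with ((2 * (rpow x 3 / (Y * Y))) * (3 * (Y * exp 4))).
      - apply Rmult_le_compat; try apply Cmod_ge_0.
        + eapply Rle_trans; [apply Cmod_minus_le|]. pose proof (Hk x ltac:(lra)). pose proof (Hk (INR N) HNx). lra.
        + eapply Rle_trans; [exact Hm|]. apply Rmult_le_compat_l; [lra|]. apply Rmult_le_compat_r; [left; apply exp_pos|auto].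
      - right. unfold K3. field. lra. }
    intros u Hu. split; apply Hgen; auto; [apply Rabs_pos_eq; lra|rewrite Rabs_Ropp; apply Rabs_pos_eq; lra]. }
  assert (Hfin : forall n, (1 <= n)%nat -> 2 * PI * (INR h * Rabs (Mert N) - INR h * INR h) - 2 * G / p <= (2 * K3 * (2 - c) + Rabs K1 + Rabs K2) * rpow (INR n) (- (1))).
  { intros n Hn. assert (Hn1 : 1 <= INR n) by (apply (le_INR 1); auto).
    set (Y := T + INR n). assert (HY : T <= Y) by (unfold Y; lra). assert (HYn : INR n <= Y) by (unfold Y; lra).
    specialize (Hint Y ltac:(lra)). specialize (HK1 Y ltac:(lra)). specialize (HK2 Y ltac:(lra)). specialize (Hshift Y HY).
    assert (EV : VI F Y 2 = VI (FN x) Y 2 - VI (FN (INR N)) Y 2).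
    { unfold VI at 1. apply is_RInt_unique.
      pose proof (is_RInt_VI (FN x) Y 2 (fun s => 1 / 2 < fst s) (FN_HD x HR) (fun t => ltac:(simpl; lra))) as V1.
      pose proof (is_RInt_VI (FN (INR N)) Y 2 (fun s => 1 / 2 < fst s) (FN_HD (INR N) HR) (fun t => ltac:(simpl; lra))) as V2.
      exact (is_RInt_minus (V := R_NormedModule) _ _ _ _ _ _ V1 V2). }
    pose proof (Asum_diff N h) as HAd.
    set (A1 := Asum (N + h)) in *. set (A2 := Asum N) in *. set (V1 := VI (FN x) Y 2) in *. set (V2 := VI (FN (INR N)) Y 2) in *.
    set (VF2 := VI F Y 2) in *. set (VFc := VI F Y c) in *.
    pose proof PI_RGT_0 as HPI.
    assert (B1 : INR h * Rabs (Mert N) <= Rabs (A1 - A2) + INR h * INR h).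
    { rewrite <- (Rabs_pos_eq (INR h)) at 1 by lra. rewrite <- Rabs_mult.
      replace (INR h * Mert N) with ((A1 - A2) - (A1 - A2 - INR h * Mert N)) by ring.
      eapply Rle_trans; [apply Rabs_triang|]. rewrite Rabs_Ropp. lra. }
    assert (B2 : 2 * PI * Rabs (A1 - A2) <= Rabs VF2 + K1 / Y + K2 / Y).
    { rewrite <- (Rabs_pos_eq (2 * PI)) by lra. rewrite <- Rabs_mult.
      replace (2 * PI * (A1 - A2)) with (VF2 + (- (V1 - 2 * PI * A1) + (V2 - 2 * PI * A2))) by (rewrite EV; ring).
      eapply Rle_trans; [apply Rabs_triang|]. rewrite Rplus_assoc. apply Rplus_le_compat_l.
      eapply Rle_trans; [apply Rabs_triang|]. rewrite Rabs_Ropp. lra. }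
    assert (B3 : Rabs VF2 <= 2 * (K3 / Y) * (2 - c) + 2 * G / p).
    { replace VF2 with ((VF2 - VFc) + VFc) by ring. eapply Rle_trans; [apply Rabs_triang|]. lra. }
    rewrite rpow_opp, rpow_1r by lra.
    assert (B4 : forall k, 0 <= k -> k / Y <= k * / INR n).
    { intros k Hk. apply Rmult_le_compat_l; auto. apply Rinv_le_contravar; lra. }
    pose proof (B4 K3 HK30). pose proof (B4 (Rabs K1) (Rabs_pos K1)). pose proof (B4 (Rabs K2) (Rabs_pos K2)).
    assert (HiY : 0 < / Y) by (apply Rinv_0_lt_compat; lra).
    assert (K1 / Y <= Rabs K1 / Y) by (apply Rmult_le_compat_r; [lra|apply Rle_abs]).
    assert (K2 / Y <= Rabs K2 / Y) by (apply Rmult_le_compat_r; [lra|apply Rle_abs]).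
    assert (2 * (K3 / Y) * (2 - c) <= 2 * (K3 * / INR n) * (2 - c)) by (apply Rmult_le_compat_r; lra).
    replace (2 * PI * (INR h * Rabs (Mert N) - INR h * INR h)) with (2 * PI * (INR h * Rabs (Mert N)) - 2 * PI * (INR h * INR h)) by ring.
    assert (2 * PI * (INR h * Rabs (Mert N)) <= 2 * PI * (Rabs (A1 - A2) + INR h * INR h)) by (apply Rmult_le_compat_l; lra).
    lra. }
  pose proof (lim0_bound _ _ Hfin (rpow_lim' _ 1 ltac:(lra))) as Hlim.
  assert (HPI3 : 3 <= PI). { pose proof PI2_3_2. lra. }
  set (M := Rabs (Mert N)) in *.
  assert (HM : 2 * 3 * (INR h * M - INR h * INR h) <= 2 * G / p).
  { destruct (Rle_dec (INR h * M - INR h * INR h) 0) as [L|L].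
    - apply Rle_trans with 0; [lra|]. apply Rmult_le_pos; [lra|left; apply Rinv_0_lt_compat; lra].
    - apply Rle_trans with (2 * PI * (INR h * M - INR h * INR h)); [|lra]. apply Rmult_le_compat_r; lra. }
  assert (E : 2 * G / p = 6 * (INR h * (2916 * rpow (2 * INR N) c * rpow T (slope b c + p) / p))) by (unfold G; field; lra).
  rewrite E in HM. apply Rmult_le_reg_l with (INR h); [lra|]. lra.
Qed.

(** * Choice of the parameters *)

Lemma exp_Rmult_INR n x : exp (INR n * x) = exp x ^ n.
Proof.
  induction n as [|n IH]; [simpl; rewrite Rmult_0_l; apply exp_0|].
  rewrite S_INR, Rmult_plus_distr_r, Rmult_1_l, exp_plus, IH. simpl. ring.
Qed.

Lemma le_div_r a b c : 0 < c -> a * c <= b -> a <= b / c.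
Proof. intros Hc H. apply Rmult_le_reg_r with c; auto. unfold Rdiv. rewrite Rmult_assoc, Rinv_l; lra. Qed.

Lemma exp_lower4 x : 0 <= x -> 1 + x + x ^ 2 / 2 + x ^ 3 / 6 + x ^ 4 / 24 <= exp x.
Proof. intros Hx. pose proof (exp_ge_taylor x 4 Hx) as H. simpl in H. lra. Qed.

(* Pade bound: [(2 + y) e^-y - (2 - y)] vanishes at 0 and has derivative [1 - (1 + y) e^-y >= 0]. *)
Lemma exp_upper y : 0 <= y < 2 -> exp y <= (2 + y) / (2 - y).
Proof.
  intros Hy.
  assert (H : 0 <= (2 + y) * exp (- y) - (2 - y)).
  { destruct (Req_dec y 0) as [->|Hn]; [rewrite Ropp_0, exp_0; lra|].
    destruct (MVT_gen (fun z => (2 + z) * exp (- z) - (2 - z)) 0 y (fun z => 1 - (1 + z) * exp (- z))) as (c & Hc & E).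
    - intros z _. auto_derive; auto. ring.
    - intros z _. apply continuity_pt_filterlim. apply (ex_derive_continuous (V := R_NormedModule) (fun w => (2 + w) * exp (- w) - (2 - w))). auto_derive; auto.
    - rewrite Rmin_left, Rmax_right in Hc by lra. rewrite Ropp_0, exp_0 in E.
      assert (0 <= 1 - (1 + c) * exp (- c)).
      { pose proof (exp_ineq1_le c). pose proof (exp_pos (- c)).
        assert (exp c * exp (- c) = 1) by (rewrite <- exp_plus, Rplus_opp_r; apply exp_0). nra. }
      assert (0 <= (1 - (1 + c) * exp (- c)) * (y - 0)) by (apply Rmult_le_pos; lra). lra. }
  assert (exp y * exp (- y) = 1) by (rewrite <- exp_plus, Rplus_opp_r; apply exp_0).
  pose proof (exp_pos y). apply Rmult_le_reg_r with (2 - y); [lra|].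
  unfold Rdiv. rewrite Rmult_assoc, Rinv_l by lra. nra.
Qed.

(** At 43/5 the left side is 5177.2, against exp(43/5) >= 5200. Beyond that point the quadratic
    Taylor polynomial of the exponential outgrows the quadratic. *)
Lemma exp_sq_lower u : 43 / 5 <= u -> 70 * u ^ 2 <= exp u.
Proof.
  intros Hu. replace u with (43 / 5 + (u - 43 / 5)) at 2 by ring. set (d := u - 43 / 5). assert (Hd : 0 <= d) by (unfold d; lra).
  replace u with (43 / 5 + d) by (unfold d; ring). rewrite exp_plus.
  assert (H1 : 5200 <= exp (43 / 5)).
  { replace (43 / 5) with (INR 10 * (43 / 50)) by (simpl; lra). rewrite exp_Rmult_INR.
    pose proof (exp_lower4 (43 / 50) ltac:(lra)). apply Rle_trans with ((2358 / 1000) ^ 10); [lra|]. apply pow_incr. lra. }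
  assert (H2 : 1 + d + d ^ 2 / 2 <= exp d). { pose proof (exp_lower4 d Hd). assert (0 <= d ^ 3) by (apply pow_le; auto). assert (0 <= d ^ 4) by (apply pow_le; auto). lra. }
  apply Rle_trans with (5200 * (1 + d + d ^ 2 / 2)); [nra|]. apply Rmult_le_compat; try lra. nra.
Qed.

(** Here [Sstar] is at least about 5 exp(u)/u, so the logarithm in the last condition is about u -
    ln u, and its product with c - b = 2.6/u is about 2.6 (1 - ln u / u). For u >= 8.6 this exceeds
    ln 7 + 1/100, about 1.96, which determines the size of c. *)
Lemma params_admissible u : 43 / 5 <= u -> admissible (1 / 2 + 1 / 100 / u) (1 / 2 + 261 / 100 / u) (exp (exp u)).
Proof.
  intros Hu. pose proof (exp_sq_lower u Hu) as HL. set (L := exp u) in *.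
  assert (Hv : 0 < / u <= 5 / 43). { split; [apply Rinv_0_lt_compat; lra|]. replace (5 / 43) with (/ (43 / 5)) by field. apply Rinv_le_contravar; lra. }
  set (v := / u) in *. assert (Huv : u * v = 1) by (unfold v; field; lra).
  replace (1 / 100 / u) with (v / 100) by (unfold v; field; lra). replace (261 / 100 / u) with (261 / 100 * v) by (unfold v; field; lra).
  assert (HLu : 602 <= L * v). { apply Rle_trans with (70 * u ^ 2 * v); [|apply Rmult_le_compat_r; lra]. replace (70 * u ^ 2 * v) with (70 * u * (u * v)) by ring. rewrite Huv. lra. }
  assert (HLp : 602 <= L) by nra.
  (* 3.316 lies just below [2.6 / (0.48 + 2.61 v)] at the largest [v = 5/43], and 4.974 = (3/2) *
     3.316. *)
  assert (HS : 4974 / 1000 * (L * v) <= Sstar (1 / 2 + v / 100) (1 / 2 + 261 / 100 * v) (exp L)).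
  { unfold Sstar, tau. rewrite ln_exp.
    assert (3316 / 1000 * v <= (1 / 2 + 261 / 100 * v - (1 / 2 + v / 100)) / (1 / 2 + 261 / 100 * v - 1 / 50)).
    { apply le_div_r; [lra|]. assert (v * v <= 5 / 43 * v) by (apply Rmult_le_compat_r; lra). lra. }
    set (X := (_ - _) / _) in *.
    assert (3316 / 1000 * v * L <= X * (L + 6)) by (apply Rmult_le_compat; nra). lra. }
  unfold admissible. set (S := Sstar _ _ _) in *.
  assert (HT : 100 <= exp L) by (pose proof (exp_ineq1_le L); lra).
  assert (Hln7 : ln 7 <= 195 / 100). { apply ln_bound; [lra|]. replace (195 / 100) with (INR 3 * (65 / 100)) by (simpl; lra). rewrite exp_Rmult_INR.
    pose proof (exp_lower4 (65 / 100) ltac:(lra)). apply Rle_trans with ((1914 / 1000) ^ 3); [lra|]. apply pow_incr. lra. }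
  repeat split; try lra.
  (* [ln u <= u/8 - 1 + ln 8] makes the right-hand side at least [2.6 (1 - (u/8 + 0.92) / u) >= 2.6 * 0.754]. *)
  assert (Hlnu : ln u <= u / 8 - 1 + 22 / 10).
  { apply ln_bound; [lra|]. pose proof (exp_ineq1_le (u / 8 - 1)). rewrite exp_plus.
    assert (8 <= exp (22 / 10)). { replace (22 / 10) with (INR 2 * (11 / 10)) by (simpl; lra). rewrite exp_Rmult_INR.
      pose proof (exp_lower4 (11 / 10) ltac:(lra)). apply Rle_trans with ((298 / 100) ^ 2); [lra|]. apply pow_incr. lra. }
    assert (u / 8 <= exp (u / 8 - 1)) by lra. nra. }
  assert (H14 : 28 / 100 <= ln (14 / 10)).
  { replace (14 / 10) with (/ (10 / 14)) by field. rewrite ln_Rinv by lra. assert (ln (10 / 14) <= 10 / 14 - 1); [|lra].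
    apply ln_bound; [lra|]. pose proof (exp_ineq1_le (10 / 14 - 1)). lra. }
  assert (Hln : 28 / 100 + u - ln u <= ln ((2 * S - 7) / 7)).
  { apply Rle_trans with (ln (14 / 10 * (L * v))).
    - rewrite !ln_mult by lra. unfold v, L. rewrite ln_exp, ln_Rinv by lra. lra.
    - apply ln_le_compat; lra. }
  apply Rle_trans with (26 / 10 * v * (28 / 100 + u - (u / 8 - 1 + 22 / 10))).
  - replace (26 / 10 * v * (28 / 100 + u - (u / 8 - 1 + 22 / 10))) with (2275 / 1000 * (u * v) - 2392 / 1000 * v) by field. rewrite Huv. lra.
  - apply Rmult_le_compat; [nra|lra| |lra].
    apply le_div_r; [lra|]. nra.
Qed.

(** With N = T^2, the step [h] is [T] rounded up and p = 0.1/u. The exponent produced is L + 8.03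
    L/u, to be compared with the permitted L + 8.2 L/u, where L = (ln N)/2. *)
Lemma Mert_bound N u : RH -> (1 <= N)%nat -> 43 / 5 <= u -> INR N = exp (2 * exp u) ->
  Rabs (Mert N) <= exp ((1 / 2 + 41 / 10 / u) * ln (INR N)).
Proof.
  intros HR HN Hu E. pose proof (exp_sq_lower u Hu) as HL. pose proof (params_admissible u Hu) as HA.
  set (L := exp u) in *. set (T := exp L) in *.
  assert (HLp : 602 <= L) by nra.
  assert (HT : 100 <= T) by (unfold T; pose proof (exp_ineq1_le L); lra).
  assert (ET : INR N = T * T) by (unfold T; rewrite <- exp_plus, E; f_equal; ring).
  destruct (archimed T) as [A1 A2].
  assert (Hup : (0 <= up T)%Z) by (apply le_IZR; lra).
  set (h := Z.to_nat (up T)). assert (Eh : INR h = IZR (up T)) by (unfold h; rewrite INR_IZR_INZ, Z2Nat.id; auto).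
  set (p := / (10 * u)). assert (Hp : 0 < p <= 1 / 2).
  { unfold p. split; [apply Rinv_0_lt_compat; lra|]. replace (1 / 2) with (/ 2) by lra. apply Rinv_le_contravar; lra. }
  set (b := 1 / 2 + 1 / 100 / u) in *. set (c := 1 / 2 + 261 / 100 / u) in *.
  pose proof HA as (Hb & Hc & _ & _ & _).
  eapply Rle_trans; [apply (Mert_bound_abs b c T N h p); auto|].
  { split; apply INR_le; simpl INR; nra. }
  { rewrite ET. apply Rmult_le_compat_r; lra. }
  assert (Hsl : slope b c <= 271 / 100 / u).
  { unfold slope. assert (E1 : c - b = 260 / 100 / u) by (unfold b, c; field; lra). rewrite E1.
    apply Rmult_le_reg_r with (2 * (c - 1 / 50)); [lra|].
    replace (260 / 100 / u / (c - 1 / 50) / 2 * (2 * (c - 1 / 50))) with (260 / 100 * / u) by (field; lra).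
    assert (0 < / u) by (apply Rinv_0_lt_compat; lra). unfold Rdiv at 1. nra. }
  assert (Huv : 0 < / u) by (apply Rinv_0_lt_compat; lra).
  assert (Hc1 : c <= 1). { unfold c. apply Rmult_le_reg_r with u; [lra|]. replace ((1 / 2 + 261 / 100 / u) * u) with (u / 2 + 261 / 100) by (field; lra). lra. }
  assert (EN : ln (INR N) = 2 * L) by (rewrite E; apply ln_exp).
  assert (R1 : rpow (2 * INR N) c <= 2 * exp (c * (2 * L))).
  { rewrite rpow_mult_base by (rewrite ?E; try lra; apply exp_pos). unfold rpow at 2. rewrite EN.
    apply Rmult_le_compat_r; [left; apply exp_pos|]. rewrite <- (rpow_1r 2) at 2 by lra. apply rpow_le_exp; lra. }
  assert (R2 : rpow T (slope b c + p) <= exp (281 / 100 / u * L)).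
  { unfold rpow, T. rewrite ln_exp. apply exp_le_compat. apply Rmult_le_compat_r; [lra|].
    assert (p = 10 / 100 / u) by (unfold p; field; lra). lra. }
  assert (R3 : INR h <= 2 * exp L) by (fold T; lra).
  (* All constants together: 58322 = 2 + 2 * 29160. The slack 0.17 L/u exceeds 11 u because L >= 70
     u^2. *)
  assert (R4 : 58322 * u <= exp (17 / 100 * L / u)).
  { apply Rle_trans with (exp (INR 10 * u + u)).
    - rewrite exp_plus, exp_Rmult_INR. pose proof (exp_ineq1_le u). apply Rmult_le_compat; try lra.
      apply Rle_trans with (9 ^ 10); [lra|]. apply pow_incr. lra.
    - apply exp_le_compat. simpl INR. apply Rmult_le_reg_r with u; [lra|]. replace (17 / 100 * L / u * u) with (17 / 100 * L) by (field; lra). nra. }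
  assert (Hup0 : 1 <= u) by lra.
  set (G := exp (L + 803 / 100 / u * L)).
  assert (R5 : exp L <= G). { apply exp_le_compat. assert (0 <= 803 / 100 / u * L); [|lra]. apply Rmult_le_pos; [|lra]. unfold Rdiv. lra. }
  assert (R6 : exp (c * (2 * L)) * exp (281 / 100 / u * L) = G).
  { unfold G. rewrite <- exp_plus. f_equal. unfold c. field. lra. }
  assert (R7 : exp ((1 / 2 + 41 / 10 / u) * (2 * L)) = G * exp (17 / 100 * L / u)).
  { unfold G. rewrite <- exp_plus. f_equal. field. lra. }
  rewrite EN, R7. assert (HG : 0 < G) by apply exp_pos.
  assert (R8 : rpow (2 * INR N) c * rpow T (slope b c + p) <= 2 * G).
  { rewrite <- R6, <- Rmult_assoc. apply Rmult_le_compat; auto; left; apply rpow_pos. }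
  replace (2916 * rpow (2 * INR N) c * rpow T (slope b c + p) / p) with (29160 * u * (rpow (2 * INR N) c * rpow T (slope b c + p))) by (unfold p; field; lra).
  apply Rle_trans with (G * (58322 * u)); [|apply Rmult_le_compat_l; lra].
  apply Rle_trans with (2 * G + 29160 * u * (2 * G)); [|nra].
  apply Rplus_le_compat; [lra|]. apply Rmult_le_compat_l; lra.
Qed.

(** * Lower bound for the first ordinate *)

Lemma is_RInt_abs_mid m : is_RInt (fun x => Rabs (m - x)) (m - 1 / 2) (m + 1 / 2) (1 / 4).
Proof.
  replace (1 / 4) with (plus (1 / 8) (1 / 8)) by (unfold plus; simpl; lra).
  apply (is_RInt_Chasles (V := R_NormedModule)) with m.
  - apply (is_RInt_ext (V := R_NormedModule) (fun x => m - x)).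
    + intros x. rewrite Rmin_left, Rmax_right by lra. intros Hx. rewrite Rabs_pos_eq; lra.
    + replace (1 / 8) with (minus (- (m - m) ^ 2 / 2) (- (m - (m - 1 / 2)) ^ 2 / 2)) by (unfold minus, plus, opp; simpl; field).
      apply (is_RInt_derive (V := R_CompleteNormedModule) (fun x => - (m - x) ^ 2 / 2)); intros x _.
      * auto_derive; auto. field.
      * apply (ex_derive_continuous (V := R_NormedModule) (fun x => m - x)). auto_derive; auto.
  - apply (is_RInt_ext (V := R_NormedModule) (fun x => x - m)).
    + intros x. rewrite Rmin_left, Rmax_right by lra. intros Hx. rewrite Rabs_left; lra.
    + replace (1 / 8) with (minus ((m - (m + 1 / 2)) ^ 2 / 2) ((m - m) ^ 2 / 2)) by (unfold minus, plus, opp; simpl; field).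
      apply (is_RInt_derive (V := R_CompleteNormedModule) (fun x => (m - x) ^ 2 / 2)); intros x _.
      * auto_derive; auto. field.
      * apply (ex_derive_continuous (V := R_NormedModule) (fun x => x - m)). auto_derive; auto.
Qed.

(** 1 - {x} = 1/2 + (1/2 - {x}). The constant half integrates exactly; the centred part has absolute
    integral 1/4 over a unit interval. *)
Lemma mterm_wB_split n s : (1 <= n)%nat -> 0 < fst s -> exists w : C,
  mterm (wB n) (INR n) s = (/ (2 * s) * (kpow (- s) (INR n) - kpow (- s) (INR n + 1)) + w)%C /\
  Cmod w <= 1 / 4 * rpow (INR n) (- (1 + fst s)).
Proof.
  intros Hn Hs. assert (Hn1 : 1 <= INR n) by (apply (le_INR 1); auto). set (N := INR n) in *.
  pose proof (Cneq_fst s Hs) as Hs0.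
  set (F := fun x => kpow (- s - 1) x).
  set (G := fun x => (RtoC (N + 1 / 2 - x) * kpow (- s - 1) x)%C).
  assert (CF : ccR F N (N + 1)).
  { unfold F. intros x Hx. destruct (ccR_cexp_ln (- s - 1) N (N + 1) ltac:(lra) x Hx); split; auto. }
  assert (CG : ccR G N (N + 1)).
  { apply ccR_mult; auto. apply ccR_real. intros x _. apply (ex_derive_continuous (V := R_NormedModule) (fun x => N + 1 / 2 - x)). auto_derive; auto. }
  exists (CI G N (N + 1)). split.
  - unfold mterm. rewrite (CI_ext _ (fun x => / 2 * F x + G x)%C).
    + rewrite CI_plus; try lra; auto. 2:{ apply ccR_mult; auto. apply ccR_const. }
      f_equal. rewrite CI_scal by (auto; lra).
      rewrite (CI_FTC F (fun x => - / s * kpow (- s) x)%C); [field; auto|lra| |auto].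
      intros x Hx. apply (cder_eq _ (0 * kpow (- s) x + - / s * (- s * kpow (- s - 1) x))%C).
      * unfold F. field. auto.
      * apply (cder_mult (fun _ => - / s)%C (kpow (- s))); [apply cder_const|apply cder_kpow; lra].
    + lra.
    + intros x Hx. unfold F, G, wB. fold N. fold (kpow (- s) x). replace (- s - 1)%C with (- s + - (1))%C by ring.
      rewrite kpow_plus, kpow_m1 by lra.
      replace (RtoC ((N + 1 - x) / x)) with ((/ 2 + RtoC (N + 1 / 2 - x)%R) * RtoC (/ x)%R)%C.
      2:{ replace (/ 2)%C with (RtoC (/ 2)) by (rewrite RtoC_inv by lra; reflexivity). rewrite <- RtoC_plus, <- RtoC_mult. f_equal. field. lra. }
      ring.
  - eapply Rle_trans; [apply (CI_bound_int _ (fun x => Rabs (N + 1 / 2 - x) * rpow N (- (1 + fst s)))); [lra|auto| |]|].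
    + pose proof (is_RInt_abs_mid (N + 1 / 2)) as HI. replace (N + 1 / 2 - 1 / 2) with N in HI by ring. replace (N + 1 / 2 + 1 / 2) with (N + 1) in HI by field.
      eexists. apply (is_RInt_ext (V := R_NormedModule) (fun x => scal (rpow N (- (1 + fst s))) (Rabs (N + 1 / 2 - x)))).
      { intros. unfold scal; simpl; unfold mult; simpl. ring. }
      apply (is_RInt_scal (V := R_NormedModule)). exact HI.
    + intros x Hx. unfold G. rewrite Cmod_mult, Cmod_R, kpow_mod. apply Rmult_le_compat_l; [apply Rabs_pos|].
      replace (fst (- s - 1)%C) with (- (1 + fst s)) by (simpl; ring). apply rpow_le_base_neg; lra.
    + right. pose proof (is_RInt_abs_mid (N + 1 / 2)) as HI. replace (N + 1 / 2 - 1 / 2) with N in HI by ring. replace (N + 1 / 2 + 1 / 2) with (N + 1) in HI by field.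
      apply is_RInt_unique. rewrite Rmult_comm.
      apply (is_RInt_ext (V := R_NormedModule) (fun x => scal (rpow N (- (1 + fst s))) (Rabs (N + 1 / 2 - x)))).
      { intros. unfold scal; simpl; unfold mult; simpl. ring. }
      apply (is_RInt_scal (V := R_NormedModule) (fun x => Rabs (N + 1 / 2 - x))). exact HI.
Qed.

(** The exact halves telescope to 1/(2s), the source of the summand 1/2. The rest is at most (1/4)(1
    + 1/Re s) <= 3/4. *)
Lemma zeta_trapezoid s : 1 / 2 <= fst s -> s <> RtoC 1 -> exists W : C,
  zeta s = (/ (s - 1) + / 2 + s * W)%C /\ Cmod W <= 3 / 4.
Proof.
  intros Hs Hs1. pose proof (Cneq_fst s ltac:(lra)) as Hs0.
  rewrite zeta_B by (auto; lra).
  set (T := fun k => kpow (- s) (INR (S k))).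
  assert (HT : forall k, Cmod (T k) = rpow (INR (S k)) (- fst s)) by (intros; unfold T; rewrite kpow_mod; reflexivity).
  set (w := fun k => (mterm (wB (S k)) (INR (S k)) s - / (2 * s) * (T k - T (S k)))%C).
  assert (Hw : forall k, Cmod (w k) <= 1 / 4 * rpow (INR (S k)) (- (1 + fst s))).
  { intros k. destruct (mterm_wB_split (S k) s ltac:(lia) ltac:(lra)) as (v & E & Hv).
    replace (w k) with v; auto. unfold w. rewrite E. unfold T. rewrite (S_INR (S k)). ring. }
  pose proof (zsum_ex (fst s) ltac:(lra)) as [Z1 Z2].
  assert (Aw : absconv w) by (apply (absconv_le _ _ Hw); apply ex_series_Rscal; auto).
  assert (AB : absconv (fun k => mterm (wB (S k)) (INR (S k)) s)) by (apply (MS_absconv wB 1 0); [apply wB_grow|lra]).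
  assert (AT : absconv (fun k => / (2 * s) * (T k - T (S k)))%C).
  { apply (absconv_ext (fun k => mterm (wB (S k)) (INR (S k)) s + (- (1)) * w k)%C); [intros; unfold w; ring|].
    apply absconv_plus; auto. apply absconv_scal; auto. }
  assert (E : B s = (/ (2 * s) + CSeries w)%C).
  { unfold B, MS. rewrite (CSeries_ext _ (fun k => / (2 * s) * (T k - T (S k)) + w k)%C) by (intros; unfold w; ring).
    rewrite CSeries_plus by auto. f_equal.
    assert (H2 : (2 * s)%C <> 0) by (apply Cmult_neq_0; auto; intros E; apply (f_equal fst) in E; simpl in E; lra).
    rewrite CSeries_scal.
    - rewrite (telescope_C T (fun k => rpow (INR (S k)) (- fst s))); [|intros; rewrite HT; lra|apply rpow_lim; lra].
      unfold T. simpl INR. rewrite kpow_1. ring.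
    - apply (absconv_ext (fun k => (2 * s) * (/ (2 * s) * (T k - T (S k))))%C); [|apply absconv_scal; auto].
      intros k. field. auto. }
  exists (CSeries w). split.
  - rewrite E. field. split; auto. apply C1_neq; auto.
  - eapply Rle_trans; [apply (CSeries_bound _ _ Hw); apply ex_series_Rscal; auto|].
    rewrite Series_scal_l. assert (/ fst s <= / (1 / 2)) by (apply Rinv_le_contravar; lra). lra.
Qed.

(** At a zero |s + 1| = 2 |s - 1| |s| |W|, and |s - 1| = |s| on the critical line. With y = 1/4 +
    g^2 this gives y + 2 <= (9/4) y^2, which fails for y <= 1.1716, that is for g <= 0.96. *)
Lemma gamma1_lower g : is_gamma1 g -> 96 / 100 <= g.
Proof.
  intros (Hg & Hz & _). destruct (Rle_dec (96 / 100) g) as [L|L]; auto. exfalso.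
  set (s := (1 / 2, g) : C) in *.
  assert (Hs1 : s <> RtoC 1). { intros E. apply (f_equal fst) in E. simpl in E. lra. }
  destruct (zeta_trapezoid s ltac:(simpl; lra) Hs1) as (W & E & HW). rewrite Hz in E.
  pose proof (C1_neq s Hs1) as H1.
  assert (E2 : (s + 1 = - (2 * (s - 1) * s * W))%C).
  { replace (- (2 * (s - 1) * s * W))%C with ((s + 1) - 2 * (s - 1) * (/ (s - 1) + / 2 + s * W))%C; [rewrite <- E; ring|].
    field. auto. }
  apply (f_equal Cmod) in E2. rewrite Cmod_opp, !Cmod_mult, Cmod_R, Rabs_pos_eq in E2 by lra.
  assert (Q1 : Cmod (s + 1) ^ 2 = 9 / 4 + g ^ 2) by (rewrite Cmod_sqr; simpl; field).
  assert (Q2 : Cmod (s - 1) ^ 2 = 1 / 4 + g ^ 2) by (rewrite Cmod_sqr; simpl; field).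
  assert (Q3 : Cmod s ^ 2 = 1 / 4 + g ^ 2) by (rewrite Cmod_sqr; simpl; field).
  rewrite E2, !Rpow_mult_distr, Q2, Q3 in Q1.
  assert (HW2 : Cmod W ^ 2 <= 9 / 16). { pose proof (Cmod_ge_0 W). nra. }
  set (y := 1 / 4 + g ^ 2) in *. assert (Hy : 0 <= y <= 11716 / 10000) by (unfold y; nra).
  assert (2 ^ 2 * y * y * Cmod W ^ 2 <= 2 ^ 2 * y * y * (9 / 16)) by (apply Rmult_le_compat_l; nra).
  assert (9 / 4 + g ^ 2 = y + 2) by (unfold y; field). nra.
Qed.

(** * Lower bound for the exponent [alpha] *)

Lemma ln_lower x y : exp x <= y -> x <= ln y.
Proof. intros H. rewrite <- (ln_exp x). apply ln_le_compat; auto. apply exp_pos. Qed.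

(** Rational certificates: the argument is cut into [n] equal parts, to each of which the Pade bound
    applies. The next lemma does the same with the Taylor polynomial. *)
Lemma exp_upper_pow n y M : 0 <= y < 2 -> ((2 + y) / (2 - y)) ^ n <= M -> exp (INR n * y) <= M.
Proof.
  intros Hy H. rewrite exp_Rmult_INR. eapply Rle_trans; [|exact H]. apply pow_incr. split; [left; apply exp_pos|]. apply exp_upper; auto.
Qed.

Lemma exp_lower_pow n y m : 0 <= y -> 0 <= m -> m <= 1 + y + y ^ 2 / 2 + y ^ 3 / 6 + y ^ 4 / 24 -> m ^ n <= exp (INR n * y).
Proof. intros Hy Hm H. rewrite exp_Rmult_INR. apply pow_incr. pose proof (exp_lower4 y Hy). lra. Qed.

Lemma ln_10_lower : 9 / 4 <= ln 10.
Proof.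
  apply ln_lower. replace (9 / 4) with (INR 10 * (9 / 40)) by (rewrite INR_IZR_INZ; simpl Z.of_nat; lra). apply exp_upper_pow; [lra|]. lra.
Qed.

(** [L] and [P] are rational lower bounds for ln ln 10^n, through ln 10 >= 9/4, and for the power of
    the logarithm. *)
Lemma Mfun_upper a b c n L P : 0 <= b -> 0 <= c -> 0 < L -> exp L <= 9 / 4 * INR n -> 0 < P -> P <= exp (c * L) ->
  Mfun a b c (10 ^ n) <= a + b / (P * L).
Proof.
  intros Hb Hc HL HE HP HPL. unfold Mfun. apply Rplus_le_compat_l. apply Rmult_le_compat_l; auto.
  pose proof ln_10_lower as H10. pose proof (pos_INR n) as Hn.
  assert (E : ln (10 ^ n) = INR n * ln 10) by (apply ln_pow; lra).
  assert (H : exp L <= ln (10 ^ n)) by (rewrite E; nra). pose proof (exp_pos L).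
  assert (HLL : L <= ln (ln (10 ^ n))) by (apply ln_lower; auto).
  apply Rinv_le_contravar; [apply Rmult_lt_0_compat; auto|]. apply Rmult_le_compat; try lra.
  unfold Rpower. eapply Rle_trans; [exact HPL|]. apply exp_le_compat. apply Rmult_le_compat_l; auto.
Qed.

(** On the second branch the positive last term is dropped; what remains is 0.96 minus at most
    0.2078. The numbers 8.55 and 11.37 bound ln ln 10^2465 and exp(0.285 * 8.55) from below. *)
Lemma phi1_lower u : 0 < u -> 3 / 4 <= phi1 u.
Proof.
  intros Hu. unfold phi1. destruct (Rlt_dec _ _); [lra|].
  assert (H : M1 (10 ^ 2465) <= 0.759282 + 20.1911 / (1137 / 100 * (855 / 100))).
  { unfold M1. apply Mfun_upper; try lra.
    - replace (855 / 100) with (INR 30 * (285 / 1000)) by (rewrite INR_IZR_INZ; simpl Z.of_nat; lra). apply exp_upper_pow; [lra|]. rewrite INR_IZR_INZ. simpl Z.of_nat. lra.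
    - replace (0.285 * (855 / 100)) with (INR 3 * (81225 / 100000)) by (rewrite INR_IZR_INZ; simpl Z.of_nat; lra).
      apply Rle_trans with ((2249 / 1000) ^ 3); [lra|]. apply exp_lower_pow; lra. }
  assert (0 <= 20.1911 / (u * exp (0.285 * u))).
  { apply Rmult_le_pos; [lra|]. left. apply Rinv_0_lt_compat. apply Rmult_lt_0_compat; auto. apply exp_pos. }
  generalize dependent (M1 (10 ^ 2465)). intros m Hm. lra.
Qed.

(** As for [phi1]: 2.491 minus at most 1.882, with 6.12 below ln ln 10^208 and 5.22 below exp(0.2705
    * 6.12). *)
Lemma phi2_lower u : 0 < u -> 6 / 10 <= phi2 u.
Proof.
  intros Hu. unfold phi2. destruct (Rlt_dec _ _); [lra|].
  assert (H : M2 (10 ^ 208) <= 0.653 + 60.12 / (522 / 100 * (612 / 100))).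
  { unfold M2. apply Mfun_upper; try lra.
    - replace (612 / 100) with (INR 40 * (153 / 1000)) by (rewrite INR_IZR_INZ; simpl Z.of_nat; lra). apply exp_upper_pow; [lra|]. rewrite INR_IZR_INZ. simpl Z.of_nat. lra.
    - replace (0.2705 * (612 / 100)) with (INR 3 * (55182 / 100000)) by (rewrite INR_IZR_INZ; simpl Z.of_nat; lra).
      apply Rle_trans with ((1735 / 1000) ^ 3); [lra|]. apply exp_lower_pow; lra. }
  assert (0 <= 60.12 / (u * exp (0.2705 * u))).
  { apply Rmult_le_pos; [lra|]. left. apply Rinv_0_lt_compat. apply Rmult_lt_0_compat; auto. apply exp_pos. }
  generalize dependent (M2 (10 ^ 208)). intros m Hm. lra.
Qed.

Lemma delta_lower t : 0 < t <= 50 -> 10404 / 10000 <= delta t.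
Proof.
  intros Ht. unfold delta. assert (/ 50 <= / t) by (apply Rinv_le_contravar; lra).
  assert (102 / 100 <= 1 + 1 / t) by lra. nra.
Qed.

(** With delta >= 1.0404 and (3 + e)/e >= 2 the value is at least 1.0404 * 40.45, just above 42. *)
Lemma a1_lower t : 0 < t <= 50 -> 42 <= a1 t.
Proof.
  intros Ht. unfold a1. cbv zeta. pose proof (delta_lower t Ht) as Hd. set (d := delta t) in *.
  assert (He : 2 <= (3 + ee) / ee).
  { unfold ee. pose proof exp_le_3. pose proof (exp_pos 1). apply le_div_r; lra. }
  assert (0 <= t / exp (exp 2)) by (apply Rmult_le_pos; [lra|left; apply Rinv_0_lt_compat, exp_pos]).
  set (X := t / exp (exp 2) + (3 + ee) / ee) in *. assert (HX : 2 <= X) by (unfold X; lra).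
  assert ((3 + d) * 2 <= (3 + d) * X) by (apply Rmult_le_compat_l; lra). nra.
Qed.

(** The source of the number 0.96: from t >= 1.92 follows 3t/2 >= 2.88, which exceeds e, so that the
    iterated logarithm is positive. *)
Lemma lambda_pos t : 192 / 100 <= t -> 0 < lambda t.
Proof.
  intros Ht. unfold lambda. apply Rmult_lt_0_compat; [lra|].
  assert (He : exp 1 <= 28 / 10). { replace 1 with (INR 2 * (1 / 2)) by (rewrite INR_IZR_INZ; simpl Z.of_nat; lra). apply exp_upper_pow; lra. }
  assert (H1 : 1 < ln (3 * t / 2)) by (rewrite <- (ln_exp 1); apply ln_increasing; [apply exp_pos|lra]).
  rewrite <- ln_1. apply ln_increasing; lra.
Qed.

(** Dropping the 1 inside the logarithm separates the variables. The minimum lies at D = 3/4 and l =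
    84/5, with value 3/2 + (3/4) ln 44.8, about 4.35. *)
Lemma two_param_min D l : 0 < D -> 0 < l -> 433 / 100 <= D + 3 / 4 * ln (1 + 2 * l / D) + 126 / 10 / l.
Proof.
  intros HD Hl.
  assert (Hln : forall y, 0 < y -> ln y <= y - 1) by (intros y Hy; apply ln_bound; auto; pose proof (exp_ineq1_le (y - 1)); lra).
  assert (HlD : 0 < 2 * l / D) by (apply Rdiv_lt_0_compat; lra).
  (* tangents of [ln] at [D = 3/4] and at [l = 84/5], the critical points *)
  assert (E : ln (2 * l / D) = ln (448 / 10) - ln (D / (3 / 4)) - ln ((84 / 5) / l)).
  { replace (2 * l / D) with (448 / 10 * / (D / (3 / 4)) * / ((84 / 5) / l)) by (field; lra).
    assert (0 < D / (3 / 4)) by lra. assert (0 < (84 / 5) / l) by (apply Rdiv_lt_0_compat; lra).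
    assert (0 < / (D / (3 / 4))) by (apply Rinv_0_lt_compat; auto). assert (0 < / ((84 / 5) / l)) by (apply Rinv_0_lt_compat; auto).
    rewrite !ln_mult, !ln_Rinv by (auto; nra). ring. }
  assert (H1 : ln (2 * l / D) <= ln (1 + 2 * l / D)) by (apply ln_le_compat; lra).
  assert (H2 : 3774 / 1000 <= ln (448 / 10)).
  { apply ln_lower. replace (3774 / 1000) with (INR 20 * (1887 / 10000)) by (rewrite INR_IZR_INZ; simpl Z.of_nat; lra). apply exp_upper_pow; lra. }
  pose proof (Hln (D / (3 / 4)) ltac:(lra)) as H3.
  pose proof (Hln ((84 / 5) / l) ltac:(apply Rdiv_lt_0_compat; lra)) as H4.
  replace ((84 / 5) / l) with (84 / 5 * / l) in * by reflexivity. unfold Rdiv in *. lra.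
Qed.

Lemma omega_lower g t u : 96 / 100 <= g -> 2 * g <= t <= 50 -> 0 < u ->
  a1 t * phi2 u / (lambda t * u) <= omega g t u.
Proof.
  intros Hg Ht Hu. pose proof (lambda_pos t ltac:(lra)) as Hl. pose proof (phi1_lower u Hu). pose proof (phi2_lower u Hu).
  pose proof (delta_lower t ltac:(lra)) as Hd.
  assert (He : 0 < ee) by apply exp_pos. assert (Hie : 0 < / ee) by (apply Rinv_0_lt_compat; auto).
  unfold omega. cbv zeta. set (l := lambda t) in *.
  assert (Hp : forall a b, 0 <= a -> 0 < b -> 0 <= a / b) by (intros a b Ha Hb; apply Rmult_le_pos; auto; left; apply Rinv_0_lt_compat; auto).
  pose proof (exp_pos u) as E1. pose proof (exp_pos (exp u)) as E2. pose proof (exp_pos (u + exp u)) as E3.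
  assert (A2 : 0 <= a2 g t).
  { unfold a2. apply Rmult_le_pos; [apply Hp; lra|]. assert (0 <= t / (2 * g)) by (apply Hp; lra). unfold Rdiv in *. lra. }
  assert (A4 : 0 <= a4 t). { unfold a4. cbv zeta. apply Rmult_le_pos; [apply Hp; lra|lra]. }
  assert (0 <= a2 g t * u / (l * exp u)) by (apply Hp; nra).
  assert (0 <= 15.83 / exp u) by (apply Hp; lra).
  assert (0 <= 12 * l / (u * exp (exp u)) * (3 * phi1 u / (2 * u) + 3 / (100 * exp (u + exp u)))).
  { apply Rmult_le_pos; [apply Hp; nra|]. apply Rplus_le_le_0_compat; apply Hp; lra. }
  assert (0 <= a4 t * phi2 u / (u ^ 2 * exp u)) by (apply Hp; [nra|]; apply Rmult_lt_0_compat; [nra|auto]).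
  lra.
Qed.

(** Multiplied by [u], the retained terms are those of [two_param_min] with D = (sg - 1/2) u: 3/4 is
    the lower bound for [phi1], and 12.6 = 42 * 0.6 / 2 comes from [a1] and [phi2]. *)
Lemma omega1_lower g sg t u : 96 / 100 <= g -> 2 * g <= t <= 50 -> 0 < u -> 1 / 2 < sg ->
  433 / 100 / u <= sg - 1 / 2 + omega1 g sg t u / 2 /\ 0 <= omega1 g sg t u.
Proof.
  intros Hg Ht Hu Hs. pose proof (lambda_pos t ltac:(lra)) as Hl. pose proof (phi1_lower u Hu) as P1. pose proof (phi2_lower u Hu) as P2.
  pose proof (omega_lower g t u Hg Ht Hu) as HO. pose proof (a1_lower t ltac:(lra)) as HA.
  unfold omega1. set (l := lambda t) in *. set (d := sg - 1 / 2). assert (Hd : 0 < d) by (unfold d; lra).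
  pose proof (two_param_min (d * u) l ltac:(nra) Hl) as HM.
  pose proof (exp_pos (u + exp u)) as E3.
  assert (Hx : 0 < 2 * l / (d * u)) by (apply Rdiv_lt_0_compat; nra).
  assert (HL : 0 <= ln (1 + 2 * l / (d * u))) by (apply ln_ge_0; lra).
  set (Lg := ln (1 + 2 * l / (d * u))) in *.
  assert (Hiu : 0 < / u) by (apply Rinv_0_lt_compat; auto).
  assert (HP : 3 / 4 * / u <= phi1 u / u + 1 / (50 * exp (u + exp u))).
  { assert (0 <= 1 / (50 * exp (u + exp u))) by (left; apply Rdiv_lt_0_compat; lra).
    assert (3 / 4 * / u <= phi1 u / u) by (apply Rmult_le_compat_r; lra). lra. }
  set (P := phi1 u / u + 1 / (50 * exp (u + exp u))) in *.
  assert (HPL : 3 / 4 * / u * Lg <= P * Lg) by (apply Rmult_le_compat_r; auto).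
  assert (HW : 252 / 10 * (/ l * / u) <= omega g t u).
  { eapply Rle_trans; [|exact HO]. unfold Rdiv at 2. rewrite Rinv_mult. apply Rmult_le_compat_r; [|nra].
    apply Rmult_le_pos; left; auto; apply Rinv_0_lt_compat; auto. }
  assert (Hil : 0 < / l) by (apply Rinv_0_lt_compat; auto).
  split.
  - assert (433 / 100 * / u <= (d * u + 3 / 4 * Lg + 126 / 10 / l) * / u) by (apply Rmult_le_compat_r; lra).
    replace ((d * u + 3 / 4 * Lg + 126 / 10 / l) * / u) with (d + 3 / 4 * / u * Lg + 126 / 10 * (/ l * / u)) in H by (field; lra).
    unfold Rdiv at 2. lra.
  - assert (0 <= / l * / u) by nra. assert (0 <= 3 / 4 * / u * Lg) by (apply Rmult_le_pos; lra). lra.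
Qed.

(** * Domination of M(n) by n^alpha and proof of the theorem *)

(** The factor 21 stems from (3e/2)^2 <= 81/4. Together with the rounding it lowers ln k by at most
    4, as exp 4 >= 35, hence v = ln ((ln k)/2) by at most 0.01 below u; and 4.1 u <= 4.33 v for u >=
    8.66. *)
Lemma Mert_le_power k x u al : RH -> 866 / 100 <= u -> exp (2 * exp u) <= 21 * x -> x < INR k + 1 ->
  1 / 2 + 433 / 100 / u <= al -> Rabs (Mert k) <= rpow (INR k) al.
Proof.
  intros HR Hu Hx Hk Hal. pose proof (exp_sq_lower u ltac:(lra)) as HL. set (E0 := exp u) in *.
  assert (HE0 : 5000 <= E0) by nra.
  assert (H4 : 35 <= exp 4).
  { pose proof exp1_lower. replace 4 with (INR 4 * 1) by (simpl; ring). rewrite exp_Rmult_INR. apply Rle_trans with ((61 / 25) ^ 4); [lra|]. apply pow_incr; lra. }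
  assert (Hk1 : exp (2 * E0 - 4) <= INR k).
  { replace (exp (2 * E0)) with (exp 4 * exp (2 * E0 - 4)) in Hx by (rewrite <- exp_plus; f_equal; ring).
    pose proof (exp_ineq1_le (2 * E0 - 4)). nra. }
  assert (Hk2 : 1 <= INR k) by (pose proof (exp_ineq1_le (2 * E0 - 4)); lra).
  assert (Hln : 2 * E0 - 4 <= ln (INR k)) by (apply ln_lower; auto).
  set (v := ln (ln (INR k) / 2)).
  assert (Ev : exp v = ln (INR k) / 2) by (unfold v; apply exp_ln; lra).
  assert (Hv : u - 1 / 100 <= v).
  { apply ln_lower. apply Rle_trans with (E0 - 2); [|lra]. unfold Rminus at 1. rewrite exp_plus. fold E0.
    assert (exp (- (1 / 100)) <= 100 / 101). { pose proof (exp_neg_bound (1 / 100) ltac:(lra)). lra. }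
    nra. }
  eapply Rle_trans; [apply (Mert_bound k v HR)|].
  - apply INR_le. exact Hk2.
  - lra.
  - rewrite Ev. replace (2 * (ln (INR k) / 2)) with (ln (INR k)) by field. rewrite exp_ln; lra.
  - apply exp_le_compat. apply Rmult_le_compat_r; [apply ln_ge_0; auto|]. eapply Rle_trans; [|exact Hal]. apply Rplus_le_compat_l.
    apply Rmult_le_reg_r with (u * v); [nra|].
    replace (41 / 10 / v * (u * v)) with (41 / 10 * u) by (field; lra). replace (433 / 100 / u * (u * v)) with (433 / 100 * v) by (field; lra). lra.
Qed.

Lemma u0_pos x0 : 1 <= x0 -> 0 < ln (ln (3 * ee * sqrt x0 / 2)) /\ 1 <= sqrt x0.
Proof.
  intros Hx. assert (Hs : 1 <= sqrt x0) by (rewrite <- sqrt_1; apply sqrt_le_1; lra). split; auto.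
  unfold ee. pose proof exp1_lower. pose proof (exp_pos 1).
  assert (H1 : 1 < ln (3 * exp 1 * sqrt x0 / 2)) by (rewrite <- (ln_exp 1) at 1; apply ln_increasing; nra).
  rewrite <- ln_1. apply ln_increasing; lra.
Qed.

Lemma Mert_le_alpha k g sigma0 t0 x0 x : RH -> is_gamma1 g -> 1 / 2 < sigma0 < 1 -> 2 * g <= t0 <= 50 ->
  1 <= x0 -> x0 <= x -> x < INR k + 1 -> (1 <= k)%nat ->
  Rabs (Mert k) <= rpow (INR k) (alpha g sigma0 t0 x0).
Proof.
  intros HR Hg Hs Ht Hx0 Hx Hk Hk1. assert (Hk1' : 1 <= INR k) by (apply (le_INR 1); auto).
  pose proof (gamma1_lower g Hg) as Hgl. destruct (u0_pos x0 Hx0) as [Hu Hsq].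
  unfold alpha, omega01. set (u := ln (ln (3 * ee * sqrt x0 / 2))) in *.
  destruct (omega1_lower g sigma0 t0 u Hgl Ht Hu ltac:(lra)) as [HW _].
  set (al := sigma0 + omega1 g sigma0 t0 u / 2). assert (Hal : 1 / 2 + 433 / 100 / u <= al) by (unfold al; lra).
  destruct (Rle_dec 1 al) as [L|L].
  - eapply Rle_trans; [apply Mert_trivial|]. rewrite <- (rpow_1r (INR k)) at 1 by lra. apply rpow_le_exp; auto.
  - assert (Hu8 : 866 / 100 <= u).
    { assert (H : 433 / 100 / u < 1 / 2) by lra. apply (Rmult_lt_compat_r u) in H; auto.
      replace (433 / 100 / u * u) with (433 / 100) in H by (field; lra). lra. }
    apply (Mert_le_power k x u al); auto.
    set (w := 3 * ee * sqrt x0 / 2) in *.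
    assert (He : 2 <= ee <= 3) by (unfold ee; pose proof exp1_lower; pose proof exp_le_3; lra).
    assert (Hw : 3 <= w <= 9 / 2 * sqrt x0) by (unfold w; nra).
    assert (Hlw : 1 < ln w) by (pose proof exp_le_3; unfold w; rewrite <- (ln_exp 1); apply ln_increasing; [apply exp_pos|fold ee; nra]).
    assert (Eu : exp u = ln w) by (unfold u; apply exp_ln; lra).
    rewrite Eu. replace (2 * ln w) with (ln w + ln w) by ring. rewrite exp_plus, exp_ln by lra.
    assert (sqrt x0 * sqrt x0 = x0) by (apply sqrt_sqrt; lra). nra.
Qed.

(** The first summand of [N1] is at least (1/PI) (1/2) >= 1/8, as its power has base above 1 and
    nonnegative exponent; and ln x0 >= 8. *)
Lemma N1_ln_lower g sigma0 t0 x0 : is_gamma1 g -> 1 / 2 < sigma0 < 1 -> 2 * g <= t0 <= 50 -> exp 8 <= x0 ->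
  1 <= N1 g sigma0 t0 x0 * ln x0.
Proof.
  intros Hg Hs Ht Hx0. assert (Hx1 : 1 < x0) by (pose proof (exp_ineq1_le 8); lra).
  pose proof (gamma1_lower g Hg) as Hgl. destruct (u0_pos x0 ltac:(lra)) as [Hu Hsq].
  pose proof (proj2 (omega1_lower g sigma0 t0 _ Hgl Ht Hu ltac:(lra))) as HW. fold (omega01 g sigma0 t0 x0) in HW.
  assert (HL : 8 <= ln x0) by (apply ln_lower; auto).
  unfold N1. cbv zeta. set (w := omega01 g sigma0 t0 x0) in *.
  assert (Hp : forall a b, 0 <= a -> 0 < b -> 0 <= a / b) by (intros a b Ha Hb; apply Rmult_le_pos; auto; left; apply Rinv_0_lt_compat; auto).
  assert (HR : forall y z, 0 < Rpower y z) by (intros; apply exp_pos).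
  pose proof PI_RGT_0 as HPI. pose proof PI_4 as HPI4.
  assert (He : 2 <= ee) by (unfold ee; pose proof exp1_lower; lra).
  assert (P1 : 1 <= Rpower (3 * ee / 2) w).
  { unfold Rpower. rewrite <- exp_0. apply exp_le_compat. apply Rmult_le_pos; auto. apply ln_ge_0. lra. }
  assert (P2 : / 4 <= / PI) by (apply Rinv_le_contravar; lra).
  assert (P3 : 1 / 2 <= 1 / 2 + 1 / ln x0 + (1.1 - sigma0) / (Rpower x0 (sigma0 - 1 / 2) * ln x0)).
  { assert (0 <= 1 / ln x0) by (apply Hp; lra).
    assert (0 <= (1.1 - sigma0) / (Rpower x0 (sigma0 - 1 / 2) * ln x0)) by (apply Hp; [lra|apply Rmult_lt_0_compat; [apply HR|lra]]). lra. }
  set (A := 1 / 2 + 1 / ln x0 + _) in *.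
  assert (P4 : 0 <= 1 / Rpower x0 (w / 2) * (8 * exp (exp 2) / (PI * sigma0 * (sigma0 - 1 / 2) * ln x0) + 23.6 / Rpower x0 (sigma0 - 1 / 2))).
  { apply Rmult_le_pos; [apply Hp; [lra|apply HR]|]. apply Rplus_le_le_0_compat; apply Hp; try lra; [| |apply HR].
    - pose proof (exp_pos (exp 2)). lra.
    - apply Rmult_lt_0_compat; [|lra]. apply Rmult_lt_0_compat; [|lra]. apply Rmult_lt_0_compat; lra. }
  assert (P5 : / 4 * 1 <= / PI * Rpower (3 * ee / 2) w) by (apply Rmult_le_compat; lra).
  assert (P6 : / 4 * 1 * (1 / 2) <= / PI * Rpower (3 * ee / 2) w * A) by (apply Rmult_le_compat; lra).
  nra.
Qed.

Theorem theorem7 :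
  RH ->
  forall (g sigma0 t0 x0 x : R) (s : C),
  is_gamma1 g ->
  1 / 2 < sigma0 < 1 ->
  2 * g <= t0 <= 50 ->
  4 * exp (2 * exp 2) <= x0 -> x0 <= x ->
  1 / 2 < fst s -> alpha g sigma0 t0 x0 < fst s ->
  let a := alpha g sigma0 t0 x0 in
  let N := N1 g sigma0 t0 x0 in
  Cmod (Cminus (mob_sum x s) (inv_zeta s))
  <= N * (1 + Cmod s / (fst s - a)) * ln x / Rpower x (fst s - a)
     + N * Cmod s / ((fst s - a) ^ 2 * Rpower x (fst s - a)).
Proof.
  intros HR g sigma0 t0 x0 x s Hg Hs0 Ht Hx0 Hx Hs Ha a N.
  assert (H8 : exp 8 <= x0).
  { assert (4 <= exp 2).
    { pose proof exp1_lower. replace 2 with (1 + 1) by ring. rewrite exp_plus. nra. }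
    assert (exp 8 <= exp (2 * exp 2)) by (apply exp_le_compat; lra). pose proof (exp_pos 8). lra. }
  assert (Hx1 : 1 < x0) by (pose proof (exp_ineq1_le 8); lra).
  assert (Hal : 1 / 2 <= a).
  { pose proof (gamma1_lower g Hg) as Hgl. destruct (u0_pos x0 ltac:(lra)) as [Hu _].
    pose proof (proj2 (omega1_lower g sigma0 t0 _ Hgl Ht Hu ltac:(lra))) as HW. fold (omega01 g sigma0 t0 x0) in HW.
    unfold a, alpha. lra. }
  fold a in Ha. pose proof (N1_ln_lower g sigma0 t0 x0 Hg Hs0 Ht H8) as HN. fold N in HN.
  assert (HLx : 0 < ln x0 <= ln x). { split; [rewrite <- ln_1; apply ln_increasing; lra|apply ln_le_compat; lra]. }
  assert (HN0 : 0 < N) by nra.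
  destruct (mob_sum_mu_sum x s ltac:(lra)) as (n0 & Hn0 & Hxn & ->).
  assert (HT : Cmod (mu_sum s n0 - inv_zeta s) <= (1 + Cmod s / (fst s - a)) * rpow x (- (fst s - a))).
  { apply mu_sum_tail; auto; try lra. intros k Hk. apply (Mert_le_alpha k g sigma0 t0 x0 x); auto; try lra; [|lia].
    apply le_INR in Hk. lra. }
  set (q := fst s - a) in *. assert (Hq : 0 < q) by (unfold q; lra).
  assert (EP : Rpower x q = rpow x q) by reflexivity. rewrite EP. pose proof (rpow_pos x q) as HP. rewrite rpow_opp in HT.
  pose proof (Cmod_ge_0 s) as Hcs.
  assert (0 <= Cmod s / q) by (apply Rmult_le_pos; auto; left; apply Rinv_0_lt_compat; auto).
  assert (HiP : 0 < / rpow x q) by (apply Rinv_0_lt_compat; auto).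
  assert (0 <= N * Cmod s / (q ^ 2 * rpow x q)).
  { apply Rmult_le_pos; [nra|]. left; apply Rinv_0_lt_compat. apply Rmult_lt_0_compat; auto. nra. }
  (* This factor turns the bound of [mu_sum_tail] into the first summand of the claim. *)
  assert (1 <= N * ln x) by nra.
  assert (1 * ((1 + Cmod s / q) * / rpow x q) <= N * ln x * ((1 + Cmod s / q) * / rpow x q)) by (apply Rmult_le_compat_r; auto; apply Rmult_le_pos; lra).
  unfold Rdiv at 2. lra.
Qed.
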